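(* Assume that $\Omega$ is an extension domain in $\mathbb{R}^n$, with $n\ge2$. Let $A$ be a non-degenerate Young function, let $B$ be a Young function, and let $f:\mathbb{R}\to\mathbb{R}$ be a locally Lipschitz continuous function such that $f(0)=0$. Let $T_f(u)=f\circ u$. (i) Assume that $$\int^{\infty}\Big(\frac{t}{A(t)}\Big)^{\frac1{n-1}}dt<\infty .$$ Then $T_f$ maps $W^{1,A}(\Omega)$ into $W^{1,A}(\Omega)$ and is continuous in the modular topology. (ii) Assume that $$\int^{\infty}\Big(\frac{t}{A(t)}\Big)^{\frac1{n-1}}dt=\infty ,$$ and that there exist a constant $\kappa>0$ and a non-decreasing continuous function $E:[0,\infty)\to[0,\infty)$, not identically $0$, such that $|f'(t)|\le\kappa E(\kappa|t|)$ for a.e. $t\in\mathbb{R}$. Suppose that there exists $t_0\ge0$ such that $$B\big(tE(H_n(t))\big)\le A(t)\quad\text{for } t\ge t_0,$$ and that there exist $t_1>0$ and a Young function $F$ such that $$B\big(tE(F^{-1}(A(t)))\big)\le A(t)\quad\text{for }0\le t\le t_1$$ and $$\limsup_{t\to0}\frac{F(\lambda t)}{A(t)}<\infty\quad\text{for every }\lambda>0.$$ Then $T_f$ maps $W^{1,A}(\Omega)$ into $W^{1,B}(\Omega)$ and is continuous in the modular topology.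
   Context: A Young function is a convex, left-continuous function $A:[0,\infty)\to[0,\infty]$ with $A(0)=0$ which is non-constant in $(0,\infty)$; it is non-degenerate if $A(t)>0$ for $t>0$. Two Young functions $A,\widehat A$ are equivalent near infinity if there are $c,t_0>0$ with $A(t/c)\le\widehat A(t)\le A(ct)$ for $t\ge t_0$. The generalized right-continuous inverse of a non-decreasing function $F$ is $F^{-1}(t)=\inf\{s\ge0:F(s)>t\}$, with $\inf\emptyset=\infty$. The symbol $\int^\infty$ refers to convergence or divergence of the integral at infinity, and $\int_0$ to convergence at zero. The Orlicz space $L^A(\Omega)$ consists of the measurable functions $u$ on $\Omega$ with $\int_\Omega A(|u|/\lambda)\,dx<\infty$ for some $\lambda>0$ (for vector-valued $u$, $|u|$ is the Euclidean length). A sequence $u_k\to u$ modularly in $L^A(\Omega)$ if there is $\lambda>0$ with $\lim_k\int_\Omega A(|u_k-u|/\lambda)\,dx=0$. $W^{1,A}(\Omega)$ consists of the weakly differentiable $u\in L^A(\Omega)$ with $\nabla u\in L^A(\Omega)$; modular convergence in $W^{1,A}(\Omega)$ means modular convergence in $L^A(\Omega)$ of the functions and of their gradients. Continuity of $T_f$ in the modular topology means that modular convergence $u_k\to u$ in the domain space implies modular convergence $f(u_k)\to f(u)$ in the target space. An extension domain is an open set $\Omega\subset\mathbb{R}^n$ (possibly with $|\Omega|=\infty$) admitting a linear operator $\mathcal E$, mapping functions defined in $\Omega$ to functions defined in $\mathbb{R}^n$, such that $\mathcal Eu=u$ in $\Omega$, and $\mathcal E$ is bounded from $W^{1,1}(\Omega)$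 into $W^{1,1}(\mathbb{R}^n)$ and from $W^{1,\infty}(\Omega)$ into $W^{1,\infty}(\mathbb{R}^n)$. $n'=n/(n-1)$ and $H_n(s)=\Big(\int_0^s\big(\tfrac{t}{A(t)}\big)^{\frac1{n-1}}dt\Big)^{1/n'}$ for $s\ge0$. If $\int_0\big(\tfrac{t}{A(t)}\big)^{1/(n-1)}dt=\infty$, then $H_n$ is defined with $A$ replaced by a Young function equivalent to $A$ near infinity for which this integral converges at $0$. *)

(* Defs.v *)
From HB Require Import structures.
From mathcomp Require Import all_boot all_order all_algebra.
From mathcomp Require Import all_classical all_reals all_analysis.

Set Implicit Arguments.
Unset Strict Implicit.
Unset Printing Implicit Defensive.

Import Order.TTheory GRing.Theory Num.Theory.
Import numFieldNormedType.Exports.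

Local Open Scope classical_set_scope.
Local Open Scope ring_scope.

Definition rV_measure_display : measure_display.
Proof. by constructor. Qed.

(* The product sigma-algebra on R^n, i.e. the Borel sets. *)
Section measurable_rV.
Context {R : realType} (n : nat).

Let coord (i : 'I_n) (x : 'rV[R]_n) : R := x 0 i.

Let rV_set0 : g_sigma_preimage coord set0.
Proof. exact: sigma_algebra0. Qed.

Let rV_setC A : g_sigma_preimage coord A -> g_sigma_preimage coord (~` A).
Proof. exact: sigma_algebraC. Qed.

Let rV_bigcup (F : (set 'rV[R]_n)^nat) :
  (forall i, g_sigma_preimage coord (F i)) ->
  g_sigma_preimage coord (\bigcup_i F i).
Proof. exact: sigma_algebra_bigcup. Qed.

HB.instance Definition _ := @isMeasurable.Build rV_measure_display 'rV[R]_n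
  (g_sigma_preimage coord) rV_set0 rV_setC rV_bigcup.

Lemma measurable_coord (i : 'I_n) :
  measurable_fun [set: 'rV[R]_n] (fun x : 'rV[R]_n => x 0 i).
Proof.
move=> _ Y mY; rewrite setTI; apply: sub_sigma_algebra => /=.
rewrite -bigcup_seq/=; exists i => /=; first by rewrite mem_index_enum.
by exists Y => //; rewrite setTI.
Qed.

Lemma measurable_fun_rV d (T : measurableType d) (f : T -> 'rV[R]_n) :
  (forall i, measurable_fun [set: T] (fun x => f x 0 i)) ->
  measurable_fun [set: T] f.
Proof.
move=> mf _; suff : measurable `<=` [set B | measurable (f @^-1` B)].
  by move=> sub B mB; rewrite setTI; exact: sub.
apply: smallest_sub.
  split=> [|B mB|F mF].
  - by rewrite /= preimage_set0.
  - by rewrite /= setTD; exact: (measurableC mB).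
  - by rewrite /= preimage_bigcup; exact: bigcupT_measurable.
move=> B; rewrite -bigcup_seq/= => -[i _ [Y mY <-]].
by rewrite /= setTI -comp_preimage -[X in measurable X]setTI; exact: mf.
Qed.

End measurable_rV.

Section borel_lebesgue_measure.
Context {R : realType}.

Definition rV_cons n (p : R * 'rV[R]_n) : 'rV[R]_n.+1 := row_mx p.1%:M p.2.

Definition rV_uncons n (x : 'rV[R]_n.+1) : R * 'rV[R]_n :=
  (x 0 ord0, \row_j x 0 (lift ord0 j)).

Lemma rV_consK n : cancel (@rV_cons n) (@rV_uncons n).
Proof.
move=> [a v]; rewrite /rV_uncons /rV_cons /=; congr pair.
  transitivity ((row_mx a%:M v : 'rV[R]_(1 + n)) 0 (lshift n ord0)).
    by congr (_ _ _); exact: val_inj.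
  by rewrite row_mxEl mxE eqxx.
apply/rowP => j; rewrite mxE.
transitivity ((row_mx a%:M v : 'rV[R]_(1 + n)) 0 (rshift 1 j)).
  by congr (_ _ _); exact: val_inj.
by rewrite row_mxEr.
Qed.

Lemma measurable_rV_cons n : measurable_fun setT (@rV_cons n).
Proof.
apply: measurable_fun_rV => i.
case: (split_ordP (i : 'I_(1 + n))) => j ->.
  rewrite [X in measurable_fun _ X](_ : _ = fst)//.
  by apply/funext => p; rewrite [LHS](@row_mxEl _ 1 1 n) ord1 mxE.
rewrite [X in measurable_fun _ X](_ : _ = (fun x : 'rV[R]_n => x 0 j) \o snd).
  by apply: measurableT_comp => //; exact: measurable_coord.
by apply/funext => p; rewrite [LHS](@row_mxEr _ 1 1 n).
Qed.

Lemma measurable_rV_uncons n : measurable_fun setT (@rV_uncons n).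
Proof.
apply: measurable_fun_pair; first exact: measurable_coord.
apply: measurable_fun_rV => i.
rewrite [X in measurable_fun _ X](_ : _ = (fun x : 'rV[R]_n.+1 => x 0 (lift ord0 i))).
  exact: measurable_coord.
by apply/funext => x; rewrite mxE.
Qed.

Section step.
Variables (n : nat) (m : {sigma_finite_measure set 'rV[R]_n -> \bar R}).

Definition borel_lebesgue_step : set 'rV[R]_n.+1 -> \bar R :=
  pushforward (lebesgue_measure \x m)%E (@rV_cons n).

Let step0 : borel_lebesgue_step set0 = 0%E.
Proof. by rewrite /borel_lebesgue_step /pushforward preimage_set0 measure0. Qed.

Let step_ge0 A : (0 <= borel_lebesgue_step A)%E.
Proof. exact: (measure_ge0 (lebesgue_measure \x m)%E). Qed.

Let step_sigma_additive : semi_sigma_additive borel_lebesgue_step.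
Proof.
move=> F mF tF mUF; rewrite /borel_lebesgue_step /pushforward preimage_bigcup.
apply: measure_semi_sigma_additive.
- by move=> k; rewrite -[X in measurable X]setTI; exact: measurable_rV_cons.
- apply/trivIsetP => /= i j _ _ ij; rewrite -preimage_setI.
  by move/trivIsetP : tF => /(_ _ _ _ _ ij) ->//; rewrite preimage_set0.
- rewrite -preimage_bigcup -[X in measurable X]setTI.
  exact: measurable_rV_cons.
Qed.

HB.instance Definition _ := isMeasure.Build _ _ _ borel_lebesgue_step
  step0 step_ge0 step_sigma_additive.

Let step_sigma_finite : sigma_finite setT borel_lebesgue_step.
Proof.
have [F TF mF] : sigma_finite setT (lebesgue_measure \x m)%E.
  have /sigma_finiteP[F [TF ndF Foo]] := sigma_finiteT (@lebesgue_measure R).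
  have /sigma_finiteP[G [TG ndG Goo]] := sigma_finiteT m.
  exists (fun k => F k `*` G k) => [|k].
    rewrite -setXTT TF TG predeqE => -[x y]; split=> [[]|[k _ []/= ? ?]].
      move=> /= [i _ Fx] [j _ Gy]; exists (maxn i j) => //; split.
      + by move: x Fx; exact/subsetPset/ndF/leq_maxl.
      + by move: y Gy; exact/subsetPset/ndG/leq_maxr.
    by split; exists k.
  have [? ?] := Foo k; have [? ?] := Goo k; split; first exact: measurableX.
  by rewrite product_measure1E// lte_mul_pinfty// ge0_fin_numE.
exists (fun k => @rV_uncons n @^-1` F k) => [|k].
  by rewrite -preimage_bigcup -TF preimage_setT.
have [mFk Fk] := mF k; split.
  by rewrite -[X in measurable X]setTI; exact: measurable_rV_uncons.
rewrite /borel_lebesgue_step /pushforward -comp_preimage.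
by rewrite (_ : _ \o _ = id)//; apply/funext => p; exact: rV_consK.
Qed.

HB.instance Definition _ :=
  Measure_isSigmaFinite.Build _ _ _ borel_lebesgue_step step_sigma_finite.
End step.

(* Lebesgue measure on the Borel sets of R^n, as the n-fold product of the
   one-dimensional one. *)
Fixpoint borel_lebesgue n : {sigma_finite_measure set 'rV[R]_n -> \bar R} :=
  if n is n'.+1 then borel_lebesgue_step (borel_lebesgue n')
  else dirac (0 : 'rV[R]_0).

Lemma measurable_rV_box n (D : 'I_n -> set R) :
  (forall i, measurable (D i)) ->
  measurable [set x : 'rV[R]_n | forall i, D i (x 0 i)].
Proof.
move=> mD; rewrite (_ : mkset _ =
    \bigcap_(i in [set: 'I_n]) ((fun x : 'rV[R]_n => x 0 i) @^-1` D i)).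
  apply: fin_bigcap_measurable => // i _; rewrite -[X in measurable X]setTI.
  exact: measurable_coord.
by apply/seteqP; split => [x Dx i _|x Dx i]; [exact: Dx|exact: (Dx i)].
Qed.

Lemma borel_lebesgue_box n (D : 'I_n -> set R) :
  (forall i, measurable (D i)) ->
  borel_lebesgue n [set x | forall i, D i (x 0 i)] =
  (\prod_(i < n) lebesgue_measure (D i))%E.
Proof.
elim: n D => [|n ih] D mD; first by rewrite big_ord0 /= diracE mem_set// => -[].
rewrite big_ord_recl -ih => [|i]; last exact: mD.
rewrite -product_measure1E; last 2 first.
- exact: mD.
- by apply: (@measurable_rV_box n (fun i => D (lift ord0 i))) => i; exact: mD.
rewrite /= /borel_lebesgue_step /pushforward; congr (product_measure1 _ _ _).
apply/seteqP; split => -[a v] /=; have [p1 p2] := rV_consK (a, v).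
  move=> Dp; split => [|i]; first by rewrite -p1; exact: Dp.
  by have := Dp (lift ord0 i); rewrite -[in X in _ -> X]p2 mxE.
move=> [Da Dv] i; case: (unliftP ord0 i) => [j|] ->; last by rewrite p1.
by have := Dv j; rewrite -[in X in X -> _]p2 mxE.
Qed.

End borel_lebesgue_measure.

(* R^n with the sigma-algebra of Lebesgue measurable sets (the Caratheodory
   measurable sets of the outer measure generated by [borel_lebesgue n]), and
   Lebesgue measure on it.  The carrier is convertible to ['rV[R]_n]; that type
   itself only carries the Borel sets, so measurability below is always stated
   with respect to [lebesgueT R n]. *)
Notation lebesgueT R n := (caratheodory_type ((@borel_lebesgue R n)^*)%mu).

Definition lebesgueN (R : realType) (n : nat) :
    {measure set (lebesgueT R n) -> \bar R} :=
  @completed_measure_extension _ _ _ (@borel_lebesgue R n).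

Lemma lebesgueN_borel (R : realType) n (D : set 'rV[R]_n) :
  measurable D -> lebesgueN R n D = borel_lebesgue n D.
Proof. exact: measurable_mu_extE. Qed.

Section young_functions.
Context {R : realType}.
Implicit Types (A F : R -> \bar R) (n : nat).

(* Functions on [0, +oo[ are represented by functions on R whose values at
   negative arguments are irrelevant. *)
Record young (A : R -> \bar R) : Prop := Young {
  young0 : A 0 = 0%E ;
  young_ge0 : forall t : R, 0 <= t -> (0 <= A t)%E ;
  young_convex : forall s t p : R, 0 <= s -> 0 <= t -> 0 <= p <= 1 ->
    (A (p * s + (1 - p) * t)%R <= p%:E * A s + (1 - p)%:E * A t)%E ;
  young_left_continuous : forall t : R, 0 < t -> A x @[x --> t^'-] --> A t ;
  young_nonconstant : exists s t : R, [/\ 0 < s, 0 < t & A s != A t] }.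

Definition nondegenerate_young A := forall t : R, 0 < t -> (0 < A t)%E.

Definition equiv_near_infty A Ah := exists c t0 : R, [/\ 0 < c, 0 < t0 &
  forall t, t0 <= t -> (A (t / c)%R <= Ah t <= A (c * t)%R)%E].

(* inf set0 = +oo *)
Definition rc_inverse F (y : \bar R) : \bar R :=
  ereal_inf [set s%:E | s in [set s | 0 <= s /\ (y < F s)%E]].

Definition cvg_int_infty (g : R -> \bar R) := exists2 t0 : R, 0 < t0 &
  (\int[lebesgue_measure]_(t in `[t0, +oo[) g t < +oo)%E.

Definition dvg_int_infty (g : R -> \bar R) := forall t0 : R, 0 < t0 ->
  (\int[lebesgue_measure]_(t in `[t0, +oo[) g t = +oo)%E.

Definition cvg_int_zero (g : R -> \bar R) := exists2 t0 : R, 0 < t0 &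
  (\int[lebesgue_measure]_(t in `]0%R, t0]) g t < +oo)%E.

Definition dvg_int_zero (g : R -> \bar R) := forall t0 : R, 0 < t0 ->
  (\int[lebesgue_measure]_(t in `]0%R, t0]) g t = +oo)%E.

(* (t / A t) ^ (1 / (n - 1)), with the conventions t / +oo = 0 and
   t / 0 = +oo for t > 0 *)
Definition sobolev_integrand n A (t : R) : \bar R :=
  ((t%:E / A t) `^ (n.-1%:R)^-1)%E.

Definition conj_exponent n : R := n%:R / n.-1%:R.

(* finite whenever A is non-degenerate and the integral converges at 0 *)
Definition H_ n A (s : R) : R :=
  fine ((\int[lebesgue_measure]_(t in `]0%R, s]) sobolev_integrand n A t)
        `^ (conj_exponent n)^-1)%E.

(* Ah is an admissible Young function to be used in place of A in the
   definition of H_n *)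
Definition H_admissible n A Ah :=
  (cvg_int_zero (sobolev_integrand n A) /\ Ah = A) \/
  [/\ dvg_int_zero (sobolev_integrand n A), young Ah, equiv_near_infty A Ah
    & cvg_int_zero (sobolev_integrand n Ah)].

End young_functions.

Section sobolev_spaces.
Context {R : realType} {n : nat}.
Implicit Types (O : set 'rV[R]_n) (u v w : 'rV[R]_n -> R).
Implicit Types (G : 'rV[R]_n -> 'rV[R]_n) (A B : R -> \bar R).

Local Notation mu := (lebesgueN R n).

(* the norm provided by the library on 'rV[R]_n is the sup norm *)
Definition euclid_norm (v : 'rV[R]_n) : R := Num.sqrt (\sum_i v 0 i ^+ 2).

Definition lebesgue_measurable O u :=
  measurable_fun (O : set (lebesgueT R n)) (u : lebesgueT R n -> R).

Definition partial (i : 'I_n) u : 'rV[R]_n -> R :=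
  fun x => 'D_(delta_mx 0 i : 'rV[R]_n) u x.

Fixpoint continuously_differentiable (k : nat) u : Prop :=
  continuous u /\
  if k is k'.+1 then
    forall i, (forall x, derivable u x (delta_mx 0 i : 'rV[R]_n)) /\
              continuously_differentiable k' (partial i u)
  else True.

Definition smooth u := forall k, continuously_differentiable k u.

Definition test_function O u := smooth u /\
  exists K : set 'rV[R]_n, [/\ compact K, K `<=` O &
    forall x, ~ K x -> u x = 0].

Definition locally_integrable_on O u := lebesgue_measurable O u /\
  forall K : set 'rV[R]_n, compact K -> K `<=` O ->
    mu.-integrable K (EFin \o u).

Definition is_weak_gradient O u G :=
  [/\ locally_integrable_on O u,
      forall i, locally_integrable_on O (fun x => G x 0 i) &
      forall i phi, test_function O phi ->
        (\int[mu]_(x in O) (u x * partial i phi x)%:E =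
         - \int[mu]_(x in O) (G x 0 i * phi x)%:E)%E].

Definition weakly_differentiable O u := exists G, is_weak_gradient O u G.

(* a representative of the weak gradient, which is unique up to a null set
   when it exists *)
Definition weak_gradient O u : 'rV[R]_n -> 'rV[R]_n :=
  xget (fun=> 0) [set G | is_weak_gradient O u G].

Definition W1p_norm (p : \bar R) O u : \bar R :=
  ('N[mu]_p[(EFin \o u) \_ O] +
   'N[mu]_p[(fun x => (euclid_norm (weak_gradient O u x))%:E) \_ O])%E.

Definition W1p (p : \bar R) O u :=
  weakly_differentiable O u /\ (W1p_norm p O u < +oo)%E.

Definition W11_plus_W1oo O u :=
  exists v w, [/\ W1p 1%E O v, W1p +oo%E O w & u = v \+ w].

(* A function on O is represented by any of its extensions to R^n, and
   functions are identified up to null sets.  By linearity and boundedness,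
   [Ext u] only depends (up to a null set) on the values of u in O. *)
Definition extension_domain O := open O /\
  exists Ext : ('rV[R]_n -> R) -> ('rV[R]_n -> R),
  [/\ forall a u v, W11_plus_W1oo O u -> W11_plus_W1oo O v ->
        {ae mu, forall x, Ext (fun y => a * u y + v y) x =
                          a * Ext u x + Ext v x},
      forall u, W11_plus_W1oo O u -> {ae mu, forall x, O x -> Ext u x = u x} &
      forall p : \bar R, p = 1%E \/ p = +oo%E ->
        exists C : R, forall u, W1p p O u ->
          W1p p setT (Ext u) /\
          (W1p_norm p setT (Ext u) <= C%:E * W1p_norm p O u)%E].

Definition orlicz A O u := lebesgue_measurable O u /\
  exists2 l : R, 0 < l & (\int[mu]_(x in O) A (`|u x| / l)%R < +oo)%E.

Definition orlicz_vec A O G :=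
  (forall i, lebesgue_measurable O (fun x => G x 0 i)) /\
  exists2 l : R, 0 < l & (\int[mu]_(x in O) A (euclid_norm (G x) / l)%R < +oo)%E.

Definition orlicz_sobolev A O u :=
  [/\ weakly_differentiable O u, orlicz A O u &
      orlicz_vec A O (weak_gradient O u)].

Definition modular_cvg A O (u_ : nat -> 'rV[R]_n -> R) u :=
  exists2 l : R, 0 < l &
    (\int[mu]_(x in O) A (`|u_ k x - u x| / l)%R)%E @[k --> \oo] --> 0%E.

Definition modular_cvg_vec A O (G_ : nat -> 'rV[R]_n -> 'rV[R]_n) G :=
  exists2 l : R, 0 < l &
    (\int[mu]_(x in O) A (euclid_norm (G_ k x - G x) / l)%R)%E @[k --> \oo]
      --> 0%E.

Definition modular_cvg_W A O (u_ : nat -> 'rV[R]_n -> R) u :=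
  modular_cvg A O u_ u /\
  modular_cvg_vec A O (fun k => weak_gradient O (u_ k)) (weak_gradient O u).

Definition maps_orlicz_sobolev A B O (T : ('rV[R]_n -> R) -> ('rV[R]_n -> R)) :=
  forall u, orlicz_sobolev A O u -> orlicz_sobolev B O (T u).

Definition modular_continuous A B O
    (T : ('rV[R]_n -> R) -> ('rV[R]_n -> R)) :=
  forall (u_ : nat -> 'rV[R]_n -> R) u,
    (forall k, orlicz_sobolev A O (u_ k)) -> orlicz_sobolev A O u ->
    modular_cvg_W A O u_ u ->
    modular_cvg_W B O (fun k => T (u_ k)) (T u).

Definition superposition (f : R -> R) u : 'rV[R]_n -> R := f \o u.

End sobolev_spaces.

(* Main.v *)
Require Import Defs.
From HB Require Import structures.
From mathcomp Require Import all_boot all_order all_algebra.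
From mathcomp Require Import all_classical all_reals all_analysis.
From mathcomp Require Import measurable_realfun.
From mathcomp Require Import ring lra.

(* Every Sobolev function is replaced by a Borel representative with Borel weak
   partial derivatives, and a locally Lipschitz [f] with [f 0 = 0] is the primitive of a Borel
   function [h] with [|h(s)| <= w(|s|)]. The chain rule [grad (f o u) = h(u) grad u] holds for
   bounded Borel [h] by a monotone class argument starting from continuous [h].

   Growth. The extension operator and a weak-type Sobolev inequality in W^{1,1} (a Loomis-Whitney
   argument) compare, for [a < b], the height [b - a] with the measure of [u > a], [u >= b] and the
   energy of the gradient on [a < u < b].  Summing over levels at which the measure of the
   superlevel sets decreases geometrically, and comparing [s] with [A s] through the integrand of
   [H_n], shows that [u] is bounded in terms of its modulars in case (i), while in case (ii), for
   dyadic levels comparable to [H_n(t_j)], [A(t_j)] times the measure of the superlevel set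
   is at most the energy of the preceding layer.  Splitting each layer according to whether
   [|grad u|] exceeds [t_j], this yields
   [B(p w(|u|) / l) <= D (A(p / L) + A(|u| / L)) + r] with a remainder [r] of integral at most
   any prescribed [e]; the constants depend only on an integrable majorant of the modulars of [u],
   so that the remainder acts as a uniform integrability bound.

   Continuity. A modularly convergent sequence has, along subsequences, such a common
   majorant, and converges a.e.  As [h] is only Borel, the convergence of [h(u_k)] is not automatic:
   for bounded [theta] the chain rule makes [u |-> theta(u) grad u] weakly continuous, and applied to
   [theta] and [theta^2] this gives [int (theta(u_k) - theta(u))^2 |d_i u| -> 0], hence a.e.
   convergence of [h(u_k)] on [d_i u <> 0] along a subsequence.  Dominated convergence, with the
   remainder [r] treated separately, concludes. *)

Set Implicit Arguments.
Unset Strict Implicit.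
Unset Printing Implicit Defensive.

Import Order.TTheory GRing.Theory Num.Theory.
Import numFieldNormedType.Exports.

Local Open Scope classical_set_scope.
Local Open Scope ring_scope.

(** * Boxes and translations in R^n *)

Section boxes.
Context {R : realType} (n : nat).
Implicit Types (a b : 'I_n -> R) (x v : 'rV[R]_n).

(** The extension operator acts on W^{1,1}, to which a function in W^{1,A} need not belong. What is
    extended is the truncation of the function between two positive levels: it is bounded, lives on
    a set of finite measure and has integrable gradient. Each layer then yields a weak-type
    estimate, and since layers are disjoint their energies add up. Young functions may fail to be
    doubling. So modulars are taken at fixed scales, every loss goes into the scale or into a factor
    outside the modular, and the target scale [l] is fixed before the subsequence and its majorant
    are chosen; this dictates the order of quantifiers in [growth_control]. The remainder there is
    not a multiple of the majorant: the value of [|u|] at a point does not control [A(t_j)] when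
    [H_n(t_j)] is comparable to [|u|], only the measure of the superlevel set does. It is controlled
    in the mean, and small because layers above a high level carry little energy. Translation,
    Fubini and Dynkin arguments run on Borel sets; Lebesgue measurability enters only through null
    sets, when passing to representatives and back. *)

Definition box a b : set 'rV[R]_n := [set x : 'rV[R]_n | forall i, `]a i, b i[%classic (x 0 i)].

Lemma measurable_box a b : measurable (box a b).
Proof.
apply: (@measurable_rV_box _ _ (fun i => `]a i, b i[%classic)) => i; exact: measurable_itv.
Qed.

Definition boxes : set (set 'rV[R]_n) := [set box ab.1 ab.2 | ab in setT].

Lemma boxes_setI : setI_closed boxes.
Proof.
move=> _ _ [[a b] _ <-] [[c d] _ <-] /=.
exists (fun i => Num.max (a i) (c i), fun i => Num.min (b i) (d i)) => //=.
apply/seteqP; split => x /=.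
  move=> H; split=> i; have := H i; rewrite /= !in_itv/= gt_max lt_min; lra.
by move=> [H1 H2] i; have := H1 i; have := H2 i; rewrite /= !in_itv/= gt_max lt_min => /andP[-> ->] /andP[-> ->].
Qed.

Lemma measurable_boxes : @measurable _ 'rV[R]_n = <<s boxes>>.
Proof.
apply/seteqP; split; last first.
  apply: smallest_sub; first exact: sigma_algebra_measurable.
  by move=> _ [[a b] _ <-]; exact: measurable_box.
apply: smallest_sub; first exact: smallest_sigma_algebra.
move=> B; rewrite -bigcup_seq/= => -[i _ [Y mY <-]]; rewrite setTI.
have : measurable `<=` [set Y : set R | <<s boxes>> ((fun x : 'rV[R]_n => x 0 i) @^-1` Y)].
  rewrite [X in X `<=` _](RGenOInfty.measurableE R).
  apply: smallest_sub.
    split=> [|B' mB|F mF] /=.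
    - by rewrite preimage_set0; apply: sigma_algebra0; exact: smallest_sigma_algebra.
    - rewrite setTD preimage_setC -setTD. 
      by apply: sigma_algebraCD => //; exact: smallest_sigma_algebra.
    - by rewrite preimage_bigcup; apply: sigma_algebra_bigcup => //; exact: smallest_sigma_algebra.
  move=> _ [t ->] /=.
  rewrite [X in <<s _ >> X](_ : _ = \bigcup_(N : nat)
      box (fun j => if j == i then t else - N%:R) (fun=> N%:R)); last first.
    apply/seteqP; split => x /=; rewrite in_itv/= andbT.
      move=> tx; exists (Num.truncn (\sum_j `|x 0 j|)).+1 => // j.
      have xN : `|x 0 j| < (Num.truncn (\sum_j `|x 0 j|)).+1%:R.
        apply: le_lt_trans (truncnS_gt _).
        by rewrite (bigD1 j)//= lerDl sumr_ge0.
      rewrite /= in_itv/=; move: xN; rewrite ltr_norml => /andP[xN1 ->]; rewrite andbT.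
      by case: eqP => [->|].
    by move=> [N _ /(_ i)]; rewrite /= in_itv/= eqxx => /andP[].
  apply: sigma_algebra_bigcup => N; apply: sub_gen_smallest.
  by exists (fun j => if j == i then t else - N%:R, fun=> N%:R).
by apply.
Qed.

Lemma ball_rV x r y : 0 < r -> ball x r y <-> forall i, `|x 0 i - y 0 i| < r.
Proof.
move=> r0; split => [[_ H] i|H]; first by have := H 0 i; rewrite -ball_normE.
by split=> // i j; rewrite ord1 -ball_normE; exact: H.
Qed.

Definition ccube x r := [set y : 'rV[R]_n | forall i, `|x 0 i - y 0 i| <= r].

(** Rational centres and radii [1/(k+1)] give a countable family, so that a.e. statements proved
    cube by cube can be combined. *)
Definition qcenter (p : 'rV[rat]_n * nat) : 'rV[R]_n := \row_i ratr (p.1 0 i).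
Definition qradius (p : 'rV[rat]_n * nat) : R := p.2.+1%:R^-1.

Lemma qradius_gt0 p : 0 < qradius p.
Proof. by rewrite invr_gt0 ltr0n. Qed.

(** The small cube covers the point; the tripled one leaves room inside [U] for test functions and
    for translates of the small cube. *)
Lemma qcube_cover (U : set 'rV[R]_n) x : open U -> U x ->
  exists p, ball (qcenter p) (qradius p) x /\ ccube (qcenter p) (3 * qradius p) `<=` U.
Proof.
move=> oU Ux; have [e /= e0 eU] : exists2 e : R, 0 < e & ball x e `<=` U.
  by apply/nbhs_ballP; exact: open_nbhs_nbhs.
(* The point lies within [1/(k+1)] of the centre and the tripled cube has radius [3/(k+1)], so four
   times [1/(k+1)] must stay below [e]. *)
pose k := Num.truncn (4 / e).
have ke : k.+1%:R^-1 < e / 4.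
  rewrite -[ltRHS]invrK ltf_pV2 ?posrE ?invr_gt0 ?divr_gt0// invf_div.
  exact: truncnS_gt.
have H i : exists q : rat, `|ratr q - x 0 i| < k.+1%:R^-1.
  have [] := @dense_rat R (ball (x 0 i) k.+1%:R^-1).
  - by exists (x 0 i); apply: ballxx; rewrite invr_gt0.
  - exact: ball_open.
  by move=> _ [] /[swap] [[q _ <-]]; rewrite -ball_normE/= distrC => H; exists q.
pose q i := projT1 (cid (H i)); have qP i : `|ratr (q i) - x 0 i| < k.+1%:R^-1.
  by rewrite /q; case: cid.
exists (\row_i q i, k); split.
  by apply/ball_rV => [|i]; rewrite ?qradius_gt0// !mxE.
move=> y yC; apply: eU; apply/ball_rV => // i.
have := yC i; have := qP i; rewrite !mxE /qradius/=; move: ke.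
set s := k.+1%:R^-1; move=> se.
rewrite !ltr_distl !ler_distl => /andP[? ?] /andP[? ?]; apply/andP; split; lra.
Qed.

Lemma measurable_ball_rV x r : measurable (ball x r).
Proof.
have [r0|r0] := leP r 0.
  by rewrite (_ : ball x r = set0)// predeqE => y; split=> // -[]; rewrite ltNge r0.
rewrite (_ : ball x r = box (fun i => x 0 i - r) (fun i => x 0 i + r)).
  exact: measurable_box.
apply/seteqP; split=> y; rewrite (ball_rV _ _ r0) => H i; have := H i.
  by rewrite /= in_itv/= ltr_distlC.
by rewrite /= in_itv/= ltr_distlC.
Qed.

Lemma open_bigcup_qcube (U : set 'rV[R]_n) : open U ->
  U = \bigcup_(p in [set p | ccube (qcenter p) (3 * qradius p) `<=` U])
        ball (qcenter p) (qradius p).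
Proof.
move=> oU; apply/seteqP; split=> x.
  by move=> Ux; have [p [? ?]] := qcube_cover oU Ux; exists p.
move=> [p pU px]; apply: pU => i; apply/ltW.
have /(ball_rV _ _ (qradius_gt0 p))/(_ i)/lt_le_trans := px; apply.
by have := qradius_gt0 p; lra.
Qed.

Lemma open_measurable_rV (U : set 'rV[R]_n) : open U -> measurable U.
Proof.
move=> oU; rewrite (open_bigcup_qcube oU).
rewrite bigcup_mkcond; apply: countable_bigcupT_measurable; first exact: countableP.
by move=> p; case: ifPn => // _; exact: measurable_ball_rV.
Qed.

Lemma closed_measurable_rV (U : set 'rV[R]_n) : closed U -> measurable U.
Proof. by move=> cU; rewrite -(setCK U); apply: measurableC; apply: open_measurable_rV; exact: closed_openC. Qed.

Lemma compact_measurable_rV (U : set 'rV[R]_n) : compact U -> measurable U.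
Proof. move=> cU; apply: closed_measurable_rV; apply: compact_closed => //; exact: norm_hausdorff. Qed.

Lemma continuous_measurable_rV (f : 'rV[R]_n -> R) : continuous f ->
  measurable_fun setT f.
Proof.
move=> /continuousP cf; apply: (measurability _ (RGenOpens.measurableE R)).
by move=> _ [_ [a [b ->] <-]]; rewrite setTI; apply: open_measurable_rV; apply: cf; exact: interval_open.
Qed.

Lemma compact_ccube x r : compact (ccube x r).
Proof.
rewrite (_ : ccube x r = [set y | forall i, `[x 0 i - r, x 0 i + r]%classic (y 0 i)]).
  by apply: (@rV_compact _ _ (fun i => `[x 0 i - r, x 0 i + r]%classic)) => i; exact: segment_compact.
by apply/seteqP; split=> y H i; have := H i; rewrite /= in_itv/= ler_distlC.
Qed.

Lemma ball_sub_ccube x r : ball x r `<=` ccube x r.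
Proof.
move=> y [r0 H] i; apply: ltW; have := H 0 i; by rewrite -ball_normE.
Qed.

End boxes.

Section translation.
Context {R : realType} (n : nat).
Implicit Types (x v : 'rV[R]_n).
Local Notation mu := (borel_lebesgue n).

Lemma measurable_addrV v : measurable_fun setT (fun x => x + v).
Proof.
apply: measurable_fun_rV => i; rewrite [X in measurable_fun _ X](_ : _ = fun x => x 0 i + v 0 i).
  by apply: measurable_funD => //; exact: measurable_coord.
by apply/funext => x; rewrite mxE.
Qed.

Lemma borel_lebesgue_boxE (a b : 'I_n -> R) :
  mu (box a b) = (\prod_(i < n) lebesgue_measure `]a i, b i[%classic)%E.
Proof. by rewrite (@borel_lebesgue_box _ _ (fun i => `]a i, b i[%classic))// => i; exact: measurable_itv. Qed.

Lemma borel_lebesgue_box_lty (a b : 'I_n -> R) : (mu (box a b) < +oo)%E.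
Proof.
rewrite borel_lebesgue_boxE.
suff : (\prod_(i < n) lebesgue_measure `]a i, b i[%classic)%E \is a @fin_num R.
  by rewrite fin_numElt => /andP[].
apply: (big_ind (fun x : \bar R => x \is a fin_num)) => // [x y|i _]; first exact: fin_numM.
by rewrite lebesgue_measure_itv/=; case: ifPn => // _; rewrite -EFinB.
Qed.

Definition translate v : set 'rV[R]_n -> \bar R := pushforward mu (fun x => x + v).

Let translate0 v : translate v set0 = 0%E.
Proof. by rewrite /translate /pushforward preimage_set0 measure0. Qed.

Let translate_ge0 v A : (0 <= translate v A)%E.
Proof. exact: (measure_ge0 mu). Qed.

Let translate_sigma_additive v : semi_sigma_additive (translate v).
Proof.
move=> F mF tF mUF; rewrite /translate /pushforward preimage_bigcup.
apply: measure_semi_sigma_additive.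
- by move=> k; rewrite -[X in measurable X]setTI; exact: measurable_addrV.
- apply/trivIsetP => /= i j _ _ ij; rewrite -preimage_setI.
  by move/trivIsetP : tF => /(_ _ _ _ _ ij) ->//; rewrite preimage_set0.
- rewrite -preimage_bigcup -[X in measurable X]setTI.
  exact: measurable_addrV.
Qed.

HB.instance Definition _ v := isMeasure.Build _ _ _ (translate v)
  (translate0 v) (translate_ge0 v) (@translate_sigma_additive v).

Lemma bigcup_boxT : \bigcup_k box (fun=> - k%:R) (fun=> k%:R) = [set: 'rV[R]_n].
Proof.
apply/seteqP; split=> // x _; exists (Num.truncn (\sum_j `|x 0 j|)).+1 => // j.
rewrite /= in_itv/= -ltr_norml.
apply: le_lt_trans (truncnS_gt _).
by rewrite (bigD1 j)//= lerDl sumr_ge0.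
Qed.

(** Boxes are stable under intersection, generate the Borel sets and exhaust the space by sets of
    finite measure. *)
Lemma borel_lebesgue_unique (m1 m2 : {measure set 'rV[R]_n -> \bar R}) :
  (forall a b, m1 (box a b) = m2 (box a b)) ->
  (forall a b, (m1 (box a b) < +oo)%E) ->
  forall S, measurable S -> m1 S = m2 S.
Proof.
move=> m12 m1oo S mS.
apply: (@measure_unique _ _ _ (@boxes R n) (fun k => box (fun=> - k%:R) (fun=> k%:R))) => //.
- exact: measurable_boxes.
- exact: boxes_setI.
- by move=> k; exists (fun=> - k%:R, fun=> k%:R).
- exact: bigcup_boxT.
- by move=> _ [[a b] _ <-]/=.
Qed.

Lemma borel_lebesgue_translation v (S : set 'rV[R]_n) : measurable S ->
  mu ((fun x => x + v) @^-1` S) = mu S.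
Proof.
move=> mS; rewrite -[LHS]/(translate v S).
have H a b : translate v (box a b) = mu (box a b).
  rewrite /translate /pushforward.
  rewrite (_ : _ @^-1` _ = box (fun i => a i - v 0 i) (fun i => b i - v 0 i)); last first.
    apply/seteqP; split=> x Hx i; have := Hx i; rewrite /= !in_itv/= !mxE; lra.
  rewrite !borel_lebesgue_boxE; apply: eq_bigr => i _.
  rewrite !lebesgue_measure_itv/= !lte_fin ltrD2r; case: ifPn => // _.
  by rewrite -!EFinB; congr EFin; lra.
apply: borel_lebesgue_unique => // a b; rewrite [X in (X < _)%E]H.
exact: borel_lebesgue_box_lty.
Qed.

Lemma ge0_integral_translation v (f : 'rV[R]_n -> \bar R) :
  measurable_fun setT f -> (forall x, 0 <= f x)%E ->
  (\int[mu]_x f (x + v)%R = \int[mu]_x f x)%E.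
Proof.
move=> mf f0; transitivity (\int[translate v]_x f x)%E.
  rewrite (@ge0_integral_pushforward _ _ _ _ _ _ (measurable_addrV v) mu setT f)//.
apply: eq_measure_integral => A mA _; exact: borel_lebesgue_translation.
Qed.

Lemma integrable_translation v (f : 'rV[R]_n -> \bar R) :
  mu.-integrable setT f -> mu.-integrable setT (fun x => f (x + v)).
Proof.
move=> /integrableP[mf foo]; apply/integrableP; split.
  by apply: measurableT_comp => //; exact: measurable_addrV.
rewrite (ge0_integral_translation v (f := abse \o f))//; last by move=> x; exact: abse_ge0.
exact: measurableT_comp.
Qed.

Lemma integral_translation v (f : 'rV[R]_n -> \bar R) :
  mu.-integrable setT f -> (\int[mu]_x f (x + v)%R = \int[mu]_x f x)%E.
Proof.
move=> fi; have mf := measurable_int _ fi.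
rewrite integralE [RHS]integralE; congr (_ - _)%E.
  by rewrite -(ge0_integral_translation v (measurable_funepos mf))//; apply: eq_integral => x _; rewrite !funeposE.
by rewrite -(ge0_integral_translation v (measurable_funeneg mf))//; apply: eq_integral => x _; rewrite !funenegE.
Qed.

End translation.

(** * Smooth plateaus *)

Section smooth_bump.
Context {R : realType}.
Implicit Types (p q : R -> R) (a b c t : R).

(** The power [t ^- k] is carried along because differentiating [exp(-c/t)] produces such powers:
    the family is closed under derivation up to linear combinations. *)
Definition beta c k t : R := if 0 < t then t ^- k * expR (- (c / t)) else 0.

Lemma expR_ge_pow m (x : R) : 0 <= x -> (x / m.+1%:R) ^+ m.+1 <= expR x.
Proof.
move=> x0; rewrite [leRHS](_ : _ = expR (x / m.+1%:R) ^+ m.+1); last first.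
  by rewrite -expRM_natl; congr expR; rewrite mulrC divfK// pnatr_eq0.
rewrite lerXn2r ?nnegrE ?expR_ge0 ?divr_ge0//.
by apply: le_trans (expR_ge1Dx _); rewrite lerDr.
Qed.

(** The exponential beats a power of order one more than the pole, which leaves a factor [t]: this
    is the flatness at 0. *)
Lemma beta_bound c k t : 0 < c -> 0 <= beta c k.+1 t <= (k.+2%:R / c) ^+ k.+2 * `|t|.
Proof.
move=> c0; rewrite /beta; case: ifPn => [t0|]; last first.
  by rewrite lexx mulr_ge0// exprn_ge0// divr_ge0// ltW.
rewrite mulr_ge0 ?expR_ge0 ?invr_ge0 ?exprn_ge0 ?(ltW t0)//=.
have ct : 0 < c / t by rewrite divr_gt0.
have H := expR_ge_pow k.+1 (ltW ct).
rewrite expRN gtr0_norm// ler_pdivrMr ?expR_gt0//.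
apply: le_trans (_ : (k.+2%:R / c) ^+ k.+2 * t * (c / t / k.+2%:R) ^+ k.+2 <= _); last first.
  by rewrite ler_pM2l// mulr_gt0// exprn_gt0// divr_gt0.
rewrite mulrAC -exprMn [X in X ^+ _ * _](_ : _ = t^-1); last first.
  by field; rewrite !gt_eqF//= ltr0n.
by rewrite [t^-1 ^+ _]exprS mulrAC mulVf ?gt_eqF// mul1r exprVn.
Qed.

Lemma isdM (f g : R -> R) t a b : is_derive t 1 f a -> is_derive t 1 g b ->
  is_derive t 1 (fun t => f t * g t) (a * g t + f t * b).
Proof.
move=> Df Dg; apply: (is_derive_eq (is_deriveM Df Dg)).
by rewrite /GRing.scale/=; ring.
Qed.

Lemma isdZ (f : R -> R) t c a : is_derive t 1 f a ->
  is_derive t 1 (fun t => c * f t) (c * a).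
Proof. by move=> Df; exact: (is_deriveZ c Df). Qed.

Lemma isdB_cst (b t : R) : is_derive t 1 (fun t => b - t) (- 1).
Proof.
apply: (is_derive_eq (is_deriveB (is_derive_cst b t 1) (is_derive_id t 1))).
by rewrite sub0r.
Qed.

Lemma isd_comp (f g : R -> R) t a b : is_derive (g t) 1 f a -> is_derive t 1 g b ->
  is_derive t 1 (fun t => f (g t)) (a * b).
Proof. by move=> Df Dg; exact: (is_derive1_comp Df Dg). Qed.

Lemma is_derive_exprn k (y : R) : is_derive y 1 (fun y => y ^+ k) (k%:R * y ^+ k.-1).
Proof.
elim: k => [|k ih]; first by rewrite mul0r; exact: is_derive_cst.
rewrite (_ : (fun y => _) = (fun y : R => y * y ^+ k)); last by apply/funext => z; rewrite exprS.
apply: (is_derive_eq (isdM (is_derive_id y 1) ih)).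
case: k {ih} => [|k]/=; first by rewrite !expr0; ring.
by rewrite -[in RHS]natr1 exprS; ring.
Qed.

Lemma is_derive_beta c k t : 0 < c ->
  is_derive t 1 (beta c k) (c * beta c k.+2 t - k%:R * beta c k.+1 t).
Proof.
move=> c0; have [t0|t0|t0] := ltgtP t 0.
- rewrite /beta !ltNge ltW//= !mulr0 subrr.
  apply: (@near_eq_is_derive _ _ _ (cst 0)) => //; near=> s => /=.
  rewrite ltNge ifN// negbK ltW//; near: s; exact: lt_nbhsl.
- rewrite /beta t0.
  (* For positive [t] the function is [g] at [1/t], and [g] is smooth on the whole line. *)
  pose g (y : R) := y ^+ k * expR (- (c * y)).
  apply: (@near_eq_is_derive _ _ _ (g \o (fun t => t^-1))).
  + near=> s; rewrite ifT /g /= ?exprVn//; near: s; exact: lt_nbhsr.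
  + have D1 : is_derive t 1 (fun t : R => t^-1) (- t ^- 2).
      apply: is_derive_eq; first by apply: is_deriveV; rewrite gt_eqF.
      by rewrite /GRing.scale/= mulr1.
    have D2 : is_derive t^-1 1 g (k%:R * t^-1 ^+ k.-1 * expR (- (c * t^-1)) - c * t^-1 ^+ k * expR (- (c * t^-1))).
      have D3 : is_derive t^-1 1 (fun y => - (c * y)) (- c).
        under eq_fun do rewrite -mulNr.
        by have := isdZ (f := id) (- c) (is_derive_id t^-1 1); rewrite mulr1; apply.
      have D4 := isd_comp (g := fun y => - (c * y)) (is_derive_expR (- (c * t^-1))) D3.
      by apply: (is_derive_eq (isdM (is_derive_exprn _ _) D4)); ring.
    apply: (is_derive_eq (isd_comp D2 D1)).
    case: k {g D2} => [|k] /=; rewrite -!exprVn ?expr0 !exprS ?expr0; ring.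
- rewrite t0 /beta ltxx !mulr0 subrr.
  suff H : h^-1 *: (beta c k (h *: 1 + 0) - beta c k 0) @[h --> 0^'] --> (0 : R).
    apply: DeriveDef; first by apply/cvg_ex; exists 0.
    exact/cvg_lim.
  (* The difference quotient at 0 is the next member of the family, which [beta_bound] sends to
     0. *)
  rewrite [X in X @ _ --> _](_ : _ = beta c k.+1); last first.
    apply/funext => h; rewrite /GRing.scale/= mulr1 addr0 /beta ltxx subr0.
    case: ifPn => h0; last by rewrite mulr0.
    by rewrite -!exprVn exprS mulrA.
  apply/cvgr0Pnorm_lt => e e0.
  pose C := (k.+2%:R / c) ^+ k.+2 : R.
  have C0 : 0 < C by rewrite exprn_gt0// divr_gt0.
  near=> h; have /andP[b0 bC] := beta_bound k h c0.
  rewrite ger0_norm//; apply: le_lt_trans bC _; rewrite -/C mulrC -ltr_pdivlMr//.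
  by near: h; apply: dnbhs0_lt; rewrite divr_gt0.
Unshelve. all: by end_near. Qed.

(** A syntactic class on which derivation acts: induction on the terms gives a derivative in the
    same class, hence derivatives of all orders. *)
Inductive smooth1 : (R -> R) -> Prop :=
| smooth1_beta c k a : 0 < c -> smooth1 (fun t => beta c k (t - a))
| smooth1_betaN c k b : 0 < c -> smooth1 (fun t => beta c k (b - t))
| smooth1D p q : smooth1 p -> smooth1 q -> smooth1 (fun t => p t + q t)
| smooth1M p q : smooth1 p -> smooth1 q -> smooth1 (fun t => p t * q t)
| smooth1Z a p : smooth1 p -> smooth1 (fun t => a * p t).

Lemma smooth1_derive p : smooth1 p ->
  exists2 q, smooth1 q & forall t, is_derive t 1 p (q t).
Proof.
elim=> {p} [c k a c0|c k b c0|p q _ [p' sp' Dp] _ [q' sq' Dq]|p q sp [p' sp' Dp] sq [q' sq' Dq]|a p sp [p' sp' Dp]].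
- exists (fun t => c * beta c k.+2 (t - a) + (- k%:R) * beta c k.+1 (t - a)).
    by apply: smooth1D; apply: smooth1Z; exact: smooth1_beta.
  move=> t; have := is_derive_beta k (t - a) c0 => H.
  have H2 : is_derive t 1 (fun t => t - a) (1 : R).
    by apply: is_derive_eq; rewrite subr0.
  have := @is_derive1_comp _ (beta c k) (fun t => t - a) t _ _ H H2.
  by rewrite mulr1 mulNr => D; exact: D.
- exists (fun t => (- c) * beta c k.+2 (b - t) + (k%:R) * beta c k.+1 (b - t)).
    by apply: smooth1D; apply: smooth1Z; exact: smooth1_betaN.
  move=> t; have := is_derive_beta k (b - t) c0 => H.
  by apply: (is_derive_eq (isd_comp (g := fun t => b - t) H (isdB_cst b t))); ring.
- exists (fun t => p' t + q' t); first exact: smooth1D.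
  move=> t; have := Dp t; have := Dq t => H1 H2; exact: is_deriveD.
- exists (fun t => p t * q' t + p' t * q t); first by apply: smooth1D; exact: smooth1M.
  move=> t; apply: (is_derive_eq (isdM (Dp t) (Dq t))); exact: addrC.
- exists (fun t => a * p' t); first exact: smooth1Z.
  move=> t; exact: isdZ.
Qed.

(** Smoothness as a tower of functions, each the derivative of the previous one; translations,
    differences and primitives then act level by level. *)
Definition cinf p := exists2 D : nat -> R -> R, D 0%N = p &
  forall k t, is_derive t 1 (D k) (D k.+1 t).

Lemma smooth1_cinf p : smooth1 p -> cinf p.
Proof.
move=> sp; pose T := {p | smooth1 p}.
have H (x : T) : {y : T | forall t, is_derive t 1 (sval x) (sval y t)}.
  apply: cid; case: x => q /= /smooth1_derive[r sr Dr].
  by exists (exist _ r sr).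
pose D := fix D k := if k is k'.+1 then sval (H (D k')) else exist _ p sp : T.
by exists (fun k => sval (D k)) => // k t; rewrite /=; case: (H (D k)).
Qed.

Lemma cinf_derive p : cinf p -> exists2 q, cinf q & forall t, is_derive t 1 p (q t).
Proof.
move=> [D D0 HD]; exists (D 1%N); last by move=> t; rewrite -D0.
by exists (fun k => D k.+1).
Qed.

Lemma cinf_prim p q : cinf q -> (forall t, is_derive t 1 p (q t)) -> cinf p.
Proof.
move=> [D D0 HD] pq; exists (fun k => if k is k'.+1 then D k' else p) => //.
by case=> // t; rewrite D0.
Qed.

Lemma cinfB_shift p s : cinf p -> cinf (fun t => p t - p (t - s)).
Proof.
move=> [D D0 HD]; exists (fun k t => D k t - D k (t - s)); first by rewrite D0.
move=> k t; have := HD k t; have := HD k (t - s) => H1 H0.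
have H2 : is_derive t 1 (fun t => t - s) (1 : R).
  by apply: is_derive_eq; rewrite subr0.
have H3 := @is_derive1_comp _ (D k) (fun t => t - s) t _ _ H1 H2.
by rewrite mulr1 in H3; exact: is_deriveB.
Qed.

Lemma cinf_continuous p : cinf p -> continuous p.
Proof.
move=> /cinf_derive[q _ pq] t; apply/differentiable_continuous/derivable1_diffP.
by have := pq t => -[].
Qed.

(** As [1/(j+1)] tends to 0 the factor [exp(-c/t)] tends to 1 for every [t > 0], so these smooth
    functions with values in [0, 1] converge to the indicator of []a, b[]. *)
Definition plateau j a b t := beta j.+1%:R^-1 0 (t - a) * beta j.+1%:R^-1 0 (b - t).

Lemma plateau_cinf j a b : cinf (plateau j a b).
Proof.
apply: smooth1_cinf; apply: smooth1M; [apply: smooth1_beta|apply: smooth1_betaN];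
by rewrite invr_gt0 ltr0n.
Qed.

Lemma beta01 c t : 0 < c -> 0 <= beta c 0 t <= 1.
Proof.
move=> c0; rewrite /beta; case: ifPn => t0; last by rewrite lexx ler01.
rewrite expr0 invr1 mul1r expR_ge0/= -[leRHS]expR0 ler_expR oppr_le0.
by rewrite divr_ge0// ltW.
Qed.

Lemma plateau01 j a b t : 0 <= plateau j a b t <= 1.
Proof.
have j0 : 0 < j.+1%:R^-1 :> R by rewrite invr_gt0 ltr0n.
have /andP[h1 h2] := beta01 (t - a) j0; have /andP[h3 h4] := beta01 (b - t) j0.
by rewrite /plateau mulr_ge0//= mulr_ile1.
Qed.

Lemma plateau_out j a b t : ~ (`]a, b[%classic t) -> plateau j a b t = 0.
Proof.
rewrite /= in_itv/= => H; rewrite /plateau /beta !subr_gt0.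
case: ifPn => [at_|_]; last by rewrite mul0r.
case: ifPn => [tb|_]; last by rewrite mulr0.
by exfalso; apply: H; rewrite at_ tb.
Qed.

Lemma plateau_cvg a b t : plateau j a b t @[j --> \oo] --> (\1_(`]a, b[%classic) t : R).
Proof.
have [H|H] := pselect (`]a, b[%classic t); last first.
  rewrite indicE memNset//; under eq_fun do rewrite plateau_out//; exact: cvg_cst.
rewrite indicE mem_set//; move: H; rewrite /= in_itv/= => /andP[at_ tb].
have Hb s : 0 < s -> beta j.+1%:R^-1 0 s @[j --> \oo] --> (1 : R).
  move=> s0; rewrite /beta s0 -[X in _ --> X]expR0.
  under eq_fun do rewrite expr0 invr1 mul1r.
  apply: (@cvg_comp _ _ _ (fun j => - (j.+1%:R^-1 / s)) expR _ (nbhs (0 : R))); last exact: continuous_expR.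
  rewrite -oppr0; apply: cvgN; rewrite -(mul0r s^-1); apply: cvgM; last exact: cvg_cst.
  exact: cvg_harmonic.
by rewrite /plateau -[X in _ --> X](mulr1 1); apply: cvgM; apply: Hb; rewrite subr_gt0.
Qed.

End smooth_bump.

Section tensor.
Context {R : realType} (n : nat).
Implicit Types (p : 'I_n -> R -> R) (x : 'rV[R]_n).

Definition tensor p : 'rV[R]_n -> R := fun x => \prod_i p i (x 0 i).

(** A partial derivative of a product of one-variable functions replaces one factor, which makes
    smoothness an induction on the order. *)
Definition subst1 p i q : 'I_n -> R -> R := fun j => if j == i then q else p j.

Lemma tensorE p i x : tensor p x = p i (x 0 i) * \prod_(j | j != i) p j (x 0 j).
Proof. by rewrite /tensor (bigD1 i). Qed.

Lemma tensor_subst1 p i q x :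
  tensor (subst1 p i q) x = q (x 0 i) * \prod_(j | j != i) p j (x 0 j).
Proof.
rewrite (tensorE _ i) /subst1 eqxx; congr (_ * _).
by apply: eq_bigr => j /negPf ->.
Qed.

Lemma tensor_is_derive p (i : 'I_n) (q : R -> R) x : (forall t : R, is_derive t 1 (p i) (q t)) ->
  is_derive x (delta_mx 0 i) (tensor p) (tensor (subst1 p i q) x).
Proof.
move=> pq; pose c := \prod_(j | j != i) p j (x 0 j).
have [dp vp] := pq (x 0 i).
suff H : h^-1 *: (tensor p (h *: delta_mx 0 i + x) - tensor p x) @[h --> 0^'] -->
    tensor (subst1 p i q) x.
  by apply: DeriveDef; [apply/cvg_ex; eexists; exact: H|exact/cvg_lim].
rewrite (_ : (fun h => _) = (fun h : R => h^-1 *: (p i (h *: 1 + x 0 i) - p i (x 0 i)) * c)).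
  rewrite tensor_subst1; apply: cvgM; last exact: cvg_cst.
  rewrite -vp; exact: dp.
apply/funext => h; rewrite !(tensorE _ i) !mxE !eqxx /GRing.scale/= -mulrA mulrBl.
congr (_ * (_ * _ - _)).
by apply: eq_bigr => j /negPf ji; rewrite !mxE ji andbF mulr0 add0r.
Qed.

Lemma prod_continuous (T : topologicalType) (I : Type) (r : seq I) (P : pred I)
  (F : I -> T -> R) : (forall i, continuous (F i)) ->
  continuous (fun y => \prod_(i <- r | P i) F i y).
Proof.
move=> cF; elim: r => [|i r ih] y.
  under eq_fun do rewrite big_nil; exact: cvg_cst.
rewrite (_ : (fun y0 => _) = (fun z => (if P i then F i z else 1) * \prod_(j <- r | P j) F j z)); last first.
  by apply/funext => z; rewrite big_cons; case: ifP => // _; rewrite mul1r.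
by apply: cvgM; [case: ifP => _; [exact: cF|exact: cvg_cst]|exact: ih].
Qed.

Lemma tensor_continuous p : (forall i, continuous (p i)) -> continuous (tensor p).
Proof.
move=> cp; apply: prod_continuous => i x.
by apply: (@continuous_comp _ _ _ (fun x : 'rV[R]_n => x 0 i) (p i)); [exact: coord_continuous|exact: cp].
Qed.

Lemma partial_tensor p (i : 'I_n) (q : R -> R) : (forall t : R, is_derive t 1 (p i) (q t)) ->
  partial i (tensor p) = tensor (subst1 p i q).
Proof. by move=> pq; apply/funext => x; rewrite /partial; have [_ ->] := tensor_is_derive x pq. Qed.

Lemma tensor_smooth p : (forall i, cinf (p i)) -> smooth (tensor p).
Proof.
move=> cp k; elim: k p cp => [|k ih] p cp; split.
- by apply: tensor_continuous => i; exact: cinf_continuous.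
- by [].
- by apply: tensor_continuous => i; exact: cinf_continuous.
move=> i; have [q cq pq] := cinf_derive (cp i); split.
  by move=> x; have [] := tensor_is_derive x pq.
rewrite (partial_tensor pq); apply: ih => j; rewrite /subst1.
by case: eqP.
Qed.

Lemma tensor_test (O : set 'rV[R]_n) p (a b : 'I_n -> R) :
  (forall i, cinf (p i)) -> (forall i t, ~ (`[a i, b i]%classic t) -> p i t = 0) ->
  [set x : 'rV[R]_n | forall i, `[a i, b i]%classic (x 0 i)] `<=` O ->
  test_function O (tensor p).
Proof.
move=> cp p0 abO; split; first exact: tensor_smooth.
exists [set x : 'rV[R]_n | forall i, `[a i, b i]%classic (x 0 i)]; split => //.
  by apply: (@rV_compact _ _ (fun i => `[a i, b i]%classic)) => i; exact: segment_compact.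
move=> x /= /existsNP[i xi]; rewrite (tensorE _ i) p0 ?mul0r//.
Qed.

End tensor.

(** * Translations and reflections of the line *)

Section line_invariance.
Context {R : realType}.
Local Notation leb := (@lebesgue_measure R).

(** The Boolean selects the reflection, so that a single uniqueness argument covers [t + r] and
    [t - r]. *)
Let opp_add (t : R) (b : bool) (r : R) : R := t + (if b then - r else r).

Let m_opp_add t b : measurable_fun setT (opp_add t b).
Proof.
rewrite /opp_add; apply: measurable_funD => //; case: b => //.
exact: (measurable_funN (f := id)).
Qed.

Definition affine_image (t : R) (b : bool) : set (measurableTypeR R) -> \bar R :=
  @pushforward _ _ (measurableTypeR R) (measurableTypeR R) R leb (opp_add t b).

Let affine_image0 t b : affine_image t b set0 = 0%E.
Proof. by rewrite /affine_image /pushforward preimage_set0 measure0. Qed.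

Let affine_image_ge0 t b A : (0 <= affine_image t b A)%E.
Proof. exact: (measure_ge0 leb). Qed.

Let affine_image_sigma_additive t b : semi_sigma_additive (affine_image t b).
Proof.
move=> F mF tF mUF; rewrite /affine_image /pushforward preimage_bigcup.
apply: measure_semi_sigma_additive.
- by move=> k; have := m_opp_add t b measurableT (mF k); rewrite setTI.
- apply/trivIsetP => /= i j _ _ ij; rewrite -preimage_setI.
  by move/trivIsetP : tF => /(_ _ _ _ _ ij) ->//; rewrite preimage_set0.
- by rewrite -preimage_bigcup; have := m_opp_add t b measurableT mUF; rewrite setTI.
Qed.

HB.instance Definition _ t b := isMeasure.Build _ _ _ (affine_image t b)
  (affine_image0 t b) (@affine_image_ge0 t b) (@affine_image_sigma_additive t b).

Lemma affine_imageE t b (S : set R) : measurable S -> affine_image t b S = leb S.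
Proof.
move=> mS; apply/esym; apply: (@lebesgue_measure_unique R (affine_image t b)) => //.
move=> X /ocitvP[->|[[x y] /= xy ->]]; first by rewrite !measure0.
rewrite /affine_image /pushforward.
have -> : leb (opp_add t b @^-1` `]x, y]) = (y - x)%:E.
  case: b; rewrite /opp_add.
    rewrite (_ : _ @^-1` _ = `[t - y, t - x[%classic).
      rewrite lebesgue_measure_itv/= lte_fin ifT; last by lra.
      by rewrite -EFinB; congr EFin; lra.
    by apply/seteqP; split=> r/=; rewrite !in_itv/= => /andP[? ?]; apply/andP; split; lra.
  rewrite (_ : _ @^-1` _ = `]x - t, y - t]%classic).
    rewrite lebesgue_measure_itv/= lte_fin ifT; last by lra.
    by rewrite -EFinB; congr EFin; lra.
  by apply/seteqP; split=> r/=; rewrite !in_itv/= => /andP[? ?]; apply/andP; split; lra.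
by rewrite lebesgue_measure_itv/= lte_fin xy -EFinB.
Qed.

Let ge0_integral_affine t b (f : R -> \bar R) :
  measurable_fun setT f -> (forall x, 0 <= f x)%E ->
  (\int[leb]_r f (opp_add t b r) = \int[leb]_r f r)%E.
Proof.
move=> mf f0; transitivity (\int[affine_image t b]_x f x)%E.
  by rewrite (@ge0_integral_pushforward _ _ (measurableTypeR R) (measurableTypeR R) R _ (m_opp_add t b) leb setT f).
apply: eq_measure_integral => A mA _; exact: affine_imageE.
Qed.

Lemma ge0_integral_addl t (f : R -> \bar R) :
  measurable_fun setT f -> (forall x, 0 <= f x)%E ->
  (\int[leb]_r f (t + r)%R = \int[leb]_r f r)%E.
Proof. exact: (@ge0_integral_affine t false). Qed.

Lemma ge0_integral_subl t (f : R -> \bar R) :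
  measurable_fun setT f -> (forall x, 0 <= f x)%E ->
  (\int[leb]_r f (t - r)%R = \int[leb]_r f r)%E.
Proof. exact: (@ge0_integral_affine t true). Qed.

End line_invariance.

(** * Dominated convergence with a bounded factor *)

Lemma norm_cvg_le {R : realType} (f_ : nat -> R) (l M : R) :
  f_ k @[k --> \oo] --> l -> (forall k, `|f_ k| <= M) -> `|l| <= M.
Proof.
move=> /cvg_norm cf fM; rewrite -(cvg_lim (@Rhausdorff R) cf).
by apply: limr_le; [exact: cvgP cf|exact: nearW].
Qed.

Section dct.
Context d (T : measurableType d) (R : realType) (mu : {measure set T -> \bar R}).

(** Convergence is asked only off the zero set of [g]. In the chain rule [g] is the weak derivative,
    and on its zero set the difference quotients of the outer function may fail to converge. *)
Lemma dct_on_support D (g phi : T -> R) (phi_ : nat -> T -> R) (M : R) :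
  measurable D -> mu.-integrable D (EFin \o g) ->
  (forall k, measurable_fun D (phi_ k)) -> measurable_fun D phi ->
  (forall k x, D x -> `|phi_ k x| <= M) ->
  {ae mu, forall x, D x -> g x != 0 -> phi_ k x @[k --> \oo] --> phi x} ->
  (\int[mu]_(x in D) (g x * phi_ k x)%:E)%E @[k --> \oo] -->
  (\int[mu]_(x in D) (g x * phi x)%:E)%E.
Proof.
move=> mD ig mphi_ mphi phiM cphi.
have mg : measurable_fun D g by apply/measurable_EFinP; exact: measurable_int ig.
have [] // := @dominated_convergence _ _ _ mu D mD (fun k x => (g x * phi_ k x)%:E)
  (fun x => (g x * phi x)%:E) (fun x => `|(M * g x)%:E|%E).
- by move=> k; apply/measurable_EFinP; exact: measurable_funM.
- by apply/measurable_EFinP; exact: measurable_funM.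
- apply: filterS cphi => x cx Dx; apply: cvg_EFin; first exact: nearW.
  have [->|gx0] := eqVneq (g x) 0.
    by rewrite mul0r; under eq_fun do rewrite mul0r; exact: cvg_cst.
  by apply: cvgM; [exact: cvg_cst|exact: cx].
- apply: integrable_abse; rewrite (_ : (fun x => _) = (fun x => M%:E * (EFin \o g) x)%E)//.
  exact: integrableZl.
- apply: aeW => x k Dx; rewrite !abse_EFin lee_fin !normrM mulrC ler_wpM2r//.
  by apply: le_trans (phiM k x Dx) _; exact: ler_norm.
Qed.

Lemma integrable_mul_bounded D (g phi : T -> R) (M : R) : measurable D ->
  mu.-integrable D (EFin \o g) -> measurable_fun D phi -> (forall x, D x -> `|phi x| <= M) ->
  mu.-integrable D (fun x => (g x * phi x)%:E).
Proof.
move=> mD ig mphi phiM.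
apply: (le_integrable mD _ _ (integrableZl mD M ig)) => [|x Dx].
  apply/measurable_EFinP; apply: measurable_funM => //; apply/measurable_EFinP.
  exact: measurable_int ig.
rewrite /= lee_fin !normrM mulrC ler_wpM2r//.
by apply: le_trans (phiM x Dx) _; exact: ler_norm.
Qed.

Lemma bounded_dct (D : set T) (g phi : T -> R) (phi_ : nat -> T -> R) (M : R) :
  measurable D -> mu.-integrable D (EFin \o g) ->
  (forall k, measurable_fun D (phi_ k)) ->
  (forall k x, D x -> `|phi_ k x| <= M) ->
  (forall x, D x -> phi_ k x @[k --> \oo] --> phi x) ->
  [/\ mu.-integrable D (fun x => (g x * phi x)%:E) &
  (\int[mu]_(x in D) (g x * phi_ k x)%:E)%E @[k --> \oo] -->
  (\int[mu]_(x in D) (g x * phi x)%:E)%E].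
Proof.
move=> mD ig mphi_ phiM cphi; have mphi : measurable_fun D phi by exact: measurable_fun_cvg mphi_ cphi.
split; last by apply: (dct_on_support mD ig mphi_ mphi phiM); apply: aeW => x Dx _; exact: cphi.
by apply: (integrable_mul_bounded mD ig mphi (M := M)) => x Dx; exact: (norm_cvg_le (cphi x Dx) (fun k => phiM k x Dx)).
Qed.

End dct.

(** * Functions with vanishing integrals on boxes *)

Section box_zero.
Context {R : realType} (n : nat).
Implicit Types (a b c d : 'I_n -> R).
Local Notation mu := (@borel_lebesgue R n).

Lemma box_ae0 (g : 'rV[R]_n -> R) a b :
  mu.-integrable setT (EFin \o g) ->
  (forall c d, (forall i, a i <= c i) -> (forall i, d i <= b i) ->
    (\int[mu]_(x in box c d) (g x)%:E = 0)%E) ->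
  {ae mu, forall x, box a b x -> g x = 0}.
Proof.
move=> ig g0; have mab : measurable (box a b) by exact: measurable_box.
(* Dynkin's argument: the sets on whose trace in the box [g] has zero integral contain the boxes and
   are stable under complement and disjoint union. *)
have key : forall S, measurable S -> (\int[mu]_(x in S `&` box a b) (g x)%:E = 0)%E.
  have igS S : measurable S -> mu.-integrable S (EFin \o g) by move=> mS; exact: integrableS ig.
  move=> S; rewrite [X in X S]measurable_boxes.
  apply: (@dynkin_induction _ _ (@boxes R n) (fun S => (\int[mu]_(x in S `&` box a b) (g x)%:E = 0)%E)).
  - exact: measurable_boxes.
  - exact: boxes_setI.
  - by rewrite setTI; apply: g0.
  - move=> _ [[c d] _ <-]/=.
    rewrite [X in integral _ X](_ : _ = box (fun i => Num.max (a i) (c i)) (fun i => Num.min (b i) (d i))).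
      by apply: g0 => i; rewrite ?le_max ?ge_min lexx.
    apply/seteqP; split => x /=.
      move=> [H1 H2] i; have := H1 i; have := H2 i; rewrite /= !in_itv/= gt_max lt_min => /andP[-> ->] /andP[-> ->] //.
    by move=> H; split=> i; have := H i; rewrite /= !in_itv/= gt_max lt_min => /andP[/andP[? ?] /andP[? ?]]; apply/andP.
  - move=> S' mS' PS'.
    have : (\int[mu]_(x in box a b) (g x)%:E = 0)%E by apply: g0.
    rewrite [X in integral _ X](_ : _ = (S' `&` box a b) `|` (~` S' `&` box a b)); last first.
      by rewrite -setIUl setUv setTI.
    rewrite integral_setU_EFin//; last 4 first.
    + exact: measurableI.
    + by apply: measurableI => //; exact: measurableC.
    + by apply: measurable_funTS; apply/measurable_EFinP; exact: measurable_int ig.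
    + by apply/disj_set2P; rewrite setIACA setICr set0I.
    by rewrite PS' add0e.
  - move=> F mF tF PF; rewrite setI_bigcupl integral_bigcup//.
    + by under eq_eseriesr do rewrite PF; rewrite eseries0.
    + by apply: trivIset_setIr.
    + by move=> k; exact: measurableI.
    + by apply: igS; apply: bigcup_measurable => k _; exact: measurableI.
have /= := @integral_ae_eq _ _ _ mu (box a b) mab (EFin \o g) (cst 0%E) _ _ _.
move=> H; apply: filterS (H _ _ _) => [x Hx abx|||E Eab mE].
- by have /= := Hx abx => -[].
- exact: integrable0.
- by apply: measurable_funTS; exact: measurable_int ig.
by rewrite integral0; apply/esym; rewrite -[E](setIidl Eab); exact: key.
Qed.

Definition plateaus k c d : 'rV[R]_n -> R := tensor (fun i => plateau k (c i) (d i)).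

Lemma plateaus_test (W : set 'rV[R]_n) k c d :
  [set x : 'rV[R]_n | forall i, `[c i, d i]%classic (x 0 i)] `<=` W ->
  test_function W (plateaus k c d).
Proof.
move=> cdW; apply: (tensor_test (a := c) (b := d)) => // [i|i t]; first exact: plateau_cinf.
rewrite /= => H; apply: plateau_out; rewrite /= in_itv/= => /andP[h1 h2]; apply: H.
by rewrite in_itv/= !ltW.
Qed.

Lemma plateaus01 k c d x : 0 <= plateaus k c d x <= 1.
Proof.
rewrite /plateaus /tensor; apply/andP; split.
  by apply: prodr_ge0 => i _; have /andP[] := plateau01 k (c i) (d i) (x 0 i).
by apply: prodr_ile1 => i _; exact: plateau01.
Qed.

Lemma plateaus_cvg c d x : plateaus k c d x @[k --> \oo] --> (\1_(box c d) x : R).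
Proof.
have -> : \1_(box c d) x = \prod_i \1_(`]c i, d i[%classic) (x 0 i) :> R.
  rewrite indicE; case: (boolP (x \in _)) => [|].
    by rewrite inE => H; rewrite big1// => i _; rewrite indicE mem_set//; exact: H.
  rewrite notin_setE => /existsNP[i Hi]; rewrite (bigD1 i)//= indicE memNset//.
  by rewrite mul0r.
rewrite /plateaus /tensor.
elim: (index_enum _) => [|i r ih].
  by under eq_fun do rewrite big_nil; rewrite big_nil; exact: cvg_cst.
under eq_fun do rewrite big_cons; rewrite big_cons; apply: cvgM => //.
exact: plateau_cvg.
Qed.

Lemma plateaus_measurable k c d : measurable_fun setT (plateaus k c d).
Proof.
apply: continuous_measurable_rV; apply: tensor_continuous => i.
by apply: cinf_continuous; exact: plateau_cinf.
Qed.

(** Plateaus converge boundedly to indicators of boxes, so testing against them already determines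
    [g]; their product form lets them be averaged explicitly along a line. *)
Lemma plateaus_ae0 (g : 'rV[R]_n -> R) a b :
  mu.-integrable setT (EFin \o g) ->
  (forall k c d, (forall i, a i <= c i) -> (forall i, d i <= b i) ->
    (\int[mu]_x (g x * plateaus k c d x)%:E = 0)%E) ->
  {ae mu, forall x, box a b x -> g x = 0}.
Proof.
move=> ig gphi; apply: box_ae0 => // c d ac db.
have bnd k x : setT x -> `|plateaus k c d x| <= 1.
  by move=> _; have /andP[h1 h2] := plateaus01 k c d x; rewrite ger0_norm.
have [_] := bounded_dct measurableT ig (fun k => @plateaus_measurable k c d) bnd
  (fun x _ => @plateaus_cvg c d x).
rewrite (_ : (fun k => _) = cst 0%E); last by apply/funext => k; exact: gphi.
move=> H; transitivity (\int[mu]_x (g x * \1_(box c d) x)%:E)%E.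
  rewrite integral_mkcond; apply: eq_integral => x _; rewrite patchE indicE.
  by case: ifPn; rewrite ?mulr1 ?mulr0.
by rewrite -(cvg_lim (@ereal_hausdorff R) H) lim_cst.
Qed.

Lemma test_ae0 (W : set 'rV[R]_n) (g : 'rV[R]_n -> R) a b :
  mu.-integrable setT (EFin \o g) ->
  [set x : 'rV[R]_n | forall i, `[a i, b i]%classic (x 0 i)] `<=` W ->
  (forall phi, test_function W phi -> (\int[mu]_x (g x * phi x)%:E = 0)%E) ->
  {ae mu, forall x, box a b x -> g x = 0}.
Proof.
move=> ig abW gphi; apply: plateaus_ae0 => // k c d ac db.
apply: gphi; apply: plateaus_test; apply: subset_trans abW => x H i.
by have := H i; have := ac i; have := db i; rewrite /= !in_itv/= => ? ? /andP[? ?]; apply/andP; split; lra.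
Qed.

End box_zero.

(** * Difference quotients *)

Section difference_quotient.
Context {R : realType} (n : nat) (i : 'I_n).
Local Notation mu := (@borel_lebesgue R n).
Local Notation leb := (@lebesgue_measure R).
Local Notation e := (delta_mx 0 i : 'rV[R]_n).
Implicit Types (g U phi : 'rV[R]_n -> R).

Lemma measurable_line :
  measurable_fun setT (fun p : 'rV[R]_n * measurableTypeR R => p.1 + p.2 *: e).
Proof.
apply: measurable_fun_rV => j.
rewrite (_ : (fun p => _) = fun p : 'rV[R]_n * measurableTypeR R => p.1 0 j + p.2 * e 0 j).
  apply: measurable_funD.
    by apply: (measurableT_comp (f := fun x : 'rV[R]_n => x 0 j)) => //; exact: measurable_coord.
  exact: measurable_funM.
by apply/funext => p; rewrite !mxE.
Qed.

(** Integrating against this indicator over the whole line, rather than over an interval, keeps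
    every double integral on the full product space, where Fubini and translation invariance apply
    directly. *)
Definition slab (s : R) : R -> R := \1_(`[0, s[%classic).

Lemma measurable_slab s : measurable_fun setT (slab s).
Proof. by apply: measurable_indic; exact: measurable_itv. Qed.

Lemma slab_ge0 s r : 0 <= slab s r.
Proof. by rewrite /slab indicE. Qed.

Let F1 s g := fun p : 'rV[R]_n * measurableTypeR R => (slab s p.2 * g (p.1 + p.2 *: e))%:E.

Let measurable_F1 s g : measurable_fun setT g -> measurable_fun setT (F1 s g).
Proof.
move=> mg; apply/measurable_EFinP; apply: measurable_funM.
  by apply: (measurableT_comp (f := slab s)) => //; exact: measurable_slab.
by apply: (measurableT_comp (f := g)) => //; exact: measurable_line.
Qed.

Lemma integral_slab s : 0 <= s -> (\int[leb]_r (slab s r)%:E = s%:E)%E.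
Proof.
move=> s0; rewrite /slab integral_indic; [|exact: measurableT|exact: measurable_itv].
rewrite setIT [LHS](lebesgue_measure_itv `[0%R, s[) /= lte_fin.
by case: ltgtP s0 => // [s0 _|<- _//]; rewrite -EFinB subr0.
Qed.

Lemma slab_integral s g : 0 <= s -> measurable_fun setT g ->
  (\int[leb]_r \int[mu]_x `|(slab s r * g (x + r *: e)%R)%:E| =
   s%:E * \int[mu]_x `|(g x)%:E|)%E.
Proof.
move=> s0 mg.
transitivity (\int[leb]_r ((slab s r)%:E * \int[mu]_x `|(g x)%:E|))%E.
  apply: eq_integral => r _.
  under eq_integral do rewrite EFinM abseM gee0_abs ?lee_fin ?slab_ge0//.
  rewrite ge0_integralZl_EFin ?slab_ge0//; last first.
    apply: measurableT_comp => //; apply/measurable_EFinP.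
    by apply: (measurableT_comp (f := g)) => //; exact: measurable_addrV.
  congr (_ * _)%E; rewrite -(ge0_integral_translation (r *: e) (f := fun x => `|(g x)%:E|%E))//.
  by apply: measurableT_comp => //; exact/measurable_EFinP.
rewrite ge0_integralZr//.
- by rewrite integral_slab.
- by apply/measurable_EFinP; exact: measurable_slab.
- by move=> r _; rewrite lee_fin slab_ge0.
- by apply: integral_ge0.
Qed.

Let integrable_F1 s g : 0 <= s -> mu.-integrable setT (EFin \o g) ->
  (mu \x leb)%E.-integrable setT (F1 s g).
Proof.
move=> s0 /integrableP[/measurable_EFinP mg goo].
apply/integrable21ltyP; first exact: measurable_F1.
rewrite /F1/= slab_integral//; exact: lte_mul_pinfty.
Qed.

(** The unnormalised Steklov average: the integral of [g] over the segment from [x] to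
    [x + s *: e]. *)
Definition line_avg s g x := \int[leb]_r (slab s r * g (x + r *: e)).

Lemma integrable_line_avg s g : 0 <= s -> mu.-integrable setT (EFin \o g) ->
  mu.-integrable setT (EFin \o line_avg s g).
Proof.
move=> s0 ig; have iF := integrable_fubini_F (integrable_F1 s0 ig).
apply: (le_integrable measurableT _ _ iF).
  apply/measurable_EFinP; apply: measurableT_comp => //.
  exact: measurable_int iF.
move=> x _ /=; rewrite /line_avg /Rintegral /fubini_F /F1/=.
by case: (integral _ _ _) => //= [|]; rewrite normr0 leey.
Qed.

Lemma ae_line_integrable s g : 0 <= s -> mu.-integrable setT (EFin \o g) ->
  {ae mu, forall x, leb.-integrable setT (fun r => (slab s r * g (x + r *: e))%:E)}.
Proof.
move=> s0 ig; have := ae_integrable1 (integrable_F1 s0 ig).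
by apply: filterS => x.
Qed.

(** Fubini, translation by [r *: e] in the inner integral, Fubini again: the average passes to [phi]
    with the direction reversed. *)
Lemma line_avg_adjoint s g phi : 0 <= s -> mu.-integrable setT (EFin \o g) ->
  measurable_fun setT phi -> (forall x, `|phi x| <= 1) ->
  (\int[mu]_x (line_avg s g x * phi x)%:E =
   \int[mu]_x (g x * \int[leb]_r (slab s r * phi (x - r *: e)))%:E)%E.
Proof.
move=> s0 ig mphi phi1.
have mg : measurable_fun setT g by apply/measurable_EFinP; exact: measurable_int ig.
(* [F2] and [F3] are the double integrands before and after the translation. *)
pose F2 := fun p : 'rV[R]_n * measurableTypeR R => (slab s p.2 * g (p.1 + p.2 *: e) * phi p.1)%:E.
pose F3 := fun p : 'rV[R]_n * measurableTypeR R => (slab s p.2 * g p.1 * phi (p.1 - p.2 *: e))%:E.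
have mF2 : measurable_fun setT F2.
  apply/measurable_EFinP; apply: measurable_funM; last exact: (measurableT_comp mphi).
  by apply/measurable_EFinP; exact: measurable_F1.
have iF2 : (mu \x leb)%E.-integrable setT F2.
  apply: (le_integrable measurableT mF2 _ (integrable_F1 s0 ig)) => p _.
  by rewrite /F2 /F1 !abse_EFin lee_fin normrM ler_piMr.
have mF3 : measurable_fun setT F3.
  apply/measurable_EFinP; apply: measurable_funM.
    apply: measurable_funM; last exact: (measurableT_comp mg).
    by apply: (measurableT_comp (f := slab s)) => //; exact: measurable_slab.
  apply: (measurableT_comp (f := phi)) => //.
  rewrite (_ : (fun p => _) = (fun p : 'rV[R]_n * measurableTypeR R => p.1 + p.2 *: e) \o (fun p => (p.1, - p.2))).
    apply: measurableT_comp; first exact: measurable_line.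
    apply: measurable_fun_pair => //.
    apply: (measurableT_comp (f := fun x : measurableTypeR R => - x : measurableTypeR R)) => //.
    exact: (measurable_funN (f := id)).
  by apply/funext => p; rewrite /= scaleNr.
have tr r : (\int[mu]_x F2 (x, r) = \int[mu]_x F3 (x, r))%E.
  have iF3r : mu.-integrable setT (fun x => F3 (x, r)).
    apply: (le_integrable measurableT _ _ (integrableZl measurableT (slab s r) ig)).
      exact: measurableT_comp.
    by move=> x _; rewrite /F3 /= !lee_fin !normrM ler_piMr.
  rewrite -(integral_translation (r *: e) iF3r); apply: eq_integral => x _.
  by rewrite /F2 /F3/= addrK.
have iF3 : (mu \x leb)%E.-integrable setT F3.
  apply/integrable12ltyP => //.
  apply: (@le_lt_trans _ _ (\int[mu]_x (`|(g x)%:E| * s%:E))%E).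
    apply: ge0_le_integral => //.
    - by move=> x _; exact: integral_ge0.
    - have mA : measurable_fun setT (fun p => `|F3 p|%E) by exact: measurableT_comp.
      rewrite -[X in measurable_fun _ X]/(fubini_F leb (fun p => `|F3 p|%E)).
      by apply: measurable_fun_fubini_tonelli_F => // p; exact: abse_ge0.
    - apply: emeasurable_funM => //; apply: measurableT_comp => //; exact/measurable_EFinP.
    move=> x _; rewrite -(integral_slab s0) -ge0_integralZl//; last 2 first.
      by apply/measurable_EFinP; exact: measurable_slab.
      by move=> r _; rewrite lee_fin slab_ge0.
    apply: ge0_le_integral => //.
    - by apply: measurableT_comp => //; exact: measurableT_comp.
    - by apply: emeasurable_funM => //; apply/measurable_EFinP; exact: measurable_slab.
    move=> r _; rewrite /F3/= -EFinM lee_fin !normrM (ger0_norm (slab_ge0 _ _)).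
    by rewrite [X in X * _]mulrC ler_piMr// mulr_ge0// slab_ge0.
  rewrite ge0_integralZr//; last by apply: measurableT_comp => //; exact/measurable_EFinP.
  by rewrite muleC lte_mul_pinfty//; case/integrableP: ig.
transitivity (\int[mu]_x \int[leb]_r F2 (x, r))%E.
  apply: ae_eq_integral => //.
  - apply/measurable_EFinP; apply: measurable_funM => //; apply/measurable_EFinP.
    by have := integrable_line_avg s0 ig; exact: measurable_int.
  - exact: measurable_fubini_F iF2.
  apply: filterS (ae_line_integrable s0 ig) => x ix _.
  rewrite /F2/= /line_avg -RintegralZr// /Rintegral fineK//.
  apply: integrable_fin_num => //.
  apply: (le_integrable measurableT _ _ ix) => [|r _].
    apply/measurable_EFinP; apply: measurable_funM => //; apply/measurable_EFinP.
    exact: measurable_int ix.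
  by rewrite /= lee_fin normrM ler_piMr.
rewrite (Fubini iF2).
transitivity (\int[leb]_r \int[mu]_x F3 (x, r))%E; first by apply: eq_integral => r _; exact: tr.
rewrite -(Fubini iF3); apply: eq_integral => x _.
have iphi : leb.-integrable setT (fun r => (slab s r * phi (x - r *: e))%:E).
  have islab : leb.-integrable setT (fun r => (slab s r)%:E).
    apply/integrableP; split; first by apply/measurable_EFinP; exact: measurable_slab.
    under eq_integral do rewrite gee0_abs ?lee_fin ?slab_ge0//.
    by rewrite integral_slab ?ltry.
  apply: (le_integrable measurableT _ _ islab) => [|r _].
    apply/measurable_EFinP; apply: measurable_funM; first exact: measurable_slab.
    apply: (measurableT_comp (f := phi)) => //; apply: measurable_fun_rV => j.
    rewrite (_ : (fun r => _) = fun r : R => x 0 j - r * e 0 j).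
      apply: measurable_funB => //; exact: measurable_funM.
    by apply/funext => r; rewrite !mxE.
  by rewrite /= lee_fin normrM ler_piMr.
rewrite /F3/= EFinM /Rintegral fineK; last exact: integrable_fin_num.
rewrite -integralZl//; apply: eq_integral => r _.
by rewrite -EFinM; congr EFin; ring.
Qed.

Section plateau_avg.
Variables (k : nat) (c d s : R).
Hypothesis s0 : 0 <= s.
Local Notation rho := (plateau k c d).

Let plateau_integrable : leb.-integrable setT (EFin \o rho).
Proof.
have mrho : measurable_fun setT rho.
  by apply: continuous_measurable_fun; apply: cinf_continuous; exact: plateau_cinf.
apply/integrableP; split; first exact/measurable_EFinP.
apply: (@le_lt_trans _ _ (\int[leb]_r (\1_(`]c, d[%classic) r)%:E)%E).
  apply: ge0_le_integral => //.
  - by apply: measurableT_comp => //; exact/measurable_EFinP.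
  - by apply/measurable_EFinP; apply: measurable_indic; exact: measurable_itv.
  move=> r _; rewrite abse_EFin lee_fin indicE.
  have [rcd|rcd] := boolP (r \in `]c, d[%classic); last first.
    by move: rcd; rewrite notin_setE => /plateau_out ->; rewrite normr0.
  by have /andP[h1 h2] := plateau01 k c d r; rewrite ger0_norm.
rewrite integral_indic; [|exact: measurableT|exact: measurable_itv].
rewrite setIT [X in (X < _)%E](lebesgue_measure_itv `]c, d[) /=.
by case: ifPn => // _; rewrite -EFinB ltry.
Qed.

(** With [P] a primitive of the plateau this is [P t - P (t - s)]: it is again smooth with compact
    support, and its derivative is a difference of two plateaus. *)
Definition plateau_avg t := \int[leb]_r (slab s r * rho (t - r)).

Let P t := \int[leb]_(r in `]-oo, t]) rho r.

Lemma plateau_avg_integrable t : leb.-integrable setT (EFin \o (fun r => slab s r * rho (t - r))).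
Proof.
have islab : leb.-integrable setT (fun r => (slab s r)%:E).
  apply/integrableP; split; first by apply/measurable_EFinP; exact: measurable_slab.
  under eq_integral do rewrite gee0_abs ?lee_fin ?slab_ge0//.
  by rewrite integral_slab ?ltry.
apply: (le_integrable measurableT _ _ islab) => [|r _].
  apply/measurable_EFinP; apply: measurable_funM; first exact: measurable_slab.
  apply: (measurableT_comp (f := rho)); last exact: measurable_funB.
  by apply: continuous_measurable_fun; apply: cinf_continuous; exact: plateau_cinf.
rewrite /= lee_fin normrM ler_piMr//.
by have /andP[h1 h2] := plateau01 k c d (t - r); rewrite ger0_norm.
Qed.

Let plateau_avgE t : plateau_avg t = P t - P (t - s).
Proof.
rewrite /plateau_avg /P Rintegral_itvB//; last 2 first.
- by apply: (integrableS _ _ _ plateau_integrable).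
- by rewrite bnd_simp lerBlDr lerDl.
congr fine.
transitivity (\int[leb]_r (slab s (t - r) * rho r)%:E)%E.
  rewrite -(ge0_integral_subl t)//.
  - by apply: eq_integral => r _; rewrite /=; congr EFin; congr (slab _ _ * _); ring.
  - apply/measurable_EFinP; apply: measurable_funM.
      apply: (measurableT_comp (f := slab s)); first exact: measurable_slab.
      exact: measurable_funB.
    by apply: continuous_measurable_fun; apply: cinf_continuous; exact: plateau_cinf.
  - by move=> r; rewrite lee_fin mulr_ge0 ?slab_ge0//; have /andP[] := plateau01 k c d r.
rewrite [RHS]integral_mkcond; apply: eq_integral => r _.
rewrite patchE /slab indicE.
rewrite (_ : (t - r \in `[0, s[%classic) = (r \in `]t - s, t]%classic)).
  by case: (boolP (r \in `]t - s, t]%classic)); rewrite ?mul1r ?mul0r.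
by apply/idP/idP; rewrite !inE/= !in_itv/= => /andP[? ?]; apply/andP; split; lra.
Qed.

Lemma is_derive_plateau_avg (t : R) :
  is_derive t 1 plateau_avg (rho t - rho (t - s)).
Proof.
have DP (u : R) : is_derive u 1 P (rho u).
  have [] := @continuous_FTC1 R rho -oo%O u (u + 1) _ _ _ _.
  - by rewrite ltrDl.
  - by apply: (integrableS _ _ _ plateau_integrable).
  - by rewrite ltNyr.
  - by apply: cinf_continuous; exact: plateau_cinf.
  by rewrite derive1E => h1 h2; exact: DeriveDef.
rewrite (_ : plateau_avg = fun t => P t - P (t - s)); last by apply/funext => u; exact: plateau_avgE.
have D1 : is_derive t 1 (fun t => t - s) (1 : R).
  by apply: is_derive_eq; rewrite subr0.
have D2 := isd_comp (g := fun t => t - s) (DP (t - s)) D1.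
by rewrite mulr1 in D2; exact: is_deriveB.
Qed.

Lemma plateau_avg_cinf : cinf plateau_avg.
Proof.
apply: (cinf_prim _ is_derive_plateau_avg); apply: cinfB_shift; exact: plateau_cinf.
Qed.

Lemma plateau_avg_out t : ~ (`[c, d + s]%classic t) -> plateau_avg t = 0.
Proof.
move=> H; rewrite /plateau_avg /Rintegral integral0_eq//= => r _.
rewrite /slab indicE; case: (boolP (r \in _)); rewrite ?mul0r// inE/= in_itv/= => /andP[r0 rs].
rewrite plateau_out ?mulr0// /= in_itv/= => /andP[h1 h2]; apply: H.
by rewrite /= in_itv/=; apply/andP; split; lra.
Qed.

End plateau_avg.

(** The weak derivative is tested against a product of plateaus averaged in direction [i]. Its
    partial derivative is the finite difference [phi x - phi (x - s *: e)]; moving the difference to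
    [U] and the average to [g] yields the identity against every product of plateaus. *)
Lemma steklov_identity (W : set 'rV[R]_n) U g s (a b : 'I_n -> R) :
  0 <= s -> mu.-integrable setT (EFin \o U) -> mu.-integrable setT (EFin \o g) ->
  [set x : 'rV[R]_n | forall j, `[a j, b j + s]%classic (x 0 j)] `<=` W ->
  (forall phi, test_function W phi ->
    \int[mu]_x (U x * partial i phi x)%:E = - \int[mu]_x (g x * phi x)%:E)%E ->
  {ae mu, forall x, box a b x -> U (x + s *: e) - U x = line_avg s g x}.
Proof.
move=> s0 iU ig abW weak.
pose D x := U (x + s *: e) - U x - line_avg s g x.
have iUs : mu.-integrable setT (EFin \o (fun x => U (x + s *: e))).
  exact: (integrable_translation (s *: e) iU).
have iavg := integrable_line_avg s0 ig.
have iD : mu.-integrable setT (EFin \o D).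
  rewrite (_ : EFin \o D = ((EFin \o (fun x => U (x + s *: e)%R)) \- (EFin \o U) \- (EFin \o line_avg s g))%E)//.
  by apply: integrableB => //; apply: integrableB.
have : {ae mu, forall x, box a b x -> D x = 0}; last first.
  by apply: filterS => x H /H /eqP; rewrite subr_eq0 => /eqP.
apply: plateaus_ae0 => // k c d ac db.
pose phi := plateaus k c d; pose q := plateau_avg k (c i) (d i) s.
(* [tensor p] is the average of [phi] along direction [i], since only the factor of index [i] varies
   on such a line. *)
pose p := subst1 (fun j => plateau k (c j) (d j)) i q.
have mphi : measurable_fun setT phi by exact: plateaus_measurable.
have phi1 x : `|phi x| <= 1.
  by have /andP[h1 h2] := plateaus01 k c d x; rewrite ger0_norm.
have test_p : test_function W (tensor p).
  apply: (tensor_test (a := a) (b := fun j => b j + s)) => [j|j t H|//].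
    by rewrite /p /subst1; case: eqP => _; [exact: plateau_avg_cinf|exact: plateau_cinf].
  rewrite /p /subst1; case: eqP => ji.
    apply: plateau_avg_out; rewrite /= in_itv/= -ji => /andP[h1 h2]; apply: H.
    by rewrite /= in_itv/=; have := ac j; have := db j; move=> ? ?; apply/andP; split; lra.
  apply: plateau_out; rewrite /= in_itv/= => /andP[h1 h2]; apply: H.
  by rewrite /= in_itv/=; have := ac j; have := db j; move=> ? ?; apply/andP; split; lra.
have phiE x : phi x = plateau k (c i) (d i) (x 0 i) * \prod_(j | j != i) plateau k (c j) (d j) (x 0 j).
  by rewrite /phi /plateaus (tensorE _ i).
have shiftE x r : phi (x - r *: e) = plateau k (c i) (d i) (x 0 i - r) *
    \prod_(j | j != i) plateau k (c j) (d j) (x 0 j).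
  rewrite phiE !mxE !eqxx mulr1; congr (_ * _); apply: eq_bigr => j /negPf ji.
  by rewrite !mxE ji andbF mulr0 subr0.
have pE x : tensor p x = \int[leb]_r (slab s r * phi (x - r *: e)).
  rewrite (tensorE _ i) /p /subst1 eqxx /q /plateau_avg -RintegralZr//; last first.
    exact: plateau_avg_integrable.
  apply: eq_Rintegral => r _; rewrite shiftE mulrA; congr (_ * _).
  by apply: eq_bigr => j /negPf ->.
have dpE x : partial i (tensor p) x = phi x - phi (x - s *: e).
  pose q' t := plateau k (c i) (d i) t - plateau k (c i) (d i) (t - s).
  have -> : partial i (tensor p) = tensor (subst1 p i q').
    by apply: partial_tensor => t; rewrite /p /subst1 eqxx; exact: is_derive_plateau_avg.
  rewrite tensor_subst1 mulrBl phiE shiftE; congr (_ * _ - _ * _); apply: eq_bigr => j /negPf ji;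
  by rewrite /p /subst1 ji.
have := weak _ test_p.
under eq_integral do rewrite dpE mulrBr EFinB.
have i1 (V : 'rV[R]_n -> R) (psi : 'rV[R]_n -> R) : mu.-integrable setT (EFin \o V) -> measurable_fun setT psi ->
    (forall x, `|psi x| <= 1) -> mu.-integrable setT (fun x => (V x * psi x)%:E).
  move=> iV mpsi psi1; apply: (le_integrable measurableT _ _ iV) => [|x _].
    by apply/measurable_EFinP; apply: measurable_funM => //; apply/measurable_EFinP; exact: measurable_int iV.
  by rewrite /= lee_fin normrM ler_piMr.
have mphis : measurable_fun setT (fun x : 'rV[R]_n => phi (x - s *: e)).
  by apply: (measurableT_comp mphi); exact: measurable_addrV.
rewrite integralB//; [|exact: i1|exact: i1].
under [X in _ = (- X)%E]eq_integral do rewrite pE.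
rewrite -line_avg_adjoint//.
rewrite -[X in (_ - X)%E](integral_translation (s *: e)); last exact: i1.
under [X in (_ - X)%E]eq_integral do rewrite addrK.
move=> H.
rewrite /D (_ : (fun x => _) = (fun x => (U (x + s *: e)%R * phi x)%:E - (U x * phi x)%:E - (line_avg s g x * phi x)%:E)%E).
  rewrite integralB//; [|by apply: integrableB => //; exact: i1|exact: i1].
  rewrite integralB//; [|exact: i1|exact: i1].
  move: H; have := integrable_fin_num measurableT (i1 _ _ iU mphi phi1).
  have := integrable_fin_num measurableT (i1 _ _ iUs mphi phi1).
  have := integrable_fin_num measurableT (i1 _ _ iavg mphi phi1).
  do 3 (case: (integral _ _ _) => // ? _).
  by rewrite -!EFinB -EFinN => -[H]; congr EFin; lra.
by apply/funext => x; rewrite -!EFinB /phi; congr EFin; ring.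
Qed.

End difference_quotient.

(** * Convergence to zero and almost everywhere subsequences *)

Lemma cvge0P {R : realType} (a : nat -> \bar R) : (forall k, 0 <= a k)%E ->
  (a k @[k --> \oo] --> 0%E) <->
  (forall e, 0 < e -> exists N, forall k, (N <= k)%N -> (a k <= e%:E)%E).
Proof.
move=> a0; split=> [acvg e e0|H].
  have [N _ NP] : (\forall k \near \oo, a k < e%:E)%E.
    apply: (acvg [set y | (y < e%:E)%E]); apply: open_nbhs_nbhs; split; first exact: open_ereal_lt_ereal.
    by rewrite /= lte_fin.
  by exists N => k Nk; apply/ltW; exact: NP.
apply/fine_cvgP; split.
  have [N NP] := H 1 ltr01; exists N => // k /= /NP ak.
  by rewrite ge0_fin_numE//; apply: le_lt_trans ak _; rewrite ltry.
apply/cvgr0Pnorm_le => e e0; have [N NP] := H e e0; exists N => // k /= /NP ak.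
rewrite ger0_norm ?fine_ge0// -lee_fin fineK// ge0_fin_numE//.
by apply: le_lt_trans ak _; rewrite ltry.
Qed.

Lemma squeeze0_cvge {R : realType} (a b : nat -> \bar R) : (forall k, 0 <= a k <= b k)%E ->
  b k @[k --> \oo] --> 0%E -> a k @[k --> \oo] --> 0%E.
Proof.
move=> ab.
have a0 k : (0 <= a k)%E by have /andP[] := ab k.
have aleb k : (a k <= b k)%E by have /andP[] := ab k.
have b0 k : (0 <= b k)%E by exact: le_trans (a0 k) (aleb k).
move=> /(cvge0P b0) bcvg; apply/(cvge0P a0) => e /bcvg[N NP]; exists N => k Nk.
exact: le_trans (aleb k) (NP k Nk).
Qed.

Lemma cvge0D {R : realType} (a b : nat -> \bar R) :
  a k @[k --> \oo] --> 0%E -> b k @[k --> \oo] --> 0%E -> (a k + b k)%E @[k --> \oo] --> 0%E.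
Proof. by move=> ca cb; rewrite -(adde0 0%E); apply: cvgeD. Qed.

Lemma cvge0Zl {R : realType} (c : R) (a : nat -> \bar R) :
  a k @[k --> \oo] --> 0%E -> (c%:E * a k)%E @[k --> \oo] --> 0%E.
Proof. by move=> ca; rewrite -(mule0 c%:E); apply: cvgeZl. Qed.

Section measure_lemmas.
Context d (T : measurableType d) (R : realType) (mu : {measure set T -> \bar R}).
Implicit Types (D : set T).

(** By monotone convergence the series of the [f k] is integrable, hence finite a.e., and the terms
    of a convergent series tend to 0. The a.e. convergent subsequences below are extracted this
    way. *)
Lemma ae_cvg0_of_summable D (f : nat -> T -> \bar R) : measurable D ->
  (forall k, measurable_fun D (f k)) -> (forall k x, D x -> 0 <= f k x)%E ->
  (\sum_(0 <= k <oo) \int[mu]_(x in D) f k x < +oo)%E ->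
  {ae mu, forall x, D x -> (\sum_(0 <= k <oo) f k x < +oo)%E} /\
  {ae mu, forall x, D x -> f k x @[k --> \oo] --> 0%E}.
Proof.
move=> mD mf f0; rewrite -integral_nneseries// => oo.
have mS : measurable_fun D (fun x => \sum_(0 <= k <oo) f k x)%E.
  by apply: (ge0_emeasurable_sum (P := xpredT)) => // k x Dx _; exact: f0.
have H : {ae mu, forall x, D x -> (\sum_(0 <= k <oo) f k x < +oo)%E}.
  have iS : mu.-integrable D (fun x => \sum_(0 <= k <oo) f k x)%E.
    apply/integrableP; split => //.
    rewrite (eq_integral (fun x => \sum_(0 <= k <oo) f k x)%E)// => x; rewrite inE => Dx.
    by rewrite gee0_abs// nneseries_ge0// => k _ _; exact: f0.
  apply: filterS (integrable_ae mD iS) => x H /H.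
  by rewrite fin_numElt => /andP[].
split=> //; apply: filterS H => x H Dx.
have := nneseries_tail_cvg (H Dx) (fun k _ => f0 k x Dx).
apply: squeeze0_cvge => k; rewrite f0//=.
have := @nneseries_lim_ge R (f ^~ x) xpredT k k.+1; rewrite big_nat1; apply.
by move=> j _ _; exact: f0.
Qed.

Lemma summable_subsequence (a : nat -> \bar R) : (forall k, 0 <= a k)%E ->
  a k @[k --> \oo] --> 0%E ->
  exists2 s : nat -> nat, {homo s : i j / (i < j)%N} &
    (\sum_(0 <= k <oo) a (s k) < +oo)%E.
Proof.
move=> a0 acvg.
have H j : exists N, forall k, (N <= k)%N -> (a k <= (1 / (2 ^ (j + 1))%:R)%:E)%E.
  by apply: (iffLR (cvge0P a0)) => //; rewrite divr_gt0// ltr0n expn_gt0.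
pose N j := projT1 (cid (H j)).
have NP j k : (N j <= k)%N -> (a k <= (1 / (2 ^ (j + 1))%:R)%:E)%E by move=> Nk; exact: (projT2 (cid (H j))).
pose s := fix s j := if j is j'.+1 then maxn (s j').+1 (N j) else N 0%N.
have sS j : (s j < s j.+1)%N by rewrite /= leq_max ltnSn.
exists s; first by apply: homo_ltn => //; exact: ltn_trans.
have sN j : (N j <= s j)%N by case: j => //= j; rewrite leq_max leqnn orbT.
apply: (@le_lt_trans _ _ (\sum_(0 <= k <oo) (1 / (2 ^ (k + 1))%:R)%:E)%E).
  by apply: lee_nneseries => // k _; exact: NP.
by rewrite (cvg_lim _ (@cvg_geometric_eseries_half R 1 0))// ltry.
Qed.

End measure_lemmas.

(** * Density of plateaus in L^1 *)

Section density.
Import HBSimple.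
Context {R : realType} (n : nat).
Local Notation mu := (@borel_lebesgue R n).
Implicit Types (f g : 'rV[R]_n -> R).
Local Notation L1 f := (mu.-integrable setT (EFin \o f)).

Variable Pr : ('rV[R]_n -> R) -> Prop.
Hypothesis Pr_plateau : forall k c d, Pr (plateaus k c d).
Hypothesis Pr_lin : forall a f g, L1 f -> L1 g -> Pr f -> Pr g -> Pr (fun x => f x + a * g x).
Hypothesis Pr_closed : forall f, L1 f ->
  (forall e, 0 < e -> exists g, [/\ L1 g, Pr g & (\int[mu]_x `|(f x - g x)%:E| <= e%:E)%E]) -> Pr f.

Let lim_closed f (f_ : nat -> 'rV[R]_n -> R) : L1 f -> (forall k, L1 (f_ k)) ->
  (forall k, Pr (f_ k)) ->
  (\int[mu]_x `|(f x - f_ k x)%:E|)%E @[k --> \oo] --> 0%E -> Pr f.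
Proof.
move=> if_ if_k Pfk cf; apply: Pr_closed => // e e0.
have a0 k : (0 <= \int[mu]_x `|(f x - f_ k x)%:E|)%E by exact: integral_ge0.
have [k kP] := iffLR (cvge0P a0) cf e e0.
by exists (f_ k); split => //; exact: kP.
Qed.

Lemma integrable_indic_lty (S : set 'rV[R]_n) : measurable S -> (mu S < +oo)%E -> L1 \1_S.
Proof.
move=> mS Soo; apply/integrableP; split.
  by apply/measurable_EFinP; exact: measurable_indic.
under eq_integral do rewrite gee0_abs ?lee_fin//.
by rewrite integral_indic// setIT.
Qed.

Let dct_closed f (f_ : nat -> 'rV[R]_n -> R) h : (forall k, L1 (f_ k)) ->
  (forall k, Pr (f_ k)) -> measurable_fun setT f -> L1 h ->
  (forall x, f_ k x @[k --> \oo] --> f x) ->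
  (forall k x, `|f_ k x| <= h x) -> Pr f.
Proof.
move=> if_k Pfk mf ih cf fh.
have [|||i1 c1 _] := @dominated_convergence _ _ _ mu setT measurableT (fun k => EFin \o f_ k)
  (EFin \o f) (EFin \o h) (fun k => measurable_int _ (if_k k)) (iffRL (measurable_EFinP _ _) mf).
- by apply: aeW => x _; apply: cvg_EFin; [exact: nearW|exact: cf].
- exact: ih.
- by apply: aeW => x k _; rewrite /= lee_fin; exact: fh.
apply: (lim_closed i1 if_k Pfk).
apply: cvg_trans c1; apply: near_eq_cvg; apply: nearW => k /=.
by apply: eq_integral => x _; rewrite distrC.
Qed.

Lemma integrable_plateaus k c d : L1 (@plateaus R n k c d).
Proof.
apply: (le_integrable measurableT _ _ (integrable_indic_lty (measurable_box c d) (borel_lebesgue_box_lty c d))).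
  by apply/measurable_EFinP; exact: plateaus_measurable.
move=> x _; rewrite !abse_EFin lee_fin [leRHS]ger0_norm//.
have /andP[h1 h2] := plateaus01 k c d x; rewrite ger0_norm// indicE.
case: (boolP (x \in _)) => //; rewrite notin_setE => /existsNP[i Hi].
by rewrite /plateaus (tensorE _ i) plateau_out// mul0r.
Qed.

Let Pr0 : Pr (cst 0).
Proof.
have i0 := integrable_plateaus 0 (fun=> 0) (fun=> 0).
have := Pr_lin (-1) i0 i0 (Pr_plateau _ _ _) (Pr_plateau _ _ _).
by congr Pr; apply/funext => x /=; ring.
Qed.

Let Pr_box c d : Pr \1_(box c d).
Proof.
apply: (dct_closed (f_ := fun k => plateaus k c d) (h := \1_(box c d))) => //.
- by move=> k; exact: integrable_plateaus.
- by apply: measurable_indic; exact: measurable_box.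
- by apply: integrable_indic_lty; [exact: measurable_box|exact: borel_lebesgue_box_lty].
- by move=> x; exact: plateaus_cvg.
move=> k x; have /andP[h1 h2] := plateaus01 k c d x; rewrite ger0_norm// indicE.
case: (boolP (x \in _)) => //; rewrite notin_setE => /existsNP[i Hi].
by rewrite /plateaus (tensorE _ i) plateau_out// mul0r.
Qed.

(** Inside a fixed cube complements keep finite measure, so linearity handles them; this is why the
    Dynkin argument is run there before the space is exhausted by cubes. *)
Let Pr_bounded_indic N S : measurable S -> Pr \1_(S `&` box (fun=> - N) (fun=> N)).
Proof.
set X := box _ _; have mX : measurable X by exact: measurable_box.
have Xoo : (mu X < +oo)%E by exact: borel_lebesgue_box_lty.
have iX A : measurable A -> L1 \1_(A `&` X).
  move=> mA; apply: integrable_indic_lty; first exact: measurableI.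
  apply: le_lt_trans Xoo; apply: le_measure; rewrite ?inE//; first exact: measurableI.
rewrite [X in X S -> _]measurable_boxes.
apply: (@dynkin_induction _ _ (@boxes R n) (fun S => Pr \1_(S `&` X))).
- exact: measurable_boxes.
- exact: boxes_setI.
- rewrite setTI; exact: Pr_box.
- move=> A bA; have [ab _ <-] : boxes (A `&` X).
    by apply: boxes_setI => //; exists (fun=> - N, fun=> N).
  exact: Pr_box.
- move=> A mA PA; have -> : \1_(~` A `&` X) = (fun x => \1_(setT `&` X) x + (-1) * \1_(A `&` X) x) :> ('rV[R]_n -> R).
    apply/funext => x; rewrite !indicE !in_setI in_setC in_setT.
    by case: (x \in A); case: (x \in X); rewrite /=; lra.
  by apply: Pr_lin => //; [exact: iX|exact: iX|rewrite setTI; exact: Pr_box].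
move=> F mF tF PF.
pose U k := \bigcup_(j in `I_k) F j.
have mU k : measurable (U k) by apply: bigcup_measurable.
pose f_ k : _ -> R := \1_(U k `&` X).
apply: (dct_closed (f_ := f_) (h := \1_X)).
- by move=> k; exact: iX.
- elim=> [|k ih].
    by rewrite /f_ (_ : U 0%N = set0) ?set0I ?indic0//; rewrite /U II0 bigcup_set0.
  rewrite (_ : f_ k.+1 = fun x => f_ k x + 1 * \1_(F k `&` X) x).
    by apply: Pr_lin => //; exact: iX.
  apply/funext => x; rewrite /f_ !indicE !in_setI mul1r.
  case: (x \in X); rewrite ?andbF ?addr0// !andbT.
  have [Fk|Fk] := boolP (x \in F k).
    rewrite (mem_set (_ : U k.+1 x)); last by exists k => /=; [exact: ltnSn|exact: set_mem].
    rewrite memNset ?add0r// => -[j /= jk Fj].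
    have /trivIsetP/(_ j k I I) := tF; rewrite ltn_eqF// => /(_ isT)/seteqP[+ _].
    by move=> /(_ x); apply; split => //; exact: set_mem.
  rewrite addr0; congr (_%:R); congr nat_of_bool; apply/idP/idP; rewrite !inE => -[j /= jk Fj].
    exists j => //=; move: jk; rewrite ltnS leq_eqVlt => /orP[/eqP jk|//].
    by move: Fk; rewrite -jk mem_set.
  by exists j => //=; exact: ltnW.
- by apply: measurable_indic; apply: measurableI => //; exact: bigcup_measurable.
- exact: integrable_indic_lty.
- move=> x; rewrite indicE in_setI.
  have [/set_mem[j _ Fj]|Fx] := boolP (x \in _).
    apply: cvg_near_cst; exists j.+1 => // k /= jk.
    by rewrite /f_ indicE in_setI mem_set//; exists j.
  rewrite (_ : (fun k => _) = cst 0); first exact: cvg_cst.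
  apply/funext => k; rewrite /f_ indicE in_setI memNset// => -[j _ Fj].
  by move: Fx; rewrite mem_set//; exists j.
- move=> k x; rewrite /f_ ger0_norm// !indicE in_setI.
  by case: (x \in X); rewrite ?andbF// andbT; case: (_ \in _).
Qed.

Let Pr_indic S : measurable S -> (mu S < +oo)%E -> Pr \1_S.
Proof.
move=> mS Soo.
apply: (dct_closed (f_ := fun k : nat => \1_(S `&` box (fun=> - k%:R) (fun=> k%:R))) (h := \1_S)) => //.
- move=> k; apply: integrable_indic_lty.
    by apply: measurableI => //; exact: measurable_box.
  apply: le_lt_trans Soo; apply: le_measure; rewrite ?inE//.
  by apply: measurableI => //; exact: measurable_box.
- by move=> k; exact: Pr_bounded_indic.
- exact: integrable_indic_lty.
- move=> x; have : [set: 'rV[R]_n] x by [].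
  rewrite -(@bigcup_boxT R n) => -[N _ Nx].
  apply: cvg_near_cst; exists N => // k /= Nk.
  rewrite !indicE in_setI andbC [x \in box _ _]mem_set// => i.
  have := Nx i; rewrite /= !in_itv/= => /andP[h1 h2].
  have : N%:R <= k%:R :> R by rewrite ler_nat.
  by move=> ?; apply/andP; split; lra.
- move=> k x; rewrite ger0_norm// !indicE in_setI.
  by case: (x \in S) => //=; case: (_ \in _).
Qed.

(** Plateaus give boxes by dominated convergence, boxes give Borel sets of finite measure, and
    simple functions are dense. It serves as an induction principle for properties that are closed
    in the L^1 norm. *)
Lemma L1_density f : L1 f -> Pr f.
Proof.
move=> if_; have [g_ [ig _ cg]] := approximation_sfun_integrable measurableT if_.
apply: (lim_closed if_ ig); last first.
  apply: cvg_trans cg; apply: near_eq_cvg; apply: nearW => k /=.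
  by apply: eq_integral => x _.
move=> k; set g := g_ k.
have gE : g = (fun x => \sum_(y <- finmap.enum_fset (fset_set (range g))) y * \1_(g @^-1` [set y]) x) :> ('rV[R]_n -> R).
  by apply/funext => x; rewrite fimfunE fsbig_finite.
rewrite [X in Pr X]gE.
have : forall r : seq R, Pr (fun x => \sum_(y <- r) y * \1_(g @^-1` [set y]) x) /\
    L1 (fun x => \sum_(y <- r) y * \1_(g @^-1` [set y]) x).
  elim=> [|y r [ih1 ih2]].
    under eq_fun do rewrite big_nil; split => //; exact: integrable0.
  (* The level set of the value 0 may have infinite measure, but its term vanishes; the others have
     finite measure since [g] is integrable. *)
  have [y0|y0] := eqVneq y 0.
    have E : (fun x => \sum_(z <- y :: r) z * \1_(g @^-1` [set z]) x) =
        (fun x => \sum_(z <- r) z * \1_(g @^-1` [set z]) x).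
      by apply/funext => x; rewrite big_cons y0 mul0r add0r.
    by rewrite E.
  have iy : L1 \1_(g @^-1` [set y]).
    apply: (le_integrable measurableT _ _ (integrableZl measurableT y^-1 (ig k))).
      by apply/measurable_EFinP; exact: measurable_indic.
    move=> x _; rewrite !abse_EFin lee_fin indicE.
    case: (boolP (x \in _)); rewrite ?normr0//= inE/= => gxy.
    by rewrite -/g gxy mulVf.
  have yoo : (mu (g @^-1` [set y]) < +oo)%E.
    have /integrableP[_] := iy; under eq_integral do rewrite gee0_abs ?lee_fin//.
    by rewrite integral_indic// setIT.
  have Py : Pr \1_(g @^-1` [set y]) by exact: Pr_indic.
  split.
    have := Pr_lin y ih2 iy ih1 Py; congr Pr; apply/funext => x.
    by rewrite big_cons addrC.
  rewrite (_ : EFin \o _ = ((fun x => (\sum_(j <- r) j * \1_(g @^-1` [set j]) x)%:E) \+ (fun x => y%:E * (\1_(g @^-1` [set y]) x)%:E))%E).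
    by apply: integrableD => //; exact: integrableZl.
  by apply/funext => x /=; rewrite big_cons addrC.
by move=> /(_ (finmap.enum_fset (fset_set (range g))))[].
Qed.

End density.

Section translation_continuity.
Context {R : realType} (n : nat) (i : 'I_n).
Local Notation mu := (@borel_lebesgue R n).
Local Notation e := (delta_mx 0 i : 'rV[R]_n).

(** An application of [L1_density]: continuity settles plateaus, and translation invariance of the
    norm makes the property stable under limits. *)
Lemma translation_L1_cvg (g : 'rV[R]_n -> R) (s : nat -> R) :
  mu.-integrable setT (EFin \o g) -> s k @[k --> \oo] --> (0 : R) ->
  (\int[mu]_x `|(g (x + s k *: e)%R - g x)%:E| @[k --> \oo] --> 0)%E.
Proof.
have L1s f r : mu.-integrable setT (EFin \o f) ->
    mu.-integrable setT (EFin \o (fun x => f (x + r *: e))).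
  by move=> if_; exact: (integrable_translation (r *: e) if_).
have L1B f1 f2 : mu.-integrable setT (EFin \o f1) -> mu.-integrable setT (EFin \o f2) ->
    mu.-integrable setT (fun x => (f1 x - f2 x)%:E).
  by move=> i1 i2; exact: (integrableB measurableT i1 i2).
pose N f r := (\int[mu]_x `|(f (x + r *: e)%R - f x)%:E|)%E.
have N0 f r : (0 <= N f r)%E by exact: integral_ge0.
pose Pr f := forall s : nat -> R, s k @[k --> \oo] --> (0 : R) -> (N f (s k) @[k --> \oo] --> 0)%E.
have mabs f1 f2 : mu.-integrable setT (EFin \o f1) -> mu.-integrable setT (EFin \o f2) ->
    measurable_fun setT (fun x => `|(f1 x - f2 x)%:E|)%E.
  by move=> i1 i2; apply: measurableT_comp => //; exact: measurable_int (L1B _ _ i1 i2).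
move=> ig; move: s; rewrite -/(Pr g); apply: (@L1_density R n Pr) ig.
- move=> k c d s s0.
  have [M [_ HM]] : bounded_fun s by apply: cvg_seq_bounded; apply/cvg_ex; exists 0.
  (* All shifts are at most [m], so the translates of the plateau live in one enlarged box, whose
     indicator dominates. *)
  pose m := `|M| + 1; have sm j : `|s j| <= m.
    by apply: HM => //; rewrite /m (le_lt_trans (ler_norm M))// ltrDl.
  pose X := box (fun j : 'I_n => c j - m) (fun j => d j + m).
  have iX : mu.-integrable setT (EFin \o \1_X).
    by apply: integrable_indic_lty; [exact: measurable_box|exact: borel_lebesgue_box_lty].
  have supp x r : `|r| <= m -> ~ X x -> plateaus k c d (x + r *: e) = 0.
    move=> rm /existsNP[j Hj]; rewrite /plateaus (tensorE _ j) plateau_out ?mul0r//.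
    move=> H; apply: Hj; move: H; rewrite /= !in_itv/= !mxE.
    case: (j == i); rewrite ?mulr1 ?mulr0; move: rm; rewrite ler_norml => /andP[? ?] /andP[? ?];
    apply/andP; split; lra.
  have ip := integrable_plateaus k c d.
  have [|||||_ H _] := @dominated_convergence _ _ _ mu setT measurableT
    (fun j x => (plateaus k c d (x + s j *: e) - plateaus k c d x)%:E) (cst 0%E) (EFin \o \1_X).
  + by move=> j; exact: measurable_int (L1B _ _ (L1s _ _ ip) ip).
  + exact: measurable_cst.
  + apply: aeW => x _; apply: cvg_EFin; first exact: nearW.
    rewrite -(subrr (plateaus k c d x)); apply: cvgB; last exact: cvg_cst.
    apply: (@cvg_comp _ _ _ (fun j => x + s j *: e) (plateaus k c d) _ (nbhs x)).
      have : x + s j *: e @[j --> \oo] --> x + 0 *: e.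
        by apply: cvgD; [exact: cvg_cst|apply: cvgZ; [exact: s0|exact: cvg_cst]].
      by rewrite scale0r addr0.
    apply: tensor_continuous => j; apply: cinf_continuous; exact: plateau_cinf.
  + exact: iX.
  + apply: aeW => x j _; rewrite abse_EFin lee_fin indicE.
    have [Xx|Xx] := pselect (X x).
      rewrite mem_set//=; have /andP[h1 h2] := plateaus01 k c d x.
      by have /andP[h3 h4] := plateaus01 k c d (x + s j *: e); rewrite ler_norml; apply/andP; split; lra.
    rewrite memNset// supp// -[x in plateaus _ _ _ x]addr0 -(scale0r e) supp ?subrr ?normr0//.
    exact: le_trans (sm 0%N).
  apply: cvg_trans H; apply: near_eq_cvg; apply: nearW => j /=.
  by apply: eq_integral => x _; rewrite subr0.
- move=> a f1 f2 i1 i2 P1 P2 s s0; apply: (@squeeze0_cvge _ _ (fun k => N f1 (s k) + `|a|%:E * N f2 (s k))%E).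
    move=> k; rewrite N0/= /N -ge0_integralZl//; last by exact: mabs (L1s _ _ i2) i2.
    rewrite -ge0_integralD//; last 2 first.
    + exact: mabs (L1s _ _ i1) i1.
    + by apply: emeasurable_funM => //; exact: mabs (L1s _ _ i2) i2.
    have i12 : mu.-integrable setT (EFin \o (fun x => f1 x + a * f2 x)).
      rewrite (_ : EFin \o _ = ((EFin \o f1) \+ (fun x => a%:E * (EFin \o f2) x))%E)//.
      by apply: integrableD => //; exact: integrableZl.
    apply: ge0_le_integral => //.
    + exact: mabs (L1s _ _ i12) i12.
    + apply: emeasurable_funD; first exact: mabs (L1s _ _ i1) i1.
      by apply: emeasurable_funM => //; exact: mabs (L1s _ _ i2) i2.
    move=> x _; rewrite !abse_EFin -EFinM -EFinD lee_fin -normrM.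
    by apply: le_trans (ler_normD _ _); rewrite le_eqVlt; apply/orP; left; apply/eqP; congr `|_|; ring.
  apply: cvge0D; first exact: P1.
  by apply: cvge0Zl; exact: P2.
- move=> f if_ H s s0; apply/cvge0P => // eps eps0.
  have e30 : 0 < eps / 3 by rewrite divr_gt0.
  have [h [ih Ph fh]] := H _ e30.
  have [K KP] := iffLR (cvge0P (fun k => N0 h (s k))) (Ph s s0) _ e30.
  exists K => k /KP Nk.
  apply: (@le_trans _ _ ((\int[mu]_x `|(f (x + s k *: e)%R - h (x + s k *: e)%R)%:E|) + N h (s k)
     + \int[mu]_x `|(f x - h x)%:E|)%E).
    rewrite -ge0_integralD//; [|exact: mabs (L1s _ _ if_) (L1s _ _ ih)|exact: mabs (L1s _ _ ih) ih].
    rewrite -ge0_integralD//; last 3 first.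
    + by move=> x _; rewrite adde_ge0.
    + by apply: emeasurable_funD; [exact: mabs (L1s _ _ if_) (L1s _ _ ih)|exact: mabs (L1s _ _ ih) ih].
    + exact: mabs.
    apply: ge0_le_integral => //.
    + exact: mabs (L1s _ _ if_) if_.
    + apply: emeasurable_funD; last exact: mabs.
      by apply: emeasurable_funD; [exact: mabs (L1s _ _ if_) (L1s _ _ ih)|exact: mabs (L1s _ _ ih) ih].
    move=> x _; rewrite !abse_EFin -!EFinD lee_fin.
    apply: le_trans (lerD (ler_normD _ _) (lexx _)).
    rewrite [X in _ <= _ + X]distrC; apply: le_trans (ler_normD _ _).
    by rewrite le_eqVlt; apply/orP; left; apply/eqP; congr `|_|; ring.
  rewrite (ge0_integral_translation (s k *: e) (f := fun x => `|(f x - h x)%:E|%E))//; last exact: mabs.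
  rewrite [X in (_ <= X%:E)%E](_ : eps = eps / 3 + eps / 3 + eps / 3); last by field.
  by rewrite !EFinD; apply: leeD => //; apply: leeD.
Qed.

End translation_continuity.

(** * Borel weak derivatives *)

Section test_functions.
Context {R : realType} (n : nat).
Local Notation mu := (@borel_lebesgue R n).
Implicit Types (phi : 'rV[R]_n -> R) (x : 'rV[R]_n).

Lemma partial_out (K : set 'rV[R]_n) phi (i : 'I_n) x : closed K ->
  (forall y, ~ K y -> phi y = 0) -> ~ K x -> partial i phi x = 0.
Proof.
move=> cK phi0 Kx; rewrite /partial.
have H : is_derive x (delta_mx 0 i : 'rV[R]_n) phi 0.
  have D0 : is_derive x (delta_mx 0 i : 'rV[R]_n) (cst (0 : R)) 0 by exact: is_derive_cst.
  apply: (near_eq_is_derive _ D0).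
  have : \forall y \near x, (~` K) y.
    by apply: open_nbhs_nbhs; split => //; exact: closed_openC.
  by apply: filterS => y Ky; rewrite phi0.
by have [_ ->] := H.
Qed.

Lemma bounded_of_compact_support (K : set 'rV[R]_n) phi : continuous phi -> compact K ->
  (forall x, ~ K x -> phi x = 0) -> exists2 M, 0 < M & forall x, `|phi x| <= M.
Proof.
move=> cphi cK phi0.
have : compact (phi @` K) by apply: continuous_compact => //; exact: continuous_subspaceT.
move=> /compact_bounded[M [_ HM]].
exists (`|M| + 1); first by rewrite ltr_wpDl.
move=> x; have [Kx|/phi0 ->] := pselect (K x); last by rewrite normr0 addr_ge0.
by apply: HM; [rewrite (le_lt_trans (ler_norm M))// ltrDl|exists x].
Qed.

Lemma test_function_facts (O : set 'rV[R]_n) phi (i : 'I_n) : test_function O phi ->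
  exists K M, [/\ compact K, K `<=` O, 0 < M,
    (forall x, ~ K x -> phi x = 0 /\ partial i phi x = 0) &
    (forall x, `|phi x| <= M /\ `|partial i phi x| <= M)] /\
    measurable_fun setT phi /\ measurable_fun setT (partial i phi).
Proof.
move=> [sphi [K [cK KO phi0]]].
have clK : closed K by apply: compact_closed => //; exact: norm_hausdorff.
have dphi0 x : ~ K x -> partial i phi x = 0 by move=> Kx; exact: (partial_out i clK phi0).
have cphi : continuous phi by have [] := sphi 0%N.
have cdphi : continuous (partial i phi) by have [_ /(_ i)[_ []]] := sphi 1%N.
have [M M0 HM] := bounded_of_compact_support cphi cK phi0.
have [N N0 HN] := bounded_of_compact_support cdphi cK dphi0.
exists K, (M + N); split; last by split; exact: continuous_measurable_rV.
split => //; first exact: addr_gt0.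
  by move=> x Kx; split; [exact: phi0|exact: dphi0].
by move=> x; have := HM x; have := HN x; split; lra.
Qed.

Lemma test_function_line (O : set 'rV[R]_n) phi (i : 'I_n) x (t : R) : test_function O phi ->
  is_derive t 1 (fun t => phi (x + t *: delta_mx 0 i)) (partial i phi (x + t *: delta_mx 0 i)).
Proof.
move=> [sphi _]; have [_ /(_ i)[dphi _]] := sphi 1%N.
have := dphi (x + t *: delta_mx 0 i) => d1.
have H : (fun h : R => h^-1 *: (phi (x + (h *: 1 + t) *: delta_mx 0 i) - phi (x + t *: delta_mx 0 i))) =
    (fun h : R => h^-1 *: (phi (h *: delta_mx 0 i + (x + t *: delta_mx 0 i)) - phi (x + t *: delta_mx 0 i))).
  apply/funext => h; congr (_ *: (phi _ - _)).
  have -> : h *: (1 : R) = h by rewrite /GRing.scale/= mulr1.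
  by rewrite scalerDl addrCA.
by apply: DeriveDef; rewrite /derivable /derive H.
Qed.

Lemma test_function_lipschitz (O : set 'rV[R]_n) phi (i : 'I_n) M x (s : R) : test_function O phi ->
  (forall x, `|partial i phi x| <= M) -> 0 <= s ->
  `|phi x - phi (x - s *: delta_mx 0 i)| <= M * s.
Proof.
move=> tphi HM s0; pose p t := phi (x + t *: delta_mx 0 i).
have s0' : - s <= 0 by rewrite oppr_le0.
have [t _||c _] := @MVT_segment R p (fun t => partial i phi (x + t *: delta_mx 0 i)) (- s) 0 s0'.
- exact: test_function_line tphi.
- apply: continuous_subspaceT => t; apply/differentiable_continuous/derivable1_diffP.
  by have [] := test_function_line i x t tphi.
rewrite /p scale0r addr0 scaleNr sub0r opprK => ->.
by rewrite normrM (ger0_norm s0) ler_wpM2r.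
Qed.

(** The quotient is a backward one because the shift is moved from the function to the test
    function. *)
Lemma test_function_dq (O : set 'rV[R]_n) phi (i : 'I_n) x (s : nat -> R) : test_function O phi ->
  (forall k, 0 < s k) -> s k @[k --> \oo] --> (0 : R) ->
  (s k)^-1 * (phi x - phi (x - s k *: delta_mx 0 i)) @[k --> \oo] --> partial i phi x.
Proof.
move=> [sphi _] s0 cs; have [_ /(_ i)[dphi _]] := sphi 1%N.
have d1 : h^-1 *: (phi (h *: delta_mx 0 i + x) - phi x) @[h --> 0^'] --> partial i phi x by exact: dphi.
have H : (fun k => - s k) @ \oo --> (0 : R)^'.
  move=> P /= [e /= e0 eP].
  move/cvgr0Pnorm_lt : cs => /(_ e e0).
  apply: filterS => k sk; apply: eP => /=; last by rewrite oppr_eq0 gt_eqF.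
  by rewrite sub0r opprK.
have := cvg_comp _ _ H d1; apply: cvg_trans; apply: near_eq_cvg; apply: nearW => k /=.
by rewrite scaleNr [- _ + x]addrC -[_ *: (_ - _)]/(_ * _) invrN mulNr -mulrN opprB.
Qed.

End test_functions.

Section borel_weak_derivative.
Context {R : realType} (n : nat).
Local Notation mu := (@borel_lebesgue R n).
Implicit Types (u G phi : 'rV[R]_n -> R) (O K : set 'rV[R]_n).

(** Integrals run over the whole space: test functions vanish outside [O], and translation
    invariance can be used without tracking the domain. *)
Definition borel_weak O i u G := [/\ measurable_fun setT u, measurable_fun setT G,
  (forall K, compact K -> K `<=` O -> mu.-integrable K (EFin \o u)),
  (forall K, compact K -> K `<=` O -> mu.-integrable K (EFin \o G)) &
  forall phi, test_function O phi ->
    (\int[mu]_x (u x * partial i phi x)%:E = - \int[mu]_x (G x * phi x)%:E)%E].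

(** Turns a locally integrable function into an L^1 function on the whole space, as translations and
    line averages require. *)
Definition cutoff K u : 'rV[R]_n -> R := fun x => \1_K x * u x.

Lemma integrable_cut K u : measurable K -> measurable_fun setT u ->
  mu.-integrable K (EFin \o u) -> mu.-integrable setT (EFin \o cutoff K u).
Proof.
move=> mK mu_ /(integrable_mkcond _ mK); congr (_.-integrable _ _).
by apply/funext => x; rewrite patchE /cutoff /= indicE; case: (x \in K); rewrite ?mul1r ?mul0r.
Qed.

Lemma cutoffE K u x : K x -> cutoff K u x = u x.
Proof. by move=> Kx; rewrite /cutoff indicE mem_set// mul1r. Qed.

Lemma borel_weak_cut O K W i u G phi : borel_weak O i u G ->
  W `<=` K -> K `<=` O -> test_function W phi ->
  (\int[mu]_x (cutoff K u x * partial i phi x)%:E = - \int[mu]_x (cutoff K G x * phi x)%:E)%E.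
Proof.
move=> [_ _ _ _ weak] WK KO tphi.
have [C [M [[cC CW M0 phi0 _] _]]] := test_function_facts i tphi.
have tO : test_function O phi.
  case: tphi => sphi [C' [? ? ?]]; split => //; exists C'; split => //.
  by apply: subset_trans KO; exact: subset_trans WK.
have cut0 v p x : (~ C x -> p x = 0) -> cutoff K v x * p x = v x * p x.
  move=> p0; have [Cx|Cx] := pselect (C x); last by rewrite p0// !mulr0.
  by rewrite cutoffE//; apply: WK; exact: CW.
under eq_integral do rewrite (cut0 _ _ _ (fun h => (phi0 _ h).2)).
under [X in _ = (- X)%E]eq_integral do rewrite (cut0 _ _ _ (fun h => (phi0 _ h).1)).
exact: weak.
Qed.

(** Finitely many rational cubes whose triples lie in [O] cover [K]. [K'] is the union of the closed
    triples and [s0] is at most every radius, so shifts by at most [s0] stay in the triple and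
    [steklov_identity] applies cube by cube. *)
Lemma borel_weak_difference O i u G K : open O -> borel_weak O i u G ->
  compact K -> K `<=` O -> exists K' s0, [/\ compact K', K' `<=` O, 0 < s0,
    (forall x r, K x -> `|r| <= s0 -> K' (x + r *: delta_mx 0 i)) &
    forall s, 0 <= s <= s0 -> {ae mu, forall x, K x ->
      cutoff K' u (x + s *: delta_mx 0 i) - cutoff K' u x = line_avg i s (cutoff K' G) x}].
Proof.
move=> oO wu cK KO; have [mu_ mG iu iG _] := wu.
pose D := [set p : 'rV[rat]_n * nat | ccube (@qcenter R n p) (3 * @qradius R n p) `<=` O].
have : cover_compact K by rewrite -compact_cover.
move=> /(_ _ D (fun p => ball (@qcenter R n p) (@qradius R n p))) [].
- by move=> p _; exact: ball_open.
- by move=> x /KO Ox; have [p [px pO]] := qcube_cover oO Ox; exists p.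
move=> F FD KF.
pose K' := \big[setU/set0]_(p <- finmap.enum_fset F) ccube (@qcenter R n p) (3 * @qradius R n p).
have K'P x : K' x <-> exists2 p, p \in finmap.enum_fset F & ccube (@qcenter R n p) (3 * @qradius R n p) x.
  rewrite /K' -bigcup_seq; split; first by move=> [p /= pF px]; exists p.
  by move=> [p pF px]; exists p.
have cK' : compact K' by apply: bigsetU_compact => p _; exact: compact_ccube.
have K'O : K' `<=` O by move=> x /K'P[p /FD]; rewrite inE; apply.
have [s0 s0_gt0 s0F] : exists2 s0, 0 < s0 & forall p, p \in finmap.enum_fset F -> s0 <= @qradius R n p.
  elim: (finmap.enum_fset F) => [|p r [s0 s00 ih]]; first by exists 1.
  exists (Num.min s0 (@qradius R n p)); first by rewrite lt_min s00 qradius_gt0.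
  move=> q; rewrite inE => /orP[/eqP ->|qr]; first by rewrite ge_min lexx orbT.
  by rewrite ge_min ih.
have mK' : measurable K' by exact: compact_measurable_rV.
have iU := integrable_cut mK' mu_ (iu _ cK' K'O).
have ig := integrable_cut mK' mG (iG _ cK' K'O).
exists K', s0; split => //.
  move=> x r Kx rs; have [p /= pF px] := KF _ Kx.
  apply/K'P; exists p => // j.
  have -> : (x + r *: delta_mx 0 i) 0 j = x 0 j + r * (j == i)%:R by rewrite !mxE eqxx.
  have := s0F _ pF; move: px => /(ball_rV _ _ (@qradius_gt0 R n p))/(_ j); move: rs.
  rewrite ltr_norml !ler_norml; case: (j == i); rewrite ?mulr1 ?mulr0 => /andP[? ?] /andP[? ?] ?;
  by have := @qradius_gt0 R n p => ?; apply/andP; split; lra.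
move=> s /andP[s_ge0 ss0].
have main p : p \in finmap.enum_fset F -> {ae mu, forall x, ball (@qcenter R n p) (@qradius R n p) x ->
    cutoff K' u (x + s *: delta_mx 0 i) - cutoff K' u x = line_avg i s (cutoff K' G) x}.
  move=> pF; have r0 := @qradius_gt0 R n p; have sr := s0F _ pF.
  have := @steklov_identity R n i (ball (@qcenter R n p) (3 * @qradius R n p)) (cutoff K' u) (cutoff K' G) s
    (fun j => @qcenter R n p 0 j - @qradius R n p) (fun j => @qcenter R n p 0 j + @qradius R n p) s_ge0 iU ig.
  have H1 : [set x : 'rV[R]_n | forall j, `[@qcenter R n p 0 j - @qradius R n p, @qcenter R n p 0 j + @qradius R n p + s]%classic (x 0 j)]
      `<=` ball (@qcenter R n p) (3 * @qradius R n p).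
    move=> x /= H; apply/ball_rV => [|j]; first by rewrite mulr_gt0.
    by have := H j; rewrite in_itv/= ltr_norml => /andP[? ?]; apply/andP; split; lra.
  move=> /(_ H1) H2; have {}H2 := H2 _; apply: filterS (H2 _) => [x Hx bx|phi tphi].
    apply: Hx => j; have /(ball_rV _ _ r0)/(_ j) := bx.
    by rewrite ltr_norml /= in_itv/= => /andP[? ?]; apply/andP; split; lra.
  apply: (borel_weak_cut wu _ K'O tphi) => x bx; apply/K'P; exists p => //.
  exact: ball_sub_ccube.
have : forall r : seq _, {subset r <= finmap.enum_fset F} ->
    {ae mu, forall x, forall p, p \in r -> ball (@qcenter R n p) (@qradius R n p) x ->
    cutoff K' u (x + s *: delta_mx 0 i) - cutoff K' u x = line_avg i s (cutoff K' G) x}.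
  elim=> [|p r ih] pr; first by apply: aeW => x.
  have H1 : {subset r <= finmap.enum_fset F} by move=> q qr; apply: pr; rewrite inE qr orbT.
  have H2 : p \in finmap.enum_fset F by apply: pr; rewrite inE eqxx.
  apply: filterS2 (ih H1) (main p H2) => x Hr Hp q; rewrite inE => /orP[/eqP ->|]; first exact: Hp.
  exact: Hr.
move=> /(_ (finmap.enum_fset F) (fun _ h => h)); apply: filterS => x Hx Kx.
by have [p /= pF px] := KF _ Kx; exact: (Hx p).
Qed.

Lemma compact_lty K : compact K -> (mu K < +oo)%E.
Proof.
move=> cK; have [M [_ HM]] := compact_bounded cK.
pose m := `|M| + 1.
apply: le_lt_trans (borel_lebesgue_box_lty (fun _ : 'I_n => - (m + 1)) (fun=> m + 1)).
apply: le_measure; rewrite ?inE//.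
- exact: compact_measurable_rV.
- exact: measurable_box.
move=> x Kx j; have : `|x| <= m by apply: HM => //; rewrite (le_lt_trans (ler_norm M))// ltrDl.
have : `|x 0 j| <= `|x|.
  rewrite [leRHS]mx_normrE; apply: le_trans (le_bigmax _ _ (0, j)) => //.
by rewrite /= in_itv/= => h1 h2; rewrite -ltr_norml; apply: le_lt_trans h1 _; rewrite (le_lt_trans h2)// ltrDl.
Qed.

Lemma integrable_cst_compact (c : R) K : compact K -> mu.-integrable K (cst c%:E).
Proof.
move=> cK; have mK := compact_measurable_rV cK; apply/integrableP; split => //.
by rewrite integral_cst//= lte_mul_pinfty// ?lee_fin// compact_lty.
Qed.

(** A uniform modulus is extracted from sequential convergence by contradiction. *)
Lemma translation_modulus (i : 'I_n) g : mu.-integrable setT (EFin \o g) ->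
  forall eps, 0 < eps -> exists2 d, 0 < d & forall r, `|r| < d ->
    (\int[mu]_x `|(g (x + r *: delta_mx 0 i)%R - g x)%:E| <= eps%:E)%E.
Proof.
move=> ig eps eps0; apply: contrapT => H.
have {}H k : exists r, `|r| < k.+1%:R^-1 /\
    (eps%:E < \int[mu]_x `|(g (x + r *: delta_mx 0 i)%R - g x)%:E|)%E.
  apply: contrapT => H'; apply: H; exists k.+1%:R^-1; first by rewrite invr_gt0.
  by move=> r rk; rewrite leNgt; apply/negP => er; apply: H'; exists r.
pose r k := projT1 (cid (H k)).
have rP k : `|r k| < k.+1%:R^-1 /\ (eps%:E < \int[mu]_x `|(g (x + r k *: delta_mx 0 i)%R - g x)%:E|)%E.
  exact: (projT2 (cid (H k))).
have r0 : r k @[k --> \oo] --> (0 : R).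
  apply/cvgr0Pnorm_lt => e e0; have := near_infty_natSinv_lt (PosNum e0).
  by apply: filterS => k; exact: lt_trans (rP k).1.
have a0 k : (0 <= \int[mu]_x `|(g (x + r k *: delta_mx 0 i)%R - g x)%:E|)%E by exact: integral_ge0.
have [N /(_ N (leqnn N))] := iffLR (cvge0P a0) (translation_L1_cvg i ig r0) _ eps0.
by rewrite leNgt (rP N).2.
Qed.

(** By Tonelli the L^1 distance is at most the mean over [r] in [[0, s k[] of the L^1 distance
    between [g] and its translate by [r], and [translation_modulus] makes each of these small. *)
Lemma line_avg_cvg (i : 'I_n) g (s : nat -> R) : mu.-integrable setT (EFin \o g) ->
  (forall k, 0 < s k) -> s k @[k --> \oo] --> (0 : R) ->
  (\int[mu]_x `|((s k)^-1 * line_avg i (s k) g x - g x)%:E| @[k --> \oo] --> 0)%E.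
Proof.
move=> ig s_gt0 s0.
have mg : measurable_fun setT g by apply/measurable_EFinP; exact: measurable_int ig.
apply/cvge0P => [k|eps eps0]; first exact: integral_ge0.
have [d d0 dP] := translation_modulus i ig eps0.
move/cvgr0Pnorm_lt : s0 => /(_ d d0) [K _ KP]; exists K => k /KP /= skd.
set t := s k; have t0 : 0 < t := s_gt0 k.
have t_ge0 := ltW t0; have td : t < d by rewrite -[t]gtr0_norm.
pose F := fun p : 'rV[R]_n * measurableTypeR R =>
  (slab t p.2 * `|g (p.1 + p.2 *: delta_mx 0 i) - g p.1|)%:E.
have mF : measurable_fun setT F.
  apply/measurable_EFinP; apply: measurable_funM.
    by apply: (measurableT_comp (f := slab t)) => //; exact: measurable_slab.
  apply: measurableT_comp => //; apply: measurable_funB; last exact: (measurableT_comp mg).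
  by apply: (measurableT_comp (f := g)) => //; exact: measurable_line.
have F0 p : (0 <= F p)%E by rewrite lee_fin mulr_ge0// slab_ge0.
have iavg := integrable_line_avg i t_ge0 ig.
have mavg : measurable_fun setT (line_avg i t g) by apply/measurable_EFinP; exact: measurable_int iavg.
apply: (@le_trans _ _ (\int[mu]_x (t^-1%:E * \int[lebesgue_measure]_r F (x, r)))%E).
  apply: ae_ge0_le_integral => //.
  - apply/measurable_EFinP; apply: measurableT_comp => //; apply: measurable_funB => //.
    exact: measurable_funM.
  - by move=> x _; rewrite mule_ge0 ?lee_fin ?invr_ge0//; exact: integral_ge0.
  - apply: emeasurable_funM => //.
    by rewrite -[X in measurable_fun _ X]/(fubini_F lebesgue_measure F); exact: measurable_fun_fubini_tonelli_F.
  apply: filterS (ae_line_integrable i t_ge0 ig) => x ix _.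
  have islab : lebesgue_measure.-integrable setT (fun r => (slab t r)%:E).
    apply/integrableP; split; first by apply/measurable_EFinP; exact: measurable_slab.
    under eq_integral do rewrite gee0_abs ?lee_fin ?slab_ge0//.
    by rewrite integral_slab ?ltry.
  have -> : t^-1 * line_avg i t g x - g x =
      t^-1 * \int[lebesgue_measure]_r (slab t r * (g (x + r *: delta_mx 0 i) - g x)).
    under eq_Rintegral do rewrite mulrBr.
    rewrite RintegralB//; last first.
      exact: (integrableZr measurableT (g x) islab).
    have slabE : \int[lebesgue_measure]_r slab t r = t by rewrite /Rintegral integral_slab.
    rewrite RintegralZr// slabE.
    by rewrite mulrBr mulrA mulVf ?gt_eqF// mul1r.
  rewrite normrM (ger0_norm (_ : 0 <= t^-1)) ?invr_ge0// EFinM; apply: lee_wpmul2l; first by rewrite lee_fin invr_ge0.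
  have iB : lebesgue_measure.-integrable setT (fun r => (slab t r * (g (x + r *: delta_mx 0 i) - g x))%:E).
    under eq_fun do rewrite mulrBr EFinB.
    by apply: integrableB => //; exact: (integrableZr measurableT (g x) islab).
  rewrite -abse_EFin /Rintegral fineK ?integrable_fin_num//.
  apply: le_trans (le_abse_integral _ measurableT (measurable_int _ iB)) _.
  rewrite le_eqVlt; apply/orP; left; apply/eqP; apply: eq_integral => r _.
  by rewrite /F/= normrM ger0_norm// slab_ge0.
rewrite ge0_integralZl//; last 3 first.
- by rewrite -[X in measurable_fun _ X]/(fubini_F lebesgue_measure F); exact: measurable_fun_fubini_tonelli_F.
- by move=> x _; exact: integral_ge0.
- by rewrite lee_fin invr_ge0.
rewrite (fubini_tonelli F mF F0)//.
rewrite -(lee_pmul2l _ (t0 : (0 < t%:E)%E)) ?lte_fin// muleA -EFinM divff ?gt_eqF// mul1e.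
rewrite -(integral_slab t_ge0) -ge0_integralZr//; last 3 first.
- by apply/measurable_EFinP; exact: measurable_slab.
- by move=> r _; rewrite lee_fin slab_ge0.
- by rewrite lee_fin ltW.
apply: ge0_le_integral => //.
- by move=> r _; exact: integral_ge0.
- rewrite -[X in measurable_fun _ X]/(fubini_G mu F); exact: measurable_fun_fubini_tonelli_G.
- by apply: emeasurable_funM => //; apply/measurable_EFinP; exact: measurable_slab.
move=> r _; rewrite /F/=.
under eq_integral do rewrite EFinM.
rewrite ge0_integralZl//; last 2 first.
- apply/measurable_EFinP; apply: measurableT_comp => //; apply: measurable_funB => //.
  by apply: (measurableT_comp mg); exact: measurable_addrV.
- by rewrite lee_fin slab_ge0.
have [->|] := eqVneq (slab t r) 0; first by rewrite !mul0e.
rewrite /slab indicE; case: (boolP (r \in _)); last by rewrite eqxx.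
rewrite inE /= in_itv/= => /andP[r0 rt] _; rewrite !mul1e; apply: dP.
by rewrite ger0_norm// (lt_trans rt).
Qed.

End borel_weak_derivative.

(** * The chain rule *)

Section chain_rule.
Context {R : realType} (n : nat).
Local Notation mu := (@borel_lebesgue R n).
Implicit Types (u G phi : 'rV[R]_n -> R) (O K : set 'rV[R]_n) (F h : R -> R).

Lemma lipschitz_continuous_fun F (L : R) : (forall a b, `|F a - F b| <= L * `|a - b|) -> continuous F.
Proof.
move=> LF a; apply/cvgrPdist_le => e e0.
have L1 : 0 < `|L| + 1 by rewrite ltr_wpDl.
near=> b; apply: le_trans (LF a b) _.
apply: (@le_trans _ _ ((`|L| + 1) * `|a - b|)).
  by rewrite ler_wpM2r// (le_trans (ler_norm L))// lerDl.
rewrite mulrC -ler_pdivlMr//; near: b.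
by apply: (@cvgr_dist_le _ _ _ (nbhs a) _ id a); [exact: cvg_id|rewrite divr_gt0].
Unshelve. all: by end_near. Qed.

Lemma measurable_invr : measurable_fun [set: R] (fun x : R => x^-1).
Proof.
rewrite (_ : (fun x : R => x^-1) = (fun x => if x == 0 then 0 else x^-1)); last first.
  by apply/funext => x; case: eqP => // ->; rewrite invr0.
apply: (measurable_fun_if (D := setT)) => //.
- rewrite (_ : (fun x : R => x == 0) = (fun x => (x <= 0) && (0 <= x))); last first.
    by apply/funext => x; rewrite eq_le.
  by apply: measurable_and; exact: measurable_fun_ler.
- rewrite setTI (_ : _ @^-1` _ = ~` [set (0 : R)]); last first.
    by apply/seteqP; split=> x /=; case: eqP.
  apply: open_continuous_measurable_fun.
    by apply: closed_openC; apply: compact_closed; [exact: Rhausdorff|exact: compact_set1].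
  by move=> x; rewrite inE /= => /eqP x0; exact: inv_continuous.
Qed.

(** A discrete chain rule passed to the limit. The increment of [F] over a shift is [xi] times the
    increment of [u], and the latter is a line average of [G]. The set [N] collects exceptional
    values of [u], at which [G] vanishes a.e. *)
Lemma chain_rule_lipschitz O i u G F h (L : R) (N : set R) :
  open O -> borel_weak O i u G ->
  (forall a b, `|F a - F b| <= L * `|a - b|) ->
  measurable_fun setT h -> (forall s, `|h s| <= L) ->
  (forall s : R, ~ N s -> is_derive s 1 F (h s)) ->
  {ae mu, forall x, O x -> N (u x) -> G x = 0} ->
  forall phi, test_function O phi ->
  (\int[mu]_x (F (u x) * partial i phi x)%:E = - \int[mu]_x (h (u x) * G x * phi x)%:E)%E.
Proof.
move=> oO wu LF mh hL dF N0 phi tphi; have [mu_ mG iu iG _] := wu.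
have [K [M [[cK KO M0 phi0 phiM] [mphi mdphi]]]] := test_function_facts i tphi.
have [K' [s0 [cK' K'O s0_gt0 KK' diff]]] := borel_weak_difference oO wu cK KO.
have mK' : measurable K' by exact: compact_measurable_rV.
set e : 'rV[R]_n := delta_mx 0 i in KK' diff *.
have L0 : 0 <= L by apply: le_trans (hL 0).
have mF : measurable_fun setT F.
  by apply: continuous_measurable_fun; exact: lipschitz_continuous_fun LF.
set U := cutoff K' u; set g := cutoff K' G.
have iU : mu.-integrable setT (EFin \o U) by apply: integrable_cut => //; exact: iu.
have ig : mu.-integrable setT (EFin \o g) by apply: integrable_cut => //; exact: iG.
have mU : measurable_fun setT U by apply/measurable_EFinP; exact: measurable_int iU.
have mg : measurable_fun setT g by apply/measurable_EFinP; exact: measurable_int ig.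
pose t k : R := s0 / k.+1%:R.
have t0 k : 0 < t k by rewrite divr_gt0.
have ts0 k : t k <= s0 by rewrite /t; apply: ler_piMr; [exact: ltW|rewrite invf_le1// ler1n].
have tcvg : t k @[k --> \oo] --> (0 : R).
  by rewrite -(mulr0 s0); apply: cvgM; [exact: cvg_cst|exact: cvg_harmonic].
pose a k x := (t k)^-1 * line_avg i (t k) g x.
have iavg k := integrable_line_avg i (ltW (t0 k)) ig.
have ia k : mu.-integrable setT (EFin \o a k).
  by apply: (integrableZl measurableT (t k)^-1 (iavg k)).
have ma k : measurable_fun setT (a k) by apply/measurable_EFinP; exact: measurable_int (ia k).
have iUt r : mu.-integrable setT (EFin \o (fun x => U (x + r *: e))).
  exact: (integrable_translation (r *: e) iU).
have mUt r : measurable_fun setT (fun x : 'rV[R]_n => U (x + r *: e)).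
  by apply/measurable_EFinP; exact: measurable_int (iUt r).
(* Both errors are summed so that one subsequence [v] yields a.e. convergence of the averages and of
   the shifted functions. *)
pose err k := (\int[mu]_x `|(a k x - g x)%:E| + \int[mu]_x `|(U (x + t k *: e)%R - U x)%:E|)%E.
have err0 k : (0 <= err k)%E by apply: adde_ge0; exact: integral_ge0.
have errcvg : err k @[k --> \oo] --> 0%E.
  by apply: cvge0D; [exact: line_avg_cvg|exact: translation_L1_cvg].
have [v v_incr vsum] := summable_subsequence err0 errcvg.
have v_ge k : (k <= v k)%N.
  by elim: k => // k ih; apply: leq_ltn_trans ih (v_incr _ _ _).
have vcvg (T : topologicalType) (f : nat -> T) (l : T) : f k @[k --> \oo] --> l -> f (v k) @[k --> \oo] --> l.
  move=> fl; apply: (cvg_comp v f) fl => P [m _ mP]; exists m => // k /= mk.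
  by apply: mP => /=; exact: leq_trans (v_ge k).
have mabs (f : 'rV[R]_n -> R) : measurable_fun setT f -> measurable_fun setT (fun x : 'rV[R]_n => `|(f x)%:E|%E).
  by move=> mf; apply: measurableT_comp => //; exact/measurable_EFinP.
have acvg : {ae mu, forall x, a (v k) x @[k --> \oo] --> g x}.
  have [||/=|_] := @ae_cvg0_of_summable _ _ R mu setT (fun k x => `|(a (v k) x - g x)%:E|%E) measurableT.
  - by move=> k; apply: mabs; exact: measurable_funB.
  - by [].
  - apply: le_lt_trans vsum; apply: lee_nneseries => // k _.
      by move=> _; exact: integral_ge0.
    by rewrite leeDl//; exact: integral_ge0.
  apply: filterS => x /(_ I) H; apply/cvgrPdist_le => eps eps0.
  have [m mP] := iffLR (cvge0P (fun k => abse_ge0 _)) H eps eps0.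
  by exists m => // k /= /mP; rewrite lee_fin distrC.
have Ucvg : {ae mu, forall x, U (x + t (v k) *: e) @[k --> \oo] --> U x}.
  have [||/=|_] := @ae_cvg0_of_summable _ _ R mu setT (fun k x => `|(U (x + t (v k) *: e)%R - U x)%:E|%E) measurableT.
  - by move=> k; apply: mabs; exact: measurable_funB.
  - by [].
  - apply: le_lt_trans vsum; apply: lee_nneseries => // k _.
      by move=> _; exact: integral_ge0.
    by rewrite leeDr//; exact: integral_ge0.
  apply: filterS => x /(_ I) H; apply/cvgrPdist_le => eps eps0.
  have [m mP] := iffLR (cvge0P (fun k => abse_ge0 _)) H eps eps0.
  by exists m => // k /= /mP; rewrite lee_fin distrC.
(* Where the increment of [U] vanishes, division by 0 returns 0; this is harmless since only the
   product of [xi] with the increment enters. *)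
pose xi k x := (F (U (x + t (v k) *: e)) - F (U x)) / (U (x + t (v k) *: e) - U x).
have mxi k : measurable_fun setT (xi k).
  apply: measurable_funM.
    by apply: measurable_funB; apply: (measurableT_comp mF).
  by apply: (measurableT_comp measurable_invr); exact: measurable_funB.
have xiL k x : `|xi k x| <= L.
  rewrite /xi; set z := _ - U x; have [->|z0] := eqVneq z 0; first by rewrite invr0 mulr0 normr0.
  by rewrite normrM normfV ler_pdivrMr ?normr_gt0.
(* [F 0] may differ from 0, so [F] composed with the cutoff [U] has to be cut off again. *)
pose P x := \1_K' x * F (U x).
have mP : measurable_fun setT P.
  by apply: measurable_funM; [exact: measurable_indic|exact: (measurableT_comp mF)].
have iP : mu.-integrable setT (EFin \o P).
  have i1 : mu.-integrable setT (EFin \o \1_K') by apply: integrable_indic_lty => //; exact: compact_lty.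
  apply: (le_integrable measurableT _ _ (integrableD measurableT (integrableZl measurableT `|F 0| i1)
    (integrableZl measurableT L (integrable_abse iU)))); first exact/measurable_EFinP.
  move=> x _; rewrite /= lee_fin; apply: le_trans _ (ler_norm _).
  rewrite /P normrM (ger0_norm (_ : 0 <= \1_K' x))// indicE; case: (x \in K') => /=; last first.
    by rewrite mul0r mulr0 add0r mulr_ge0.
  rewrite mul1r mulr1; have := LF (U x) 0; rewrite subr0.
  by have := ler_normB (F (U x)) (F 0); have := ler_normD (F (U x) - F 0) (F 0); rewrite subrK; lra.
have key k : {ae mu, forall x, K x -> U (x + t k *: e) - U x = line_avg i (t k) g x}.
  by apply: diff; rewrite ts0 ltW.
have q_bound k x : `|(t k)^-1 * (F (U (x + t k *: e)) - F (U x))| <= (t k)^-1 * (L * `|U (x + t k *: e) - U x|).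
  by rewrite normrM gtr0_norm ?invr_gt0// ler_wpM2l// invr_ge0 ltW.
(* Summation by parts: translation invariance moves the shift from [phi] to [P]; for a point of the
   support of [phi], both it and its shift lie in [K'], where [P] is [F] of [U]. *)
have discrete k : (\int[mu]_x (P x * ((t k)^-1 * (phi x - phi (x - t k *: e))))%:E =
    - \int[mu]_x ((t k)^-1 * (F (U (x + t k *: e)%R) - F (U x)) * phi x)%:E)%E.
  have mphit : measurable_fun setT (fun x : 'rV[R]_n => phi (x - t k *: e)).
    by apply: (measurableT_comp mphi); exact: measurable_addrV.
  have iPt : mu.-integrable setT (EFin \o (fun x => P (x + t k *: e))).
    exact: (integrable_translation (t k *: e) iP).
  have M1 x : `|phi x| <= M by exact: (phiM x).1.
  have i1 := integrable_mul_bounded measurableT iP mphi (fun x _ => M1 x).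
  have i2 := integrable_mul_bounded measurableT iP mphit (fun x _ => M1 _).
  have i3 := integrable_mul_bounded measurableT iPt mphi (fun x _ => M1 x).
  transitivity ((t k)^-1%:E * (\int[mu]_x (P x * phi x)%:E - \int[mu]_x (P x * phi (x - t k *: e))%:E))%E.
    rewrite -integralB// -integralZl//; last exact: integrableB.
    by apply: eq_integral => x _; rewrite -EFinB -EFinM; congr EFin; ring.
  rewrite -(integral_translation (t k *: e) i2).
  under [X in (_ * (_ - X))%E]eq_integral do rewrite addrK.
  have Q x : (t k)^-1 * (F (U (x + t k *: e)) - F (U x)) * phi x =
      (t k)^-1 * (P (x + t k *: e) * phi x - P x * phi x).
    have [Kx|/phi0[-> _]] := pselect (K x); last by rewrite !mulr0 subrr mulr0.
    have K'x : K' x by have := KK' x 0 Kx; rewrite scale0r addr0; apply; rewrite normr0 ltW.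
    have K'xt : K' (x + t k *: e) by apply: KK' => //; rewrite gtr0_norm.
    by rewrite /P !indicE !mem_set//=; ring.
  under [in RHS]eq_integral do rewrite Q EFinM EFinB.
  rewrite integralZl//; last exact: integrableB.
  rewrite integralB// -[RHS]muleN; congr (_ * _)%E.
  by rewrite [RHS]fin_num_oppeB ?integrable_fin_num// addeC.
have lhs : (\int[mu]_x (P x * ((t (v k))^-1 * (phi x - phi (x - t (v k) *: e))))%:E)%E @[k --> \oo] -->
    (\int[mu]_x (F (u x) * partial i phi x)%:E)%E.
  have -> : (\int[mu]_x (F (u x) * partial i phi x)%:E = \int[mu]_x (P x * partial i phi x)%:E)%E.
    apply: eq_integral => x _; have [Kx|/phi0[_ ->]] := pselect (K x); last by rewrite !mulr0.
    have K'x : K' x by have := KK' x 0 Kx; rewrite scale0r addr0; apply; rewrite normr0 ltW.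
    by rewrite /P indicE mem_set// mul1r /U cutoffE.
  apply: (dct_on_support (M := M)) => //.
  - move=> k; apply: measurable_funM => //; apply: measurable_funB => //.
    by apply: (measurableT_comp mphi); exact: measurable_addrV.
  - move=> k x _; rewrite normrM gtr0_norm ?invr_gt0// ler_pdivrMl// mulrC.
    by apply: (test_function_lipschitz x tphi); [move=> y; exact: (phiM y).2|exact: ltW].
  - by apply: aeW => x _ _; apply: (@test_function_dq R n O phi i x (fun k => t (v k)) tphi) => //; exact: vcvg.
have iag k : mu.-integrable setT (EFin \o (fun x => a k x - g x)).
  exact: (integrableB measurableT (ia k) ig).
have mxp k : measurable_fun setT (fun x => xi k x * phi x) by exact: measurable_funM.
have xp_bound k x : `|xi k x * phi x| <= L * M by rewrite normrM ler_pM//; exact: (phiM x).1.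
have rhs : (\int[mu]_x ((t (v k))^-1 * (F (U (x + t (v k) *: e)%R) - F (U x)) * phi x)%:E)%E @[k --> \oo] -->
    (\int[mu]_x (h (u x) * G x * phi x)%:E)%E.
  have E k : (\int[mu]_x ((t (v k))^-1 * (F (U (x + t (v k) *: e)%R) - F (U x)) * phi x)%:E =
      \int[mu]_x ((a (v k) x - g x) * (xi k x * phi x))%:E + \int[mu]_x (g x * (xi k x * phi x))%:E)%E.
    rewrite -integralD//; last 2 first.
    - exact: (integrable_mul_bounded _ (iag _) (mxp _) (fun x _ => xp_bound _ _)).
    - exact: (integrable_mul_bounded _ ig (mxp _) (fun x _ => xp_bound _ _)).
    apply: ae_eq_integral => //.
    - apply/measurable_EFinP; apply: measurable_funM => //; apply: measurable_funM => //.
      by apply: measurable_funB; apply: (measurableT_comp mF).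
    - by apply: emeasurable_funD; apply/measurable_EFinP; apply: measurable_funM => //; exact: measurable_funB.
    apply: filterS (key (v k)) => x keyx _; rewrite -EFinD; congr EFin.
    have [/keyx {}keyx|/phi0[-> _]] := pselect (K x); last by rewrite !mulr0 addr0.
    rewrite -mulrDl subrK mulrA; congr (_ * _).
    rewrite /a -keyx /xi; have [->|z0] := eqVneq (U (x + t (v k) *: e)) (U x).
      by rewrite !subrr !mulr0 mul0r.
    by rewrite -mulrA; congr (_ * _); rewrite mulrCA divff ?mulr1// subr_eq0.
  rewrite (eq_cvg _ _ E).
  have -> : (\int[mu]_x (h (u x) * G x * phi x)%:E = 0 + \int[mu]_x (g x * (h (U x) * phi x))%:E)%E.
    rewrite add0e; apply: eq_integral => x _; congr EFin.
    have [Kx|/phi0[-> _]] := pselect (K x); last by rewrite !mulr0.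
    have K'x : K' x by have := KK' x 0 Kx; rewrite scale0r addr0; apply; rewrite normr0 ltW.
    by rewrite /g /U !cutoffE//; ring.
  apply: cvgeD.
  - by [].
  - apply/cvg_abse0P; apply: (@squeeze0_cvge _ _ (fun k => ((L * M)%:E * \int[mu]_x `|(a (v k) x - g x)%:E|)%E)); last first.
      by apply: cvge0Zl; apply: (vcvg _ (fun k => (\int[mu]_x `|(a k x - g x)%:E|)%E)); exact: line_avg_cvg.
    move=> k; rewrite abse_ge0/=.
    apply: le_trans (le_abse_integral _ _ _) _ => //.
      by apply/measurable_EFinP; apply: measurable_funM => //; exact: measurable_funB.
    rewrite -ge0_integralZl//; last 2 first.
    - by apply: mabs; exact: measurable_funB.
    - by rewrite lee_fin mulr_ge0// ltW.
    apply: ge0_le_integral => //.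
    - by apply: mabs; apply: measurable_funM => //; exact: measurable_funB.
    - by apply: emeasurable_funM => //; apply: mabs; exact: measurable_funB.
    by move=> x _; rewrite /= -EFinM lee_fin normrM mulrC ler_wpM2r.
  - apply: (dct_on_support (M := L * M)) => //.
    + by apply: measurable_funM => //; exact: (measurableT_comp mh).
    have keys := ae_foralln (fun k => key (v k)).
    apply: filterS3 (filterI acvg Ucvg) keys N0 => x [ax Ux] keyx NG _ gx0.
    have [Kx|/phi0[-> _]] := pselect (K x); last first.
      by under eq_fun do rewrite mulr0; rewrite mulr0; exact: cvg_cst.
    have K'x : K' x by have := KK' x 0 Kx; rewrite scale0r addr0; apply; rewrite normr0 ltW.
    have nN : ~ N (U x).
      rewrite /U cutoffE// => /NG; rewrite -(cutoffE _ K'x) => /(_ (K'O _ K'x)) Gx.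
      by rewrite /g Gx eqxx in gx0.
    apply: cvgMl; have [d1 d2] := dF _ nN.
    have dq : h0^-1 *: (F (h0 *: 1 + U x) - F (U x)) @[h0 --> (0:R)^'] --> h (U x) by rewrite -d2; exact: d1.
    (* The averages tend to [g x], which is nonzero, so the increments are eventually nonzero and
       the limit defining the derivative may be taken along them. *)
    have H : (fun k => U (x + t (v k) *: e) - U x) @ \oo --> (0 : R)^'.
      move=> Q /= [ep /= ep0 epQ].
      have U0 : U (x + t (v k) *: e) - U x @[k --> \oo] --> (0 : R).
        by rewrite -(subrr (U x)); apply: cvgB => //; exact: cvg_cst.
      move/cvgr0Pnorm_lt : U0 => /(_ ep ep0).
      have : \forall k \near \oo, a (v k) x != 0 by exact: (cvgr_neq0 _ ax gx0).
      apply: filterS2 => k ak Uk; apply: epQ => /=; first by rewrite sub0r normrN.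
      by rewrite keyx//; move: ak; apply: contra_neq => ak0; rewrite /a ak0 mulr0.
    have := cvg_comp _ _ H dq; apply: cvg_trans; apply: near_eq_cvg; apply: nearW => k /=.
    rewrite /xi mulrC; congr (_ * (F _ - _)).
    by rewrite /GRing.scale/= mulr1 subrK.
have H : (\int[mu]_x (P x * ((t (v k))^-1 * (phi x - phi (x - t (v k) *: e))))%:E)%E @[k --> \oo] -->
    (- \int[mu]_x (h (u x) * G x * phi x)%:E)%E.
  by under eq_fun => k do rewrite discrete; exact: cvgeN.
exact: (cvg_unique (@ereal_hausdorff R) lhs H).
Qed.

End chain_rule.

(** * A functional monotone class theorem *)

Section monotone_class.
Context d (T : measurableType d) (R : realType) (C : set (set T)) (P : (T -> R) -> Prop).
Hypothesis genC : @measurable _ T = <<s C >>.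
Hypothesis CI : setI_closed C.
Hypothesis P1 : P (cst 1).
Hypothesis PC : forall S, C S -> P \1_S.
Definition bounded_measurable (f : T -> R) :=
  measurable_fun setT f /\ exists M, forall x, `|f x| <= M.
Hypothesis Plin : forall a f g, bounded_measurable f -> bounded_measurable g ->
  P f -> P g -> P (fun x => a * f x + g x).
Hypothesis Plim : forall (f_ : nat -> T -> R) f M, (forall k, measurable_fun setT (f_ k)) ->
  (forall k x, `|f_ k x| <= M) -> (forall x, f_ k x @[k --> \oo] --> f x) ->
  (forall k, P (f_ k)) -> P f.

Lemma bounded_measurable_indic S : measurable S -> bounded_measurable (\1_S : T -> R).
Proof.
by split; [exact: measurable_indic|exists 1 => x; rewrite indicE; case: (x \in S); rewrite ?normr1 ?normr0].
Qed.

Lemma monotone_class_indic S : measurable S -> P \1_S.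
Proof.
rewrite genC; apply: (dynkin_induction (P := fun S => P \1_S)) => //.
- rewrite (_ : \1_setT = cst 1)//; first by apply/funext => x; rewrite indicE in_setT.
- move=> A mA PA; rewrite (_ : \1_(~` A) = (fun x => -1 * \1_A x + cst 1 x)).
    apply: Plin => //; first exact: bounded_measurable_indic.
    by split => //; exists 1 => x; rewrite normr1.
  apply/funext => x; rewrite !indicE /= in_setC; case: (x \in A) => /=.
    by rewrite mulr1 addNr.
  by rewrite mulr0 add0r.
move=> F mF tF PF.
have mU k : measurable (\bigcup_(i < k) F i) by exact: bigcup_measurable.
have PU k : P \1_(\bigcup_(i < k) F i).
  elim: k => [|k ih].
    rewrite (_ : \1__ = (fun x => -1 * cst 1 x + cst 1 x)).
      by apply: Plin => //; split => //; exists 1 => x; rewrite normr1.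
    apply/funext => x; rewrite indicE memNset ?mulr1 ?addNr//.
    by move=> -[].
  rewrite (_ : \1__ = (fun x => 1 * \1_(\bigcup_(i < k) F i) x + \1_(F k) x)).
    by apply: Plin => //; exact: bounded_measurable_indic.
  apply/funext => x; rewrite mul1r !indicE.
  have [xk|xk] := pselect (F k x).
    rewrite mem_set; last by exists k => /=.
    rewrite memNset ?add0r ?mem_set// => -[j /= jk Fj].
    have /trivIsetP/(_ j k I I) := tF; rewrite ltn_eqF// => /(_ isT)/seteqP[/(_ x) H _]; apply: H.
    by split.
  rewrite (memNset xk) addr0; congr (_%:R); congr nat_of_bool.
  apply/idP/idP; rewrite !inE => -[j /= jk Fj]; exists j => //=; last exact: ltnW.
  move: jk; rewrite ltnS leq_eqVlt => /predU1P[jk|//]; subst j.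
  by [].
apply: (Plim (f_ := fun k => \1_(\bigcup_(i < k) F i)) (M := 1)) => //.
- by move=> k x; rewrite indicE; case: (x \in _); rewrite ?normr1 ?normr0.
move=> x; have [[j _ Fj]|nx] := pselect ((\bigcup_k F k) x).
  apply: cvg_near_cst; exists j.+1 => // k /= jk.
  by rewrite !indicE !mem_set//; exists j.
apply: cvg_near_cst; apply: nearW => k.
by rewrite !indicE !memNset// => -[j ? ?]; apply: nx; exists j.
Qed.

Lemma monotone_class f : bounded_measurable f -> P f.
Proof.
move=> [mf [M fM]].
pose K := `|M| + 1; have K0 : 0 < K by rewrite ltr_wpDl.
have fK x : `|f x| <= K by apply: le_trans (fM x) _; rewrite (le_trans (ler_norm M))// lerDl.
pose e k : R := 2 * K / (2 ^ k)%:R.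
have e0 k : 0 < e k by rewrite divr_gt0 ?mulr_gt0// ltr0n expn_gt0.
have eS k : e k = e k.+1 + e k.+1.
  by rewrite /e expnS natrM -mulr2n -mulr_natl; field; rewrite pnatr_eq0 -lt0n expn_gt0.
have b1 : bounded_measurable (cst 1) by split => //; exists 1 => x; rewrite normr1.
have P0 : P (cst 0).
  rewrite (_ : cst 0 = (fun x => -1 * cst 1 x + cst 1 x)); first exact: Plin.
  by apply/funext => x; rewrite /= mulr1 addNr.
have b0 : bounded_measurable (cst 0) by split => //; exists 0 => x; rewrite normr0.
(* Greedy approximation from below starting at the constant [-K]: [e k] is added wherever the result
   stays below [f], and each stage halves the error. *)
pose g := fix g (k : nat) : T -> R := if k is k'.+1
  then fun x => e k * \1_[set y | g k' y + e k <= f y] x + g k' x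
  else fun x => - K * cst 1 x + cst 0 x.
have Pg k : P (g k) /\ bounded_measurable (g k).
  elim: k => [|k [ih1 [mg [M' gM]]]].
    split; first exact: Plin.
    rewrite -[g 0%N]/(cst (- K * 1 + 0)); split; first exact: measurable_cst.
    by exists K => x; rewrite /= mulr1 addr0 normrN gtr0_norm.
  have mlvl : measurable [set y | g k y + e k.+1 <= f y].
    rewrite -[X in measurable X]setTI.
    have := @measurable_fun_ler _ _ R setT (fun y => g k y + e k.+1) f.
    by move=> /(_ (measurable_funD mg (measurable_cst _)) mf measurableT [set true]); apply.
  have bg : bounded_measurable (g k) by split => //; exists M'.
  split; first by apply: Plin => //; [exact: bounded_measurable_indic|exact: monotone_class_indic].
  split; first by apply: measurable_funD => //; apply: measurable_funM => //; exact: measurable_indic.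
  exists (e k.+1 + M') => x /=; rewrite (le_trans (ler_normD _ _))// lerD// normrM gtr0_norm//.
  apply: ler_piMr; first exact: ltW.
  by rewrite indicE; case: (x \in _); rewrite ?normr1 ?normr0.
have approx k x : g k x <= f x <= g k x + e k.
  elim: k => [|k /andP[ih1 ih2]].
    by rewrite /= /e expn0; have := fK x; rewrite ler_norml => /andP[]; lra.
  rewrite /= indicE; have [H|H] := pselect (g k x + e k.+1 <= f x).
    by rewrite mem_set//= -/(e k.+1); move: ih2; rewrite eS; lra.
  by rewrite memNset//= -/(e k.+1); move/negP : H; rewrite -ltNge; lra.
have ee0 k : e k <= 2 * K.
  apply: ler_piMr; first by rewrite mulr_ge0// ltW.
  by rewrite invf_le1 ?ltr0n ?expn_gt0// ler1n expn_gt0.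
apply: (Plim (f_ := g) (M := 3 * K)) => //.
- by move=> k; have [_ []] := Pg k.
- move=> k x; have := approx k x; have := fK x; have := ee0 k.
  by rewrite !ler_norml; lra.
- move=> x; apply/cvgrPdist_le => d0 d0_gt0.
  have : e k @[k --> \oo] --> (0 : R).
    rewrite -(mulr0 (2 * K)); apply: cvgM; first exact: cvg_cst.
    rewrite (_ : (fun k => _) = GRing.exp (2^-1 : R)); last by apply/funext => k; rewrite natrX exprVn.
    by apply: cvg_expr; rewrite ger0_norm ?invf_lt1 ?ltr1n.
  move/cvgr0Pnorm_le => /(_ d0 d0_gt0); apply: filterS => k; rewrite gtr0_norm// ler_norml.
  by have := approx k x; lra.
by move=> k; have [] := Pg k.
Qed.

End monotone_class.

(** * Primitives of bounded Borel functions on the line *)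

Section primitive.
Context {R : realType}.
Local Notation leb := (@lebesgue_measure R).
Implicit Types (h : R -> R).

(** A signed indicator: 1 on []0, s]] when [s] is nonnegative and -1 on []s, 0]] when it is
    negative, so that one formula covers both signs. *)
Definition step (s x : R) : R := (x <= s)%R%:R - (x <= 0)%R%:R.

(* The primitive of [h] vanishing at 0, as a single integral over the line. *)
Definition prim h (s : R) : R := \int[leb]_x (step s x * h x).

Lemma stepB (a b x : R) : a <= b -> step b x - step a x = \1_(`]a, b]) x.
Proof.
move=> ab; rewrite /step opprB addrA subrK indicE mem_setE in_itv/=.
case: (leP x a) => xa; rewrite ?(le_trans xa ab) ?subrr//= subr0.
by case: (x <= b).
Qed.

Lemma measurable_step s : measurable_fun [set: measurableTypeR R] (step s).
Proof.
have H (a : R) : measurable_fun [set: measurableTypeR R] (fun x : R => (x <= a)%R%:R : R).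
  rewrite (_ : (fun _ => _) = \1_(`]-oo, a])); first exact: measurable_indic.
  by apply/funext => x; rewrite indicE mem_setE in_itv.
by apply: measurable_funB; exact: H.
Qed.

Lemma step_le s x : `|step s x| <= \1_(`]- `|s|, `|s|]) x.
Proof.
rewrite indicE mem_setE in_itv/= /step.
have := ler_norm s; have := ler_norm (- s); rewrite normrN.
case: (leP x s) => xs; case: (leP x 0) => x0; rewrite ?subrr ?normr0 ?ler0n// ?subr0 ?sub0r ?normrN normr1.
- by move=> _ ss; rewrite (le_trans xs ss) (le_lt_trans _ x0)// oppr_le0.
- by move=> s1 s2; rewrite (le_trans x0)// (_ : - `|s| < x)//; lra.
Qed.

Lemma integrable_step s : leb.-integrable setT (EFin \o step s).
Proof.
have i1 : leb.-integrable setT (EFin \o \1_(`]- `|s|, `|s|])).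
  apply/integrableP; split; first by apply/measurable_EFinP; exact: measurable_indic.
  under eq_integral do rewrite gee0_abs ?lee_fin//.
  rewrite integral_indic// setIT.
  by rewrite [X in (X < _)%E](lebesgue_measure_itv `]_, _]); case: ifP => _; rewrite ?ltry// -EFinB ltry.
apply: (le_integrable measurableT _ _ i1); first by apply/measurable_EFinP; exact: measurable_step.
move=> x _; rewrite /= lee_fin [leRHS]ger0_norm//; exact: step_le.
Qed.

Lemma integrable_step_mul h s : bounded_measurable (h : measurableTypeR R -> R) ->
  leb.-integrable setT (fun x => (step s x * h x)%:E).
Proof.
move=> [mh [M hM]].
exact: (integrable_mul_bounded measurableT (integrable_step s) mh (fun x _ => hM x)).
Qed.

Lemma prim_itv h a b : bounded_measurable (h : measurableTypeR R -> R) -> a <= b ->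
  prim h b - prim h a = \int[leb]_(x in `]a, b]) h x.
Proof.
move=> bh ab; rewrite /prim -RintegralB//; [|exact: integrable_step_mul..].
rewrite [RHS]Rintegral_mkcond; apply: eq_Rintegral => x _.
rewrite -mulrBl stepB// patchE indicE; case: (x \in _); rewrite ?mul1r ?mul0r//.
Qed.

Lemma integrable_cst_itv (c a b : R) : leb.-integrable `]a, b] (EFin \o cst c).
Proof.
apply/integrableP; split; first by apply/measurable_EFinP; exact: measurable_cst.
rewrite [X in (X < _)%E](_ : _ = \int[leb]_(x in `]a, b]) cst `|c|%:E x)%E//.
rewrite integral_cst// lte_mul_pinfty//.
by rewrite [X in (X < _)%E](lebesgue_measure_itv `]_, _]); case: ifP => _; rewrite ?ltry// -EFinB ltry.
Qed.

Lemma integrable_itv h a b : bounded_measurable (h : measurableTypeR R -> R) ->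
  leb.-integrable `]a, b] (EFin \o h).
Proof.
move=> [mh [M hM]].
apply: (le_integrable _ _ _ (integrable_cst_itv M a b)) => //; first by apply/measurable_EFinP; exact: measurable_funTS.
by move=> x _; rewrite /= lee_fin (le_trans (hM x))// ler_norm.
Qed.

Lemma prim_le_itv h a b M : bounded_measurable (h : measurableTypeR R -> R) -> a <= b ->
  (forall x, a <= x <= b -> `|h x| <= M) -> `|prim h b - prim h a| <= M * (b - a).
Proof.
move=> bh ab hM; rewrite prim_itv//.
have ih := integrable_itv a b bh.
apply: le_trans (le_normr_Rintegral _ ih) _ => //.
have -> : M * (b - a) = \int[leb]_(x in `]a, b]) M.
  rewrite Rintegral_cst// [X in fine X](lebesgue_measure_itv `]_, _])/= lte_fin.
  by move: ab; rewrite le_eqVlt => /predU1P[->|->]//; rewrite ltxx subrr.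
apply: le_Rintegral => //.
- exact: integrable_abse ih.
- exact: integrable_cst_itv.
by move=> x /=; rewrite in_itv/= => /andP[/ltW ax xb]; apply: hM; rewrite ax xb.
Qed.

Lemma prim_le h a b M : bounded_measurable (h : measurableTypeR R -> R) ->
  (forall x, `|x - a| <= `|b - a| -> `|h x| <= M) -> `|prim h b - prim h a| <= M * `|b - a|.
Proof.
move=> bh hM; have [ab|/ltW ba] := leP a b.
  rewrite [`|b - a|]ger0_norm ?subr_ge0//; apply: prim_le_itv => // x /andP[ax xb]; apply: hM.
  by rewrite !ger0_norm ?subr_ge0// lerB.
rewrite distrC [`|b - a|]distrC [`|a - b|]ger0_norm ?subr_ge0//; apply: prim_le_itv => // x /andP[ax xb]; apply: hM.
by rewrite distrC [leRHS]distrC !ger0_norm ?subr_ge0// lerB.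
Qed.

Lemma prim0 h : prim h 0 = 0.
Proof.
rewrite /prim; under eq_Rintegral do rewrite /step subrr mul0r.
by rewrite Rintegral_cst// mul0r.
Qed.

Lemma primDZ f g c s : bounded_measurable (f : measurableTypeR R -> R) ->
  bounded_measurable (g : measurableTypeR R -> R) ->
  prim (fun x => c * f x + g x) s = c * prim f s + prim g s.
Proof.
move=> bf bg; rewrite /prim -RintegralZl//; last exact: integrable_step_mul.
rewrite -RintegralD//; last 2 first.
- exact: (integrableZl measurableT c (integrable_step_mul s bf)).
- exact: integrable_step_mul.
by apply: eq_Rintegral => x _; ring.
Qed.

Lemma bounded_measurable_cst (c : R) : bounded_measurable (fun _ : measurableTypeR R => c).
Proof. by split; [exact: measurable_cst|exists `|c|]. Qed.

Lemma prim_cst c s : prim (fun=> c) s = c * s.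
Proof.
have H a b : a <= b -> prim (fun=> c) b - prim (fun=> c) a = c * (b - a).
  move=> ab; rewrite prim_itv//; last exact: bounded_measurable_cst.
  rewrite Rintegral_cst// [X in fine X](lebesgue_measure_itv `]_, _])/= lte_fin.
  by move: ab; rewrite le_eqVlt => /predU1P[->|->]//; rewrite ltxx subrr.
have [s0|/ltW s0] := leP 0 s; first by have := H _ _ s0; rewrite prim0 !subr0.
by have := H _ _ s0; rewrite prim0 !sub0r mulrN => /oppr_inj.
Qed.

Lemma prim_limit (f_ : nat -> R -> R) f M s :
  (forall k, measurable_fun [set: measurableTypeR R] (f_ k)) ->
  (forall k x, `|f_ k x| <= M) -> (forall x, f_ k x @[k --> \oo] --> f x) ->
  prim (f_ k) s @[k --> \oo] --> prim f s.
Proof.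
move=> mf fM cf.
have mf' : measurable_fun [set: measurableTypeR R] f by apply: (measurable_fun_cvg mf) => x _; exact: cf.
have fM' x : `|f x| <= M.
  exact: (norm_cvg_le (cf x)).
rewrite /prim; apply: fine_cvg; rewrite fineK.
  by apply: (dct_on_support (M := M)) => //; [exact: integrable_step|apply: aeW => x _ _; exact: cf].
by apply: integrable_fin_num => //; apply: integrable_step_mul; split => //; exists M.
Qed.

Lemma prim_derive h (s : R) : bounded_measurable (h : measurableTypeR R -> R) -> {for s, continuous h} ->
  is_derive s 1 (prim h) (h s).
Proof.
move=> bh ch.
have H : t^-1 *: (prim h (t *: 1 + s) - prim h s) @[t --> (0:R)^'] --> h s.
  apply/cvgrPdist_le => e e0.
  have /cvgrPdist_le/(_ e e0)[d /= d0 dP] := ch.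
  near=> t.
  have t0 : t != 0 by near: t; exact: nbhs_dnbhs_neq.
  have td : `|t| < d.
    by near: t; exists d => //= t; rewrite /ball_/= sub0r normrN.
  have -> : t *: (1 : R) = t by rewrite /GRing.scale/= mulr1.
  (* Subtracting the constant [h s] leaves a function that is at most [e] near [s], whose primitive
     therefore moves by at most [e] times the increment. *)
  pose k x := -1 * (fun=> h s) x + h x.
  have bc := bounded_measurable_cst (h s).
  have bk : bounded_measurable (k : measurableTypeR R -> R).
    case: (bh) => mh [M hM]; split; first by apply: measurable_funD => //; exact: measurable_funM.
    by exists (`|h s| + M) => x; rewrite /k mulN1r (le_trans (ler_normD _ _))// normrN lerD.
  have E x : prim k x = - (h s * x) + prim h x by rewrite primDZ// prim_cst mulN1r.
  have : `|prim k (t + s) - prim k s| <= e * `|t + s - s|.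
    apply: prim_le => // x xs; rewrite /k mulN1r addrC distrC; apply: dP => /=.
    by rewrite distrC; apply: le_lt_trans xs _; rewrite addrK.
  rewrite addrK !E => H.
  rewrite /GRing.scale/= -(ler_pM2r (_ : 0 < `|t|)) ?normr_gt0// -normrM.
  rewrite mulrBl mulrAC mulVf// mul1r -normrN; apply: le_trans H.
  by rewrite le_eqVlt; apply/orP; left; apply/eqP; congr `|_|; ring.
by apply: DeriveDef; [exact: (cvgP _ H)|exact: (cvg_lim _ H)].
Unshelve. all: by end_near. Qed.

End primitive.

(** * The chain rule with a Borel derivative *)

Section chain_rule_bounded.
Context {R : realType} (n : nat).
Local Notation mu := (@borel_lebesgue R n).
Implicit Types (u G phi : 'rV[R]_n -> R) (O K : set 'rV[R]_n) (F h : R -> R).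

Lemma integrable_test O u phi : measurable_fun setT u ->
  (forall K, compact K -> K `<=` O -> mu.-integrable K (EFin \o u)) ->
  forall K, compact K -> K `<=` O -> (forall x, ~ K x -> phi x = 0) ->
  forall M, measurable_fun setT phi -> (forall x, `|phi x| <= M) ->
  mu.-integrable setT (fun x => (u x * phi x)%:E).
Proof.
move=> mu_ iu K cK KO phi0 M mphi phiM.
have iU := integrable_cut (compact_measurable_rV cK) mu_ (iu K cK KO).
have := integrable_mul_bounded measurableT iU mphi (fun x _ => phiM x).
congr (_.-integrable _ _); apply/funext => x; congr EFin.
have [Kx|/phi0 ->] := pselect (K x); last by rewrite !mulr0.
by rewrite cutoffE.
Qed.

Lemma borel_weak_integrable O i u G phi : borel_weak O i u G -> test_function O phi ->
  mu.-integrable setT (fun x => (u x * partial i phi x)%:E) /\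
  mu.-integrable setT (fun x => (G x * phi x)%:E).
Proof.
move=> [mu_ mG iu iG _] tphi.
have [K [M [[cK KO M0 phi0 phiM] [mphi mdphi]]]] := test_function_facts i tphi.
split; [apply: (integrable_test mu_ iu cK KO _ mdphi)|apply: (integrable_test mG iG cK KO _ mphi)].
- by move=> x /phi0[].
- by move=> x; exact: (phiM x).2.
- by move=> x /phi0[].
- by move=> x; exact: (phiM x).1.
Qed.

Lemma chain_rule_bounded O i u G h : open O -> borel_weak O i u G ->
  bounded_measurable (h : measurableTypeR R -> R) ->
  forall phi, test_function O phi ->
  (\int[mu]_x (prim h (u x) * partial i phi x)%:E = - \int[mu]_x (h (u x) * G x * phi x)%:E)%E.
Proof.
move=> oO wu bh phi tphi; have [mu_ mG _ _ _] := wu.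
have [i1 i2] := borel_weak_integrable wu tphi.
have [K [M [[cK KO M0 phi0 phiM] [mphi mdphi]]]] := test_function_facts i tphi.
have bcont f : bounded_measurable (f : measurableTypeR R -> R) -> forall a b, exists2 L, 0 <= L & `|prim f a - prim f b| <= L * `|a - b| /\ `|prim f a| <= L * `|a|.
  move=> bf a b; case: (bf) => mf [L fL]; exists L; first exact: le_trans (fL 0).
  by split; [exact: prim_le|have := @prim_le _ f 0 a L bf (fun x _ => fL x); rewrite prim0 !subr0].
have mprim f : bounded_measurable (f : measurableTypeR R -> R) -> measurable_fun [set: R] (prim f).
  move=> bf; case: (bf) => mf [L fL]; apply: continuous_measurable_fun.
  by apply: (@lipschitz_continuous_fun _ _ L) => a b; exact: prim_le.
(* Dividing by [u x] turns the unbounded primitive into a factor bounded by any bound of [f]; both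
   sides become integrals of fixed integrable functions against bounded factors depending on [f]. *)
pose q f x := prim f (u x) / u x.
have mq f : bounded_measurable (f : measurableTypeR R -> R) -> measurable_fun [set: 'rV[R]_n] (q f).
  move=> bf; apply: measurable_funM; first exact: (measurableT_comp (mprim _ bf)).
  exact: (measurableT_comp (@measurable_invr R)).
have q_le f L x : bounded_measurable (f : measurableTypeR R -> R) -> (forall s, `|f s| <= L) -> `|q f x| <= L.
  move=> bf fL; rewrite /q; have [->|u0] := eqVneq (u x) 0.
    by rewrite invr0 mulr0 normr0 (le_trans _ (fL 0)).
  rewrite normrM normfV ler_pdivrMr ?normr_gt0//.
  by have := @prim_le _ f 0 (u x) L bf (fun s _ => fL s); rewrite prim0 !subr0.
have qE f x : prim f (u x) * partial i phi x = u x * partial i phi x * q f x.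
  rewrite /q; have [->|u0] := eqVneq (u x) 0; first by rewrite prim0 !mul0r.
  by rewrite mulrC -[RHS]mulrA mulrCA; congr (_ * _); rewrite mulrCA divff// mulr1.
have hE f x : f (u x) * G x * phi x = G x * phi x * f (u x) by rewrite -mulrA mulrC.
have mfu f : bounded_measurable (f : measurableTypeR R -> R) -> measurable_fun [set: 'rV[R]_n] (f \o u).
  by move=> [mf _]; exact: (measurableT_comp mf).
have iq f : bounded_measurable (f : measurableTypeR R -> R) ->
    mu.-integrable setT (fun x => (u x * partial i phi x * q f x)%:E) /\
    mu.-integrable setT (fun x => (G x * phi x * f (u x))%:E).
  move=> bf; case: (bf) => mf [L fL]; split.
    exact: (integrable_mul_bounded measurableT i1 (mq _ bf) (fun x _ => q_le f L x bf fL)).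
  exact: (integrable_mul_bounded measurableT i2 (mfu _ bf) (fun x _ => fL (u x))).
pose P (f : measurableTypeR R -> R) := (\int[mu]_x (u x * partial i phi x * q f x)%:E = - \int[mu]_x (G x * phi x * f (u x))%:E)%E.
have Pcont f : bounded_measurable (f : measurableTypeR R -> R) -> continuous (f : R -> R) -> P f.
  move=> bf cf; case: (bf) => mf [L fL]; rewrite /P.
  under eq_integral do rewrite -qE.
  under [X in (- X)%E]eq_integral do rewrite -hE.
  apply: (@chain_rule_lipschitz R n O i u G (prim f) f L set0) => //.
  - by move=> a b; apply: prim_le.
  - by move=> s _; apply: prim_derive => //; exact: cf.
  - by apply: aeW.
have Plim (f_ : nat -> R -> R) f L : (forall k, measurable_fun [set: measurableTypeR R] (f_ k)) ->
    (forall k x, `|f_ k x| <= L) -> (forall x, f_ k x @[k --> \oo] --> f x) ->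
    (forall k, P (f_ k)) -> P f.
  move=> mf fL cf Pf.
  have bf k : bounded_measurable (f_ k : measurableTypeR R -> R) by split => //; exists L.
  have bf' : bounded_measurable (f : measurableTypeR R -> R).
    split; first by apply: (measurable_fun_cvg mf) => x _; exact: cf.
    by exists L => x; exact: (norm_cvg_le (cf x)).
  have c1 : (\int[mu]_x (u x * partial i phi x * q (f_ k) x)%:E)%E @[k --> \oo] -->
      (\int[mu]_x (u x * partial i phi x * q f x)%:E)%E.
    apply: (dct_on_support (M := L)) => //; [by move=> k; exact: mq|exact: mq|by move=> k x _; exact: q_le|].
    apply: aeW => x _ _; rewrite /q; apply: cvgMl; exact: (prim_limit (M := L)).
  have c2 : (\int[mu]_x (G x * phi x * f_ k (u x))%:E)%E @[k --> \oo] -->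
      (\int[mu]_x (G x * phi x * f (u x))%:E)%E.
    apply: (dct_on_support (M := L)) => //; [by move=> k; exact: mfu|exact: mfu|].
    by apply: aeW => x _ _; exact: cf.
  have H : (\int[mu]_x (u x * partial i phi x * q (f_ k) x)%:E)%E @[k --> \oo] -->
      (- \int[mu]_x (G x * phi x * f (u x))%:E)%E.
    by under eq_fun => k do rewrite Pf; exact: cvgeN.
  exact: (cvg_unique (@ereal_hausdorff R) c1 H).
suff : P h by rewrite /P; under eq_integral do rewrite -qE; under [X in (- X)%E]eq_integral do rewrite -hE.
apply: (@monotone_class _ (measurableTypeR R) R (@RGenOInfty.G R) P) => //.
- exact: RGenOInfty.measurableE.
- move=> _ _ [a ->] [b ->]; exists (Num.max a b); apply/seteqP; split => x /=; rewrite !in_itv/= !andbT gt_max.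
    by move=> [-> ->].
  by move=> /andP[].
- by apply: Pcont; [exact: bounded_measurable_cst|exact: cst_continuous].
- move=> _ [a ->].
  (* Continuous ramps increasing to the indicator of []a, +oo[]; these half-lines generate the Borel
     sets. *)
  pose f k (s : R) : R := Num.min 1 (Num.max 0 (k%:R * (s - a))).
  have cf k : continuous (f k).
    move=> s; apply: (@continuous_min _ _ (cst 1) (fun s => Num.max 0 (k%:R * (s - a)))); first exact: cst_continuous.
    apply: (@continuous_max _ _ (cst 0) (fun s => k%:R * (s - a))); first exact: cst_continuous.
    by apply: cvgM; [exact: cvg_cst|apply: cvgB; [exact: cvg_id|exact: cvg_cst]].
  have f01 k s : 0 <= f k s <= 1.
    by rewrite /f ge_min lexx le_min ler01 le_max lexx.
  have fk1 k s : `|f k s| <= 1 by have /andP[? ?] := f01 k s; rewrite ger0_norm.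
  have mf k : measurable_fun [set: measurableTypeR R] (f k) by exact: (continuous_measurable_fun (cf k)).
  apply: (Plim f _ 1) => //; last by move=> k; apply: Pcont => //; split => //; exists 1.
  move=> s; rewrite indicE mem_setE in_itv/= andbT; case: ltP => as_.
    apply: cvg_near_cst; have sa : 0 < s - a by rewrite subr_gt0.
    near=> k; apply/min_idPl; rewrite le_max; apply/orP; right.
    rewrite -ler_pdivrMr//; near: k; exact: nbhs_infty_ger.
  apply: cvg_near_cst; apply: nearW => k; rewrite /f.
  rewrite (_ : Num.max 0 _ = 0); first by apply/min_idPr.
  by apply/max_idPl; rewrite mulr_ge0_le0// subr_le0.
- move=> c f g bf g_b Pf Pg; rewrite /P.
  have [f1 f2] := iq _ bf; have [g1 g2] := iq _ g_b.
  transitivity (\int[mu]_x (c%:E * (u x * partial i phi x * q f x)%:E + (u x * partial i phi x * q g x)%:E))%E.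
    by apply: eq_integral => x _; rewrite -EFinM -EFinD /q primDZ//; congr EFin; ring.
  rewrite integralD//; last exact: integrableZl.
  rewrite integralZl// Pf Pg.
  transitivity (- \int[mu]_x (c%:E * (G x * phi x * f (u x))%:E + (G x * phi x * g (u x))%:E))%E; last first.
    by congr (- _)%E; apply: eq_integral => x _; rewrite -EFinM -EFinD; congr EFin; ring.
  rewrite integralD//; last exact: integrableZl.
  rewrite integralZl// muleN fin_num_oppeD//.
  exact: integrable_fin_num.
Unshelve. all: by end_near. Qed.

Definition truncated (m : R) h : R -> R := fun s => h s * \1_(`[- m, m]) s.

Lemma truncated_le m h w : (forall s, `|h s| <= w `|s|) ->
  (forall s t, 0 <= s -> s <= t -> w s <= w t) ->
  (forall s, `|truncated m h s| <= w `|m|) /\ (forall s, `|truncated m h s| <= w `|s|).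
Proof.
move=> hw wmon; have w0 t : 0 <= t -> 0 <= w t.
  by move=> t0; apply: le_trans (wmon _ _ (lexx 0) t0); have := le_trans (normr_ge0 _) (hw 0); rewrite normr0.
have th s : `|truncated m h s| <= `|h s|.
  rewrite /truncated normrM ler_piMr// indicE; case: (_ \in _); rewrite ?normr1 ?normr0//.
split=> s; last exact: le_trans (th s) (hw s).
rewrite /truncated indicE mem_setE in_itv/= -ler_norml; case: (leP `|s| m) => sm.
  by rewrite mulr1 (le_trans (hw s))// wmon// (le_trans sm)// ler_norm.
by rewrite mulr0 normr0 w0.
Qed.

(* [f] is the primitive of [h] vanishing at 0, stated through truncations so that [prim] is
   only applied to bounded functions; [w] dominates [h] radially. *)
Definition local_primitive (f h w : R -> R) := [/\ measurable_fun [set: measurableTypeR R] h,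
  forall s, `|h s| <= w `|s|, forall s t, 0 <= s -> s <= t -> w s <= w t &
  forall m s, `|s| <= m -> f s = prim (truncated m h) s].

Lemma bounded_truncated f h w m : local_primitive f h w ->
  bounded_measurable (truncated m h : measurableTypeR R -> R).
Proof.
move=> [mh hw wmon _]; split; last by exists (w `|m|) => s; have [] := truncated_le m hw wmon.
by apply: measurable_funM => //; exact: measurable_indic.
Qed.

Lemma prim_truncated_le f h w m s : local_primitive f h w ->
  `|prim (truncated m h) s| <= `|s| * w `|s|.
Proof.
move=> fhw; have [mh hw wmon _] := fhw.
have := @prim_le _ (truncated m h) 0 s (w `|s|) (bounded_truncated m fhw).
rewrite prim0 !subr0 mulrC; apply => x; rewrite subr0 => xs.
by have [_ H] := truncated_le m hw wmon; apply: le_trans (H x) _; exact: wmon.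
Qed.

Lemma local_primitive_le f h w s : local_primitive f h w -> `|f s| <= `|s| * w `|s|.
Proof. by move=> fhw; have [_ _ _ /(_ _ _ (lexx _)) ->] := fhw; exact: prim_truncated_le fhw. Qed.

Lemma measurable_prim (h : R -> R) : bounded_measurable (h : measurableTypeR R -> R) ->
  measurable_fun [set: R] (prim h).
Proof.
move=> bf; case: (bf) => mf [L fL]; apply: continuous_measurable_fun.
by apply: (@lipschitz_continuous_fun _ _ L) => a b; exact: prim_le.
Qed.

Lemma local_primitive_cvg f h w s : local_primitive f h w ->
  (prim (truncated k%:R h) s @[k --> \oo] --> f s) /\ (truncated k%:R h s @[k --> \oo] --> h s).
Proof.
move=> [_ _ _ fE]; have E : \forall k \near \oo, `|s| <= k%:R by exact: nbhs_infty_ger.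
split; apply: cvg_near_cst; apply: filterS E => k sk; first by rewrite -fE.
by rewrite /truncated indicE mem_set ?mulr1//= in_itv/= -ler_norml.
Qed.

Lemma measurable_local_primitive f h w : local_primitive f h w -> measurable_fun [set: R] f.
Proof.
move=> fhw; apply: (measurable_fun_cvg (h := fun k => prim (truncated k%:R h))) => [k|x _].
  by apply: measurable_prim; exact: bounded_truncated fhw.
by have [] := local_primitive_cvg x fhw.
Qed.

(** The two integrability hypotheses provide the majorants under which the truncations of [h] to
    [[-k, k]] are removed by dominated convergence. *)
Lemma chain_rule_local O i u G f h w : open O -> borel_weak O i u G -> local_primitive f h w ->
  measurable_fun [set: R] w ->
  (forall K, compact K -> K `<=` O -> mu.-integrable K (EFin \o (fun x => `|u x| * w `|u x|))) ->
  (forall K, compact K -> K `<=` O -> mu.-integrable K (EFin \o (fun x => h (u x) * G x))) ->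
  borel_weak O i (f \o u) (fun x => h (u x) * G x).
Proof.
move=> oO wu fhw mw iw ihG; have [mh hw wmon fE] := fhw; have [mu_ mG iu iG _] := wu.
have mhu : measurable_fun setT (h \o u) by exact: (measurableT_comp mh).
have mabs : measurable_fun setT (fun x => `|u x|) by exact: measurableT_comp.
split.
- exact: (measurableT_comp (measurable_local_primitive fhw)).
- exact: measurable_funM.
- move=> K cK KO; apply: (le_integrable (compact_measurable_rV cK) _ _ (iw K cK KO)).
    apply/measurable_EFinP; apply: measurable_funTS; exact: (measurableT_comp (measurable_local_primitive fhw)).
  move=> x _; rewrite !abse_EFin lee_fin (le_trans (local_primitive_le _ fhw))// ler_norm//.
- exact: ihG.
move=> phi tphi.
have [K [M [[cK KO M0 phi0 phiM] [mphi mdphi]]]] := test_function_facts i tphi.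
have mD : measurable_fun setT (fun x => `|u x| * w `|u x|).
  by apply: measurable_funM => //; exact: (measurableT_comp mw).
have iD := integrable_test mD iw cK KO (fun x Kx => (phi0 x Kx).2) mdphi (fun x => (phiM x).2).
have iH := integrable_test (measurable_funM mhu mG) ihG cK KO (fun x Kx => (phi0 x Kx).1) mphi (fun x => (phiM x).1).
have bt m := bounded_truncated m fhw.
pose hk k := truncated k%:R h.
have mhk k : measurable_fun setT (hk k \o u) by apply: (measurableT_comp (f := hk k)) => //; case: (bt k%:R).
have c1 : (\int[mu]_x (prim (hk k) (u x) * partial i phi x)%:E)%E @[k --> \oo] -->
    (\int[mu]_x (f (u x) * partial i phi x)%:E)%E.
  have [|||||_ _ H] := @dominated_convergence _ _ R mu setT measurableT
    (fun k x => (prim (hk k) (u x) * partial i phi x)%:E) (fun x => (f (u x) * partial i phi x)%:E)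
    (fun x => `|(`|u x| * w `|u x| * partial i phi x)%:E|%E); last exact: H.
  - move=> k; apply/measurable_EFinP; apply: measurable_funM => //.
    exact: (measurableT_comp (measurable_prim (bt k%:R))).
  - apply/measurable_EFinP; apply: measurable_funM => //.
    exact: (measurableT_comp (measurable_local_primitive fhw)).
  - apply: aeW => x _; apply: cvg_EFin; first exact: nearW.
    by apply: cvgMl; have [] := local_primitive_cvg (u x) fhw.
  - exact: integrable_abse.
  - apply: aeW => x k _; rewrite !abse_EFin lee_fin !normrM ler_wpM2r// normr_id.
    by apply: le_trans (prim_truncated_le _ _ fhw) _; rewrite ler_wpM2l// ler_norm.
have c2 : (\int[mu]_x (hk k (u x) * G x * phi x)%:E)%E @[k --> \oo] -->
    (\int[mu]_x (h (u x) * G x * phi x)%:E)%E.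
  have [|||||_ _ H] := @dominated_convergence _ _ R mu setT measurableT
    (fun k x => (hk k (u x) * G x * phi x)%:E) (fun x => (h (u x) * G x * phi x)%:E)
    (fun x => `|(h (u x) * G x * phi x)%:E|%E); last exact: H.
  - move=> k; apply/measurable_EFinP; do 2!apply: measurable_funM => //; exact: mhk.
  - by apply/measurable_EFinP; do 2!apply: measurable_funM => //.
  - apply: aeW => x _; apply: cvg_EFin; first exact: nearW.
    by apply: cvgMl; apply: cvgMl; have [] := local_primitive_cvg (u x) fhw.
  - exact: integrable_abse.
  - apply: aeW => x k _; rewrite !abse_EFin lee_fin !normrM ler_wpM2r// ler_wpM2r//.
    apply: ler_piMr => //.
    by rewrite indicE; case: (_ \in _); rewrite ?normr1 ?normr0.
apply: (cvg_unique (@ereal_hausdorff R) c1).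
have -> : (fun k => \int[mu]_x (prim (hk k) (u x) * partial i phi x)%:E)%E =
    (fun k => - \int[mu]_x (hk k (u x) * G x * phi x)%:E)%E.
  by apply/funext => k; exact: chain_rule_bounded (bt _) _ tphi.
exact: cvgeN.
Qed.

End chain_rule_bounded.

(** * Locally Lipschitz functions as primitives *)

#[global] Instance ae_lebesgue_filter (R : realType) :
  Filter (nbhs (almost_everywhere (@lebesgue_measure R))) := ae_filter_ringOfSetsType _.

Section lipschitz_primitive.
Context {R : realType}.
Local Notation leb := (@lebesgue_measure R).
Implicit Types (f h w : R -> R) (L m : R).

(** Compactness gives one scale at which [f] is Lipschitz around every point of the interval; two
    points are joined by a chain of steps below that scale, and the bounds add up along the
    segment. *)
Lemma locally_lipschitz_itv f m : [locally [lipschitz f x | x in [set: R]]] ->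
  exists2 L, 0 < L & forall x y, `|x| <= m -> `|y| <= m -> `|f x - f y| <= L * `|x - y|.
Proof.
move=> lipf.
have loc x : exists r L, [/\ 0 < r, 0 < L & forall u v, `|u - x| < r -> `|v - x| < r -> `|f u - f v| <= L * `|u - v|].
  have := lipf (x, x) (conj I I); move=> -[M [_ HM]].
  have /HM : M < `|M| + 1 by rewrite (le_lt_trans (ler_norm M))// ltrDl.
  rewrite /dominated_by /self_sub /= => H; have := H; rewrite /within/= => -[[P Q] /= [[r /= r0 rP] [s /= s0 sQ]] PQ].
  exists (Num.min r s), (`|M| + 1); split.
  - by rewrite lt_min r0 s0.
  - by rewrite ltr_wpDl.
  move=> u v; rewrite !lt_min => /andP[ur us] /andP[vr vs].
  have := PQ (u, v); apply => //; split => /=; [apply: rP|apply: sQ]; by rewrite /ball_/= distrC.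
(* [L] serves both as Lipschitz constant and as inverse radius, so the covering argument involves a
   single parameter going to infinity. *)
pose P L x := forall y, `|y - x| <= L^-1 -> `|f y - f x| <= L * `|y - x|.
have : compact `[- m, m] by exact: segment_compact.
move/compact_near_coveringP => /(_ _ (pinfty_nbhs R) P _) [].
  move=> x _; have [r [L [r0 L0 rL]]] := loc x.
  exists ([set y | `|y - x| < r / 2], [set M | Num.max L (2 / r) <= M]) => /=.
    split; first by exists (r / 2) => [|y] /=; [rewrite divr_gt0|rewrite /ball_/= distrC].
    by apply: nbhs_pinfty_ge; rewrite num_real.
  move=> [y M] [/= yr]; rewrite ge_max => /andP[LM rM] z zM.
  have M0 : 0 < M by exact: lt_le_trans LM.
  have zr : `|z - y| <= r / 2.
    apply: le_trans zM _; rewrite -[leRHS]invrK lef_pV2 ?posrE ?invr_gt0 ?divr_gt0//.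
    by rewrite invf_div.
  apply: le_trans (rL _ _ _ _) _; last by rewrite ler_wpM2r.
    have := ler_normD (z - y) (y - x); rewrite addrA subrK; lra.
  by rewrite (lt_trans yr)// ltr_pdivrMr// ltr_pMr// ltr1n.
move=> M [_ HM]; pose L := `|M| + 1.
have L0 : 0 < L by rewrite ltr_wpDl.
have {}HM : forall x, `|x| <= m -> P L x.
  move=> x xm; apply: HM; first by rewrite (le_lt_trans (ler_norm M))// ltrDl.
  by rewrite /= in_itv/= -ler_norml.
exists L => //.
have step k : forall x y, `|x| <= m -> `|y| <= m -> `|y - x| <= k%:R * L^-1 -> `|f y - f x| <= L * `|y - x|.
  elim: k => [|k ih] x y xm ym; first by rewrite mul0r normr_le0 subr_eq0 => /eqP ->; rewrite !subrr normr0 mulr0.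
  move=> xyk; have k0 : 0 < k.+1%:R :> R by rewrite ltr0n.
  (* The first of [k.+1] equal steps from [x] to [y]; what remains is the fraction [k / k.+1] of the
     whole, as the induction requires. *)
  pose z := x + (y - x) / k.+1%:R.
  have k1 : 0 <= (k.+1%:R : R)^-1 <= 1 by rewrite invr_ge0 ltW//= invf_le1// ler1n.
  have zE : z = (1 - k.+1%:R^-1) * x + k.+1%:R^-1 * y by rewrite /z; ring.
  have zm : `|z| <= m.
    rewrite zE (le_trans (ler_normD _ _))// !normrM.
    have /andP[k1a k1b] := k1; rewrite (ger0_norm k1a) ger0_norm ?subr_ge0//.
    have -> : m = (1 - k.+1%:R^-1) * m + k.+1%:R^-1 * m by ring.
    by rewrite lerD// ler_wpM2l// subr_ge0.
  have zx : z - x = (y - x) / k.+1%:R by rewrite /z; ring.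
  have yz : y - z = (y - x) * (k%:R / k.+1%:R).
    by rewrite /z -[in RHS]natr1; field; rewrite natr1 gt_eqF.
  have h1 : `|f z - f x| <= L * `|z - x|.
    apply: HM => //; rewrite zx normrM (gtr0_norm (_ : 0 < k.+1%:R^-1)) ?invr_gt0//.
    by rewrite ler_pdivrMr// mulrC.
  have h2 : `|f y - f z| <= L * `|y - z|.
    apply: ih => //; rewrite yz normrM (ger0_norm (_ : 0 <= k%:R / k.+1%:R)) ?divr_ge0//.
    apply: le_trans (ler_wpM2r _ xyk) _; first by rewrite divr_ge0.
    by rewrite le_eqVlt; apply/orP; left; apply/eqP; field; rewrite !gt_eqF.
  have -> : L * `|y - x| = L * `|y - z| + L * `|z - x|.
    rewrite -mulrDr; congr (_ * _); rewrite zx yz !normrM !normfV !normr_nat.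
    by rewrite -mulrDr -[X in _ = _ * (_ + X)]mul1r -mulrDl natr1 divff ?mulr1// pnatr_eq0.
  by rewrite -(subrKA (f z)) (le_trans (ler_normD _ _))// lerD.
move=> x y xm ym; rewrite distrC [`|x - y|]distrC.
apply: (step (Num.truncn (`|y - x| * L)).+1) => //.
by rewrite ler_pdivlMr// ltW// truncnS_gt.
Qed.

Section density.
Variables (f : R -> R) (L m : R).
Hypotheses (L0 : 0 < L) (m0 : 0 < m) (lipf : forall x y, `|f x - f y| <= L * `|x - y|).

Let contf : continuous f. Proof. exact: lipschitz_continuous_fun lipf. Qed.

(** Both [f x + L x] and [L x - f x] are nondecreasing, and their Stieltjes measures add up to
    [2 * L] times Lebesgue measure; so each of them is absolutely continuous. *)
Let gp x := f x + L * x.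
Let gm x := L * x - f x.

Let gp_cumulative : nondecreasing gp /\ right_continuous gp.
Proof.
split=> [x y xy|].
  by have := lipf y x; rewrite [`|y - x|]ger0_norm ?subr_ge0// ler_norml /gp => /andP[]; lra.
apply: right_continuousW => x; apply: cvgD; first exact: contf.
by apply: cvgM; [exact: cvg_cst|exact: cvg_id].
Qed.

Let gm_cumulative : nondecreasing gm /\ right_continuous gm.
Proof.
split=> [x y xy|].
  by have := lipf y x; rewrite [`|y - x|]ger0_norm ?subr_ge0// ler_norml /gm => /andP[]; lra.
apply: right_continuousW => x; apply: cvgB; last exact: contf.
by apply: cvgM; [exact: cvg_cst|exact: cvg_id].
Qed.

HB.instance Definition _ := isCumulative.Build R _ R gp gp_cumulative.1 gp_cumulative.2.
HB.instance Definition _ := isCumulative.Build R _ R gm gm_cumulative.1 gm_cumulative.2.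

Let nu := lebesgue_stieltjes_measure gp.
Let nu' := lebesgue_stieltjes_measure gm.

Let stieltjes_itv (g : cumulative R R) (a b : R) : a <= b ->
  lebesgue_stieltjes_measure g `]a, b] = (g b - g a)%:E.
Proof.
move=> ab; rewrite /lebesgue_stieltjes_measure /measure_extension measurable_mu_extE//=; last exact: is_ocitv.
rewrite wlength_itv/= lte_fin; move: ab; rewrite le_eqVlt => /predU1P[->|->]//.
by rewrite ltxx subrr.
Qed.

Let nu_dominated : nu `<< leb.
Proof.
apply/null_content_dominatesP => A mA A0.
have Li : 0 <= (2 * L)^-1 by rewrite invr_ge0 mulr_ge0// ltW.
pose M := mscale (NngNum Li) (measure_add nu nu').
have ME B : M B = ((2 * L)^-1%:E * (nu B + nu' B))%E.
  by rewrite /M /mscale/=; congr (_ * _)%E; exact: measure_addE.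
have : leb A = M A.
  apply: lebesgue_measure_unique => // X [[a b] /= _ <-].
  rewrite [RHS](ME `]a, b]%classic).
  have [ab|ba] := leP a b; last first.
    rewrite (set_itv_ge (_ : ~~ (BRight a < BRight b)%O)) ?bnd_simp -?leNgt ?ltW// measure0.
    have -> : nu set0 = 0%E by exact: measure0.
    have -> : nu' set0 = 0%E by exact: measure0.
    by rewrite adde0 mule0.
  rewrite /nu /nu' !stieltjes_itv// [LHS](lebesgue_measure_itv `]a, b])/= lte_fin.
  have -> : (if a < b then (b%:E - a%:E)%E else 0%E) = (b - a)%:E.
    by move: ab; rewrite le_eqVlt => /predU1P[->|->]//; rewrite ltxx subrr.
  rewrite -EFinD -EFinM; congr EFin; rewrite /gp /gm; field.
  by rewrite gt_eqF.
rewrite A0 [X in _ = X](ME A) => /esym/eqP.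
rewrite mule_eq0 eqe invr_eq0 mulf_eq0 pnatr_eq0/= gt_eqF//= padde_eq0//.
by move=> /andP[/eqP].
Qed.

Lemma lipschitz_density : exists h, [/\ measurable_fun [set: measurableTypeR R] h,
  leb.-integrable setT (EFin \o h) &
  forall x y, - m <= x -> x <= y -> y <= m -> f y - f x = \int[leb]_(t in `]x, y]) h t].
Proof.
pose D : set (measurableTypeR R) := `]- m, m]%classic.
have mD : measurable D by exact: measurable_itv.
have mm : - m <= m by rewrite ge0_cp// ltW.
have Doo : (nu D < +oo)%E by rewrite /nu /D stieltjes_itv// ltry.
pose nuD := charge_of_finite_measure (mfrestr mD Doo).
have dom : nuD `<< leb.
  apply/null_content_dominatesP => A mA A0.
  have := iffLR (null_content_dominatesP _ _) nu_dominated (A `&` D) (measurableI _ _ mA mD).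
  apply; apply: (subset_measure0 _ _ _ A0) => //; exact: measurableI.
pose r := Radon_Nikodym nuD leb.
have ir : leb.-integrable setT r by exact: Radon_Nikodym_integrable.
have rfin x : r x \is a fin_num by exact: Radon_Nikodym_fin_num.
have mr : measurable_fun [set: measurableTypeR R] (fine \o r).
  by apply: measurableT_comp => //; exact: measurable_int ir.
(* [gp] has the Radon-Nikodym density of [nuD] on []-m, m]]; removing [L] gives the density of [f]
   itself. *)
pose h x : R := fine (r x) * \1_D x - L * \1_D x.
have iD : leb.-integrable setT (EFin \o \1_D).
  apply/integrableP; split; first by apply/measurable_EFinP; exact: measurable_indic.
  under eq_integral do rewrite gee0_abs ?lee_fin//.
  rewrite integral_indic// setIT.
  by rewrite [X in (X < _)%E](lebesgue_measure_itv `]_, _]); case: ifP => _; rewrite ?ltry// -EFinB ltry.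
have ir' : leb.-integrable setT (EFin \o (fine \o r)).
  by apply: eq_integrable ir => // x _; rewrite /= fineK.
have D1 (x : measurableTypeR R) : setT x -> `|\1_D x : R| <= 1.
  by move=> _; rewrite indicE; case: (_ \in _); rewrite ?normr1 ?normr0.
have irD := integrable_mul_bounded measurableT ir' (measurable_indic mD) D1.
exists h; split.
- apply: measurable_funB; apply: measurable_funM => //; exact: measurable_indic.
- exact: (integrableB measurableT irD (integrableZl measurableT L iD)).
move=> x y mx xy ym.
have sub : `]x, y]%classic `<=` D.
  move=> t; rewrite /D /= !in_itv/= => /andP[xt ty]; apply/andP; split; first exact: le_lt_trans xt.
  exact: le_trans ym.
have E1 : (\int[leb]_(t in `]x, y]) (fine (r t))%:E)%E = (gp y - gp x)%:E.
  under eq_integral do rewrite fineK//.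
  rewrite -(Radon_Nikodym_integral dom)// /nuD /charge_of_finite_measure/= /mfrestr /mrestr.
  by rewrite setIidl// /nu stieltjes_itv.
transitivity (\int[leb]_(t in `]x, y]) (fine (r t) - L)); last first.
  by apply: eq_Rintegral => t; rewrite inE => /sub Dt; rewrite /h indicE mem_set// !mulr1.
rewrite RintegralB//; last 2 first.
- exact: integrableS ir'.
- exact: integrable_cst_itv.
rewrite /Rintegral E1 integral_cst// [X in (_ * X)%E](lebesgue_measure_itv `]_, _])/= lte_fin.
have -> : (if x < y then (y%:E - x%:E)%E else 0%E) = (y - x)%:E.
  by move: xy; rewrite le_eqVlt => /predU1P[->|->]//; rewrite ltxx subrr.
by rewrite -EFinM/= /gp; ring.
Qed.

End density.

(** Lebesgue differentiation of the indefinite integral of the density, from which [f] differs by a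
    constant on [[-m, m]]. *)
Lemma lipschitz_ae_derive f L m : 0 < L -> 0 < m ->
  (forall x y, `|f x - f y| <= L * `|x - y|) ->
  exists h, [/\ measurable_fun [set: measurableTypeR R] h,
    leb.-integrable setT (EFin \o h),
    (forall x y, - m <= x -> x <= y -> y <= m -> f y - f x = \int[leb]_(t in `]x, y]) h t) &
    {ae leb, forall x : R, - m < x < m -> derivable f x 1 /\ derive1 f x = h x}].
Proof.
move=> L0 m0 lipf; have [h [mh ih hE]] := lipschitz_density L0 m0 lipf.
exists h; split => //.
have ihy (y : R) : leb.-integrable `]-oo, y] (EFin \o h) by exact: integrableS ih.
have loc : locally_integrable [set: R] h by have := integrable_locally measurableT ih; rewrite patch_setT.
have := FTC1Ny ihy loc; apply: filterS => x [dF F'] /andP[mx xm].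
have H := DeriveDef dF (etrans (esym (derive1E _ x)) F').
have H2 : is_derive x 1 f (h x).
  have H1 := is_deriveD (is_derive_cst (f (- m) - \int[leb]_(t in `]-oo, - m]) h t) x 1) H.
  rewrite add0r in H1; apply: (near_eq_is_derive _ H1).
  have : \forall y \near x, - m < y < m.
    by apply: (near_in_itvoo (a := - m) (b := m)); rewrite in_itv/= mx xm.
  apply: filterS => y /andP[my ym].
  have := hE (- m) y (lexx _) (ltW my) (ltW ym).
  rewrite -(@Rintegral_itvB R h -oo%O (BRight y) (- m)) ?bnd_simp//; last exact: ltW.
  rewrite -[X in _ -> X = _]/(f (- m) - \int[leb]_(t in `]-oo, - m]) h t + \int[leb]_(t in `]-oo, y]) h t).
  by move=> /eqP; rewrite subr_eq => /eqP ->; rewrite addrC -[RHS]addrA; congr (_ + _); exact: addrC.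
by split; [case: H2|rewrite derive1E; case: H2].
Qed.

Lemma clamp_lipschitz m (x y : R) : 0 <= m ->
  `|Num.max (- m) (Num.min m x) - Num.max (- m) (Num.min m y)| <= `|x - y| /\
  `|Num.max (- m) (Num.min m x)| <= m.
Proof.
move=> m0.
have maxL (a u v : R) : `|Num.max a u - Num.max a v| <= `|u - v|.
  have := ler_norm (u - v); have := ler_norm (- (u - v)); rewrite normrN !maxEle => n1 n2.
  by rewrite ler_norml; case: (leP a u) => ?; case: (leP a v) => ?; apply/andP; split; lra.
split; last by rewrite ler_norml le_max lexx ge_max ge_min lexx/= andbT (le_trans _ m0)// oppr_le0.
apply: (le_trans (maxL _ _ _)).
rewrite (_ : Num.min m x - Num.min m y = - (Num.max (- m) (- x) - Num.max (- m) (- y))) ?normrN.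
  by apply: (le_trans (maxL _ _ _)); rewrite -opprD normrN.
by rewrite -!oppr_min; ring.
Qed.

Lemma clamp_id m (x : R) : `|x| <= m -> Num.max (- m) (Num.min m x) = x.
Proof. by rewrite ler_norml => /andP[mx xm]; rewrite (min_idPr xm) (max_idPr mx). Qed.

(** The densities on growing intervals agree only a.e., so [h] is not glued from them. It is the
    upper limit of difference quotients with step [1/(k+1)], which is Borel and equals the
    derivative wherever this exists, set to 0 where it exceeds [w]. *)
Lemma locally_lipschitz_primitive f w : [locally [lipschitz f x | x in [set: R]]] -> f 0 = 0 ->
  measurable_fun [set: R] w -> (forall s, 0 <= s -> 0 <= w s) ->
  (forall s t, 0 <= s -> s <= t -> w s <= w t) ->
  {ae leb, forall t : R, derivable f t 1 -> `|derive1 f t| <= w `|t|} ->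
  exists h, local_primitive f h w.
Proof.
move=> lipf f0 mw w0 wmon fw.
pose clamp m x := Num.max (- m) (Num.min m x).
have loc (k : nat) : exists h, [/\ measurable_fun [set: measurableTypeR R] h,
    leb.-integrable setT (EFin \o h),
    (forall x y, - k.+1%:R <= x -> x <= y -> y <= k.+1%:R -> f y - f x = \int[leb]_(t in `]x, y]) h t) &
    {ae leb, forall x : R, - k.+1%:R < x < k.+1%:R -> derivable f x 1 /\ derive1 f x = h x}].
  have k0 : 0 < k.+1%:R :> R by rewrite ltr0n.
  have [L L0 fL] := locally_lipschitz_itv k.+1%:R lipf.
  have [|h [mh ih hE hd]] := @lipschitz_ae_derive (f \o clamp k.+1%:R) L k.+1%:R L0 k0.
    move=> x y /=; have [H1 H2] := clamp_lipschitz x y (ltW k0); have [_ H3] := clamp_lipschitz y y (ltW k0).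
    by apply: le_trans (fL _ _ H2 H3) _; rewrite ler_wpM2l// ltW.
  have E x : - k.+1%:R <= x <= k.+1%:R -> f (clamp k.+1%:R x) = f x.
    by move=> xk; rewrite /clamp clamp_id// ler_norml.
  exists h; split => // [x y kx xy yk|].
    by rewrite -hE//= !E// ?kx ?yk ?(le_trans kx xy) ?(le_trans xy yk).
  apply: filterS hd => x Hx xk; have [d1 d2] := Hx xk.
  have H2 : is_derive x 1 f (h x).
    have d3 : is_derive x 1 (f \o clamp k.+1%:R) (h x) by apply: DeriveDef => //; rewrite -d2 derive1E.
    apply: (near_eq_is_derive _ d3).
    have : \forall y \near x, - k.+1%:R < y < k.+1%:R.
      by apply: (near_in_itvoo (a := - k.+1%:R) (b := k.+1%:R)); rewrite in_itv/=.
    by apply: filterS => y /andP[? ?]; rewrite /= E// !ltW.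
  by split; [case: H2|rewrite derive1E; case: H2].
pose h_ k := projT1 (cid (loc k)); have h_P k := projT2 (cid (loc k)).
pose dq (k : nat) (x : R) := (k.+1%:R * (f (x + k.+1%:R^-1) - f x))%:E.
pose h0 x := fine (limn_esup (fun k => dq k x)).
have contf : continuous f.
  move=> x; have [L L0 fL] := locally_lipschitz_itv (`|x| + 1) lipf.
  have c : {for x, continuous (f \o clamp (`|x| + 1))}.
    apply: (@lipschitz_continuous_fun _ _ L) => a b /=.
    have m0 : 0 <= `|x| + 1 by rewrite addr_ge0.
    have [H1 H2] := clamp_lipschitz a b m0; have [_ H3] := clamp_lipschitz b b m0.
    by apply: le_trans (fL _ _ H2 H3) _; rewrite ler_wpM2l// ltW.
  apply/cvgrPdist_le => e e0; have /cvgrPdist_le/(_ e e0) := c.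
  have : \forall y \near x, - (`|x| + 1) < y < `|x| + 1.
    by apply: (near_in_itvoo (a := - (`|x| + 1)) (b := `|x| + 1)); rewrite in_itv/= -ltr_norml ltrDl.
  apply: filterS2 => y /andP[y1 y2] /=.
  have cx : clamp (`|x| + 1) x = x by rewrite /clamp clamp_id// lerDl.
  have cy : clamp (`|x| + 1) y = y by rewrite /clamp clamp_id// ler_norml !ltW.
  by rewrite cx cy.
have mf : measurable_fun [set: measurableTypeR R] f by exact: continuous_measurable_fun.
have mh0 : measurable_fun [set: measurableTypeR R] h0.
  apply: measurableT_comp => //; apply: measurable_fun_limn_esup => k.
  apply/measurable_EFinP; apply: measurable_funM => //; apply: measurable_funB => //.
  by apply: (measurableT_comp mf); exact: measurable_funD.
have h0E x : derivable f x 1 -> h0 x = derive1 f x.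
  move=> df; have c : dq k x @[k --> \oo] --> (derive1 f x)%:E.
    apply: cvg_EFin; first exact: nearW.
    have H : (fun k : nat => k.+1%:R^-1 : R) @ \oo --> (0 : R)^'.
      move=> P /= [e /= e0 eP]; have := near_infty_natSinv_lt (PosNum e0).
      apply: filterS => k ke; apply: eP => /=; last by rewrite invr_eq0 pnatr_eq0.
      by rewrite sub0r normrN gtr0_norm ?invr_gt0.
    have d : t^-1 *: (f (t *: 1 + x) - f x) @[t --> (0:R)^'] --> derive1 f x.
      by rewrite derive1E; exact: df.
    have := cvg_comp _ _ H d; apply: cvg_trans; apply: near_eq_cvg; apply: nearW => k /=.
    by rewrite invrK [x + _]addrC /GRing.scale/= mulr1.
  by rewrite /h0 is_cvg_limn_esupE; [rewrite (cvg_lim _ c)|exact: cvgP c].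
(* The cut makes the bound by [w] hold everywhere; as [f] is differentiable a.e., the hypothesis on
   [w] shows that it changes [h0] only on a null set. *)
pose h x := if `|h0 x| <= w `|x| then h0 x else 0.
have mh : measurable_fun [set: measurableTypeR R] h.
  apply: measurable_fun_if => //.
  - apply: measurable_fun_ler; first exact: measurableT_comp.
    by apply: (measurableT_comp (f := w)) => //; exact: measurableT_comp.
  - exact: measurable_funTS.
have hw x : `|h x| <= w `|x| by rewrite /h; case: ifP => // _; rewrite normr0 w0.
exists h; split => // m s sm.
have bt : bounded_measurable (truncated m h : measurableTypeR R -> R).
  split; last by exists (w `|m|) => t; have [] := truncated_le m hw wmon.
  by apply: measurable_funM => //; exact: measurable_indic.
pose k := (Num.truncn m).+1.
have mk : m < k.+1%:R by rewrite (lt_le_trans (truncnS_gt m))// ler_nat.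
have [mhk ihk hkE hkd] := h_P k.
have ae_eqh : {ae leb, forall t : R, `|t| <= m -> truncated m h t = h_ k t}.
  apply: filterS2 hkd fw => t Ht fwt tm; have tmk : `|t| < k.+1%:R := le_lt_trans tm mk.
  rewrite ltr_norml in tmk; have [d1 d2] := Ht tmk.
  rewrite /truncated indicE mem_set ?mulr1; last by rewrite /= in_itv/= -ler_norml.
  by rewrite /h h0E// fwt// d2.
have key a b : - m <= a -> a <= b -> b <= m -> prim (truncated m h) b - prim (truncated m h) a = f b - f a.
  move=> ma ab bm; rewrite prim_itv// hkE//; last 2 first.
  - by rewrite (le_trans _ ma)// lerN2 ltW.
  - exact: le_trans (ltW mk).
  rewrite /Rintegral; congr fine; apply: ae_eq_integral => //.
  - by apply/measurable_EFinP; apply: measurable_funTS; case: bt.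
  - by apply/measurable_EFinP; exact: measurable_funTS.
  apply: filterS ae_eqh => t Ht /=; rewrite in_itv/= => /andP[at_ tb]; rewrite Ht//.
  by rewrite ler_norml (le_trans ma (ltW at_)) (le_trans tb).
move: sm; rewrite ler_norml => /andP[s1 s2].
have [s0|/ltW s0] := leP 0 s.
  have m0 : - m <= 0 by rewrite oppr_le0 (le_trans s0 s2).
  by have := key 0 s m0 s0 s2; rewrite prim0 f0 !subr0 => ->.
have m0 : 0 <= m by rewrite -oppr_le0 (le_trans s1 s0).
by have := key s 0 s1 s0 m0; rewrite prim0 f0 !sub0r => H; apply: oppr_inj; rewrite H.
Qed.

End lipschitz_primitive.

(** * Borel representatives of Sobolev functions *)

Lemma negligible_bigcup_countable d (T : measurableType d) (R : realType) (mu : {measure set T -> \bar R})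
    (I : countType) (N : I -> set T) : (forall i, mu.-negligible (N i)) -> mu.-negligible (\bigcup_i N i).
Proof.
move=> HN; pose N_ k := if unpickle k is Some i then N i else set0.
apply: (@negligibleS _ _ _ _ (\bigcup_k N_ k)).
  by move=> x [i _ Nx]; exists (pickle i) => //; rewrite /N_ pickleK.
by apply: negligible_bigcup => k; rewrite /N_; case: unpickle => [i|]; [exact: HN|exact: negligible_set0].
Qed.

Section borel_hull.
Context d (T : measurableType d) (R : realType) (mu : {sigma_finite_measure set T -> \bar R}).
Local Notation cT := (caratheodory_type (mu^*)%mu).

Lemma outer_lt_cover X c : ((mu^*)%mu X < c)%E -> exists U, [/\ measurable U, X `<=` U & (mu U < c)%E].
Proof.
move=> /ereal_inf_lt[_ [F [mF XF] <-] Fc]; exists (\bigcup_k F k); split => //.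
  exact: bigcupT_measurable.
apply: le_lt_trans Fc; apply: measure_sigma_subadditive => //.
exact: bigcupT_measurable.
Qed.

Lemma outer_hull X : ((mu^*)%mu X < +oo)%E ->
  exists B, [/\ measurable B, X `<=` B & mu B = (mu^*)%mu X].
Proof.
move=> Xoo; have X0 : (0 <= (mu^*)%mu X)%E by exact: outer_measure_ge0.
have Xfin : (mu^*)%mu X \is a fin_num by rewrite ge0_fin_numE.
have H k : exists U, [/\ measurable U, X `<=` U & (mu U < (mu^*)%mu X + (k.+1%:R^-1)%:E)%E].
  by apply: outer_lt_cover; rewrite lteDl// lte_fin invr_gt0.
pose U k := projT1 (cid (H k)).
have UP k : [/\ measurable (U k), X `<=` U k & (mu (U k) < (mu^*)%mu X + (k.+1%:R^-1)%:E)%E].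
  exact: (projT2 (cid (H k))).
exists (\bigcap_k U k); split.
- by apply: bigcapT_measurable => k; case: (UP k).
- by move=> x Xx k _; case: (UP k) => _ + _; apply.
apply/eqP; rewrite eq_le; apply/andP; split; last first.
  rewrite -[leRHS](measurable_mu_extE mu); last by apply: bigcapT_measurable => k; case: (UP k).
  by apply: le_outer_measure => x Xx k _; case: (UP k) => _ + _; apply.
apply/lee_addgt0Pr => e e0; have [K _ KP] := near_infty_natSinv_lt (PosNum e0).
have /= Ke := KP K (leqnn K).
apply: (@le_trans _ _ (mu (U K))).
  apply: le_measure; rewrite ?inE//; [|by case: (UP K)|by move=> x /(_ K I)].
  by apply: bigcapT_measurable => k; case: (UP k).
have [_ _ /ltW UK] := UP K; apply: le_trans UK _.
by rewrite leeD2l// lee_fin ltW.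
Qed.

(** On each piece of finite measure a Borel hull exceeds [E] by a set of outer measure 0, because
    [E] is Caratheodory measurable; a second hull encloses this excess in a Borel null set. *)
Lemma caratheodory_borel (E : set cT) : measurable E ->
  exists B N : set T, [/\ measurable B, measurable N, mu N = 0%E & forall x, ~ N x -> (E x <-> B x)].
Proof.
move=> mE; have [S ST mS] := sigma_finiteT mu.
pose M := @completed_measure_extension _ _ _ mu.
have cmeas (B : set T) : measurable B -> measurable (B : set cT).
  by move=> mB; apply: sub_caratheodory; exact: sub_sigma_algebra.
have H j : exists B N : set T, [/\ measurable B, measurable N, mu N = 0%E, E `&` S j `<=` B & B `\` (E `&` S j) `<=` N].
  have [mSj Sjoo] := mS j.
  have mEj : measurable (E `&` S j : set cT) by apply: measurableI => //; exact: cmeas.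
  have Ejoo : ((mu^*)%mu (E `&` S j) < +oo)%E.
    by apply: le_lt_trans Sjoo; rewrite -[leRHS](measurable_mu_extE mu)//; apply: le_outer_measure => x [].
  have [B [mB EB muB]] := outer_hull Ejoo.
  have D0 : (mu^*)%mu (B `\` (E `&` S j)) = 0%E.
    have MB : M B = (mu^*)%mu (E `&` S j) by rewrite -muB; exact: measurable_mu_extE.
    have MBoo : (M B < +oo)%E by rewrite MB.
    apply: (etrans (@measureD _ cT R M B (E `&` S j) (cmeas _ mB) mEj MBoo)); rewrite (setIidr EB).
    apply: (etrans (congr2 (fun a b => a - b)%E MB (erefl ((mu^*)%mu (E `&` S j))))).
    by rewrite subee// ge0_fin_numE//; exact: outer_measure_ge0.
  have D0oo : ((mu^*)%mu (B `\` (E `&` S j)) < +oo)%E by rewrite D0 ltry.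
  have [N [mN DN N0]] := outer_hull D0oo.
  by exists B, N; split => //; rewrite N0.
pose B j := projT1 (cid (H j)); pose N j := projT1 (cid (projT2 (cid (H j)))).
have BN j : [/\ measurable (B j), measurable (N j), mu (N j) = 0%E, E `&` S j `<=` B j & B j `\` (E `&` S j) `<=` N j].
  exact: (projT2 (cid (projT2 (cid (H j))))).
exists (\bigcup_j B j), (\bigcup_j N j); split.
- by apply: bigcupT_measurable => j; case: (BN j).
- by apply: bigcupT_measurable => j; case: (BN j).
- apply/negligibleP; first by apply: bigcupT_measurable => j; case: (BN j).
  by apply: negligible_bigcup_countable => j; have [_ mNj Nj0 _ _] := BN j; apply/negligibleP.
move=> x Nx; split.
  move=> Ex; have : [set: T] x by []. 
  by rewrite ST => -[j _ Sx]; exists j => //; case: (BN j) => _ _ _ + _; apply.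
move=> [j _ Bx]; apply: contrapT => Ex; apply: Nx; exists j => //.
by case: (BN j) => _ _ _ _; apply; split => // -[].
Qed.

(** The sublevel sets at rational levels are Borel up to null sets; discarding the countable union
    of these null sets makes all of them Borel at once. *)
Lemma borel_representative (O : set T) (u : T -> R) : measurable O ->
  measurable_fun (O : set cT) (u : cT -> R) ->
  exists (v : T -> R) (N : set T), [/\ measurable_fun [set: T] v, measurable N, mu N = 0%E,
    forall x, O x -> ~ N x -> u x = v x & forall x, ~ O x -> v x = 0].
Proof.
move=> mO mu_.
have cmeas (B : set T) : measurable B -> measurable (B : set cT).
  by move=> mB; apply: sub_caratheodory; exact: sub_sigma_algebra.
have H (q : rat) : exists B N : set T, [/\ measurable B, measurable N, mu N = 0%E &
    forall x, ~ N x -> ((O `&` u @^-1` `]-oo, ratr q[) x <-> B x)].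
  by apply: caratheodory_borel; exact: mu_ (cmeas _ mO) _ (measurable_itv _).
pose B q := projT1 (cid (H q)); pose N q := projT1 (cid (projT2 (cid (H q)))).
have BN q : [/\ measurable (B q), measurable (N q), mu (N q) = 0%E &
    forall x, ~ N q x -> ((O `&` u @^-1` `]-oo, ratr q[) x <-> B q x)].
  exact: (projT2 (cid (projT2 (cid (H q))))).
pose N' := \bigcup_q N q.
have mN' : measurable N' by apply: bigcupT_measurable_rat => q; case: (BN q).
have N0 : mu N' = 0%E.
  apply/negligibleP => //; apply: negligible_bigcup_countable => q.
  by have [_ mNq Nq0 _] := BN q; apply/negligibleP.
exists (fun x => u x * \1_(O `\` N') x), N'; split => //; last 2 first.
- by move=> x Ox Nx; rewrite indicE mem_set// mulr1.
- by move=> x Ox; rewrite indicE memNset ?mulr0// => -[].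
pose Z := O `\` N'.
have mZ : measurable Z by exact: measurableD.
(* The sublevel set of the modified function: off [Z] its value is 0, so those points belong exactly
   when [q] is positive. *)
pose W (q : rat) := (B q `&` Z) `|` (if 0 < ratr q :> R then ~` Z else set0).
have mW q : measurable (W q).
  apply: measurableU; first by apply: measurableI => //; case: (BN q).
  by case: ifP => _ //; exact: measurableC.
have WE q x : W q x <-> u x * \1_Z x < ratr q.
  rewrite /W indicE; have [Zx|Zx] := pselect (Z x).
    rewrite mem_set// mulr1; have [Ox Nx] := Zx.
    have Nq : ~ N q x by move=> Nq; apply: Nx; exists q.
    have [_ _ _ /(_ x Nq) /= H1] := BN q; rewrite in_itv/= in H1.
    split; first by case => [[/H1[]]|]//; case: ifP.
    by move=> uq; left; split => //; apply/H1.
  rewrite memNset// mulr0; split; first by case => [[]|]//; case: ifP.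
  by move=> q0; right; rewrite q0.
apply: (@measurability _ _ T (measurableTypeR R) setT _ _ (RGenInftyO.measurableE R)) => _ [_ [a ->] <-]; rewrite setTI.
rewrite (_ : _ @^-1` _ = \bigcup_q (if ratr q <= a then W q else set0)).
  by apply: bigcupT_measurable_rat => q; case: ifP.
apply/seteqP; split => [x /=|x [q _]].
  rewrite in_itv/= => /rat_in_itvoo[q]; rewrite in_itv/= => /andP[uq qa]; exists q => //.
  by rewrite (ltW qa); apply/WE.
by case: ifP => // qa /WE uq; rewrite /= in_itv/= (lt_le_trans uq).
Qed.

End borel_hull.

Section transfer.
Context {R : realType} (n : nat).
Local Notation mu := (@borel_lebesgue R n).
Local Notation lmu := (lebesgueN R n).

Lemma measurable_lebesgueT (D : set 'rV[R]_n) : measurable D -> measurable (D : set (lebesgueT R n)).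
Proof. by move=> mD; apply: sub_caratheodory; exact: sub_sigma_algebra. Qed.

Lemma measurable_fun_lebesgueT d (Y : measurableType d) (D : set 'rV[R]_n) (g : 'rV[R]_n -> Y) :
  measurable_fun [set: 'rV[R]_n] g -> measurable_fun (D : set (lebesgueT R n)) (g : lebesgueT R n -> Y).
Proof.
move=> mg; apply: (@measurable_funTS _ _ (lebesgueT R n)) => _ B mB; rewrite setTI; apply: measurable_lebesgueT.
by rewrite -[X in measurable X]setTI; exact: mg.
Qed.

(** The identity, from Lebesgue measurable to Borel sets, is measurable and pushes one measure to
    the other. *)
Lemma integral_lebesgueN (D : set 'rV[R]_n) (g : 'rV[R]_n -> \bar R) : measurable D -> measurable_fun D g ->
  (\int[lmu]_(x in D) g x = \int[mu]_(x in D) g x)%E.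
Proof.
move=> mD mg.
have mid : measurable_fun [set: lebesgueT R n] (id : lebesgueT R n -> 'rV[R]_n).
  by move=> _ B mB; rewrite setTI; exact: measurable_lebesgueT.
have ge0 (f : 'rV[R]_n -> \bar R) : measurable_fun D f -> (forall x, D x -> (0 <= f x)%E) ->
    (\int[lmu]_(x in D) f x = \int[mu]_(x in D) f x)%E.
  move=> mf f0; rewrite -[LHS](@ge0_integral_pushforward _ _ (lebesgueT R n) 'rV[R]_n R id mid lmu D f mD)//.
    by apply: eq_measure_integral => B mB BD; exact: lebesgueN_borel.
  by move=> x; rewrite inE; exact: f0.
rewrite integralE [RHS]integralE ge0//; last exact: measurable_funepos.
by rewrite ge0//; exact: measurable_funeneg.
Qed.

Lemma ae_lebesgueN (P : 'rV[R]_n -> Prop) : {ae lmu, forall x, P x} <-> {ae mu, forall x, P x}.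
Proof.
split=> -[A [mA A0 PA]].
  have Aoo : (((borel_lebesgue n)^*)%mu A < +oo)%E by rewrite -[X in (X < _)%E]/(lmu A) A0 ltry.
  have [B [mB AB B0]] := outer_hull Aoo; exists B; split => //.
    by rewrite B0.
  exact: subset_trans AB.
exists A; split => //; first exact: measurable_lebesgueT.
by rewrite lebesgueN_borel.
Qed.

End transfer.

Lemma ae_forall_countable d (T : measurableType d) (R : realType) (mu : {measure set T -> \bar R})
    (I : countType) (Q : I -> T -> Prop) :
  (forall i, {ae mu, forall x, Q i x}) -> {ae mu, forall x, forall i, Q i x}.
Proof.
move=> HQ; have : {ae mu, forall x, forall k : nat, if unpickle k is Some i then Q i x else True}.
  by apply: ae_foralln => k; case: unpickle => [i|]; [exact: HQ|exact: aeW].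
by apply: filterS => x H i; have := H (pickle i); rewrite pickleK.
Qed.

#[global] Instance ae_lebesgueN_filter (R : realType) n :
  Filter (nbhs (almost_everywhere (lebesgueN R n))) := ae_filter_ringOfSetsType _.

Section weak_gradients.
Context {R : realType} (n : nat).
Local Notation mu := (@borel_lebesgue R n).
Local Notation lmu := (lebesgueN R n).
Implicit Types (O K : set 'rV[R]_n) (u v : 'rV[R]_n -> R) (G : 'rV[R]_n -> 'rV[R]_n).

Lemma lebesgue_borel_representative O u : open O -> lebesgue_measurable O u ->
  exists v, [/\ measurable_fun setT v, {ae mu, forall x, O x -> u x = v x} & forall x, ~ O x -> v x = 0].
Proof.
move=> oO /(borel_representative (mu := mu) (open_measurable_rV oO))[v [N [mv mN N0 uv v0]]].
exists v; split => //; exists N; split => // x /= H; apply: contrapT => Nx; apply: H => Ox; exact: uv.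
Qed.

Lemma integral_ae_lebesgueN O D (p q : 'rV[R]_n -> \bar R) : measurable D -> D `<=` O ->
  measurable_fun (D : set (lebesgueT R n)) (p : lebesgueT R n -> \bar R) ->
  measurable_fun setT q -> {ae mu, forall x, O x -> p x = q x} ->
  (\int[lmu]_(x in D) p x = \int[mu]_(x in D) q x)%E.
Proof.
move=> mD DO mp mq pq; rewrite -(integral_lebesgueN (g := q)) //; last exact: measurable_funTS.
apply: ae_eq_integral => //.
- exact: measurable_lebesgueT.
- exact: measurable_fun_lebesgueT.
by move/ae_lebesgueN : pq; apply: filterS => x H Dx; exact/H/DO.
Qed.

Lemma integral_norm_lebesgueN O D u v : measurable D -> D `<=` O ->
  measurable_fun (D : set (lebesgueT R n)) (u : lebesgueT R n -> R) ->
  measurable_fun setT v -> {ae mu, forall x, O x -> u x = v x} ->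
  (\int[lmu]_(x in D) `|(u x)%:E| = \int[mu]_(x in D) `|(v x)%:E|)%E.
Proof.
move=> mD DO mu_ mv uv.
have mp : measurable_fun (D : set (lebesgueT R n)) (fun x : lebesgueT R n => `|(u x)%:E|%E).
  exact: (measurableT_comp (@abse_measurable R setT) (iffRL (measurable_EFinP _ _) mu_)).
have mq : measurable_fun setT (fun x => `|(v x)%:E|%E).
  exact: (measurableT_comp (@abse_measurable R setT) (iffRL (measurable_EFinP _ _) mv)).
have pq : {ae mu, forall x, O x -> `|(u x)%:E|%E = `|(v x)%:E|%E} by apply: filterS uv => x H Ox; rewrite H.
exact: (integral_ae_lebesgueN mD DO mp mq pq).
Qed.

Lemma integral_mul_lebesgueN O u v (psi : 'rV[R]_n -> R) : measurable O -> lebesgue_measurable O u ->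
  measurable_fun setT v -> measurable_fun setT psi -> {ae mu, forall x, O x -> u x = v x} ->
  (\int[lmu]_(x in O) (u x * psi x)%:E = \int[mu]_(x in O) (v x * psi x)%:E)%E.
Proof.
move=> mO mu_ mv mpsi uv; have mpsiO := measurable_fun_lebesgueT (D := O) mpsi.
have mp : measurable_fun (O : set (lebesgueT R n)) (fun x : lebesgueT R n => (u x * psi x)%:E).
  exact: (iffRL (measurable_EFinP _ _) (measurable_funM mu_ mpsiO)).
have mq : measurable_fun setT (fun x => (v x * psi x)%:E).
  exact: (iffRL (measurable_EFinP _ _) (measurable_funM mv mpsi)).
have pq : {ae mu, forall x, O x -> (u x * psi x)%:E = (v x * psi x)%:E} by apply: filterS uv => x H Ox; rewrite H.
exact: (integral_ae_lebesgueN mO (fun x Ox => Ox) mp mq pq).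
Qed.

Lemma integrable_ae_lebesgueN O D u v : measurable D -> D `<=` O ->
  measurable_fun (D : set (lebesgueT R n)) (u : lebesgueT R n -> R) ->
  measurable_fun setT v -> {ae mu, forall x, O x -> u x = v x} ->
  lmu.-integrable D (EFin \o u) <-> mu.-integrable D (EFin \o v).
Proof.
move=> mD DO mu_ mv uv.
have E : (\int[lmu]_(x in D) `|(EFin \o u) x| = \int[mu]_(x in D) `|(EFin \o v) x|)%E.
  exact: (integral_norm_lebesgueN mD DO mu_ mv uv).
split=> /integrableP[m1 m2]; apply/integrableP; split.
- by apply/measurable_EFinP; exact: measurable_funTS.
- by rewrite -E.
- exact/measurable_EFinP.
- by rewrite E.
Qed.

Lemma integral_test_support O i phi (g : 'rV[R]_n -> R) : open O -> test_function O phi ->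
  (\int[mu]_(x in O) (g x * phi x)%:E = \int[mu]_x (g x * phi x)%:E)%E /\
  (\int[mu]_(x in O) (g x * partial i phi x)%:E = \int[mu]_x (g x * partial i phi x)%:E)%E.
Proof.
move=> oO tphi; have [K [M [[cK KO M0 phi0 phiM] _]]] := test_function_facts i tphi.
split; rewrite [LHS]integral_mkcond; apply: eq_integral => x _; rewrite patchE; case: (boolP (x \in O)) => // /negP Ox;
  have /phi0[p1 p2] : ~ K x by (move=> /KO Ox'; apply: Ox; rewrite inE).
  by rewrite p1 mulr0.
by rewrite p2 mulr0.
Qed.

Lemma weak_gradient_borel O u G : open O -> is_weak_gradient O u G ->
  exists v (H : 'I_n -> 'rV[R]_n -> R), (forall i, borel_weak O i v (H i)) /\
    {ae mu, forall x, O x -> u x = v x /\ forall i, G x 0 i = H i x}.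
Proof.
move=> oO [[mu_ lu] lG weak]; have mO := open_measurable_rV oO.
have [v [mv uv v0]] := lebesgue_borel_representative oO mu_.
have HG i : exists w, [/\ measurable_fun setT w, {ae mu, forall x, O x -> G x 0 i = w x} & forall x, ~ O x -> w x = 0].
  by apply: lebesgue_borel_representative => //; case: (lG i).
pose H i := projT1 (cid (HG i)).
have HP i : [/\ measurable_fun setT (H i), {ae mu, forall x, O x -> G x 0 i = H i x} & forall x, ~ O x -> H i x = 0].
  exact: (projT2 (cid (HG i))).
exists v, H; split; last first.
  have : {ae mu, forall x, forall i, O x -> G x 0 i = H i x}.
    have : forall s : seq 'I_n, {ae mu, forall x, forall i, i \in s -> O x -> G x 0 i = H i x}.
      elim=> [|j s ih]; first by apply: aeW.
      have [_ Hj _] := HP j; apply: filterS2 ih Hj => x H1 H2 i; rewrite inE => /orP[/eqP ->//|]; exact: H1.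
    by move=> /(_ (enum 'I_n)); apply: filterS => x Hx i; apply: Hx; rewrite mem_enum.
  by apply: filterS2 uv => x H1 H2 Ox; split; [exact: H1|move=> i; exact: H2].
move=> i; have [mH GH H0] := HP i; split => //.
- move=> K cK KO; have mK := compact_measurable_rV cK; apply/(integrable_ae_lebesgueN mK KO _ mv uv).
    exact: (measurable_funS (measurable_lebesgueT mO) KO).
  exact: lu.
- move=> K cK KO; have mK := compact_measurable_rV cK; have [mG lGi] := lG i.
  apply/(integrable_ae_lebesgueN mK KO _ mH GH).
    exact: (measurable_funS (measurable_lebesgueT mO) KO).
  exact: lGi.
move=> phi tphi.
have [K [M [[cK KO M0 phi0 phiM] [mphi mdphi]]]] := test_function_facts i tphi.
have [s1 _] := integral_test_support i (H i) oO tphi.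
have [_ s2] := integral_test_support i v oO tphi.
rewrite -s1 -s2.
have [mG _] := lG i.
rewrite -(integral_mul_lebesgueN mO mu_ mv mdphi uv) -(integral_mul_lebesgueN mO mG mH mphi GH).
exact: weak.
Qed.

Lemma borel_weak_gradient O u v (H : 'I_n -> 'rV[R]_n -> R) : open O -> lebesgue_measurable O u ->
  {ae mu, forall x, O x -> u x = v x} -> measurable_fun setT v -> (forall i, borel_weak O i v (H i)) ->
  (forall K, compact K -> K `<=` O -> mu.-integrable K (EFin \o v)) ->
  is_weak_gradient O u (fun x => \row_i H i x).
Proof.
move=> oO mu_ uv mv wv iv; have mO := open_measurable_rV oO.
have rowE i : (fun x : 'rV[R]_n => (\row_i H i x) 0 i) = H i by apply/funext => x; rewrite mxE.
split.
- split => // K cK KO; have mK := compact_measurable_rV cK; apply/(integrable_ae_lebesgueN mK KO _ mv uv).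
    exact: (measurable_funS (measurable_lebesgueT mO) KO).
  exact: iv.
- move=> i; rewrite rowE; have [_ mH _ iH _] := wv i; split; first exact: measurable_fun_lebesgueT.
  move=> K cK KO; have mK := compact_measurable_rV cK; apply/(integrable_ae_lebesgueN mK KO (v := H i)) => //.
    exact: measurable_fun_lebesgueT.
  + by apply: aeW.
  exact: iH.
move=> i phi tphi; have [_ mH _ _ weak] := wv i.
have [K [M [[cK KO M0 phi0 phiM] [mphi mdphi]]]] := test_function_facts i tphi.
have [s1 _] := integral_test_support i (H i) oO tphi.
have [_ s2] := integral_test_support i v oO tphi.
rewrite (integral_mul_lebesgueN mO mu_ mv mdphi uv).
under [X in _ = (- X)%E]eq_integral do rewrite mxE.
rewrite integral_lebesgueN//; last by apply: measurable_funTS; apply/measurable_EFinP; exact: measurable_funM.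
by rewrite s1 s2; exact: weak.
Qed.

(** [test_ae0] is applied on the countably many rational cubes whose triples lie in [O]; cutting off
    to a triple makes the difference integrable. *)
Lemma weak_derivative_unique O i v (H1 H2 : 'rV[R]_n -> R) : open O ->
  borel_weak O i v H1 -> borel_weak O i v H2 -> {ae mu, forall x, O x -> H1 x = H2 x}.
Proof.
move=> oO w1 w2; have [mv m1 iv i1 weak1] := w1; have [_ m2 _ i2 weak2] := w2.
have cube (p : 'rV[rat]_n * nat) : ccube (@qcenter R n p) (3 * @qradius R n p) `<=` O ->
    {ae mu, forall x, ball (@qcenter R n p) (@qradius R n p) x -> H1 x = H2 x}.
  move=> pO; have r0 := @qradius_gt0 R n p; set c := @qcenter R n p; set r := @qradius R n p.
  pose K := ccube c (3 * r); have cK : compact K by exact: compact_ccube.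
  have mK := compact_measurable_rV cK.
  have j1 := integrable_cut mK m1 (i1 K cK pO); have j2 := integrable_cut mK m2 (i2 K cK pO).
  have j12 : mu.-integrable setT (EFin \o (fun x => cutoff K H1 x - cutoff K H2 x)).
    exact: (integrableB measurableT j1 j2).
  have sub : [set x : 'rV[R]_n | forall j, `[c 0 j - r, c 0 j + r]%classic (x 0 j)] `<=` K.
    move=> x /= H j; have := H j; rewrite in_itv/= ler_norml -/r => /andP[? ?].
    by have r0' : 0 < r := r0; apply/andP; split; lra.
  have := test_ae0 j12 sub; have H3 : forall phi, test_function K phi ->
      (\int[mu]_x ((cutoff K H1 x - cutoff K H2 x) * phi x)%:E = 0)%E.
    move=> phi tphi.
    have [C [M [[_ _ M0 _ phiM] [mphi _]]]] := test_function_facts i tphi.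
    have e1 := borel_weak_cut w1 (fun x h => h) pO tphi.
    have e2 := borel_weak_cut w2 (fun x h => h) pO tphi.
    have e12 : (\int[mu]_x (cutoff K H1 x * phi x)%:E = \int[mu]_x (cutoff K H2 x * phi x)%:E)%E.
      by apply/eqP; rewrite -eqe_opp -e1 e2.
    have k1 := integrable_mul_bounded measurableT j1 mphi (fun x _ => (phiM x).1).
    have k2 := integrable_mul_bounded measurableT j2 mphi (fun x _ => (phiM x).1).
    under eq_integral do rewrite mulrBl EFinB.
    by rewrite integralB// e12 subee// integrable_fin_num.
  move=> /(_ H3); apply: filterS => x Hx bx.
  have Kx : K x by move=> j; move/(ball_rV _ _ r0) : bx => /(_ j); have r0' : 0 < r := r0; rewrite -/c -/r; lra.
  have := Hx _; rewrite !cutoffE// => Hx'; apply/eqP; rewrite -subr_eq0; apply/eqP; apply: Hx' => j.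
  by move/(ball_rV _ _ r0) : bx => /(_ j); rewrite -/c -/r /= in_itv/= ltr_norml => /andP[? ?]; apply/andP; split; lra.
have : {ae mu, forall x, forall p : 'rV[rat]_n * nat, ccube (@qcenter R n p) (3 * @qradius R n p) `<=` O ->
    ball (@qcenter R n p) (@qradius R n p) x -> H1 x = H2 x}.
  apply: ae_forall_countable => p; have [pO|npO] := pselect (ccube (@qcenter R n p) (3 * @qradius R n p) `<=` O).
    by apply: filterS (cube p pO) => x H _.
  by apply: aeW.
apply: filterS => x Hx Ox; have [p [px pO]] := qcube_cover oO Ox; exact: (Hx p).
Qed.

End weak_gradients.

(** * A weak-type Sobolev inequality *)

Lemma measure_integral_indic d (T : measurableType d) (R : realType) (mu : {measure set T -> \bar R}) A :
  measurable A -> (mu A = \int[mu]_x (\1_A x)%:E)%E.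
Proof. by move=> mA; rewrite integral_indic// setIT. Qed.

Section loomis_whitney.
Context {R : realType}.
Local Notation leb := (@lebesgue_measure R).

Lemma rV_cons0 n (t : R) (y : 'rV[R]_n) : rV_cons (t, y) 0 ord0 = t.
Proof. by have /(congr1 fst) := rV_consK (t, y). Qed.

Lemma rV_consS n (t : R) (y : 'rV[R]_n) j : rV_cons (t, y) 0 (lift ord0 j) = y 0 j.
Proof. by have /(congr1 snd)/rowP/(_ j) := rV_consK (t, y); rewrite mxE. Qed.

Lemma shift_coord n (x : 'rV[R]_n) (r : R) i k :
  (x + r *: delta_mx 0 i) 0 k = x 0 k + r * (k == i)%:R.
Proof. by rewrite mxE [X in _ + X]mxE [X in _ * X]mxE eqxx. Qed.

Lemma rV_cons_shift0 n (t r : R) (y : 'rV[R]_n) :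
  rV_cons (t, y) + r *: delta_mx 0 ord0 = rV_cons (t + r, y).
Proof.
apply/rowP => k; rewrite shift_coord; case: (unliftP ord0 k) => [j|] ->.
  by rewrite !rV_consS -[lift _ _ == _]/(false) mulr0 addr0.
by rewrite !rV_cons0 eqxx mulr1.
Qed.

Lemma rV_cons_shiftS n (t r : R) (y : 'rV[R]_n) i :
  rV_cons (t, y) + r *: delta_mx 0 (lift ord0 i) = rV_cons (t, y + r *: delta_mx 0 i).
Proof.
apply/rowP => k; rewrite shift_coord; case: (unliftP ord0 k) => [j|] ->.
  by rewrite !rV_consS shift_coord (inj_eq lift_inj).
by rewrite !rV_cons0 -[ord0 == lift _ _]/(false) mulr0 addr0.
Qed.

Lemma ge0_integral_cons n (f : 'rV[R]_n.+1 -> \bar R) : measurable_fun setT f -> (forall x, (0 <= f x)%E) ->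
  (\int[borel_lebesgue n.+1]_x f x = \int[leb]_t \int[borel_lebesgue n]_y f (rV_cons (t, y)))%E.
Proof.
move=> mf f0.
transitivity (\int[pushforward (leb \x borel_lebesgue n)%E (@rV_cons R n)]_x f x)%E.
  by apply: eq_measure_integral => [|? B mB _]; [exact: measurable_rV_cons|exact: erefl].
rewrite ge0_integral_pushforward//; last exact: measurable_rV_cons.
rewrite preimage_setT fubini_tonelli1//; last by move=> p; exact: f0.
by apply: (measurableT_comp mf); exact: measurable_rV_cons.
Qed.

Lemma prod_le_avg_expn n (a : 'I_n.+1 -> R) : (forall i, 0 <= a i) ->
  \prod_i a i <= ((\sum_i a i) / n.+1%:R) ^+ n.+1.
Proof.
move=> a0; have [H _] := @leif_AGM R _ predT a (fun i _ => a0 i).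
by rewrite card_ord in H; exact: H.
Qed.

(* Each line through a point of [E] parallel to a coordinate axis carries [g]-mass at least 1;
   this replaces the projections of [E] in the classical inequality. *)
Lemma loomis_whitney n (E : set 'rV[R]_n.+1) (g : 'I_n.+1 -> 'rV[R]_n.+1 -> \bar R) (c : 'I_n.+1 -> R) :
  measurable E -> (forall i, measurable_fun setT (g i)) -> (forall i x, (0 <= g i x)%E) ->
  (forall i, 0 < c i) -> (forall i, \int[borel_lebesgue n.+1]_x g i x <= (c i)%:E)%E ->
  (forall x, E x -> forall i, 1 <= \int[leb]_r g i (x + r *: delta_mx 0 i)%R)%E ->
  E !=set0 -> forall m, 0 <= m -> (m%:E <= borel_lebesgue n.+1 E)%E -> m ^+ n <= \prod_i c i.
Proof.
elim: n E g c => [|n ih] E g c mE mg g0 c0 gc line [x0 Ex0] m m0 mE_le.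
  (* In dimension one the left side is 1, and the line through any point of [E] carries the whole
     integral of [g]. *)
  rewrite expr0 big_ord1 -lee_fin; apply: le_trans (line x0 Ex0 0) _; apply: le_trans (gc 0).
  have x0E : x0 = rV_cons (x0 0 0, 0 : 'rV[R]_0).
    apply/rowP => k; case: (unliftP ord0 k) => [[]//|] ->; by rewrite rV_cons0.
  rewrite ge0_integral_cons//=.
  under [leRHS]eq_integral => t _.
    rewrite integral_dirac//; last first.
      by apply: (measurableT_comp (mg 0)); apply: (measurableT_comp (measurable_rV_cons (n := 0))); exact: measurable_pair1.
    rewrite diracT mul1e; over.
  have shE r : x0 + r *: delta_mx 0 0 = rV_cons (x0 0 0 + r, 0) by rewrite [in LHS]x0E; exact: rV_cons_shift0.
  have -> : (\int[leb]_r g 0%R (x0 + r *: delta_mx 0 0)%R = \int[leb]_r g 0%R (rV_cons (x0 0 0 + r, 0))%R)%E.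
    by apply: eq_integral => r _; congr (g 0 _); exact: shE.
  have mgc : measurable_fun [set: measurableTypeR R] (fun t : R => g 0 (rV_cons (t, 0 : 'rV[R]_0))).
    by apply: (measurableT_comp (mg 0)); apply: (measurableT_comp (measurable_rV_cons (n := 0))); exact: measurable_pair2.
  rewrite -(ge0_integral_addl (x0 0 0) mgc)//.
pose Et t := [set y | E (rV_cons (t, y))].
have mcons2 t : measurable_fun setT (fun y : 'rV[R]_n.+1 => rV_cons (t, y)).
  by apply: (measurableT_comp (measurable_rV_cons (n := n.+1))); exact: measurable_pair1.
have mcons1 y : measurable_fun [set: measurableTypeR R] (fun t : R => rV_cons (t, y : 'rV[R]_n.+1)).
  by apply: (measurableT_comp (measurable_rV_cons (n := n.+1))); exact: measurable_pair2.
have mEt t : measurable (Et t).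
  by rewrite -[Et t]setTI; exact: mcons2.
(* The mass of the slice at height [t], for the coordinate directions within the slice. *)
pose gam i t := (\int[borel_lebesgue n.+1]_y g (lift ord0 i) (rV_cons (t, y)))%E.
have mgam i : measurable_fun [set: measurableTypeR R] (gam i).
  pose Fi := fun p : measurableTypeR R * 'rV[R]_n.+1 => g (lift ord0 i) (rV_cons p).
  rewrite -[X in measurable_fun _ X]/(fubini_F (borel_lebesgue n.+1) Fi).
  apply: measurable_fun_fubini_tonelli_F => [|p]; last exact: g0.
  by apply: (measurableT_comp (mg _)); exact: measurable_rV_cons.
have gam0 i t : (0 <= gam i t)%E by exact: integral_ge0.
have gamc i : (\int[leb]_t gam i t <= (c (lift ord0 i))%:E)%E.
  by rewrite /gam -ge0_integral_cons.
have gamoo : {ae leb, forall t, forall i, (gam i t < +oo)%E}.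
  apply: (@ae_forall_countable _ (measurableTypeR R) R leb 'I_n.+1 (fun i t => (gam i t < +oo)%E)) => i.
  have igam : leb.-integrable setT (gam i).
    apply/integrableP; split => //; under eq_integral do rewrite gee0_abs//.
    by rewrite (le_lt_trans (gamc i))// ltry.
  by apply: filterS (integrable_ae measurableT igam) => t /(_ I); rewrite ge0_fin_numE.
(* Lines in the first direction through points of the slice each carry mass at least 1, so the slice
   has measure at most the total mass of [g ord0]. *)
have Ec0 t : (borel_lebesgue n.+1 (Et t) <= (c ord0)%:E)%E.
  apply: le_trans (gc ord0); rewrite ge0_integral_cons//.
  have -> : (\int[leb]_t \int[borel_lebesgue n.+1]_y g ord0 (rV_cons (t, y)) =
      \int[borel_lebesgue n.+1]_y \int[leb]_t g ord0 (rV_cons (t, y)))%E.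
    apply: (fubini_tonelli (fun p : measurableTypeR R * 'rV[R]_n.+1 => g ord0 (rV_cons p))) => //.
    by apply: (measurableT_comp (mg _)); exact: measurable_rV_cons.
  rewrite measure_integral_indic//; apply: ge0_le_integral => //.
  - by apply/measurable_EFinP; exact: measurable_indic.
  - pose F0 := fun p : measurableTypeR R * 'rV[R]_n.+1 => g ord0 (rV_cons p).
    rewrite -[X in measurable_fun _ X]/(fubini_G leb F0).
    apply: measurable_fun_fubini_tonelli_G => [|p]; last exact: g0.
    by apply: (measurableT_comp (mg _)); exact: measurable_rV_cons.
  move=> y _; rewrite indicE; have [Ey|Ey] := pselect (Et t y); last first.
    by rewrite memNset//; exact: integral_ge0.
  rewrite mem_set//; apply: le_trans (line _ Ey ord0) _.
  under eq_integral do rewrite rV_cons_shift0.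
  have mgc : measurable_fun [set: measurableTypeR R] (fun t : R => g ord0 (rV_cons (t, y))) by exact: (measurableT_comp (mg _)).
  by rewrite -(ge0_integral_addl t mgc).
pose P := \prod_i c i.
have P0 : 0 < P by apply: prodr_gt0.
pose K := P `^ (n.+1%:R^-1).
have K0 : 0 < K by exact: powR_gt0.
have KP : K ^+ n.+1 = P.
  by rewrite -powR_mulrn ?powR_ge0// -powRrM mulVf ?pnatr_eq0// powRr1// ltW.
pose S t := (\sum_i (gam i t * ((c (lift ord0 i))^-1)%:E))%E.
(* Induction bounds [mt ^+ n] by the product of the [gam i t], and [Ec0] supplies one more factor.
   The arithmetic-geometric mean inequality linearises the resulting geometric mean, normalised by
   the [c i], so that it can be integrated term by term. *)
have main : {ae leb, forall t, borel_lebesgue n.+1 (Et t) <= (K / n.+1%:R)%:E * S t}%E.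
  apply: filterS gamoo => t goo.
  have gE i : gam i t = (fine (gam i t))%:E by rewrite fineK// ge0_fin_numE.
  pose a i := fine (gam i t); have a0 i : 0 <= a i by exact: fine_ge0.
  have -> : S t = (\sum_i a i / c (lift ord0 i))%:E.
    by rewrite /S -sumEFin; apply: eq_bigr => i _; rewrite gE -EFinM.
  have E1 : borel_lebesgue n.+1 (Et t) = (fine (borel_lebesgue n.+1 (Et t)))%:E.
    by rewrite fineK// ge0_fin_numE// (le_lt_trans (Ec0 t))// ltry.
  pose mt := fine (borel_lebesgue n.+1 (Et t)).
  have mt0 : 0 <= mt by exact: fine_ge0.
  rewrite E1 -EFinM lee_fin -/mt.
  have [Et0|Et0] := eqVneq (Et t) set0.
    rewrite /mt Et0 measure0/=; apply: mulr_ge0; first by rewrite divr_ge0// ltW.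
    by apply: sumr_ge0 => i _; rewrite divr_ge0// ltW.
  have mtc : mt <= c ord0 by rewrite -lee_fin /mt -E1.
  (* The induction hypothesis asks for positive bounds, while the mass of a slice may vanish; [e] is
     removed at the end. *)
  have eps_bound e : 0 < e -> mt <= K * ((\sum_i (a i / c (lift ord0 i) + e)) / n.+1%:R).
    move=> e0.
    have H : mt ^+ n <= \prod_i (a i + e * c (lift ord0 i)).
      apply: (ih (Et t) (fun i y => g (lift ord0 i) (rV_cons (t, y)))) => //.
      - by move=> i; exact: (measurableT_comp (mg _)).
      - by move=> i; rewrite ltr_wpDl// mulr_gt0.
      - by move=> i; rewrite -/(gam i t) gE lee_fin lerDl mulr_ge0// ltW.
      - move=> y Ey i; have := line _ Ey (lift ord0 i).
        by under eq_integral do rewrite rV_cons_shiftS.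
      - by apply/set0P.
      - by rewrite /mt -E1.
    have H2 : mt ^+ n.+1 <= (K * ((\sum_i (a i / c (lift ord0 i) + e)) / n.+1%:R)) ^+ n.+1.
      rewrite exprMn KP exprS; apply: (@le_trans _ _ (c ord0 * \prod_i (a i + e * c (lift ord0 i)))).
        by apply: ler_pM => //; exact: exprn_ge0.
      have -> : c ord0 * \prod_i (a i + e * c (lift ord0 i)) = P * \prod_i (a i / c (lift ord0 i) + e).
        have -> : P = c ord0 * \prod_(i < n.+1) c (lift ord0 i) by exact: big_ord_recl.
        rewrite -mulrA; congr (_ * _); rewrite -big_split; apply: eq_bigr => i _ /=.
        by rewrite mulrDr mulrCA divff ?gt_eqF// mulr1 [_ * e]mulrC.
      rewrite ler_pM2l//; apply: prod_le_avg_expn => i.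
      by rewrite addr_ge0 ?divr_ge0// ltW.
    rewrite -(@ler_pXn2r _ n.+1) ?nnegrE//.
    apply: mulr_ge0; first exact: ltW.
    apply: divr_ge0 => //; apply: sumr_ge0 => i _.
    by rewrite addr_ge0 ?divr_ge0// ltW.
  apply/ler_addgt0Pr => e e0; apply: le_trans (eps_bound (e / K) _) _; first exact: divr_gt0.
  rewrite big_split/= sumr_const card_ord -mulr_natl.
  rewrite le_eqVlt; apply/orP; left; apply/eqP; field.
  by rewrite nat1r pnatr_eq0/= gt_eqF.
have mu_le : (borel_lebesgue n.+2 E <= K%:E)%E.
  have -> : borel_lebesgue n.+2 E = (\int[leb]_t borel_lebesgue n.+1 (Et t))%E.
    rewrite measure_integral_indic//.
    rewrite ge0_integral_cons//; last by apply/measurable_EFinP; exact: measurable_indic.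
    by apply: eq_integral => t _; rewrite measure_integral_indic.
  apply: (@le_trans _ _ (\int[leb]_t ((K / n.+1%:R)%:E * S t))%E).
    apply: ae_ge0_le_integral => //.
    - pose F1 := fun p : measurableTypeR R * 'rV[R]_n.+1 => (\1_E (rV_cons p))%:E : \bar R.
      rewrite (_ : (fun t => _) = fubini_F (borel_lebesgue n.+1) F1); last first.
        by apply/funext => t; rewrite measure_integral_indic.
      apply: measurable_fun_fubini_tonelli_F => [|p]; last by rewrite lee_fin.
      apply/measurable_EFinP; apply: (measurableT_comp (measurable_indic mE)); exact: measurable_rV_cons.
    - move=> t _; apply: mule_ge0; first by rewrite lee_fin divr_ge0// ltW.
      apply: sume_ge0 => i _.
      by rewrite mule_ge0// lee_fin invr_ge0 ltW.
    - apply: emeasurable_funM => //; apply: emeasurable_fun_sum => i.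
      exact: emeasurable_funM.
    by apply: filterS main => t H _.
  have mS : measurable_fun [set: measurableTypeR R] S.
    by apply: emeasurable_fun_sum => i; exact: emeasurable_funM.
  have gc0 i t : (0 <= gam i t * ((c (lift ord0 i))^-1)%:E)%E by rewrite mule_ge0// lee_fin invr_ge0 ltW.
  rewrite ge0_integralZl//; last 2 first.
  - by move=> t _; exact: sume_ge0.
  - by rewrite lee_fin divr_ge0// ltW.
  rewrite ge0_integral_sum//; last by move=> i; exact: emeasurable_funM.
  apply: (@le_trans _ _ ((K / n.+1%:R)%:E * \sum_(i < n.+1) 1)%E).
    apply: lee_wpmul2l; first by rewrite lee_fin divr_ge0// ltW.
    apply: lee_sum => i _; rewrite ge0_integralZr//; last by rewrite lee_fin invr_ge0 ltW.
    rewrite -(@mulfV _ (c (lift ord0 i))) ?gt_eqF// EFinM.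
    by apply: lee_wpmul2r; [rewrite lee_fin invr_ge0 ltW|exact: gamc].
  by rewrite sumEFin sumr_const card_ord -EFinM lee_fin divfK// pnatr_eq0.
rewrite -/P -KP ler_pXn2r ?nnegrE//; last exact: ltW.
by rewrite -lee_fin; exact: le_trans mu_le.
Qed.

End loomis_whitney.

Lemma measure_setD_null d (T : measurableType d) (R : realType) (mu : {measure set T -> \bar R}) (E N : set T) :
  measurable E -> measurable N -> mu N = 0%E -> mu (E `\` N) = mu E.
Proof.
move=> mE mN N0; have mEN : measurable (E `\` N) by exact: measurableD.
apply/eqP; rewrite eq_le; apply/andP; split.
  by apply: le_measure; rewrite ?inE//; exact: subDsetl.
have sub : E `<=` (E `\` N) `|` N.
  by move=> x Hx; have [Nx|Nx] := pselect (N x); [right|left].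
apply: (@le_trans _ _ (mu ((E `\` N) `|` N))).
  by apply: le_measure; rewrite ?inE//; exact: measurableU.
have H : (mu ((E `\` N) `|` N) <= mu (E `\` N) + mu N)%E := measureU2 mu mEN mN.
by rewrite N0 adde0 in H.
Qed.

Section sobolev_weak_type.
Context {R : realType} (n : nat).
Local Notation leb := (@lebesgue_measure R).
Local Notation mu := (@borel_lebesgue R n).
Implicit Types (w G : 'rV[R]_n -> R).

Lemma measurable_line1 (i : 'I_n) (x : 'rV[R]_n) :
  measurable_fun [set: measurableTypeR R] (fun r : R => x + r *: delta_mx 0 i).
Proof.
apply: measurable_fun_rV => j; under eq_fun do rewrite shift_coord.
by apply: measurable_funD => //; exact: measurable_funM.
Qed.

(** Integer translates of a unit slab are disjoint, so the integrals of [|w|] over them are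
    summable; moved back to the first slab they are integrals of translates of [|w|]. *)
Lemma translates_cvg0 (i : 'I_n) w : mu.-integrable setT (EFin \o w) ->
  {ae mu, forall x, w (x + k%:R *: delta_mx 0 i) @[k --> \oo] --> (0 : R)}.
Proof.
move=> iw; set e : 'rV[R]_n := delta_mx 0 i.
have mw : measurable_fun setT w by apply/measurable_EFinP; exact: measurable_int iw.
pose F (a : int) (k : nat) := [set x : 'rV[R]_n | a%:~R + k%:R <= x 0 i < a%:~R + k%:R + 1].
have mF a k : measurable (F a k).
  rewrite (_ : F a k = (fun x : 'rV[R]_n => x 0 i) @^-1` `[a%:~R + k%:R, a%:~R + k%:R + 1[%classic).
    by rewrite -[X in measurable X]setTI; exact: measurable_coord.
  by apply/seteqP; split => x /=; rewrite in_itv.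
have tF a : trivIset setT (F a).
  apply/trivIsetP => j k _ _; wlog jk : j k / (j < k)%N => [H jk|_].
    by move: (jk); rewrite neq_ltn => /orP[]/H; [|rewrite setIC]; apply; rewrite // eq_sym.
  apply/seteqP; split => // x [] /= /andP[_ h1] /andP[h2 _].
  have : j.+1%:R <= k%:R :> R by rewrite ler_nat.
  by rewrite -natr1; lra.
pose f a k x := (`|w (x + k%:R *: e)| * \1_(F a 0%N) x)%:E.
have main a : {ae mu, forall x, F a 0%N x -> w (x + k%:R *: e) @[k --> \oo] --> (0 : R)}.
  have mf k : measurable_fun setT (f a k).
    apply/measurable_EFinP; apply: measurable_funM; last exact: measurable_indic.
    by apply: measurableT_comp => //; apply: (measurableT_comp mw); exact: measurable_addrV.
  have f0 k x : (0 <= f a k x)%E by rewrite lee_fin mulr_ge0.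
  have fF k : (\int[mu]_x f a k x = \int[mu]_(x in F a k) `|(w x)%:E|)%E.
    rewrite [RHS]integral_mkcond.
    have mp : measurable_fun setT ((fun x => `|(w x)%:E|%E) \_ (F a k)).
      apply/(measurable_restrictT _ _).1 => //; apply: measurable_funTS.
      by apply: measurableT_comp => //; exact/measurable_EFinP.
    rewrite -(ge0_integral_translation (k%:R *: e) mp)//; last first.
      by move=> x; rewrite patchE; case: ifP.
    apply: eq_integral => x _; rewrite patchE /f indicE.
    have -> : (x + k%:R *: e \in F a k) = (x \in F a 0%N).
      apply/idP/idP; rewrite !inE /F /= shift_coord eqxx mulr1 addr0; lra.
    by case: (x \in _); rewrite ?mulr1 ?mulr0.
  have [//|/=|_ H] := @ae_cvg0_of_summable _ _ R mu setT (f a) measurableT mf.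
  - under eq_eseriesr do rewrite fF.
    have mabs : measurable_fun setT (fun x => `|(w x)%:E|%E) by apply: measurableT_comp => //; exact/measurable_EFinP.
    rewrite -ge0_integral_bigcup//; last exact: measurable_funTS.
    move/integrableP : iw => [_]; apply: le_lt_trans.
    by apply: ge0_subset_integral => //; exact: bigcupT_measurable.
  apply: filterS H => x /(_ I) Hx Fx; apply/cvgr0Pnorm_le => eps eps0.
  have [N NP] := iffLR (cvge0P (f0^~ x)) Hx eps eps0.
  exists N => // k /= /NP; rewrite /f indicE mem_set// mulr1 lee_fin; exact.
have : {ae mu, forall x, forall a, F a 0%N x -> w (x + k%:R *: e) @[k --> \oo] --> (0 : R)}.
  exact: (ae_forall_countable main).
apply: filterS => x Hx; apply: (Hx (Num.floor (x 0 i))).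
by rewrite /F /= addr0; have := floor_itv (x 0 i); rewrite intrD.
Qed.

(** Steklov's identity over [[0, k]], where the value at the far end tends to 0 as [k] grows. *)
Lemma weak_derivative_line_bound (i : 'I_n) w G : borel_weak setT i w G ->
  mu.-integrable setT (EFin \o w) -> mu.-integrable setT (EFin \o G) ->
  {ae mu, forall x, (`|w x|%:E <= \int[leb]_r `|(G (x + r *: delta_mx 0 i))%:E|)%E}.
Proof.
move=> [mw mG _ _ weak] iw iG; set e : 'rV[R]_n := delta_mx 0 i.
have diff (k : nat) : {ae mu, forall x, w (x + k%:R *: e) - w x = line_avg i k%:R G x}.
  have : {ae mu, forall x, forall j : nat, box (fun=> - j%:R) (fun=> j%:R) x -> w (x + k%:R *: e) - w x = line_avg i k%:R G x}.
    apply: ae_forall_countable => j.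
    by apply: (@steklov_identity R n i setT w G k%:R (fun=> - j%:R) (fun=> j%:R)) => //.
  apply: filterS => x Hx; have : (\bigcup_(j : nat) box (fun _ : 'I_n => - j%:R : R) (fun=> j%:R)) x.
    by rewrite bigcup_boxT.
  by move=> [j _ /Hx].
have bound (k : nat) : {ae mu, forall x, (`|line_avg i k%:R G x|%:E <= \int[leb]_r `|(G (x + r *: e))%:E|)%E}.
  apply: filterS (ae_line_integrable i (ler0n R k) iG) => x ix.
  rewrite /line_avg -abse_EFin /Rintegral fineK ?integrable_fin_num//.
  apply: le_trans (le_abse_integral _ measurableT (measurable_int _ ix)) _.
  have mline : measurable_fun [set: measurableTypeR R] (fun r : R => G (x + r *: e)).
    by apply: (measurableT_comp mG); exact: (measurable_line1 i x).
  apply: ge0_le_integral => //.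
  - by apply: measurableT_comp => //; exact: measurable_int ix.
  - by apply: measurableT_comp => //; exact/measurable_EFinP.
  move=> r _; rewrite !abse_EFin lee_fin normrM; apply: ler_piMl => //.
  by rewrite /slab indicE; case: (_ \in _); rewrite ?normr1 ?normr0.
have := ae_foralln diff; have := ae_foralln bound; have := translates_cvg0 i iw.
apply: filterS3 => x cx bx dx.
apply/lee_addgt0Pr => eps eps0; have [N _ /(_ N (leqnn N)) /= Nx] := iffLR (cvgr0Pnorm_le _) cx eps eps0.
apply: le_trans (leeD2r _ (bx N)); rewrite -EFinD lee_fin -dx.
have := ler_normB (w (x + N%:R *: e)) (w (x + N%:R *: e) - w x).
by rewrite subKr; lra.
Qed.

Lemma loomis_whitney_pos (E : set 'rV[R]_n) (g : 'I_n -> 'rV[R]_n -> \bar R) (c : 'I_n -> R) : (0 < n)%N ->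
  measurable E -> (forall i, measurable_fun setT (g i)) -> (forall i x, (0 <= g i x)%E) ->
  (forall i, 0 < c i) -> (forall i, \int[mu]_x g i x <= (c i)%:E)%E ->
  (forall x, E x -> forall i, 1 <= \int[leb]_r g i (x + r *: delta_mx 0 i)%R)%E ->
  E !=set0 -> forall m, 0 <= m -> (m%:E <= mu E)%E -> m ^+ n.-1 <= \prod_i c i.
Proof.
by case: n E g c => // n' E g c _ mE mg g0 c0 gc gE E0 m m0 mE'; exact: (loomis_whitney mE mg g0 c0 gc gE E0 m0 mE').
Qed.

(** [loomis_whitney] is applied to [|G i| / s] on the set where [|w|] is at least [s], less the null
    set where the line bound fails. *)
Lemma sobolev_weak_type w (G : 'I_n -> 'rV[R]_n -> R) (c s m : R) : (1 < n)%N ->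
  (forall i, borel_weak setT i w (G i)) -> mu.-integrable setT (EFin \o w) ->
  (forall i, mu.-integrable setT (EFin \o G i)) ->
  0 < c -> (forall i, \int[mu]_x `|(G i x)%:E| <= c%:E)%E -> 0 < s -> 0 <= m ->
  (m%:E <= mu [set x | (s <= `|w x|)%R])%E -> m ^+ n.-1 <= (c / s) ^+ n.
Proof.
move=> n1 wG iw iG c0 Gc s0 m0 mE.
have mw : measurable_fun setT w by apply/measurable_EFinP; exact: measurable_int iw.
have mG i : measurable_fun setT (G i) by apply/measurable_EFinP; exact: measurable_int (iG i).
have : {ae mu, forall x, forall i : 'I_n,
    (`|w x|%:E <= \int[lebesgue_measure]_r `|(G i (x + r *: delta_mx 0 i))%:E|)%E}.
  by apply: ae_forall_countable => i; exact: weak_derivative_line_bound.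
move=> [N [mN N0 HN]].
pose E := [set x | s <= `|w x|] `\` N.
have mE0 : measurable [set x | s <= `|w x|].
  rewrite -[X in measurable X]setTI.
  have := @measurable_fun_ler _ _ R setT (cst s) (fun x => `|w x|).
  by move=> /(_ (measurable_cst _) (measurableT_comp (@normr_measurable R setT) mw) measurableT [set true]); apply.
have mE' : measurable E by exact: measurableD.
have muE : mu E = mu [set x | s <= `|w x|].
  exact: measure_setD_null.
have [E0|/set0P E0] := eqVneq E set0.
  have -> : m = 0 by apply/eqP; rewrite eq_le m0 andbT -lee_fin; apply: (le_trans mE); rewrite -muE E0 measure0.
  have n10 : (n.-1 == 0)%N = false by rewrite -subn1 subn_eq0 leqNgt n1.
  by rewrite expr0n n10 exprn_ge0// divr_ge0// ltW.
have si0 : (0 <= (s^-1)%:E)%E by rewrite lee_fin invr_ge0 ltW.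
have := @loomis_whitney_pos E (fun i x => ((s^-1)%:E * `|(G i x)%:E|)%E) (fun=> c / s) (ltnW n1) mE'.
have mabs i : measurable_fun setT (fun x => `|(G i x)%:E|%E) by apply: measurableT_comp => //; exact/measurable_EFinP.
move=> /(_ _ _ _ _ _ E0 m m0) H; have {}H := H _ _ _ _ _ _.
rewrite -[leRHS](_ : \prod_(i < n) (c / s) = _); last by rewrite prodr_const card_ord.
apply: H.
- by move=> i; apply: emeasurable_funM.
- by move=> i x; rewrite mule_ge0.
- by move=> i; rewrite divr_gt0.
- move=> i; rewrite ge0_integralZl// mulrC EFinM; apply: lee_wpmul2l => //.
- move=> x [sx Nx] i; have {}Nx : forall i : 'I_n, (`|w x|%:E <= \int[lebesgue_measure]_r `|(G i (x + r *: delta_mx 0 i))%:E|)%E.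
    by apply: contrapT => H'; apply: Nx; apply: HN.
  rewrite ge0_integralZl//; last first.
    apply: measurableT_comp => //; apply/measurable_EFinP; apply: (measurableT_comp (mG i)); exact: (measurable_line1 i x).
  have -> : 1%E = ((s^-1)%:E * s%:E)%E by rewrite -EFinM mulVf// gt_eqF.
  apply: lee_wpmul2l => //.
  by apply: le_trans (Nx i); rewrite lee_fin.
by rewrite muE.
Qed.

End sobolev_weak_type.

(** * Extension domains *)

Lemma sum_sqr_le {R : realType} (I : Type) (s : seq I) (a : I -> R) : (forall i, 0 <= a i) ->
  \sum_(i <- s) a i ^+ 2 <= (\sum_(i <- s) a i) ^+ 2.
Proof.
move=> a0; elim: s => [|i s ih]; first by rewrite !big_nil expr0n.
rewrite !big_cons sqrrD; have S0 : 0 <= \sum_(j <- s) a j by apply: sumr_ge0.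
have := mulr_ge0 (a0 i) S0; rewrite -mulr_natr; lra.
Qed.

Lemma Lnormoo_ae0 d (T : measurableType d) (R : realType) (mu : {measure set T -> \bar R}) (f : T -> \bar R) :
  {ae mu, forall x, f x = 0%E} -> ('N[mu]_+oo[f] < +oo)%E.
Proof.
move=> f0; rewrite unlock; case: ifPn => // _.
apply: (@le_lt_trans _ _ 0%E) => //; apply/ess_sup_inf.ess_supP.
move: f0 => [N [mN N0 HN]]; exists N; split => // x /= Hx; apply: HN => /= fx; apply: Hx.
by rewrite fx abse0.
Qed.

Section gradients.
Context {R : realType} (n : nat).
Local Notation mu := (@borel_lebesgue R n).
Local Notation lmu := (lebesgueN R n).
Implicit Types (O K : set 'rV[R]_n) (u v w : 'rV[R]_n -> R) (H : 'I_n -> 'rV[R]_n -> R).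

Definition gradnorm H x : R := euclid_norm (\row_i H i x).

Lemma gradnormE H x : gradnorm H x = Num.sqrt (\sum_i H i x ^+ 2).
Proof. by rewrite /gradnorm /euclid_norm; congr Num.sqrt; apply: eq_bigr => i _; rewrite mxE. Qed.

Lemma measurable_gradnorm H : (forall i, measurable_fun setT (H i)) -> measurable_fun setT (gradnorm H).
Proof.
move=> mH; rewrite (_ : gradnorm H = fun x => Num.sqrt (\sum_i H i x ^+ 2)); last by apply/funext => x; exact: gradnormE.
apply: (measurableT_comp (continuous_measurable_fun (@sqrt_continuous R))).
by apply: measurable_sum => i; exact: measurable_funX.
Qed.

Lemma gradnorm_ge0 H x : 0 <= gradnorm H x. Proof. exact: sqrtr_ge0. Qed.

Lemma le_gradnorm H i x : `|H i x| <= gradnorm H x.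
Proof.
rewrite gradnormE -sqrtr_sqr ler_wsqrtr//; rewrite (bigD1 i)//= lerDl; apply: sumr_ge0 => j _; exact: sqr_ge0.
Qed.

Lemma gradnorm_le H x : gradnorm H x <= \sum_i `|H i x|.
Proof.
have S0 : 0 <= \sum_i `|H i x| by apply: sumr_ge0.
rewrite gradnormE -[leRHS]ger0_norm// -sqrtr_sqr ler_wsqrtr//.
apply: le_trans (@sum_sqr_le R _ (index_enum _) (fun i => `|H i x|) (fun i => normr_ge0 _)).
by rewrite le_eqVlt; apply/orP; left; apply/eqP; apply: eq_bigr => i _; rewrite real_normK ?num_real.
Qed.

Lemma gradnorm_scale (c : R) H x : gradnorm (fun i x => c * H i x) x = `|c| * gradnorm H x.
Proof.
rewrite !gradnormE -sqrtr_sqr -sqrtrM ?sqr_ge0// mulr_sumr; congr Num.sqrt.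
by apply: eq_bigr => i _; rewrite exprMn.
Qed.

Lemma euclid_norm_ae O (G : 'rV[R]_n -> 'rV[R]_n) H :
  {ae mu, forall x, O x -> forall i, G x 0 i = H i x} ->
  {ae mu, forall x, O x -> euclid_norm (G x) = gradnorm H x}.
Proof.
apply: filterS => x Hx Ox; rewrite gradnormE /euclid_norm; congr Num.sqrt.
by apply: eq_bigr => i _; rewrite Hx.
Qed.

Lemma borel_weak_ae O i v v' (h : 'rV[R]_n -> R) : open O -> borel_weak O i v h -> measurable_fun setT v' ->
  {ae mu, forall x, O x -> v x = v' x} -> borel_weak O i v' h.
Proof.
move=> oO [mv mh iv ih weak] mv' vv'; split => //.
  move=> K cK KO; have mK := compact_measurable_rV cK.
  have /integrableP[_ ivK] := iv K cK KO.
  have m1 : measurable_fun K (EFin \o v) by apply/measurable_EFinP; exact: measurable_funTS.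
  have m2 : measurable_fun K (EFin \o v') by apply/measurable_EFinP; exact: measurable_funTS.
  apply/integrableP; split => //.
  have -> // : (\int[mu]_(x in K) `|(EFin \o v') x| = \int[mu]_(x in K) `|(EFin \o v) x|)%E.
  apply: ae_eq_integral => //; [exact: measurableT_comp|exact: measurableT_comp|].
  by apply: filterS vv' => x Hx Kx /=; rewrite Hx//; exact: KO.
move=> phi tphi; rewrite -weak//.
have [K [M [[cK KO M0 phi0 phiM] [mphi mdphi]]]] := test_function_facts i tphi.
apply: ae_eq_integral => //.
- by apply/measurable_EFinP; exact: measurable_funM.
- by apply/measurable_EFinP; exact: measurable_funM.
apply: filterS vv' => x Hx _; congr EFin.
by have [Kx|/phi0[_ ->]] := pselect (K x); [rewrite Hx//; exact: KO|rewrite !mulr0].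
Qed.

Lemma weak_gradient_unique O u G v H : open O -> is_weak_gradient O u G ->
  (forall i, borel_weak O i v (H i)) -> measurable_fun setT v -> {ae mu, forall x, O x -> u x = v x} ->
  {ae mu, forall x, O x -> forall i, G x 0 i = H i x}.
Proof.
move=> oO wG wH mv uv; have [v' [H' [w' vH']]] := weak_gradient_borel oO wG.
have uniq_ i : {ae mu, forall x, O x -> H' i x = H i x}.
  apply: (weak_derivative_unique oO _ (wH i)); apply: (borel_weak_ae oO (w' i) mv).
  by apply: filterS2 vH' uv => x H1 H2 Ox; have [<- _] := H1 Ox; exact: H2.
have := @ae_forall_countable _ _ _ mu 'I_n (fun i x => O x -> H' i x = H i x) uniq_.
by apply: filterS2 vH' => x H1 H2 Ox i; have [_ ->] := H1 Ox; exact: H2.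
Qed.

Lemma weak_gradientP O u : weakly_differentiable O u -> is_weak_gradient O u (weak_gradient O u).
Proof. by move=> [G wG]; rewrite /weak_gradient; apply: (@xgetPex _ _ [set G | is_weak_gradient O u G]); exists G. Qed.

Lemma integrable_on_compact O v : mu.-integrable O (EFin \o v) -> open O ->
  forall K, compact K -> K `<=` O -> mu.-integrable K (EFin \o v).
Proof. by move=> iv oO K cK KO; apply: integrableS KO iv => //; [exact: open_measurable_rV|exact: compact_measurable_rV]. Qed.

Lemma W1p1_borel O u v H : open O -> lebesgue_measurable O u ->
  (forall i, borel_weak O i v (H i)) -> measurable_fun setT v -> (forall i, measurable_fun setT (H i)) ->
  {ae mu, forall x, O x -> u x = v x} ->
  weakly_differentiable O u ->
  (W1p_norm 1 O u = \int[mu]_(x in O) `|(v x)%:E| + \int[mu]_(x in O) (gradnorm H x)%:E)%E.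
Proof.
move=> oO mu_ wH mv mH uv wu; have mO := open_measurable_rV oO.
have wG := weak_gradientP wu; have GH := weak_gradient_unique oO wG wH mv uv.
have patchE' (f : 'rV[R]_n -> R) (x : 'rV[R]_n) : (`|((EFin \o f) \_ O) x| = ((fun x => `|(f x)%:E|) \_ O) x)%E.
  by rewrite !patchE; case: ifP => //; rewrite abse0.
rewrite /W1p_norm !Lnorm1; congr (_ + _)%E.
  under eq_integral do rewrite patchE'.
  rewrite -(integral_mkcond (mu := lmu) O (fun x : 'rV[R]_n => `|(u x)%:E|%E)).
  exact: (integral_norm_lebesgueN mO (fun x Ox => Ox) mu_ mv uv).
under eq_integral do rewrite patchE'.
rewrite -(integral_mkcond (mu := lmu) O (fun x : 'rV[R]_n => `|(euclid_norm (weak_gradient O u x))%:E|%E)).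
have [_ lG _] := wG.
have mG : measurable_fun (O : set (lebesgueT R n)) ((fun x => euclid_norm (weak_gradient O u x)) : lebesgueT R n -> R).
  apply: (measurableT_comp (continuous_measurable_fun (@sqrt_continuous R))).
  apply: (@measurable_sum _ (lebesgueT R n)) => i; apply: measurable_funX.
  by case: (lG i).
rewrite (integral_norm_lebesgueN mO (fun x Ox => Ox) mG (measurable_gradnorm mH) (euclid_norm_ae GH)).
by apply: eq_integral => x _; rewrite gee0_abs// lee_fin; exact: gradnorm_ge0.
Qed.

(** Places a W^{1,1} function in the sum space on which the extension operator reproduces its
    argument. *)
Lemma W1poo0 O : open O -> W1p +oo%E O (fun=> 0).
Proof.
move=> oO; have mO := open_measurable_rV oO.
have w0 i : borel_weak O i (fun=> 0) (fun=> 0).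
  split => //; try by move=> K cK KO; apply: integrable0.
  move=> phi _; under eq_integral do rewrite mul0r; under [X in _ = (- X)%E]eq_integral do rewrite mul0r.
  by rewrite !integral0 oppe0.
have m0 : lebesgue_measurable O (fun=> 0) by exact: measurable_cst.
have wd : weakly_differentiable O (fun=> 0).
  exists (fun x => \row_i (fun=> 0) i); apply: (borel_weak_gradient (v := fun=> 0) (H := fun _ _ => 0)) => //.
  - by apply: aeW.
  - by move=> K cK KO; apply: integrable0.
split => //.
have GH := weak_gradient_unique oO (weak_gradientP wd) w0 (measurable_cst _) (aeW _ (fun _ _ => erefl)).
have L0 (f : 'rV[R]_n -> R) : {ae mu, forall x, O x -> f x = 0} -> ('N[lmu]_+oo[(EFin \o f) \_ O] < +oo)%E.
  move=> f0; apply: Lnormoo_ae0; apply/ae_lebesgueN; apply: filterS f0 => x Hx.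
  by rewrite patchE; case: ifP => //; rewrite inE => /Hx /= ->.
apply: lte_add_pinfty; apply: L0; first by apply: aeW.
apply: filterS (euclid_norm_ae GH) => x Hx Ox; rewrite Hx// gradnormE big1 ?sqrtr0// => i _.
by rewrite expr0n.
Qed.

End gradients.

Section extension.
Context {R : realType} (n : nat).
Local Notation mu := (@borel_lebesgue R n).
Local Notation lmu := (lebesgueN R n).
Implicit Types (O K : set 'rV[R]_n) (u v w : 'rV[R]_n -> R) (H G : 'I_n -> 'rV[R]_n -> R).

(** The form in which the level estimates use an extension domain: Borel representatives, with the
    derivatives of the extension bounded in L^1 by the full norm. *)
Definition borel_extension O (C : R) := forall v H,
  measurable_fun setT v -> (forall i, borel_weak O i v (H i)) ->
  (\int[mu]_(x in O) `|(v x)%:E| < +oo)%E -> (\int[mu]_(x in O) (gradnorm H x)%:E < +oo)%E ->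
  exists w G, [/\ (forall i, borel_weak setT i w (G i)), mu.-integrable setT (EFin \o w),
    (forall i, mu.-integrable setT (EFin \o G i)), {ae mu, forall x, O x -> w x = v x} &
    (forall i, \int[mu]_x `|(G i x)%:E| <=
       C%:E * (\int[mu]_(x in O) `|(v x)%:E| + \int[mu]_(x in O) (gradnorm H x)%:E))%E].

Lemma extension_domain_borel O : (0 < n)%N -> extension_domain O ->
  exists2 C : R, 0 < C & borel_extension O C.
Proof.
move=> n0 [oO [Ext [_ ExtO ExtB]]]; have mO := open_measurable_rV oO.
have [C HC] := ExtB 1%E (or_introl erefl).
(* The given constant may fail to be positive, whereas its inverse is needed later to fix the radius
   [r0]. *)
exists (`|C| + 1); first by rewrite ltr_wpDl.
move=> v H mv wH v1 H1.
have mH i : measurable_fun setT (H i) by case: (wH i).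
have lv : lebesgue_measurable O v by exact: measurable_fun_lebesgueT.
have vv : {ae mu, forall x, O x -> v x = v x} by apply: aeW.
have iv : mu.-integrable O (EFin \o v) by apply/integrableP; split => //; apply/measurable_EFinP; exact: measurable_funTS.
have wd : weakly_differentiable O v.
  by eexists; exact: (borel_weak_gradient oO lv vv mv wH (integrable_on_compact iv oO)).
have normE := W1p1_borel oO lv wH mv mH vv wd.
have Wv : W1p 1 O v by split => //; rewrite normE lte_add_pinfty.
have [WE WEle] := HC v Wv.
have Wsum : W11_plus_W1oo O v.
  exists v, (fun=> 0); split; [exact: Wv|exact: W1poo0|].
  by apply/funext => x; rewrite /= addr0.
have /ae_lebesgueN Eu := ExtO v Wsum.
have [wE normE_fin] := WE.
have [w [G [wG wGE]]] := weak_gradient_borel openT (weak_gradientP wE).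
have [mw _ _ _ _] := wG (Ordinal n0).
have mG i : measurable_fun setT (G i) by case: (wG i).
have lE : lebesgue_measurable setT (Ext v) by have [[]] := weak_gradientP wE.
have EvwT : {ae mu, forall x, [set: 'rV[R]_n] x -> Ext v x = w x}.
  by apply: filterS wGE => x Hx Ox; case: (Hx Ox).
have normT := W1p1_borel openT lE wG mw mG EvwT wE.
rewrite normT normE in WEle.
set S := (\int[mu]_(x in O) _ + \int[mu]_(x in O) _)%E in WEle *.
have Soo : (S < +oo)%E by exact: lte_add_pinfty.
have S0 : (0 <= S)%E by apply: adde_ge0; apply: integral_ge0 => x _; rewrite ?lee_fin ?gradnorm_ge0.
have CS : (C%:E * S <= (`|C| + 1)%:E * S)%E.
  by apply: lee_wpmul2r => //; rewrite lee_fin (le_trans (ler_norm C))// lerDl.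
have CSoo : ((`|C| + 1)%:E * S < +oo)%E by rewrite lte_mul_pinfty// lee_fin addr_ge0.
have mabs (f : 'rV[R]_n -> R) : measurable_fun setT f -> measurable_fun setT (fun x => `|(f x)%:E|%E).
  by move=> mf; apply: measurableT_comp => //; exact/measurable_EFinP.
have mgG : measurable_fun setT (fun x => (gradnorm G x)%:E) by apply/measurable_EFinP; exact: measurable_gradnorm.
have gG0 : (0 <= \int[mu]_x (gradnorm G x)%:E)%E by apply: integral_ge0 => x _; rewrite lee_fin gradnorm_ge0.
have Gi i : (\int[mu]_x `|(G i x)%:E| <= (`|C| + 1)%:E * S)%E.
  apply: le_trans CS; apply: le_trans WEle; apply: (@le_trans _ _ (\int[mu]_x (gradnorm G x)%:E)%E).
    apply: ge0_le_integral => //; first exact: mabs.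
    by move=> x _; rewrite abse_EFin lee_fin le_gradnorm.
  by rewrite leeDr//; exact: integral_ge0.
exists w, G; split => //.
- apply/integrableP; split; first exact/measurable_EFinP.
  apply: le_lt_trans CSoo; apply: le_trans CS; apply: le_trans WEle.
  by rewrite leeDl.
- move=> i; apply/integrableP; split; first exact/measurable_EFinP.
  exact: le_lt_trans (Gi i) CSoo.
by apply: filterS2 Eu wGE => x H1' H2 Ox; have [<- _] := H2 I; exact: H1'.
Qed.

End extension.

(** * Level sets of Sobolev functions *)

Section level.
Context {R : realType} (n : nat).
Local Notation mu := (@borel_lebesgue R n).
Implicit Types (O : set 'rV[R]_n).

(* The derivative of the truncation of the absolute value between the levels [a] and [b]. *)
Definition level_slope (a b : R) (s : R) : R := \1_(`]a, b[) s - \1_(`]- b, - a[) s.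

Lemma level_slope_bounded a b : bounded_measurable (level_slope a b : measurableTypeR R -> R).
Proof.
split; first by apply: measurable_funB; exact: measurable_indic.
exists 2 => s; apply: le_trans (ler_normB _ _) _; rewrite !indicE.
by case: (_ \in _); case: (_ \in _); rewrite ?normr0 ?normr1; lra.
Qed.

Lemma level_slopeE a b s : 0 < a -> `|level_slope a b s| = \1_(`]a, b[) `|s|.
Proof.
move=> a0; rewrite /level_slope !indicE !mem_setE !in_itv/=.
case: (leP 0 s) => s0.
  have -> : (- b < s < - a) = false by (apply/negbTE/negP => /andP[]; lra).
  by rewrite subr0 ger0_norm// (ger0_norm s0).
have -> : (a < s < b) = false by apply/negbTE/negP => /andP[]; lra.
by rewrite sub0r normrN ger0_norm// (ltr0_norm s0) ltrNr [- b < _]ltrNl andbC.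
Qed.

Lemma level_trunc a b s : 0 < a -> a < b -> [/\ `|prim (level_slope a b) s| <= b - a,
  `|s| <= a -> prim (level_slope a b) s = 0 & b <= `|s| -> `|prim (level_slope a b) s| = b - a].
Proof.
move=> a0 ab; set h := level_slope a b; have bh := level_slope_bounded a b.
have const0 x y : x <= y -> (forall t, x <= t <= y -> h t = 0) -> prim h y = prim h x.
  move=> xy h0; apply/eqP; rewrite -subr_eq0 -normr_le0 -(mul0r (y - x)).
  by apply: prim_le_itv => // t ty; rewrite h0// normr0.
have small s' : `|s'| <= a -> prim h s' = 0.
  move=> s'a; have h0 t : `|t| <= a -> h t = 0.
    by move=> ta; apply/eqP; rewrite -normr_eq0 level_slopeE// indicE memNset//= in_itv/= ltNge ta.
  have [s0|/ltW s0] := leP 0 s'.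
    rewrite -(prim0 h); apply: const0 => // t /andP[t0 ts]; apply: h0; rewrite ger0_norm//.
    by apply: le_trans ts _; rewrite (le_trans (ler_norm _)).
  rewrite -(prim0 h); apply/esym/const0 => // t /andP[t0 ts]; apply: h0; rewrite ler0_norm//.
  by rewrite ler0_norm in s'a => //; lra.
have mid (c x y : R) : x < y -> (forall t, x < t < y -> h t = c) -> prim h y - prim h x = c * (y - x).
  move=> xy hc; rewrite prim_itv//; last exact: ltW.
  rewrite -Rintegral_itv_bndo_bndc; last first.
    have sub : `]x, y[%classic `<=` `]x, y]%classic by apply: subset_itvl; rewrite bnd_simp.
    by have := integrable_itv x y bh; apply: integrableS => //; exact: measurable_itv.
  rewrite (@eq_Rintegral _ _ _ _ _ (fun=> c)); last first.
    by move=> t; rewrite inE/= in_itv/= => /hc.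
  rewrite Rintegral_cst; last exact: measurable_itv.
  by rewrite [X in fine X](lebesgue_measure_itv `]_, _[)/= lte_fin xy.
have ha : prim h a = 0 by apply: small; rewrite ger0_norm// ltW.
have hna : prim h (- a) = 0 by apply: small; rewrite normrN ger0_norm// ltW.
have pb : prim h b = b - a.
  have := mid 1 a b ab; rewrite ha subr0 mul1r; apply => t /andP[at_ tb].
  rewrite /h /level_slope !indicE mem_set/= ?in_itv/= ?at_// memNset ?subr0//= in_itv/= => /andP[].
  lra.
have pnb : prim h (- b) = b - a.
  have bna : - b < - a by rewrite ltrN2.
  have H : (forall t, - b < t < - a -> h t = -1) -> _ := mid (-1) (- b) (- a) bna.
  have hh t : - b < t < - a -> h t = -1.
    move=> /andP[bt ta].
    rewrite /h /level_slope !indicE !mem_setE !in_itv/= bt ta.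
    have -> : (a < t < b) = false by (apply/negbTE/negP => /andP[]; lra).
    by rewrite sub0r.
  have := H hh; rewrite hna sub0r mulN1r => /oppr_inj ->; lra.
have big s' : b <= `|s'| -> prim h s' = b - a.
  have h0 t : b <= `|t| -> h t = 0.
    by move=> ta; apply/eqP; rewrite -normr_eq0 level_slopeE// indicE memNset//= in_itv/= [X in _ && X]ltNge ta andbF.
  move=> bs; have [s0|/ltW s0] := leP 0 s'.
    rewrite -pb; apply: const0; first by rewrite ger0_norm in bs.
    by move=> t /andP[bt _]; apply: h0; rewrite (le_trans bt)// ler_norm.
  rewrite -pnb; apply/esym/const0; first by rewrite ler0_norm in bs => //; lra.
  by move=> t /andP[_ tb]; apply: h0; rewrite -normrN (le_trans _ (ler_norm _))//; lra.
split; [|exact: small|by move=> /big ->; rewrite ger0_norm// subr_ge0 ltW].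
have [bs|sb] := leP b `|s|.
  by rewrite big// ger0_norm// subr_ge0 ltW.
have h1 t : `|h t| <= 1 by rewrite level_slopeE// indicE; case: (_ \in _).
have [sa|as_] := leP `|s| a; first by rewrite small// normr0 subr_ge0 ltW.
have [s0|/ltW s0] := leP 0 s.
  rewrite ger0_norm// in sb as_; have := @prim_le_itv _ h a s 1 bh (ltW as_) (fun t _ => h1 t).
  by rewrite ha subr0 mul1r => /le_trans; apply; rewrite lerB// ltW.
rewrite ler0_norm// in sb as_; have sa : s <= - a by lra.
have := @prim_le_itv _ h s (- a) 1 bh sa (fun t _ => h1 t).
rewrite hna sub0r normrN mul1r; lra.
Qed.

(* Sobolev's inequality for the truncation of [u] between the levels [a] and [b]. *)
Lemma level_inequality O (C : R) : borel_extension O C -> (1 < n)%N -> 0 <= C -> open O ->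
  forall u G, (forall i, borel_weak O i u (G i)) ->
  forall a b N I c m : R, 0 < a -> a < b -> 0 < c -> 0 <= m ->
  (mu (O `&` [set x | (a < `|u x|)%R]) <= N%:E)%E ->
  (\int[mu]_(x in O `&` [set x | (a < `|u x| < b)%R]) (gradnorm G x)%:E <= I%:E)%E ->
  (m%:E <= mu (O `&` [set x | (b <= `|u x|)%R]))%E ->
  C * ((b - a) * N + I) <= c -> m ^+ n.-1 <= (c / (b - a)) ^+ n.
Proof.
move=> ext n1 C0 oO u G uG a b N I c m a0 ab c0 m0 HN HI Hm Hc.
have mO := open_measurable_rV oO.
pose i0 : 'I_n := Ordinal (ltnW n1).
have mu_ : measurable_fun setT u by case: (uG i0).
have mG i : measurable_fun setT (G i) by case: (uG i).
pose h := level_slope a b; have bh := level_slope_bounded a b.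
have [mh [Mh hM]] := bh.
have mprim : measurable_fun setT (prim h : measurableTypeR R -> measurableTypeR R) by exact: measurable_prim.
pose V x := prim h (u x); pose K i x := h (u x) * G i x.
have mV : measurable_fun setT V by exact: (measurableT_comp mprim mu_).
have mhu : measurable_fun setT (fun x => h (u x)) by exact: (measurableT_comp mh mu_).
have mK i : measurable_fun setT (K i) by apply: measurable_funM.
have mabs (f : 'rV[R]_n -> R) : measurable_fun setT f -> measurable_fun setT (fun x => `|f x|).
  by move=> mf; apply: measurableT_comp.
have mset (D : set (measurableTypeR R)) : measurable D -> measurable [set x | D `|u x|].
  by move=> mD; rewrite -[X in measurable X]setTI; exact: mabs.
have mset1 : measurable (O `&` [set x | (a < `|u x|)%R]).
  apply: measurableI => //; rewrite (_ : [set x | _] = [set x | `]a, +oo[%classic `|u x|]); first exact: mset.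
  by apply/seteqP; split => x /=; rewrite in_itv/= andbT.
have mset2 : measurable (O `&` [set x | (a < `|u x| < b)%R]).
  apply: measurableI => //; rewrite (_ : [set x | _] = [set x | `]a, b[%classic `|u x|]); first exact: mset.
  by apply/seteqP; split => x /=; rewrite in_itv.
have ba0 : 0 < b - a by rewrite subr_gt0.
have N0 : 0 <= N by rewrite -lee_fin; apply: le_trans HN.
have Vint : (\int[mu]_(x in O) `|(V x)%:E| <= ((b - a) * N)%:E)%E.
  apply: (@le_trans _ _ (\int[mu]_(x in O `&` [set x | (a < `|u x|)%R]) (b - a)%:E)%E).
    rewrite integral_mkcond [leRHS]integral_mkcond; apply: ge0_le_integral => //.
    - by move=> x _; apply: erestrict_ge0.
    - apply/(measurable_restrictT _ mO); apply: measurable_funTS; apply: measurableT_comp => //.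
      exact/measurable_EFinP.
    - by apply/(measurable_restrictT _ mset1).
    move=> x _; rewrite !patchE in_setI; case: (x \in O) => //=.
    have [h1 h2 _] := level_trunc (u x) a0 ab.
    case: ifPn => [_|]; first by rewrite lee_fin.
    by rewrite notin_setE/= => /negP; rewrite -leNgt => /h2; rewrite /V /h => ->; rewrite normr0.
  by rewrite integral_cst// EFinM lee_pmul2l// lte_fin.
have gK x : gradnorm K x = \1_(`]a, b[) `|u x| * gradnorm G x.
  by rewrite -level_slopeE// -gradnorm_scale !gradnormE.
have Kint : (\int[mu]_(x in O) (gradnorm K x)%:E <= I%:E)%E.
  apply: le_trans HI; rewrite integral_mkcondr le_eqVlt; apply/orP; left; apply/eqP.
  apply: eq_integral => x _; rewrite gK patchE indicE.
  have -> : (x \in [set x | (a < `|u x| < b)%R]) = (`|u x| \in `]a, b[%classic).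
    by apply/idP/idP => /set_mem bu; apply/mem_set; move: bu; rewrite /= in_itv.
  by case: (_ \in _); rewrite ?mul1r ?mul0r.
have wV i : borel_weak O i V (K i).
  have [_ _ iu iG _] := uG i; split => //.
  - move=> L cL LO; apply: (@integrableS _ _ _ mu O) => //; first exact: compact_measurable_rV.
    apply/integrableP; split; first by apply/measurable_EFinP; exact: measurable_funTS.
    exact: le_lt_trans Vint (ltry _).
  - move=> L cL LO; have mL := compact_measurable_rV cL; rewrite (_ : _ \o _ = fun x => (G i x * h (u x))%:E); last first.
      by apply/funext => x /=; rewrite /K mulrC.
    apply: (integrable_mul_bounded mL (iG L cL LO) (measurable_funTS mhu)) => x _; exact: hM.
  - by move=> phi tphi; exact: (chain_rule_bounded oO (uG i) bh tphi).
have [w [W [wW iw iW wE Wle]]] := ext V K mV wV (le_lt_trans Vint (ltry _)) (le_lt_trans Kint (ltry _)).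
have mw : measurable_fun setT w by apply/measurable_EFinP; exact: measurable_int iw.
apply: (@sobolev_weak_type _ _ w W c (b - a) m n1 wW iw iW c0 _ ba0 m0).
  move=> i; apply: le_trans (Wle i) _; apply: (@le_trans _ _ (C%:E * ((b - a) * N + I)%:E)%E).
    by rewrite EFinD lee_wpmul2l ?lee_fin// leeD.
  by rewrite -EFinM lee_fin.
have [Z [mZ Z0 HZ]] := wE.
have mE : measurable (O `&` [set x | (b <= `|u x|)%R]).
  apply: measurableI => //; rewrite (_ : [set x | _] = [set x | `[b, +oo[%classic `|u x|]); first exact: mset.
  by apply/seteqP; split => x /=; rewrite in_itv/= andbT.
apply: le_trans Hm _; rewrite -(measure_setD_null mE mZ Z0).
apply: le_measure; rewrite ?inE.
- exact: measurableD.
- rewrite (_ : [set x | _] = (fun x => `|w x|) @^-1` `[b - a, +oo[); last first.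
    by apply/seteqP; split => x /=; rewrite in_itv/= andbT.
  by rewrite -[X in measurable X]setTI; exact: mabs.
move=> x [[Ox /= bu] Zx]; have -> : w x = V x by apply: contrapT => H; apply: Zx; apply: HZ => /= /(_ Ox).
by have [_ _ ->] := level_trunc (u x) a0 ab.
Qed.

End level.

(** * Elementary estimates for Young functions *)

Section young_facts.
Context {R : realType}.
Implicit Types (A : R -> \bar R).

Lemma young_le_scale A s t : young A -> 0 <= s <= t -> 0 < t -> (A s <= (s / t)%:E * A t)%E.
Proof.
move=> yA /andP[s0 st] t0.
have := young_convex yA (ltW t0) (lexx 0) (_ : 0 <= s / t <= 1).
rewrite mulr0 addr0 mulfVK ?gt_eqF// (young0 yA) mule0 adde0; apply.
by rewrite divr_ge0 ?(ltW t0)//= ler_pdivrMr// mul1r.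
Qed.

Lemma young_homo A s t : young A -> 0 <= s <= t -> (A s <= A t)%E.
Proof.
move=> yA /andP[s0 st]; have [t0|t0] := ltP 0 t; last first.
  by have -> : s = t by apply/eqP; rewrite eq_le st (le_trans t0).
apply: (le_trans (young_le_scale yA _ t0)); first by rewrite s0.
by rewrite gee_pMl ?young_ge0 ?(ltW t0)// lee_fin ler_pdivrMr// mul1r.
Qed.

(** Stands in for a triangle inequality: a sum is estimated through the midpoint, at the price of a
    factor 2 in the argument. *)
Lemma young_mid A x s t : young A -> 0 <= s -> 0 <= t -> 0 <= x -> x <= (s + t) / 2 -> (A x <= A s + A t)%E.
Proof.
move=> yA s0 t0 x0 xst; have h0 : 0 <= (2^-1 : R) <= 1 by apply/andP; split; lra.
apply: (@le_trans _ _ (A (2^-1 * s + (1 - 2^-1) * t))).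
  by apply: (young_homo yA); rewrite x0/=; apply: le_trans xst _; lra.
apply: (le_trans (young_convex yA s0 t0 h0)); apply: leeD.
  by rewrite gee_pMl ?young_ge0// lee_fin; lra.
by rewrite gee_pMl ?young_ge0// lee_fin; lra.
Qed.

Lemma young_finite_somewhere A : young A -> exists2 t, 0 < t & (A t < +oo)%E.
Proof.
move=> yA; have [s [t [s0 t0 st]]] := young_nonconstant yA.
have [As|As] := ltP (A s) +oo%E; first by exists s.
exists t => //; rewrite ltNge leye_eq; apply/negP => /eqP At.
by move: st; rewrite At; move: As; rewrite leye_eq => /eqP ->; rewrite eqxx.
Qed.

Lemma young_positive_somewhere A : young A -> exists2 t, 0 < t & (0 < A t)%E.
Proof.
move=> yA; have [s [t [s0 t0 st]]] := young_nonconstant yA.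
have [As|As] := ltP 0%E (A s); first by exists s.
exists t => //; rewrite lt_neqAle (young_ge0 yA (ltW t0)) andbT.
by move: st; have -> : A s = 0%E by apply/eqP; rewrite eq_le As young_ge0// ltW.
Qed.

Lemma young_small A : young A -> exists t c : R, [/\ 0 < t, 0 <= c &
  forall s, 0 <= s <= t -> (A s <= (c * s)%:E)%E].
Proof.
move=> yA; have [t t0 At] := young_finite_somewhere yA.
have Atf : A t \is a fin_num by rewrite ge0_fin_numE// young_ge0// ltW.
exists t, (fine (A t) / t); split => // [|s st].
  by rewrite divr_ge0 ?fine_ge0 ?young_ge0// ltW.
apply: (le_trans (young_le_scale yA st t0)).
by rewrite -{1}(fineK Atf) -EFinM lee_fin [leRHS]mulrC mulrA [leRHS]mulrAC.
Qed.

(** Beyond a point where [A] is positive, [A] lies above a line through the origin; [d] covers the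
    part before. This turns modular bounds into local L^1 bounds. *)
Lemma young_linear A : young A -> exists c d : R, [/\ 0 < c, 0 <= d &
  forall t, 0 <= t -> ((c * t)%:E <= A t + d%:E)%E].
Proof.
move=> yA; have [t t0 At] := young_positive_somewhere yA.
have [x [x0 xA]] : exists x : R, 0 < x /\ (x%:E <= A t)%E.
  case: (A t) At => [r|_|//]; first by rewrite lte_fin => r0; exists r.
  by exists 1; rewrite leey.
exists (x / t), x; split; [exact: divr_gt0|exact: ltW|move=> s s0].
have [st|ts] := leP s t.
  apply: (@le_trans _ _ x%:E); last by rewrite leeDr// young_ge0.
  by rewrite lee_fin mulrAC ler_pdivrMr// ler_wpM2l// ltW.
have s0' : 0 < s by exact: lt_trans ts.
apply: (@le_trans _ _ (A s)); last by rewrite leeDl// lee_fin ltW.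
have ts1 : 0 <= t <= s by rewrite !ltW.
have := le_trans xA (young_le_scale yA ts1 s0'); rewrite muleC -lee_pdivrMr ?divr_gt0// -EFinM.
by rewrite invf_div mulrA mulrAC.
Qed.

Lemma measurable_young A : young A -> measurable_fun setT (fun t : measurableTypeR R => A `|t|).
Proof.
move=> yA; apply: (measurability _ (ErealGenOInfty.measurableE R)) => // _ [_ [x ->] <-]; rewrite setTI.
rewrite -[X in measurable X]setCK; apply: measurableC; apply: is_interval_measurable => s t.
rewrite /= => As At r /andP[sr rt]; rewrite in_itv/= andbT => Ar.
move: As At; rewrite !in_itv/= !andbT => As At.
have [rs|rs] := leP `|r| `|s|.
  by apply: As; apply: lt_le_trans Ar _; apply: young_homo => //; rewrite normr_ge0.
apply: At; apply: lt_le_trans Ar _; apply: young_homo => //; rewrite normr_ge0/=.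
have [r0|r0] := leP 0 r; first by rewrite !ger0_norm// (le_trans r0).
by move: rs; rewrite (ltr0_norm r0) (ltr0_norm (le_lt_trans sr r0)) ltrN2 ltNge sr.
Qed.

Lemma young_ivt A (a b y : R) : young A -> (forall t, 0 <= t -> (A t < +oo)%E) -> 0 <= a -> a <= b ->
  (A a <= y%:E <= A b)%E -> exists2 t, a <= t <= b & A t = y%:E.
Proof.
move=> yA Af a0 ab /andP[ya yb].
have Afin t : 0 <= t -> A t = (fine (A t))%:E by move=> t0; rewrite fineK// ge0_fin_numE ?Af// young_ge0.
pose A' t := fine (A t).
have A'0 t : 0 <= t -> 0 <= A' t by move=> t0; rewrite fine_ge0// young_ge0.
have b0 := le_trans a0 ab.
have mono s t : 0 <= s <= t -> A' s <= A' t.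
  by move=> st; rewrite -lee_fin -!Afin ?young_homo//; case/andP: st => // /le_trans; apply.
(* Convexity between [s] and [b + 1] bounds the slope on [[a, b]]; the margin 1 keeps the
   denominator [b + 1 - s] at least 1. *)
have lip s t : a <= s -> s <= t -> t <= b -> A' t - A' s <= A' (b + 1) * (t - s).
  move=> as_ st tb; have s0 := le_trans a0 as_.
  pose p := (t - s) / (b + 1 - s); have d0 : 0 < b + 1 - s by lra.
  have p01 : 0 <= p <= 1.
    apply/andP; split; first by apply: divr_ge0; [rewrite subr_ge0|exact: ltW].
    by rewrite /p ler_pdivrMr// mul1r; lra.
  have := young_convex yA (_ : 0 <= b + 1) s0 p01.
  have -> : p * (b + 1) + (1 - p) * s = t.
    by rewrite mulrBl mul1r addrCA -mulrBr /p mulfVK ?gt_eqF//; lra.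
  rewrite (Afin _ s0) (Afin (b + 1)) ?addr_ge0// (Afin t) ?(le_trans s0)// -!EFinM -EFinD lee_fin -/(A' t) -/(A' s) -/(A' (b + 1)).
  move=> /(_ isT) H; have B0 := A'0 (b + 1) (addr_ge0 b0 ler01); have S0 := A'0 s s0.
  have p1 : p <= t - s.
    rewrite /p ler_pdivrMr//; rewrite ler_peMr//; lra.
  have := ler_wpM2l B0 p1; have := mulr_ge0 (proj1 (andP p01)) S0; nra.
have cont : {within `[a, b], continuous A'}.
  apply/subspace_continuousP => x; rewrite /= in_itv/= => /andP[ax xb].
  apply/cvgrPdist_le => e e0; pose K := A' (b + 1) + 1.
  have K0 : 0 < K by rewrite ltr_wpDl// A'0// addr_ge0.
  have nb : \forall t \near x, `|x - t| <= e / K.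
    by apply/nbhs_ballP; exists (e / K); [exact: divr_gt0|move=> t /ltW].
  rewrite near_withinE; apply: filterS nb => t td tab.
  have /andP[at_ tb] : a <= t <= b by move: tab; rewrite /= in_itv.
  have KL z : 0 <= z -> A' (b + 1) * z <= K * z by move=> z0; rewrite ler_wpM2r// lerDl.
  have ee : K * (e / K) = e by rewrite mulrC mulfVK ?gt_eqF.
  have [xt|tx] := leP x t.
    have := lip _ _ ax xt tb; have := mono x t; rewrite (le_trans a0 ax) xt => /(_ isT) m1 l1.
    have tx0 : 0 <= t - x by lra.
    rewrite distrC ger0_norm ?subr_ge0//; rewrite distrC ger0_norm// in td.
    apply: (le_trans l1); apply: (le_trans (KL _ tx0)); rewrite -ee ler_wpM2l// ltW//.
  have := lip _ _ at_ (ltW tx) xb; have := mono t x; rewrite (le_trans a0 at_) (ltW tx) => /(_ isT) m1 l1.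
  have tx0 : 0 <= x - t by lra.
  rewrite ger0_norm ?subr_ge0//; rewrite ger0_norm// in td.
  apply: (le_trans l1); apply: (le_trans (KL _ tx0)); rewrite -ee ler_wpM2l// ltW//.
have [|c] := IVT ab cont (v := y).
  have ab' : A' a <= A' b by apply: mono; rewrite a0.
  by rewrite min_l// max_r// -!lee_fin -!Afin// ya.
by rewrite in_itv/= => /andP[ac cb] Ac; exists c; rewrite ?ac ?cb// Afin ?(le_trans a0)//; congr (_%:E).
Qed.

End young_facts.

(** * The integrand of H_n and its level sets *)

Section sobolev_integrand.
Context {R : realType} (n : nat).
Hypothesis n1 : (1 < n)%N.
Variable A : R -> \bar R.
Hypotheses (yA : young A).
Local Notation p := (n.-1%:R^-1 : R).

Lemma predn_pos : (0 < n.-1)%N. Proof. by rewrite -ltnS prednK// (ltn_trans _ n1). Qed.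

Lemma inv_predn_gt0 : 0 < p. Proof. by rewrite invr_gt0 ltr0n predn_pos. Qed.

Lemma sobolev_integrand_fin s : 0 < s -> (0 < A s)%E -> (A s < +oo)%E ->
  sobolev_integrand n A s = ((s / fine (A s)) `^ p)%:E.
Proof.
move=> s0 A0 As; have Af : A s \is a fin_num by rewrite ge0_fin_numE// young_ge0// ltW.
rewrite /sobolev_integrand -{1}(fineK Af) inver; case: eqP => [A0'|_]; last by rewrite -EFinM poweR_EFin.
by move: A0; rewrite -(fineK Af) A0' ltxx.
Qed.

Lemma sobolev_integrand_infty s : 0 < s -> A s = 0%E -> sobolev_integrand n A s = +oo%E.
Proof.
move=> s0 A0; rewrite /sobolev_integrand A0 inve0 gt0_muley ?lte_fin//.
by rewrite poweRyr// gt_eqF// inv_predn_gt0.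
Qed.

Lemma sobolev_integrand_ge0 s : (0 <= sobolev_integrand n A s)%E.
Proof. exact: poweR_ge0. Qed.

(** Convexity makes [t / A t] nonincreasing; the other cases are the conventions for infinite and
    vanishing values. *)
Lemma sobolev_integrand_anti s t : 0 < s -> s <= t -> (sobolev_integrand n A t <= sobolev_integrand n A s)%E.
Proof.
move=> s0 st; have t0 := lt_le_trans s0 st.
have [At|] := ltP (A t) +oo%E; last first.
  rewrite leye_eq => /eqP At; rewrite /sobolev_integrand At invey mule0 poweR0r ?poweR_ge0//.
  by rewrite gt_eqF// inv_predn_gt0.
have As : (A s < +oo)%E by apply: le_lt_trans At; apply: (young_homo yA); rewrite st ltW.
have [As0|As0] := eqVneq (A s) 0%E; first by rewrite (sobolev_integrand_infty s0 As0) leey.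
have {}As0 : (0 < A s)%E by rewrite lt_neqAle eq_sym As0 young_ge0// ltW.
have At0 : (0 < A t)%E by apply: lt_le_trans As0 _; apply: (young_homo yA); rewrite st ltW.
rewrite !sobolev_integrand_fin// lee_fin; apply: ge0_ler_powR.
- exact: ltW inv_predn_gt0.
- by rewrite nnegrE divr_ge0 ?(ltW t0) ?fine_ge0 ?young_ge0// ltW.
- by rewrite nnegrE divr_ge0 ?(ltW s0) ?fine_ge0 ?young_ge0// ltW.
have pos r : (0 < A r)%E -> (A r < +oo)%E -> 0 < fine (A r) by move=> r0 Ar; rewrite fine_gt0// r0 Ar.
rewrite ler_pdivrMr ?pos// mulrAC ler_pdivlMr ?pos//.
have := young_le_scale yA (_ : 0 <= s <= t) t0; rewrite st (ltW s0) => /(_ isT).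
rewrite -{1}(@fineK _ (A s)) ?ge0_fin_numE ?young_ge0 ?(ltW s0)//.
rewrite -{1}(@fineK _ (A t)) ?ge0_fin_numE ?young_ge0 ?(ltW t0)// -EFinM lee_fin.
by rewrite mulrAC ler_pdivlMr// mulrC.
Qed.

Lemma measurable_sobolev_integrand (D : set (measurableTypeR R)) : measurable D -> (forall x, D x -> 0 < x) ->
  measurable_fun D (sobolev_integrand n A : measurableTypeR R -> \bar R).
Proof.
move=> mD D0; have sub : D `<=` `]0, +oo[%classic by move=> x /D0; rewrite /= in_itv/= andbT.
apply: (measurable_funS _ sub); first exact: measurable_itv.
apply: (measurability _ (ErealGenOInfty.measurableE R)) => // _ [_ [x ->] <-].
apply: is_interval_measurable => s t; rewrite /= !in_itv/= !andbT => -[s0 xs] [t0 xt] r /andP[sr rt].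
rewrite !in_itv/= !andbT in xs xt *; split; first exact: lt_le_trans sr.
by apply: lt_le_trans xt _; apply: sobolev_integrand_anti => //; exact: lt_le_trans sr.
Qed.

Hypothesis ndA : nondegenerate_young A.

Lemma sobolev_integrandE s : 0 < s -> (A s < +oo)%E ->
  sobolev_integrand n A s = ((s / fine (A s)) `^ p)%:E.
Proof. by move=> s0; apply: sobolev_integrand_fin => //; exact: ndA. Qed.

Lemma sobolev_integrand_ge k s : 0 < k -> 0 < s -> ((k ^+ n.-1)%:E * A s <= s%:E)%E ->
  (k%:E <= sobolev_integrand n A s)%E.
Proof.
move=> k0 s0 kA; have kn0 : 0 < k ^+ n.-1 by exact: exprn_gt0.
have As : (A s < +oo)%E.
  rewrite ltNge leye_eq; apply/negP => /eqP Aoo; move: kA.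
  by rewrite Aoo gt0_muley ?lte_fin.
have Af : A s \is a fin_num by rewrite ge0_fin_numE// young_ge0// ltW.
have a0 : 0 < fine (A s) by rewrite fine_gt0// ndA//= As.
rewrite sobolev_integrandE// lee_fin.
have -> : k = (k ^+ n.-1) `^ p.
  by rewrite -powR_mulrn ?(ltW k0)// -powRrM mulfV ?powRr1 ?(ltW k0)// pnatr_eq0 -lt0n predn_pos.
apply: ge0_ler_powR; rewrite ?nnegrE.
- exact: ltW inv_predn_gt0.
- exact: ltW.
- by rewrite divr_ge0 ?ltW.
by rewrite ler_pdivlMr// -lee_fin EFinM fineK.
Qed.

End sobolev_integrand.

(** The selected terms of a geometric sequence of ratio 1/2 add up to at most twice the first
    selected one. *)
Lemma geometric_indicator_sum {R : realType} (J : nat) (r x : R) (b : nat -> bool) : 0 <= r -> 0 <= x ->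
  (forall j, (j < J)%N -> b j -> r / 2 ^+ j <= x) ->
  \sum_(j < J) (b j)%:R * (r / 2 ^+ j) <= 2 * x.
Proof.
elim: J r x b => [|J ih] r x b r0 x0 bx; first by rewrite big_ord0; apply: mulr_ge0.
rewrite big_ord_recl/= expr0 divr1.
have E (y : R) : 0 <= y -> (forall j, (j < J)%N -> b j.+1 -> (r / 2) / 2 ^+ j <= y) ->
    \sum_(i < J) (b (bump 0 i))%:R * (r / 2 ^+ bump 0 i) <= 2 * y.
  move=> y0 H; rewrite (eq_bigr (fun i : 'I_J => (b i.+1)%:R * ((r / 2) / 2 ^+ i))); last first.
    by move=> i _; rewrite (_ : bump 0 i = i.+1)// exprS invfM [r * (_ * _)]mulrA.
  by apply: (ih _ _ (fun j => b j.+1)) => //; exact: divr_ge0.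
have [b0|b0] := boolP (b 0%N); last first.
  rewrite mul0r add0r; apply: E => // j jJ bj.
  by have := bx j.+1 jJ bj; rewrite exprS invfM mulrA.
have := bx 0%N (ltn0Sn _) b0; rewrite expr0 divr1 => rx.
have r20 : 0 <= r / 2 by exact: divr_ge0.
have H := E (r / 2) r20; rewrite mul1r.
have : \sum_(i < J) (b (bump 0 i))%:R * (r / 2 ^+ bump 0 i) <= 2 * (r / 2).
  apply: H => j jJ _; rewrite ler_pdivrMr ?exprn_gt0// ler_peMr ?divr_ge0//.
  by rewrite exprn_ege1// ler1n.
rewrite mulrCA divff ?mulr1 ?pnatr_eq0// => H1; lra.
Qed.

(** An initial interval of the half-line, by convexity. Off it [s] is at most [k * A s], so a
    gradient value is absorbed by the energy; on it the value is bounded by the length of the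
    interval. *)
Definition sublinear_set {R : realType} (A : R -> \bar R) (k : R) : set (measurableTypeR R) :=
  [set s | (0 < s)%R /\ (k%:E * A s < s%:E)%E].

Section sublinear_set.
Context {R : realType}.
Variables (A : R -> \bar R) (k : R).
Hypotheses (yA : young A) (k0 : 0 <= k).
Local Notation P := (sublinear_set A k).

Lemma sublinear_set_down s t : 0 < s -> s <= t -> P t -> P s.
Proof.
move=> s0 st [t0 Pt]; split => //; apply: (@le_lt_trans _ _ ((s / t)%:E * (k%:E * A t))%E).
  rewrite muleCA; apply: lee_wpmul2l; first by rewrite lee_fin.
  by apply: (young_le_scale yA) => //; rewrite st ltW.
have -> : s%:E = ((s / t)%:E * t%:E)%E by rewrite -EFinM mulfVK// gt_eqF.
by rewrite lte_pmul2l// lte_fin divr_gt0.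
Qed.

Lemma measurable_sublinear_set : measurable P.
Proof.
apply: is_interval_measurable => s t Ps Pt r /andP[sr rt].
by apply: sublinear_set_down Pt => //; case: Ps => s0 _; exact: lt_le_trans sr.
Qed.

Lemma sublinear_set_lty (a b : R) : (lebesgue_measure (`]a, b] `&` P) < +oo)%E.
Proof.
apply: (@le_lt_trans _ _ (lebesgue_measure (`]a, b]%classic : set (measurableTypeR R)))).
  apply: le_measure; rewrite ?inE; [|exact: measurable_itv|exact: subIsetl].
  by apply: measurableI; [exact: measurable_itv|exact: measurable_sublinear_set].
by rewrite (lebesgue_measure_itv `]_, _])/=; case: ifP => _; rewrite ?ltry// -EFinB ltry.
Qed.

(** The hypothesis on [S] keeps the sublinear set below [S], so that its length beyond [S0] is
    measured in []S0, S]]. *)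
Lemma linear_cut (S0 S g : R) : 0 <= S0 -> 0 < S -> (S%:E <= k%:E * A S)%E -> 0 <= g ->
  (g%:E <= (S0 + fine (lebesgue_measure (`]S0, S] `&` P)))%:E + k%:E * A g)%E.
Proof.
move=> S00 Sp kAS g0; have kA0 : (0 <= k%:E * A g)%E by apply: mule_ge0 => //; exact: young_ge0.
have w0 : 0 <= fine (lebesgue_measure (`]S0, S] `&` P)) by rewrite fine_ge0.
have [Pg|Pg] := pselect (P g); last first.
  have [gA|gA] := leP g%:E (k%:E * A g)%E; first by rewrite lee_paddl// lee_fin addr_ge0.
  have [->|gn0] := eqVneq g 0; first by apply: adde_ge0; rewrite ?lee_fin ?addr_ge0//; apply: mule_ge0 => //; exact: young_ge0.
  by exfalso; apply: Pg; split => //; rewrite lt_neqAle eq_sym gn0.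
apply: (@le_trans _ _ (S0 + fine (lebesgue_measure (`]S0, S] `&` P)))%:E); last by rewrite leeDl.
have gS : g <= S.
  rewrite leNgt; apply/negP => Sg; have [_] := sublinear_set_down Sp (ltW Sg) Pg.
  by rewrite ltNge kAS.
have [gS0|S0g] := leP g S0; first by rewrite lee_fin (le_trans gS0)// lerDl.
rewrite EFinD fineK ?ge0_fin_numE ?sublinear_set_lty// -leeBlDl// -EFinB.
have -> : ((g - S0)%:E = lebesgue_measure (`]S0, g]%classic : set (measurableTypeR R)))%E.
  by rewrite (lebesgue_measure_itv `]_, _])/= lte_fin S0g.
apply: le_measure; rewrite ?inE; first exact: measurable_itv.
  by apply: measurableI; [exact: measurable_itv|exact: measurable_sublinear_set].
move=> s /=; rewrite !in_itv/= => /andP[S0s sg]; split; first by rewrite S0s (le_trans sg).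
by apply: sublinear_set_down Pg => //; exact: le_lt_trans S0s.
Qed.

End sublinear_set.

(** Exchange sum and integral: [s] lies in the set of index [j] only if [th * (r / 2 ^+ j)] is at
    most the integrand at [s], and such radii form a geometric sum. This is where the integral
    defining [H_n] enters. *)
Lemma sublinear_sets_sum {R : realType} (n : nat) (A : R -> \bar R) (r th S0 S X : R) (J : nat) :
  (1 < n)%N -> young A -> nondegenerate_young A -> 0 < r -> 0 < th -> 0 <= S0 ->
  (\int[lebesgue_measure]_(s in `]S0, S]) sobolev_integrand n A s <= X%:E)%E ->
  \sum_(j < J) r / 2 ^+ j * fine (lebesgue_measure (`]S0, S] `&`
     sublinear_set A ((th * (r / 2 ^+ j)) ^+ n.-1))) <= 2 * X / th.
Proof.
move=> n1 yA ndA r0 th0 S00 intX; pose k j := (th * (r / 2 ^+ j)) ^+ n.-1.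
have rj0 j : 0 < r / 2 ^+ j by rewrite divr_gt0// exprn_gt0.
have k0 j : 0 < k j by rewrite exprn_gt0// mulr_gt0.
pose D : set (measurableTypeR R) := `]S0, S]%classic.
have mD : measurable D by exact: measurable_itv.
have mP j : measurable (sublinear_set A (k j)) by apply: measurable_sublinear_set => //; exact: ltW.
rewrite -lee_fin -sumEFin.
have -> : (\sum_(j < J) (r / 2 ^+ j * fine (lebesgue_measure (`]S0, S] `&` sublinear_set A (k j))))%:E)%E =
   (\int[lebesgue_measure]_(s in D) \sum_(j < J) (r / 2 ^+ j * \1_(sublinear_set A (k j)) s)%:E)%E.
  rewrite ge0_integral_sum//; last 2 first.
  - move=> j; apply/measurable_EFinP; apply: measurable_funM => //; exact: measurable_indic.
  - by move=> j s _; rewrite lee_fin mulr_ge0// ltW.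
  apply: eq_bigr => j _; under eq_integral do rewrite EFinM.
  rewrite ge0_integralZl//; last 2 first.
  - by apply/measurable_EFinP; exact: measurable_indic.
  - by rewrite lee_fin ltW.
  rewrite integral_indic// EFinM fineK; first by rewrite setIC.
  by rewrite ge0_fin_numE//; exact: (sublinear_set_lty yA (ltW (k0 j))).
rewrite mulrAC EFinM.
apply: (@le_trans _ _ ((2 / th)%:E * \int[lebesgue_measure]_(s in D) sobolev_integrand n A s)%E); last first.
  by apply: lee_wpmul2l => //; rewrite lee_fin divr_ge0// ltW.
have pos s : D s -> 0 < s by rewrite /D /= in_itv/= => /andP[/(le_lt_trans S00)].
have msig := measurable_sobolev_integrand n1 yA mD pos.
rewrite -ge0_integralZl//; last 2 first.
- by move=> s _; exact: sobolev_integrand_ge0.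
- by rewrite lee_fin divr_ge0// ltW.
apply: ge0_le_integral => //.
- by move=> s _; apply: sume_ge0 => j _; rewrite lee_fin mulr_ge0// ltW.
- apply: emeasurable_sum => j; apply/measurable_EFinP; apply: measurable_funM => //; exact: measurable_indic.
- exact: measurable_funeM.
move=> s Ds; have s0 := pos s Ds.
case E : (sobolev_integrand n A s) => [x| |]; last 2 first.
- by rewrite gt0_muley ?leey// lte_fin divr_gt0.
- by have := @sobolev_integrand_ge0 R n A s; rewrite E.
have x0 : 0 <= x by rewrite -lee_fin -E; exact: sobolev_integrand_ge0.
rewrite sumEFin -EFinM lee_fin mulrAC -mulrA.
under eq_bigr do rewrite mulrC indicE.
apply: (geometric_indicator_sum (b := fun j => s \in sublinear_set A (k j)) (ltW r0)) => [|j _ /set_mem Pj].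
  by rewrite divr_ge0// ltW.
rewrite ler_pdivlMr// mulrC -lee_fin -E; apply: sobolev_integrand_ge => //; first exact: mulr_gt0.
by case: Pj => _ /ltW.
Qed.

(** * Widths of the layers between two levels *)

Section superlevel.
Context {R : realType} (n : nat).
Local Notation mu := (@borel_lebesgue R n).
Implicit Types (O : set 'rV[R]_n) (u : 'rV[R]_n -> R).

Lemma measurable_level O u (D : set (measurableTypeR R)) : measurable O -> measurable_fun setT u ->
  measurable D -> measurable (O `&` [set x | D `|u x|]).
Proof.
move=> mO mu_ mD; apply: measurableI => //; rewrite -[X in measurable X]setTI.
have mabs : measurable_fun setT (fun x : 'rV[R]_n => `|u x|) by exact: measurableT_comp.
exact: mabs.
Qed.

Definition superlevel O u (t : R) := O `&` [set x | (t < `|u x|)%R].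
Definition slice O u (a b : R) := O `&` [set x | (a < `|u x| < b)%R].

Lemma measurable_superlevel O u t : measurable O -> measurable_fun setT u -> measurable (superlevel O u t).
Proof.
move=> mO mu_; have -> : superlevel O u t = O `&` [set x | `]t, +oo[%classic `|u x|].
  by apply/seteqP; split => x /=; rewrite /superlevel /= in_itv/= andbT.
by apply: measurable_level => //; exact: measurable_itv.
Qed.

Lemma measurable_slice O u a b : measurable O -> measurable_fun setT u -> measurable (slice O u a b).
Proof.
move=> mO mu_; have -> : slice O u a b = O `&` [set x | `]a, b[%classic `|u x|].
  by apply/seteqP; split => x /=; rewrite /slice /= in_itv/=.
by apply: measurable_level => //; exact: measurable_itv.
Qed.

Lemma measurable_superlevel_ge O u t : measurable O -> measurable_fun setT u ->
  measurable (O `&` [set x | (t <= `|u x|)%R]).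
Proof.
move=> mO mu_; have -> : O `&` [set x | (t <= `|u x|)%R] = O `&` [set x | `[t, +oo[%classic `|u x|].
  by apply/seteqP; split => x /=; rewrite /= in_itv/= andbT.
by apply: measurable_level => //; exact: measurable_itv.
Qed.

Lemma superlevel_anti O u s t : measurable O -> measurable_fun setT u -> s <= t ->
  (mu (superlevel O u t) <= mu (superlevel O u s))%E.
Proof.
move=> mO mu_ st; apply: le_measure; rewrite ?inE; [exact: measurable_superlevel..|].
by move=> x [Ox /= tx]; split => //=; exact: le_lt_trans tx.
Qed.

(** The layer on which the superlevel measure falls from [r ^+ n] to [(r / 2) ^+ n]. The gradient is
    split by [linear_cut], and the term [(b - a) * r ^+ n] coming from the extension is absorbed on
    the left thanks to [2 ^+ n * C * r <= 1]. *)
Lemma level_step O (C : R) u G A (a b r th S0 S : R) : borel_extension O C -> (1 < n)%N -> 0 < C ->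
  open O -> (forall i, borel_weak O i u (G i)) -> young A ->
  0 < a -> a < b -> 0 < r -> 2 ^+ n * C * r <= 1 -> 0 < th -> 0 <= S0 -> 0 < S ->
  (S%:E <= ((th * r) ^+ n.-1)%:E * A S)%E ->
  (mu (superlevel O u a) <= (r ^+ n)%:E)%E -> (((r / 2) ^+ n)%:E <= mu (superlevel O u b))%E ->
  forall F : R, (\int[mu]_(x in slice O u a b) A (gradnorm G x) <= F%:E)%E ->
  b - a <= 2 ^+ n * C * (r * (S0 + fine (lebesgue_measure (`]S0, S] `&` sublinear_set A ((th * r) ^+ n.-1))))
    + th ^+ n.-1 * F).
Proof.
move=> ext n1 C0 oO uG yA a0 ab r0 Cr th0 S00 Sp SA Na Nb F HF.
set k := (th * r) ^+ n.-1 in SA *; set P := sublinear_set _ _; set s := S0 + _.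
have mO := open_measurable_rV oO; pose i0 : 'I_n := Ordinal (ltnW n1).
have mu_ : measurable_fun setT u by case: (uG i0).
have mG i : measurable_fun setT (G i) by case: (uG i).
have k0 : 0 <= k by rewrite exprn_ge0// mulr_ge0// ltW.
have s0 : 0 <= s by rewrite addr_ge0// fine_ge0.
have mS := measurable_slice a b mO mu_.
have mAG D : measurable D -> measurable_fun D (fun x => A (gradnorm G x)).
  move=> mD; apply: measurable_funTS; rewrite (_ : (fun x => _) = (fun t : measurableTypeR R => A `|t|) \o gradnorm G).
    by apply: measurableT_comp; [exact: measurable_young|exact: measurable_gradnorm].
  by apply/funext => x /=; rewrite ger0_norm// gradnorm_ge0.
have F0 : 0 <= F.
  by rewrite -lee_fin; apply: le_trans HF; apply: integral_ge0 => x _; rewrite young_ge0// gradnorm_ge0.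
have HI : (\int[mu]_(x in slice O u a b) (gradnorm G x)%:E <= (s * r ^+ n + k * F)%:E)%E.
  apply: (@le_trans _ _ (\int[mu]_(x in slice O u a b) (s%:E + k%:E * A (gradnorm G x)))%E).
    apply: ge0_le_integral => //.
    - by move=> x _; rewrite lee_fin gradnorm_ge0.
    - by apply/measurable_EFinP; apply: measurable_funTS; exact: measurable_gradnorm.
    - by apply: emeasurable_funD => //; apply: measurable_funeM; exact: mAG.
    - by move=> x _; apply: linear_cut => //; exact: gradnorm_ge0.
  rewrite ge0_integralD//; last 2 first.
  - by move=> x _; apply: mule_ge0 => //; rewrite young_ge0// gradnorm_ge0.
  - by apply: measurable_funeM; exact: mAG.
  rewrite integral_cst// ge0_integralZl//; last 2 first.
  - exact: mAG.
  - by move=> x _; rewrite young_ge0// gradnorm_ge0.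
  rewrite [leRHS]EFinD (EFinM s) (EFinM k); apply: leeD; apply: lee_wpmul2l; rewrite ?lee_fin//.
  apply: le_trans Na; apply: le_measure; rewrite ?inE//; first exact: measurable_superlevel.
  by move=> x [Ox /= /andP[? _]]; split.
have rn0 : 0 < r ^+ n by exact: exprn_gt0.
have ba0 : 0 < b - a by rewrite subr_gt0.
have c0 : 0 < C * ((b - a) * r ^+ n + (s * r ^+ n + k * F)).
  apply: mulr_gt0 => //; apply: ltr_pwDl; first exact: mulr_gt0.
  by apply: addr_ge0; apply: mulr_ge0 => //; exact: ltW.
have r2 : 0 <= (r / 2) ^+ n by rewrite exprn_ge0// divr_ge0// ltW.
have Nb' : (((r / 2) ^+ n)%:E <= mu (O `&` [set x | (b <= `|u x|)%R]))%E.
  apply: (le_trans Nb); apply: le_measure; rewrite ?inE; [exact: measurable_superlevel|exact: measurable_superlevel_ge|].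
  by move=> x [Ox /= ?]; split => //=; exact: ltW.
have := level_inequality ext n1 (ltW C0) oO uG a0 ab c0 r2 Na HI Nb' (lexx _).
have n1' := predn_pos n1.
(* Both sides are [n]-th powers; taking roots leaves [(r / 2) ^+ n.-1] against [c / (b - a)]. *)
rewrite -exprM mulnC exprM ler_pXn2r ?nnegrE; last 3 first.
- by rewrite (ltn_trans _ n1).
- by rewrite exprn_ge0// divr_ge0// ltW.
- by rewrite divr_ge0// ltW.
rewrite ler_pdivlMr// => H.
have E : r ^+ n = r * r ^+ n.-1 by rewrite -exprS prednK// (ltn_trans _ n1).
have E2 : 2 ^+ n = 2 * 2 ^+ n.-1 :> R by rewrite -exprS prednK// (ltn_trans _ n1).
have q0 : 0 < r ^+ n.-1 by exact: exprn_gt0.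
have t0 : 0 < 2 ^+ n.-1 :> R by exact: exprn_gt0.
move: H; rewrite expr_div_n /k exprMn E -mulrA [_ * (b - a)]mulrC => H.
have {}H : (b - a) / 2 ^+ n.-1 <= C * ((b - a) * r + (s * r + th ^+ n.-1 * F)).
  rewrite -(ler_pM2l q0); apply: (le_trans _ (le_trans H _)); first by rewrite mulrA [_ * (b - a)]mulrC mulrA.
  by rewrite le_eqVlt; apply/orP; left; apply/eqP; ring.
move: H; rewrite ler_pdivrMr// => H.
have : 2 ^+ n * C * r * (b - a) <= b - a by rewrite ler_piMl// ltW.
rewrite E2; nra.
Qed.

(* Splitting [a, b] at the points where the nonincreasing function [N] crosses
   the levels [p 1], ..., [p J.-1]. *)
Lemma level_chain (N : R -> \bar R) (L : R -> R -> R) (K : R) (J : nat) (p q : nat -> R) (a b : R) :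
  (forall s t, s <= t -> (N t <= N s)%E) -> 0 <= K -> (forall x y, 0 <= L x y) -> (forall j, 0 <= q j) ->
  (forall x y z w, x <= z -> y <= w -> y <= z -> L x y + L z w <= L x w) -> a < b ->
  (N a <= (p 0%N)%:E)%E -> (forall t, t < b -> ((p J)%:E < N t)%E) ->
  (forall j a' b', (j < J)%N -> a <= a' -> a' < b' -> b' <= b -> (N a' <= (p j)%:E)%E ->
     ((p j.+1)%:E <= N b')%E -> b' - a' <= q j + K * L a' b') ->
  b - a <= \sum_(j < J) q j + K * L a b.
Proof.
move=> Nd K0 L0 q0 Ls; elim: J p q q0 a => [|J ih] p q q0 a ab Na Nb step.
  by have := Nb a ab; rewrite ltNge Na.
(* [b] is put in by hand so that the infimum [tau], the first crossing of [p 1], exists and is at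
   most [b]. *)
pose T := [set t | a <= t <= b /\ ((N t <= (p 1%N)%:E)%E \/ t = b)].
have Tb : T b by split; [rewrite lexx ltW|right].
have hT : has_inf T by split; [exists b|exists a => t [/andP[]]].
pose tau := inf T.
have atau : a <= tau by apply: lb_le_inf; [exists b|move=> t [/andP[]]].
have taub : tau <= b by apply: ge_inf => //; case: hT.
apply/ler_addgt0Pr => e2 e20; pose e := e2 / 2; have e0 : 0 < e by exact: divr_gt0.
(* The side of the threshold on which [N tau] falls is unknown, so one piece ends a distance [e]
   before [tau] and the other starts a distance [e] after it. *)
have S1 : tau - e - a <= q 0%N + K * L a (tau - e).
  have [ta|ta] := leP (tau - e) a.
    by apply: (@le_trans _ _ 0); [lra|rewrite addr_ge0// mulr_ge0].
  apply: step => //; first by lra.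
  apply: ltW; rewrite ltNge; apply/negP => H.
  have : T (tau - e) by split; [apply/andP; split; lra|left].
  by move=> /(ge_inf (proj2 hT)); rewrite -/tau; lra.
have S2 : b - (tau + e) <= \sum_(j < J) q j.+1 + K * L (tau + e) b.
  have [ta|ta] := leP b (tau + e).
    by apply: (@le_trans _ _ 0); [lra|rewrite addr_ge0// ?mulr_ge0// sumr_ge0].
  apply: (ih (fun j => p j.+1) (fun j => q j.+1)) => //.
    have [t [[_ [Nt|tb]] te]] : exists t, T t /\ t < tau + e.
    - by have [t Tt te] := inf_adherent e0 hT; exists t.
    - by apply: le_trans Nt; apply: Nd; exact: ltW.
    - by exfalso; move: te; rewrite tb => te; lra.
  by move=> j a' b' jJ aa'; apply: (step j.+1) => //; lra.
rewrite big_ord_recl /=; have := Ls a (tau - e) (tau + e) b; rewrite /bump/= => H.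
have {}H : L a (tau - e) + L (tau + e) b <= L a b by apply: H; lra.
have := ler_wpM2l K0 H; rewrite mulrDr.
have -> : \sum_(i < J) q (1 + i)%N = \sum_(i < J) q i.+1 by [].
have : e + e = e2 by rewrite /e; lra.
lra.
Qed.

(** [level_chain] with thresholds [r j ^+ n], where [r j] is [r0 / 2 ^+ j]. The energies of the
    pieces add up to at most [F], the radii to at most [2 * r0], and the lengths of the sublinear
    sets are summed by [sublinear_sets_sum]; the bound is thus independent of the number of
    steps. *)
Lemma level_set_width O (C : R) u G A (a b r0 th S0 S Nb F X : R) : borel_extension O C -> (1 < n)%N -> 0 < C ->
  open O -> (forall i, borel_weak O i u (G i)) -> young A -> nondegenerate_young A ->
  0 < a -> a < b -> 0 < r0 -> 2 ^+ n * C * r0 <= 1 -> 0 < th -> 0 <= S0 -> 0 < S -> 0 < Nb ->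
  (forall r, 0 < r -> Nb <= r ^+ n -> (S%:E <= ((th * r) ^+ n.-1)%:E * A S)%E) ->
  (mu (superlevel O u a) <= (r0 ^+ n)%:E)%E -> (Nb%:E <= mu (O `&` [set x | (b <= `|u x|)%R]))%E ->
  (\int[mu]_(x in slice O u a b) A (gradnorm G x) <= F%:E)%E ->
  (\int[lebesgue_measure]_(s in `]S0, S]) sobolev_integrand n A s <= X%:E)%E ->
  b - a <= 2 ^+ n * C * (2 * r0 * S0 + 2 * X / th + th ^+ n.-1 * F).
Proof.
move=> ext n1 C0 oO uG yA ndA a0 ab r00 Cr th0 S00 Sp Nb0 SA Na HNb HF HX.
have mO := open_measurable_rV oO; pose i0 : 'I_n := Ordinal (ltnW n1).
have mu_ : measurable_fun setT u by case: (uG i0).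
have mG i : measurable_fun setT (G i) by case: (uG i).
pose r j : R := r0 / 2 ^+ j; have rj0 j : 0 < r j by rewrite divr_gt0// exprn_gt0.
have rS j : r j.+1 = r j / 2 by rewrite /r exprSr invfM mulrA.
have r_le j : r j <= r0 by rewrite ler_pdivrMr ?exprn_gt0// ler_peMr ?(ltW r00)// exprn_ege1// ler1n.
have [J0 HJ0] : exists j, r j ^+ n < Nb.
  have x0 : 0 <= r0 ^+ n / Nb by rewrite divr_ge0 ?exprn_ge0// ltW.
  have := archi_boundP x0; set j := Num.bound _ => Hj; exists j.
  rewrite /r expr_div_n ltr_pdivrMr ?exprn_gt0// mulrC -ltr_pdivrMr//; apply: (lt_le_trans Hj).
  apply: (@le_trans _ _ (2 ^+ j)); first by rewrite -natrX ler_nat ltnW// ltn_expl.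
  by rewrite ler_eXnr ?exprn_ege1 ?ler1n// (ltn_trans _ n1).
(* By minimality of [J] the thresholds of smaller index are at least [Nb], where the hypothesis on
   [S] is available, and the one of index [J] is below the superlevel measure at every level under
   [b]. *)
have [J HJ Jmin] := ex_minnP (ex_intro (fun j => r j ^+ n < Nb) J0 HJ0).
have NbJ j : (j < J)%N -> Nb <= r j ^+ n.
  by move=> jJ; rewrite leNgt; apply/negP => /Jmin; rewrite leqNgt jJ.
have mAG D : measurable D -> measurable_fun D (fun x => A (gradnorm G x)).
  move=> mD; apply: measurable_funTS; rewrite (_ : (fun x => _) = (fun t : measurableTypeR R => A `|t|) \o gradnorm G).
    by apply: measurableT_comp; [exact: measurable_young|exact: measurable_gradnorm].
  by apply/funext => x /=; rewrite ger0_norm// gradnorm_ge0.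
have AG0 x : (0 <= A (gradnorm G x))%E by rewrite young_ge0// gradnorm_ge0.
pose W := slice O u a b; pose L x y := fine (\int[mu]_(z in W `&` slice O u x y) A (gradnorm G z)).
have mW : measurable W by exact: measurable_slice.
have mWs x y : measurable (W `&` slice O u x y) by apply: measurableI => //; exact: measurable_slice.
have sub_le D1 D2 : measurable D1 -> measurable D2 -> D1 `<=` D2 ->
    (\int[mu]_(z in D1) A (gradnorm G z) <= \int[mu]_(z in D2) A (gradnorm G z))%E.
  by move=> m1 m2 s12; apply: ge0_subset_integral => //; exact: mAG.
have Lfin x y : ((L x y)%:E = \int[mu]_(z in W `&` slice O u x y) A (gradnorm G z))%E.
  rewrite fineK// ge0_fin_numE; last exact: integral_ge0.
  by apply: le_lt_trans (ltry F); apply: le_trans HF; apply: sub_le => // z [].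
have LF : L a b <= F by rewrite -lee_fin Lfin; apply: le_trans HF; apply: sub_le => // z [].
have K0 : 0 <= 2 ^+ n * C * th ^+ n.-1 by rewrite mulr_ge0// ?exprn_ge0 ?mulr_ge0 ?exprn_ge0// ltW.
pose w j := fine (lebesgue_measure (`]S0, S] `&` sublinear_set A ((th * r j) ^+ n.-1))).
pose q j := 2 ^+ n * C * (r j * (S0 + w j)).
have q0 j : 0 <= q j.
  apply: mulr_ge0; first by rewrite mulr_ge0 ?exprn_ge0// ltW.
  by apply: mulr_ge0; [exact: ltW|rewrite addr_ge0// fine_ge0].
have := @level_chain (fun t => mu (superlevel O u t)) L (2 ^+ n * C * th ^+ n.-1) J (fun j => r j ^+ n) q a b.
have -> : \sum_(j < J) q j = 2 ^+ n * C * (\sum_(j < J) r j * S0 + \sum_(j < J) r j * w j).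
  by rewrite -big_split/= mulr_sumr; apply: eq_bigr => j _; rewrite /q mulrDr.
move=> chain; apply: (le_trans (chain _ _ _ _ _ _ _ _ _)) => //.
- by move=> s t st; exact: superlevel_anti.
- by move=> x y; rewrite fine_ge0// integral_ge0.
- move=> x y z v xz yv yz; rewrite -lee_fin EFinD !Lfin -ge0_integral_setU//.
  + apply: sub_le; [exact: measurableU|exact: mWs|].
    move=> t [[Wt [Ot /= /andP[t1 t2]]]|[Wt [Ot /= /andP[t1 t2]]]]; split => //; split => //=.
      by rewrite t1 (lt_le_trans t2 yv).
    by rewrite t2 (le_lt_trans xz t1).
  + by apply: mAG; exact: measurableU.
  + by apply/disj_setPS => t [[_ [_ /= /andP[_ t1]]] [_ [_ /= /andP[t2 _]]]]; lra.
- by rewrite /r expr0 divr1.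
- move=> t tb; apply: (lt_le_trans (_ : (_ < Nb%:E)%E)); first by rewrite lte_fin.
  apply: (le_trans HNb); apply: le_measure; rewrite ?inE; [exact: measurable_superlevel_ge|exact: measurable_superlevel|].
  by move=> x [Ox /= bu]; split => //=; exact: lt_le_trans bu.
- move=> j a' b' jJ aa' a'b' b'b Na' Nb'.
  rewrite -mulrA -mulrDr; apply: (level_step (S0 := S0) (S := S) ext n1 C0 oO uG yA) => //.
  + exact: lt_le_trans aa'.
  + by apply: le_trans Cr; rewrite ler_pM2l// mulr_gt0// exprn_gt0.
  + by apply: SA => //; exact: NbJ.
  + by rewrite -rS.
  + rewrite Lfin; apply: sub_le; [exact: measurable_slice|exact: mWs|].
    move=> x [Ox /= /andP[t1 t2]]; split; split => //=; apply/andP; split => //; first exact: le_lt_trans t1.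
    exact: lt_le_trans b'b.
- have s1 : \sum_(j < J) r j * S0 <= 2 * r0 * S0.
    rewrite -mulr_suml ler_wpM2r//.
    have := @geometric_indicator_sum _ J r0 r0 (fun=> true) (ltW r00) (ltW r00).
    by under eq_bigr do rewrite mul1r; apply => j _ _; exact: r_le.
  have s2 := sublinear_sets_sum J n1 yA ndA r00 th0 S00 HX.
  rewrite -[_ * _ * L a b]mulrA -mulrDr ler_pM2l ?mulr_gt0 ?exprn_gt0//.
  apply: lerD; first exact: lerD.
  by rewrite ler_wpM2l// exprn_ge0// ltW.
Qed.

End superlevel.

(** * Boundedness and weak-type decay of Sobolev functions *)

Section levels.
Context {R : realType} (n : nat).
Hypothesis n1 : (1 < n)%N.
Local Notation mu := (@borel_lebesgue R n).
Variables (O : set 'rV[R]_n) (C : R).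
Hypotheses (ext : borel_extension O C) (C0 : 0 < C) (oO : open O).

Let mO : measurable O := open_measurable_rV oO.
Let i0 : 'I_n := Ordinal (ltnW n1).
Let n0 : (0 < n)%N := ltnW n1.

Lemma measurable_young_comp (A : R -> \bar R) (v : 'rV[R]_n -> R) : young A -> measurable_fun setT v ->
  measurable_fun setT (fun x => A `|v x|).
Proof. by move=> yA mv; apply: (measurableT_comp (measurable_young yA) mv). Qed.

Lemma superlevel_chebyshev (A : R -> \bar R) u (a x : R) : young A -> measurable_fun setT u -> 0 <= a -> 0 <= x ->
  (x%:E <= A a)%E -> (x%:E * mu (superlevel O u a) <= \int[mu]_(z in superlevel O u a) A `|u z|%R)%E.
Proof.
move=> yA mu_ a0 x0 xA; have mS := measurable_superlevel a mO mu_.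
rewrite -integral_cst//; apply: ge0_le_integral => //.
- by apply: measurable_funTS; exact: measurable_young_comp.
- move=> z [_ /= az]; apply: (le_trans xA); apply: (young_homo yA); rewrite a0 ltW//.
Qed.

(** The width bound with [th = 1] involves only the tail integral [X], [t0] and [M], and not the
    measure [Nb] of the top set. If that measure were positive for [b = a + w + 1], the width would
    be at most [w]. *)
Lemma sobolev_bounded (A : R -> \bar R) (M : R) : young A -> nondegenerate_young A ->
  cvg_int_infty (sobolev_integrand n A) -> 0 <= M ->
  exists2 b : R, 0 < b & forall u G, (forall i, borel_weak O i u (G i)) ->
    (\int[mu]_(x in O) A `|u x|%R <= M%:E)%E -> (\int[mu]_(x in O) A (gradnorm G x) <= M%:E)%E ->
    {ae mu, forall x, O x -> `|u x| <= b}.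
Proof.
move=> yA ndA [t0 t00 Ioo] M0; pose X := fine (\int[lebesgue_measure]_(t in `[t0, +oo[) sobolev_integrand n A t)%E.
pose D : set (measurableTypeR R) := `[t0, +oo[%classic; have mD : measurable D by exact: measurable_itv.
have Dpos x : D x -> 0 < x by rewrite /D /= in_itv/= andbT; exact: lt_le_trans.
have XE : (X%:E = \int[lebesgue_measure]_(t in D) sobolev_integrand n A t)%E.
  by rewrite fineK// ge0_fin_numE//; apply: integral_ge0 => t _; exact: sobolev_integrand_ge0.
have msig := measurable_sobolev_integrand n1 yA mD Dpos.
have [c [d [c0 d0 Alin]]] := young_linear yA.
have K0 : 0 < 2 ^+ n * C by rewrite mulr_gt0// exprn_gt0.
pose r0 := (2 ^+ n * C)^-1; have r00 : 0 < r0 by rewrite invr_gt0.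
(* Chosen so that [A a] is at least [M / r0 ^+ n + c]: Chebyshev's inequality then makes the
   superlevel set at [a] small enough for the absorption. *)
pose a := (M / r0 ^+ n + d) / c + 1.
have Mr0 : 0 <= M / r0 ^+ n by rewrite divr_ge0// exprn_ge0// ltW.
have a0 : 0 < a by rewrite ltr_wpDl// divr_ge0 ?addr_ge0// ltW.
pose w := 2 ^+ n * C * (2 * r0 * t0 + 2 * X / 1 + 1 ^+ n.-1 * M).
have X0 : 0 <= X by rewrite -lee_fin XE; apply: integral_ge0 => t _; exact: sobolev_integrand_ge0.
have w0 : 0 <= w.
  rewrite mulr_ge0 ?(ltW K0)// expr1n mul1r divr1 addr_ge0// addr_ge0 ?mulr_ge0 ?(ltW r00) ?(ltW t00)//.
exists (a + w + 1) => [|u G uG HA HG]; first by rewrite ltr_wpDl// addr_ge0// ltW.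
set b := a + w + 1; have ab : a < b by rewrite /b; lra.
have mu_ : measurable_fun setT u by case: (uG i0).
have mG i : measurable_fun setT (G i) by case: (uG i).
have mb := measurable_superlevel_ge b mO mu_.
have mAu D' : measurable D' -> measurable_fun D' (fun x => A `|u x|).
  by move=> mD'; apply: measurable_funTS; exact: measurable_young_comp.
have mAG : measurable_fun setT (fun x => A (gradnorm G x)).
  rewrite (_ : (fun x => _) = (fun x => A `|gradnorm G x|)); last by apply/funext => x; rewrite ger0_norm// gradnorm_ge0.
  by apply: measurable_young_comp => //; exact: measurable_gradnorm.
have Aa : ((M / r0 ^+ n + c)%:E <= A a)%E.
  have := Alin a (ltW a0); rewrite -leeBlDr//; apply: le_trans; rewrite -EFinB lee_fin.
  by rewrite /a mulrDr [c * (_ / c)]mulrC mulfVK ?gt_eqF//; lra.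
have x0 : 0 < M / r0 ^+ n + c by rewrite ltr_wpDl.
have Na : (mu (superlevel O u a) <= (r0 ^+ n)%:E)%E.
  have := superlevel_chebyshev yA mu_ (ltW a0) (ltW x0) Aa => H.
  have {}H : ((M / r0 ^+ n + c)%:E * mu (superlevel O u a) <= M%:E)%E.
    apply: (le_trans H); apply: le_trans HA; apply: ge0_subset_integral => //.
    - exact: measurable_superlevel.
    - exact: mAu.
    - by move=> x _; exact: young_ge0.
    - by move=> x [].
  rewrite -(lee_pmul2l _ (x := (M / r0 ^+ n + c)%:E)) ?fin_numE ?lte_fin//.
  apply: (le_trans H); rewrite -EFinM lee_fin mulrDl mulfVK ?gt_eqF ?exprn_gt0//.
  by rewrite lerDl mulr_ge0 ?exprn_ge0 ?(ltW c0) ?(ltW r00).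
suff b0 : mu (O `&` [set x | (b <= `|u x|)%R]) = 0%E.
  exists (O `&` [set x | (b <= `|u x|)%R]); split => // x /= H.
  have [Ox|] := pselect (O x); last by move=> nO; exfalso; apply: H.
  by split => //=; rewrite leNgt; apply/negP => ub; apply: H => _; exact: ltW.
apply/eqP; rewrite eq_le measure_ge0 andbT leNgt; apply/negP => b_pos.
have boo : (mu (O `&` [set x | (b <= `|u x|)%R]) < +oo)%E.
  apply: le_lt_trans (ltry (r0 ^+ n)); apply: le_trans Na; apply: le_measure; rewrite ?inE//.
    exact: measurable_superlevel.
  by move=> x [Ox /= bx]; split => //=; exact: lt_le_trans bx.
pose Nb := fine (mu (O `&` [set x | (b <= `|u x|)%R])).
have Nb0 : 0 < Nb by rewrite fine_gt0// b_pos.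
(* If [Nb <= r ^+ n] then [rho <= r]: either [r] is at least 1, or [r ^+ n <= r]. *)
pose rho := Num.min 1 Nb; have rho0 : 0 < rho by rewrite lt_min ltr01.
(* Otherwise the integrand would be at least [rho] on a half-line, against its integrability. *)
have [S t0S HS] : exists2 S, t0 <= S & (S%:E <= (rho ^+ n.-1)%:E * A S)%E.
  apply: contrapT => H; move: Ioo; apply/negP; rewrite -leNgt leye_eq; apply/eqP/eqyP => z z0.
  apply: (@le_trans _ _ (\int[lebesgue_measure]_(t in D) rho%:E)%E).
    rewrite /D integral_cst; last exact: measurable_itv.
    rewrite [X in (_ * X)%E](lebesgue_measure_itv `[_, +oo[)/= ltry addye//.
    by rewrite gt0_muley ?leey.
  apply: ge0_le_integral => //; first by move=> t _; rewrite lee_fin ltW.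
  move=> t Dt; apply: sobolev_integrand_ge => //; first exact: Dpos.
  apply: ltW; rewrite ltNge; apply/negP => Ht; apply: H; exists t => //.
  by move: Dt; rewrite /D /= in_itv/= andbT.
have Spos := lt_le_trans t00 t0S.
have width := @level_set_width R n O C u G A a b r0 1 t0 S Nb M X ext n1 C0 oO uG yA ndA a0 ab r00.
suff : b - a <= w by rewrite /b; lra.
apply: width => //.
- by rewrite /r0 divff// gt_eqF.
- exact: ltW.
- move=> r r_pos Nbr; apply: (le_trans HS); apply: lee_wpmul2r; first by rewrite young_ge0// ltW.
  rewrite lee_fin mul1r ler_pXn2r ?nnegrE ?(ltW rho0) ?(ltW r_pos) ?predn_pos//.
  rewrite ge_min; have [//|r1] := leP 1 r; apply/orP; right; apply: (le_trans Nbr).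
  by apply: ler_iXnr => //; exact: ltW.
- by rewrite fineK// ge0_fin_numE.
- apply: le_trans HG; apply: ge0_subset_integral => //; first exact: measurable_slice.
  - exact: measurable_funTS.
  - by move=> x _; rewrite young_ge0// gradnorm_ge0.
  - by move=> x [].
- rewrite XE; apply: (@ge0_subset_integral _ _ _ lebesgue_measure (`]t0, S]%classic : set (measurableTypeR R)) D) => //.
  - by move=> t _; exact: sobolev_integrand_ge0.
  - by move=> t; rewrite /D /= !in_itv/= => /andP[/ltW ->].
Qed.

(** By contradiction: a top set of too large a measure makes the layer narrow. With [S0 = 0] and
    [S = t] the terms of [level_set_width] reduce to [2 ^+ n * C] times at most [3 * y ^+ n.-1 * m],
    and [y ^+ n.-1] is the value of [H_n] at [t]. *)
Lemma weak_type_level (A : R -> \bar R) u G (t y m0 a b r0 F : R) : young A -> nondegenerate_young A ->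
  (forall i, borel_weak O i u (G i)) -> 0 < t -> (A t < +oo)%E -> 0 < y -> 0 < m0 -> 0 < a -> a < b ->
  0 < r0 -> 2 ^+ n * C * r0 <= 1 ->
  (\int[lebesgue_measure]_(s in `]0%R, t]) sobolev_integrand n A s = (y ^+ n)%:E)%E ->
  (mu (superlevel O u a) <= (r0 ^+ n)%:E)%E ->
  (\int[mu]_(x in slice O u a b) A (gradnorm G x) <= F%:E)%E -> F < m0 ^+ n ->
  3 * (2 ^+ n * C) * y ^+ n.-1 * m0 < b - a ->
  (A t * mu (O `&` [set x | (b <= `|u x|)%R]) <= F%:E)%E.
Proof.
move=> yA ndA uG t0 Aoo y0 m00 a0 ab r00 Cr Hy Na HF Fm0 wide.
have mu_ : measurable_fun setT u by case: (uG i0).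
have mb := measurable_superlevel_ge b mO mu_.
have boo : (mu (O `&` [set x | (b <= `|u x|)%R]) < +oo)%E.
  apply: le_lt_trans (ltry (r0 ^+ n)); apply: le_trans Na; apply: le_measure; rewrite ?inE//.
    exact: measurable_superlevel.
  by move=> x [Ox /= bx]; split => //=; exact: lt_le_trans bx.
have K0 : 0 < 2 ^+ n * C by rewrite mulr_gt0// exprn_gt0.
have F0 : 0 <= F.
  rewrite -lee_fin; apply: le_trans HF; apply: integral_ge0 => x _; rewrite young_ge0//; exact: gradnorm_ge0.
pose Nb := fine (mu (O `&` [set x | (b <= `|u x|)%R])).
have NbE : (Nb%:E = mu (O `&` [set x | (b <= `|u x|)%R]))%E by rewrite fineK// ge0_fin_numE.
pose al := fine (A t); have alE : (al%:E = A t)%E by rewrite fineK// ge0_fin_numE// young_ge0// ltW.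
have al0 : 0 < al by rewrite -lte_fin alE ndA.
rewrite -alE -NbE -EFinM lee_fin leNgt; apply/negP => FN.
(* [z] exceeds [F] and is at most both [m0 ^+ n] and [A t] times the measure; its [n]-th root [m]
   sets [th = y / m], which makes the two remaining terms of the width bound comparable. *)
pose z := Num.min (m0 ^+ n) (al * Nb); have Fz : F < z by rewrite lt_min Fm0.
have z0 := le_lt_trans F0 Fz.
have Nb0 : 0 < Nb by rewrite -(pmulr_rgt0 _ al0); exact: le_lt_trans FN.
pose m := z `^ (n%:R^-1); have m_pos : 0 < m by exact: powR_gt0.
have mn : m ^+ n = z by rewrite -powR_mulrn ?(ltW m_pos)// -powRrM mulVf ?powRr1 ?(ltW z0)// pnatr_eq0 -lt0n.
have mm0 : m <= m0.
  by rewrite -(@ler_pXn2r _ n) ?nnegrE ?(ltW m_pos) ?(ltW m00)// mn ge_min lexx.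
have n1' := predn_pos n1.
pose q := (t / al) `^ (n.-1%:R^-1).
have qn : q ^+ n.-1 = t / al.
  by rewrite -powR_mulrn ?powR_ge0// -powRrM mulVf ?powRr1 ?divr_ge0 ?(ltW t0) ?(ltW al0)// pnatr_eq0 -lt0n.
have q0 : 0 <= q by exact: powR_ge0.
(* The integrand is nonincreasing, so [t] times its value at [t] is below the integral; raised to
   the power [n.-1] this reads [t ^+ n <= A t * y ^+ (n * n.-1)]. *)
have tq : t * q <= y ^+ n.
  rewrite -lee_fin -Hy.
  have -> : ((t * q)%:E = \int[lebesgue_measure]_(s in (`]0%R, t]%classic : set (measurableTypeR R))) q%:E)%E.
    rewrite integral_cst; last exact: measurable_itv.
    by rewrite [X in (_ * X)%E](lebesgue_measure_itv `]_, _])/= lte_fin t0 -EFinD -EFinM oppr0 addr0 mulrC.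
  have mD : measurable (`]0%R, t]%classic : set (measurableTypeR R)) by exact: measurable_itv.
  have Dpos s : (`]0%R, t]%classic : set R) s -> 0 < s by rewrite /= in_itv/= => /andP[].
  apply: ge0_le_integral => //; first exact: measurable_sobolev_integrand.
  move=> s Ds; have st : s <= t by move: Ds; rewrite /= in_itv/= => /andP[].
  have := sobolev_integrand_anti n1 yA (Dpos s Ds) st.
  by rewrite [sobolev_integrand n A t]sobolev_integrandE.
have ym0 : 0 < y / m by exact: divr_gt0.
have width := @level_set_width R n O C u G A a b r0 (y / m) 0 t Nb F (y ^+ n) ext n1 C0 oO uG yA ndA a0 ab r00 Cr ym0 (lexx 0) t0 Nb0.
have : b - a <= 2 ^+ n * C * (2 * r0 * 0 + 2 * y ^+ n / (y / m) + (y / m) ^+ n.-1 * F).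
  apply: width => //.
  - move=> r r_pos Nbr; rewrite -alE -EFinM lee_fin.
    have rhs0 : 0 <= (y / m * r) ^+ n.-1 * al.
      by rewrite mulr_ge0 ?(ltW al0)// exprn_ge0// mulr_ge0 ?(ltW ym0) ?(ltW r_pos).
    rewrite -(@ler_pXn2r _ n) ?nnegrE ?(ltW t0)//.
    have h1 : 1 <= (r / m) ^+ n * al.
      rewrite expr_div_n mulrAC ler_pdivlMr ?exprn_gt0// mul1r mn /z ge_min; apply/orP; right.
      by rewrite mulrC ler_wpM2r// ltW.
    have h2 : t ^+ n.-1 * (t / al) <= (y ^+ n) ^+ n.-1.
      by rewrite -qn -exprMn ler_pXn2r ?nnegrE ?mulr_ge0 ?exprn_ge0 ?(ltW t0) ?(ltW y0).
    have tn : t ^+ n = t ^+ n.-1 * (t / al) * al by rewrite mulrA mulfVK ?gt_eqF// -exprSr prednK.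
    have -> : ((y / m * r) ^+ n.-1 * al) ^+ n = (y ^+ n) ^+ n.-1 * al * ((r / m) ^+ n * al) ^+ n.-1.
      have key (Y r' e : R) k : ((Y * r') ^+ k * e) ^+ k.+1 = (Y ^+ k.+1) ^+ k * e * (r' ^+ k.+1 * e) ^+ k.
        by rewrite !exprMn -!exprM [(k.+1 * k)%N]mulnC (exprS e); ring.
      have -> : y / m * r = y * (r / m) by rewrite mulrA mulrAC.
      by have := key y (r / m) al n.-1; rewrite prednK.
    have X0 : 0 <= (y ^+ n) ^+ n.-1 * al by rewrite mulr_ge0 ?(ltW al0)// !exprn_ge0// ltW.
    rewrite tn; apply: (@le_trans _ _ ((y ^+ n) ^+ n.-1 * al)); first by rewrite ler_wpM2r// ltW.
    by rewrite ler_peMr// exprn_ege1.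
  - by rewrite -NbE.
  - by rewrite Hy.
have yn : y ^+ n / (y / m) = y ^+ n.-1 * m.
  by rewrite -[in y ^+ n](prednK n0) exprSr invf_div mulrA mulrAC mulfK ?gt_eqF// mulrAC.
have mF : (y / m) ^+ n.-1 * F <= y ^+ n.-1 * m.
  rewrite expr_div_n mulrAC -mulrA ler_wpM2l ?exprn_ge0 ?(ltW y0)// ler_pdivrMr ?exprn_gt0//.
  by rewrite -exprS prednK// mn ltW.
move=> H; suff : b - a <= 3 * (2 ^+ n * C) * y ^+ n.-1 * m0 by rewrite leNgt wide.
have y2 : 2 * y ^+ n / (y / m) = 2 * (y ^+ n.-1 * m) by rewrite -yn mulrA.
apply: (le_trans H); rewrite mulr0 add0r y2.
apply: (@le_trans _ _ (2 ^+ n * C * (3 * (y ^+ n.-1 * m)))).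
  by rewrite ler_pM2l//; lra.
have : y ^+ n.-1 * m <= y ^+ n.-1 * m0 by rewrite ler_wpM2l ?exprn_ge0// ltW.
move=> /(ler_wpM2l (ltW K0)); lra.
Qed.

End levels.

(** * The function H_n *)

Lemma ge0_integral_scale {R : realType} (c : R) (f : measurableTypeR R -> \bar R) : 0 < c ->
  measurable_fun setT f -> (forall x, (0 <= f x)%E) ->
  (\int[lebesgue_measure]_x f x = c%:E * \int[lebesgue_measure]_x f (c * x)%R)%E.
Proof.
move=> c0 mf f0; pose phi (x : measurableTypeR R) : measurableTypeR R := c * x.
have mphi : measurable_fun setT phi by apply: measurable_funM => //; exact: measurable_cst.
pose k : {nonneg R} := NngNum (ltW c0).
have [P PE] : exists P : {measure set (measurableTypeR R) -> \bar R}, P = pushforward lebesgue_measure phi :> (set _ -> \bar R).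
  by unshelve refine (ex_intro _ (pushforward lebesgue_measure phi : {measure set (measurableTypeR R) -> \bar R}) erefl).
transitivity (\int[mscale k P]_x f x)%E; last first.
  rewrite ge0_integral_mscale//; congr (_ * _)%E.
  transitivity (\int[pushforward lebesgue_measure phi]_x f x)%E.
    by apply: eq_measure_integral => S mS _; rewrite PE.
  by rewrite ge0_integral_pushforward.
apply: eq_measure_integral => S mS _.
apply: (@lebesgue_measure_unique R (mscale k P)) => //.
move=> X /ocitvP[->|[[x y] /= xy ->]]; first by rewrite !measure0.
rewrite /mscale /= PE /pushforward /=.
have -> : phi @^-1` `]x, y] = `]x / c, y / c]%classic.
  by apply/seteqP; split=> r/=; rewrite !in_itv/= /phi ltr_pdivrMr// ler_pdivlMr// [r * c]mulrC.
rewrite !lebesgue_measure_itv/= !lte_fin xy ltr_pM2r ?invr_gt0// xy -!EFinB -EFinM.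
by rewrite -mulrBl mulrCA mulfV ?mulr1// gt_eqF.
Qed.

Section profile.
Context {R : realType} (n : nat).
Hypothesis n1 : (1 < n)%N.
Variable A : R -> \bar R.
Hypotheses (yA : young A) (ndA : nondegenerate_young A) (fA : forall t, 0 <= t -> (A t < +oo)%E).
Hypothesis A0 : cvg_int_zero (sobolev_integrand n A).
Local Notation sig := (sobolev_integrand n A).
Local Notation H := (H_ n A).

Let n0 : (0 < n)%N := ltnW n1.

Let D t : set (measurableTypeR R) := `]0, t]%classic.

Let mD t : measurable (D t). Proof. exact: measurable_itv. Qed.

Let Dpos t x : D t x -> 0 < x. Proof. by rewrite /D /= in_itv/= => /andP[]. Qed.

Let sig0 x : (0 <= sig x)%E := sobolev_integrand_ge0 n A x.

Let msig (S : set (measurableTypeR R)) : measurable S -> (forall x, S x -> 0 < x) -> measurable_fun S sig.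
Proof. by move=> mS Spos; apply: measurable_sobolev_integrand. Qed.

Let I t := (\int[lebesgue_measure]_(s in D t) sig s)%E.

Let splitI s t : 0 < s -> s <= t ->
  (I t = I s + \int[lebesgue_measure]_(x in (`]s, t]%classic : set (measurableTypeR R))) sig x)%E.
Proof.
move=> s0 st; rewrite /I -ge0_integral_setU//.
- congr (integral _ _ _); apply/seteqP; split => x; rewrite /D /= !in_itv/=.
    by move=> /andP[x0 xt]; have [xs|sx] := leP x s; [left; rewrite x0|right; rewrite xt].
  by move=> [/andP[-> /le_trans ->]//|/andP[/(lt_trans s0) -> ->]].
- apply: msig; first by apply: measurableU => //; exact: measurable_itv.
  by move=> x [/Dpos//|]; rewrite /= in_itv/= => /andP[/(lt_trans s0)].
- by apply/disj_setPS => x [] /=; rewrite /D /= !in_itv/= => /andP[_ xs] /andP[]; rewrite ltNge xs.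
Qed.

Let tail_le s t : 0 < s -> s <= t ->
  (\int[lebesgue_measure]_(x in (`]s, t]%classic : set (measurableTypeR R))) sig x <= (t - s)%:E * sig s)%E.
Proof.
move=> s0 st; rewrite (sobolev_integrandE n yA ndA s0 (fA (ltW s0))); set q := (_ `^ _).
apply: (@le_trans _ _ (\int[lebesgue_measure]_(x in (`]s, t]%classic : set (measurableTypeR R))) q%:E)%E).
  apply: ge0_le_integral => //.
  - by apply: msig => // x; rewrite /= in_itv/= => /andP[/(lt_trans s0)].
  - move=> x; rewrite /= in_itv/= => /andP[sx _].
    by rewrite /q -sobolev_integrandE ?fA// ?(ltW s0)//; apply: sobolev_integrand_anti => //; exact: ltW.
rewrite integral_cst; last exact: measurable_itv.
rewrite [X in (_ * X)%E](lebesgue_measure_itv `]_, _])/= lte_fin.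
move: st; rewrite le_eqVlt => /predU1P[->|st]; first by rewrite ltxx mule0 subrr mul0e.
by rewrite st -EFinB muleC.
Qed.

Let head_ge t : 0 < t -> (t%:E * sig t <= I t)%E.
Proof.
move=> t0; rewrite (sobolev_integrandE n yA ndA t0 (fA (ltW t0))); set q := (_ `^ _).
have -> : (t%:E * q%:E = \int[lebesgue_measure]_(x in D t) q%:E)%E.
  rewrite integral_cst//; rewrite /D [X in _ = (_ * X)%E](lebesgue_measure_itv `]_, _])/= lte_fin t0.
  by rewrite -EFinB subr0 muleC.
apply: ge0_le_integral => //.
- by move=> x _; rewrite lee_fin powR_ge0.
- by apply: msig => // x; exact: Dpos.
- move=> x Dx; rewrite /q -sobolev_integrandE ?fA// ?(ltW t0)//.
  apply: sobolev_integrand_anti => //; first exact: Dpos Dx.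
  by move: Dx; rewrite /D /= in_itv/= => /andP[].
Qed.

Let I_lty t : 0 < t -> (I t < +oo)%E.
Proof.
move=> t0; have [s s0 Is] := A0; have {}Is : (I s < +oo)%E by [].
have [ts|/ltW st] := leP t s.
  by apply: le_lt_trans Is; rewrite (splitI t0 ts) leeDl//; apply: integral_ge0.
rewrite (splitI s0 st) lte_add_pinfty//; apply: (le_lt_trans (tail_le s0 st)).
by rewrite sobolev_integrandE ?fA// ?(ltW s0)// -EFinM ltry.
Qed.

(** Writing the integral as [y ^+ n] turns the exponent [1/n'] into the integer power [n.-1] of [y],
    which removes fractional powers from the later estimates. *)
Lemma H_root t : 0 < t -> exists y, [/\ 0 < y, H t = y ^+ n.-1 &
  (\int[lebesgue_measure]_(s in `]0%R, t]) sig s = (y ^+ n)%:E)%E].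
Proof.
move=> t0; have Ifin : I t \is a fin_num by rewrite ge0_fin_numE ?I_lty// integral_ge0.
have I0 : 0 < fine (I t).
  rewrite -lte_fin fineK//; apply: lt_le_trans (head_ge t0); rewrite mule_gt0//.
  rewrite sobolev_integrandE ?fA ?(ltW t0)// lte_fin powR_gt0// divr_gt0// fine_gt0// ndA//=.
  by rewrite fA// ltW.
pose y := fine (I t) `^ n%:R^-1; have y0 : 0 < y by exact: powR_gt0.
have yn : y ^+ n = fine (I t).
  by rewrite -powR_mulrn ?(ltW y0)// -powRrM mulVf ?powRr1 ?(ltW I0)// pnatr_eq0 -lt0n.
exists y; split => //; last by rewrite yn fineK.
have -> : H t = fine (I t) `^ (conj_exponent n)^-1 by rewrite /H_ fine_poweR.
rewrite -yn /conj_exponent -(powR_mulrn n (ltW y0)) -(powR_mulrn n.-1 (ltW y0)) -powRrM.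
by rewrite invf_div mulrCA mulfV ?mulr1// pnatr_eq0 -lt0n.
Qed.

Lemma H_homo s t : 0 < s -> s <= t -> H s <= H t.
Proof.
move=> s0 st; have t0 := lt_le_trans s0 st.
have [y [y0 -> Hy]] := H_root s0; have [z [z0 -> Hz]] := H_root t0.
rewrite ler_pXn2r ?nnegrE ?(ltW y0) ?(ltW z0) ?predn_pos//.
rewrite -(@ler_pXn2r _ n) ?nnegrE ?(ltW y0) ?(ltW z0)// -lee_fin -Hy -Hz.
by rewrite -[leLHS]/(I s) -[leRHS]/(I t) (splitI s0 st) leeDl//; apply: integral_ge0.
Qed.

Lemma H_ge0 t : 0 < t -> 0 <= H t.
Proof. by move=> t0; have [y [y0 -> _]] := H_root t0; rewrite exprn_ge0// ltW. Qed.

(** The integrand is nonincreasing, so its integral grows at most by the factor [c], and the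
    exponent [(n - 1) / n] only improves this because [c >= 1]. *)
Lemma H_scale c t : 1 <= c -> 0 < t -> H (c * t) <= c * H t.
Proof.
move=> c1 t0; have c0 : 0 < c := lt_le_trans ltr01 c1.
have tct : t <= c * t by rewrite ler_peMl// ltW.
have [y [y0 -> Hy]] := H_root t0; have [z [z0 -> Hz]] := H_root (mulr_gt0 c0 t0).
have zy : z ^+ n <= c * y ^+ n.
  rewrite -lee_fin -Hz EFinM -Hy -[leLHS]/(I (c * t)) -[X in (_ * X)%E]/(I t) (splitI t0 tct).
  apply: (@le_trans _ _ (I t + (c * t - t)%:E * sig t)%E); first by rewrite leeD2l// tail_le.
  have -> : (c%:E * I t = I t + (c - 1)%:E * I t)%E.
    rewrite -{2}[I t]mul1e -ge0_muleDl ?lee_fin ?subr_ge0//; congr (_ * _)%E; rewrite -EFinD; congr (_%:E).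
    by rewrite addrC subrK.
  rewrite leeD2l//; have -> : c * t - t = (c - 1) * t by rewrite mulrBl mul1r.
  by rewrite EFinM -muleA lee_wpmul2l ?lee_fin ?subr_ge0// head_ge.
rewrite -(@ler_pXn2r _ n) ?nnegrE ?mulr_ge0 ?exprn_ge0 ?(ltW y0) ?(ltW z0) ?(ltW c0)//.
rewrite exprMn -!exprM mulnC !exprM; apply: (@le_trans _ _ ((c * y ^+ n) ^+ n.-1)).
  by rewrite ler_pXn2r ?nnegrE ?mulr_ge0 ?exprn_ge0 ?(ltW y0) ?(ltW z0) ?(ltW c0)// predn_pos.
rewrite exprMn ler_wpM2r ?exprn_ge0 ?(ltW y0)//.
by rewrite ler_weXn2l// leq_pred.
Qed.

Lemma H_unbounded x : dvg_int_infty sig -> exists2 t, 0 < t & x <= H t.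
Proof.
move=> Aoo; apply: contrapT => bound.
have {}bound t : 0 < t -> H t < x by move=> t0; rewrite ltNge; apply/negP => xH; apply: bound; exists t.
have x0 : 0 < x by apply: le_lt_trans (bound 1 _) => //; exact: H_ge0.
have Ibound t : 0 < t -> (I t <= (1 + x ^+ n)%:E)%E.
  move=> t0; have := bound t t0; have [y [y0 -> Hy]] := H_root t0 => yx.
  rewrite /I Hy lee_fin; have [y1|y1] := leP y 1.
    by apply: (@le_trans _ _ 1); [exact: exprn_ile1 (ltW y0) y1|rewrite lerDl exprn_ge0// ltW].
  have yy : y <= y ^+ n.-1 by rewrite -{1}[y]expr1 ler_weXn2l ?(ltW y1)// predn_pos.
  apply: (@le_trans _ _ (x ^+ n)); last by rewrite lerDr.
  by rewrite ler_pXn2r ?nnegrE ?(ltW y0) ?(ltW x0)// (le_trans yy)// ltW.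
have := Aoo 1 ltr01; rewrite (_ : `[1, +oo[%classic = \bigcup_k `[1, k%:R]%classic); last first.
  apply/seteqP; split => y /=; last by move=> [k _]; rewrite /= !in_itv/= andbT => /andP[].
  rewrite in_itv/= andbT => y1; have := archi_boundP (le_trans ler01 y1) => yb.
  by exists (Num.bound y) => //=; rewrite in_itv/= y1 ltW.
have nd : nondecreasing_seq (fun k : nat => (`[1, k%:R]%classic : set (measurableTypeR R))).
  by move=> k l kl; apply/subsetPset => y /=; rewrite !in_itv/= => /andP[-> /le_trans]; apply; rewrite ler_nat.
have cv := @ge0_nondecreasing_set_cvg_integral _ _ R (fun k : nat => (`[1, k%:R]%classic : set (measurableTypeR R))) sig lebesgue_measure nd.
move=> E; have : (+oo <= (1 + x ^+ n)%:E :> \bar R)%E; last by rewrite leye_eq.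
rewrite -E; apply: cvge_le (cv _ _ _).
- apply: nearW => k; have [k0|k0] := ltP 0 (k%:R : R); last first.
    rewrite (_ : `[1, k%:R]%classic = set0) ?integral_set0 ?lee_fin ?addr_ge0 ?exprn_ge0 ?(ltW x0)//.
    apply/seteqP; split => y //=; rewrite in_itv/= => /andP[y1 yk].
    by have := lt_le_trans ltr01 (le_trans y1 (le_trans yk k0)); rewrite ltxx.
  apply: le_trans (Ibound _ k0); apply: ge0_subset_integral => //.
  - by apply: msig => // z; exact: Dpos.
  - by move=> y; rewrite /D /= !in_itv/= => /andP[/(lt_le_trans ltr01) -> ->].
- by move=> k; exact: measurable_itv.
- by move=> k; apply: msig => // y; rewrite /= in_itv/= => /andP[/(lt_le_trans ltr01)].
- by [].
Qed.

(** Doubling the argument at most doubles [H], so the values along [2 ^+ k * t] cannot jump over the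
    interval [[x, 2 * x]]. *)
Lemma H_between (t x : R) : dvg_int_infty sig -> 0 < t -> H t <= x -> exists2 s, t <= s & x <= H s <= 2 * x.
Proof.
move=> Aoo t0 Hx; have x0 := le_trans (H_ge0 t0) Hx.
have [s s0 xs] := H_unbounded x Aoo.
have t2 k : 0 < 2 ^+ k * t by rewrite mulr_gt0// exprn_gt0.
have [k0 Hk0] : exists k, x <= H (2 ^+ k * t).
  have := archi_boundP (divr_ge0 (ltW s0) (ltW t0)); set k := Num.bound _ => sk; exists k.
  apply: (le_trans xs); apply: H_homo => //; rewrite -ler_pdivrMr//; apply: (le_trans (ltW sk)).
  by rewrite -natrX ler_nat ltnW// ltn_expl.
have [k Hk kmin] := ex_minnP (ex_intro (fun k => x <= H (2 ^+ k * t)) k0 Hk0).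
exists (2 ^+ k * t); first by rewrite ler_peMl ?(ltW t0)// exprn_ege1// ler1n.
rewrite Hk/=; case: k => [|k] in Hk kmin *; first by rewrite expr0 mul1r; lra.
have Hk' : H (2 ^+ k * t) < x by rewrite ltNge; apply/negP => /kmin; rewrite ltnn.
rewrite exprS -mulrA; apply: (le_trans (H_scale _ (t2 k))); first by rewrite ler1n.
by rewrite ler_pM2l// ltW.
Qed.

End profile.

(** * Replacing A near the origin *)

Section admissible.
Context {R : realType} (n : nat).
Hypothesis n1 : (1 < n)%N.
Variables (A Ah : R -> \bar R).
Hypotheses (yA : young A) (ndA : nondegenerate_young A).
Hypothesis Aoo : dvg_int_infty (sobolev_integrand n A).
Hypothesis AAh : H_admissible n A Ah.

(** An infinite value of [A] would make the integrand vanish from there on. *)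
Lemma dvg_young_finite t : 0 <= t -> (A t < +oo)%E.
Proof.
move=> t0; rewrite ltNge leye_eq; apply/negP => /eqP Atoo.
have s0 : 0 < t + 1 by rewrite ltr_wpDl.
have := Aoo s0; rewrite integral0_eq//= => s; rewrite in_itv/= andbT => ts.
have Asoo : A s = +oo%E.
  by apply/eqP; rewrite -leye_eq -Atoo; apply: (young_homo yA); rewrite t0/=; lra.
by rewrite /sobolev_integrand Asoo invey mule0 poweR0r// gt_eqF// inv_predn_gt0.
Qed.

Lemma admissible_young : [/\ young Ah, nondegenerate_young Ah, cvg_int_zero (sobolev_integrand n Ah) &
  exists c T : R, [/\ 1 <= c, 0 < T & forall t, T <= t -> (A t <= Ah (c * t) /\ Ah t <= A (c * t))%E]].
Proof.
case: AAh => [[A0 ->]|[_ yAh [c [t0 [c0 t00 eqv]]] Ah0]].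
  split => //; exists 1, 1; split => // t _; rewrite mul1r; split; exact: lexx.
split => //.
  (* If [Ah] vanished at [t], its integrand would be infinite on a right neighbourhood of 0. *)
  move=> t tp; rewrite lt_neqAle (young_ge0 yAh (ltW tp)) andbT eq_sym; apply/negP => /eqP At.
  have [s s0 Is] := Ah0; pose m := Num.min s t; have m0 : 0 < m by rewrite lt_min s0.
  have mD a : measurable (`]0%R, a]%classic : set (measurableTypeR R)) by exact: measurable_itv.
  suff : (+oo <= \int[lebesgue_measure]_(x in (`]0%R, s]%classic : set (measurableTypeR R))) sobolev_integrand n Ah x)%E.
    by rewrite leNgt Is.
  apply: (@le_trans _ _ (\int[lebesgue_measure]_(x in (`]0%R, m]%classic : set (measurableTypeR R))) sobolev_integrand n Ah x)%E).
    rewrite (eq_integral (cst +oo%E)); last first.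
      move=> x /set_mem; rewrite /= in_itv/= => /andP[x0 xm]; apply: sobolev_integrand_infty => //.
      apply/eqP; rewrite eq_le (young_ge0 yAh (ltW x0)) andbT -At; apply: (young_homo yAh).
      by rewrite (ltW x0) (le_trans xm)// /m ge_min lexx orbT.
    rewrite integral_cst// [X in (_ * X)%E](lebesgue_measure_itv `]_, _])/= lte_fin m0 -EFinB subr0.
    by rewrite gt0_mulye ?lte_fin.
  apply: (@ge0_subset_integral _ _ _ lebesgue_measure) => //.
  - by apply: measurable_sobolev_integrand => // x; rewrite /= in_itv/= => /andP[].
  - by move=> x _; exact: sobolev_integrand_ge0.
  - by move=> x; rewrite /= !in_itv/= => /andP[-> xm]; rewrite (le_trans xm)// /m ge_min lexx.
(* One of the two inequalities uses the equivalence at [c * t], so [T] has to dominate [t0 / c] as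
   well as [t0]. *)
exists (Num.max 1 c), (Num.max t0 (t0 / c)); split; first by rewrite le_max lexx.
  by rewrite lt_max t00.
move=> t; rewrite ge_max => /andP[t0t t0ct].
have tp : 0 < t := lt_le_trans t00 t0t.
have ct : c * t <= Num.max 1 c * t by rewrite ler_wpM2r ?le_max ?lexx ?orbT// ltW.
have ctp : 0 < c * t by exact: mulr_gt0.
split.
  apply: (@le_trans _ _ (Ah (c * t))); last by apply: (young_homo yAh); rewrite ct ltW.
  have h : t0 <= c * t by rewrite mulrC -ler_pdivrMr.
  have /andP[+ _] := eqv _ h.
  by rewrite mulrAC mulfV ?mul1r ?gt_eqF.
have /andP[_ /le_trans] := eqv t t0t; apply.
by apply: (young_homo yA); rewrite ct ltW.
Qed.

Lemma admissible_finite t : 0 <= t -> (Ah t < +oo)%E.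
Proof.
move=> t0; have [yAh _ _ [c [T [c1 T0 /(_ (Num.max t T))]]]] := admissible_young.
rewrite le_max lexx orbT => /(_ isT) [_ le].
apply: le_lt_trans (dvg_young_finite (_ : 0 <= c * Num.max t T)); last first.
  by rewrite mulr_ge0 ?le_max ?t0// (le_trans ler01).
by apply: le_trans le; apply: (young_homo yAh); rewrite t0 le_max lexx.
Qed.

(** The comparison [Ah t <= A (c * t)] bounds the integrand of [Ah] from below by a multiple of that
    of [A] at [c * t]; a change of variables keeps the divergence. *)
Lemma admissible_dvg : dvg_int_infty (sobolev_integrand n Ah).
Proof.
have [yAh ndAh _ [c [T [c1 T0 eqv]]]] := admissible_young.
have c0 : 0 < c := lt_le_trans ltr01 c1.
move=> t0 t00; pose s := Num.max t0 T; have s0 : 0 < s by rewrite lt_max t00.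
pose I (a : R) : set (measurableTypeR R) := `[a, +oo[%classic.
have mI a : measurable (I a) by exact: measurable_itv.
have Ipos a x : 0 < a -> I a x -> 0 < x by rewrite /I /= in_itv/= andbT; exact: lt_le_trans.
apply/eqP; rewrite -leye_eq.
apply: (@le_trans _ _ (\int[lebesgue_measure]_(x in I s) sobolev_integrand n Ah x)%E); last first.
  apply: (@ge0_subset_integral _ _ _ lebesgue_measure (I s) (I t0)) => //.
  - by apply: measurable_sobolev_integrand => // x; exact: Ipos.
  - by move=> x _; exact: sobolev_integrand_ge0.
  - by move=> x; rewrite /I /= !in_itv/= !andbT /s ge_max => /andP[].
pose k := c^-1 `^ (n.-1%:R^-1); have k0 : 0 < k by rewrite powR_gt0// invr_gt0.
have cmp x : I s x -> (k%:E * sobolev_integrand n A (c * x) <= sobolev_integrand n Ah x)%E.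
  move=> sx; have x0 := Ipos _ _ s0 sx; have cx0 : 0 < c * x by exact: mulr_gt0.
  have Tx : T <= x by move: sx; rewrite /I /= in_itv/= andbT /s ge_max => /andP[].
  have [_ AhA] := eqv x Tx; have fA := dvg_young_finite (ltW cx0); have fAh := admissible_finite (ltW x0).
  rewrite !sobolev_integrandE// -EFinM lee_fin.
  have pA : 0 < fine (A (c * x)) by rewrite fine_gt0// ndA//= fA.
  have pAh : 0 < fine (Ah x) by rewrite fine_gt0// ndAh//= fAh.
  rewrite /k -powRM ?invr_ge0 ?divr_ge0 ?(ltW c0) ?(ltW cx0) ?(ltW pA)//.
  apply: ge0_ler_powR; rewrite ?nnegrE.
  - by rewrite ltW// inv_predn_gt0.
  - by rewrite mulr_ge0 ?invr_ge0 ?divr_ge0 ?(ltW c0) ?(ltW cx0) ?(ltW pA).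
  - by rewrite divr_ge0 ?(ltW x0) ?(ltW pAh).
  rewrite mulrA mulKf ?gt_eqF// ler_pdivrMr// mulrAC ler_pdivlMr// ler_pM2l//.
  by rewrite fine_le ?ge0_fin_numE ?young_ge0 ?(ltW x0) ?(ltW cx0).
have mA : measurable_fun (I (c * s)) (sobolev_integrand n A : measurableTypeR R -> \bar R).
  by apply: measurable_sobolev_integrand => // x; apply: Ipos; exact: mulr_gt0.
have mR : measurable_fun setT ((sobolev_integrand n A : measurableTypeR R -> \bar R) \_ (I (c * s))).
  by apply/(measurable_restrictT _ (mI _)).
have R0 x : (0 <= ((sobolev_integrand n A : measurableTypeR R -> \bar R) \_ (I (c * s)%R)) x)%E.
  by apply: erestrict_ge0 => ? _; exact: sobolev_integrand_ge0.
have := ge0_integral_scale c0 mR R0; rewrite -integral_mkcond.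
rewrite [X in X = _ -> _](_ : _ = +oo%E); last by apply: Aoo; exact: mulr_gt0.
have -> : (\int[lebesgue_measure]_x ((sobolev_integrand n A : measurableTypeR R -> \bar R) \_ (I (c * s)%R)) (c * x)%R =
    \int[lebesgue_measure]_(x in I s) sobolev_integrand n A (c * x)%R)%E.
  rewrite [RHS]integral_mkcond; apply: eq_integral => x _; rewrite !patchE.
  have -> : (c * x \in I (c * s)) = (x \in I s) => //.
  by apply/idP/idP => /set_mem xs; apply/mem_set; move: xs; rewrite /I /= !in_itv/= !andbT ler_pM2l.
set J := (\int[_]_(x in I s) _)%E => cJ.
have Joo : J = +oo%E.
  have J0 : (0 <= J)%E by apply: integral_ge0 => x _; exact: sobolev_integrand_ge0.
  by move: cJ J0; case: J => //= r; rewrite -EFinM.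
have mcx : measurable_fun (I s) (fun x : measurableTypeR R => sobolev_integrand n A (c * x)).
  apply: (measurability _ (ErealGenOInfty.measurableE R)) => // _ [_ [z ->] <-].
  apply: is_interval_measurable => x y; rewrite /= !in_itv/= !andbT => -[x0 zx] [y0 zy] r /andP[xr ry].
  have sx : s <= x by move: x0; rewrite /I /= in_itv/= andbT.
  have rs := le_trans sx xr; split; first by rewrite /I /= in_itv/= rs.
  rewrite in_itv/= andbT; apply: lt_le_trans zy _; apply: sobolev_integrand_anti => //; last by rewrite ler_pM2l.
  by rewrite mulr_gt0// (lt_le_trans s0).
rewrite (_ : +oo%E = (k%:E * J)%E); last by rewrite Joo gt0_muley// lte_fin.
rewrite /J -ge0_integralZl//; last 2 first.
- by move=> x _; exact: sobolev_integrand_ge0.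
- by rewrite lee_fin ltW.
apply: ge0_le_integral => //.
- by move=> x _; rewrite mule_ge0 ?lee_fin ?(ltW k0)// sobolev_integrand_ge0.
- exact: measurable_funeM.
- by apply: measurable_sobolev_integrand => // x; exact: Ipos.
Qed.

End admissible.

(** * Growth of the composition *)

Section growth.
Context {R : realType}.
Variables (A B F : R -> \bar R) (E H : R -> R) (t0 t1 : R).
Hypotheses (yA : young A) (ndA : nondegenerate_young A) (fA : forall t, 0 <= t -> (A t < +oo)%E).
Hypotheses (yB : young B) (yF : young F).
Hypotheses (E0 : forall t, 0 <= t -> 0 <= E t).
Hypothesis Emono : forall s t, 0 <= s -> s <= t -> E s <= E t.
Hypothesis H0 : forall t, 0 < t -> 0 <= H t.
Hypothesis Hmono : forall s t, 0 < s -> s <= t -> H s <= H t.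
Hypothesis Hoo : forall x, exists2 t, 0 < t & x <= H t.
Hypothesis BA : forall t, t0 <= t -> (B (t * E (H t))%R <= A t)%E.
Hypothesis t10 : 0 < t1.
Hypothesis BF : forall t, 0 <= t <= t1 -> (B (t * E (fine (rc_inverse F (A t))))%R <= A t)%E.
Hypothesis FA : forall l, 0 < l ->
  (limf_esup (fun t : R => F (l * t)%R / A t) (0%R : R)^'+ < +oo)%E.

(** The growth hypothesis is used at the larger of [p] and [t]. *)
Lemma growth_large p v t : 0 <= p -> 0 <= v -> 0 < t -> t0 <= t -> v <= H t ->
  (B (p * E v)%R <= A p + A t)%E.
Proof.
move=> p0 v0 tp t0t vH; have [tp'|pt] := leP t p.
  apply: (@le_trans _ _ (A p)); last by rewrite leeDl// young_ge0// ltW.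
  apply: le_trans (BA (le_trans t0t tp')); apply: (young_homo yB); rewrite mulr_ge0 ?E0//=.
  by rewrite ler_wpM2l// Emono// (le_trans vH)// Hmono.
apply: (@le_trans _ _ (A t)); last by rewrite leeDr// young_ge0.
apply: le_trans (BA t0t); apply: (young_homo yB); rewrite mulr_ge0 ?E0//=.
by apply: ler_pM => //; [exact: E0|exact: ltW|exact: Emono].
Qed.

Lemma le_rc_inverse w z : 0 <= w -> (F w <= z)%E -> (z < +oo)%E -> w <= fine (rc_inverse F z).
Proof.
move=> w0 Fz zoo.
have lb : (w%:E <= rc_inverse F z)%E.
  apply: le_ereal_inf_tmp => _ [s [s0 zs] <-]; rewrite lee_fin leNgt; apply/negP => sw.
  have := lt_le_trans zs (le_trans (young_homo yF (_ : 0 <= s <= w)) Fz).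
  by rewrite s0 (ltW sw) ltxx => /(_ isT).
have [c [d [c0 d0 Flin]]] := young_linear yF.
have [s s0 zs] : exists2 s, 0 <= s & (z < F s)%E.
  have [z' zz'] : exists z' : R, (z <= z'%:E)%E.
    by case: z zoo {Fz lb} => [r _|//|_]; [exists r|exists 0; exact: leNye].
  pose s := (Num.max z' 0 + d + 1) / c; have s0 : 0 <= s.
    by rewrite divr_ge0 ?(ltW c0)// !addr_ge0// le_max lexx orbT.
  exists s => //; apply: (le_lt_trans zz'); have := Flin s s0; rewrite -leeBlDr//; apply: lt_le_trans.
  rewrite -EFinB lte_fin /s mulrC mulfVK ?gt_eqF//.
  have : z' <= Num.max z' 0 by rewrite le_max lexx.
  lra.
rewrite -lee_fin fineK// fin_numE; apply/andP; split.
  by rewrite gt_eqF// (lt_le_trans (ltNyr w)).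
rewrite lt_eqF//; apply: (@le_lt_trans _ _ s%:E); last exact: ltry.
by apply: ereal_inf_lbound; exists s.
Qed.

Lemma growth_limsup l : 0 < l -> exists e C : R, [/\ 0 < e, 0 <= C &
  forall t, 0 <= t -> t < e -> (F (l * t)%R <= C%:E * A t)%E].
Proof.
move=> l0; have := FA l0; rewrite limf_esupE => /ereal_inf_lt[_ [V nV <-]] VC.
have [C [C0 HC]] : exists C : R, 0 <= C /\ (ereal_sup [set (F (l * t)%R / A t)%E | t in V] <= C%:E)%E.
  case: (ereal_sup _) VC => [r _|//|_]; last by exists 0; split => //; exact: leNye.
  by exists (Num.max r 0); split; [rewrite le_max lexx orbT|rewrite lee_fin le_max lexx].
have [e /= e0 eV] := nV; exists e, C; split => // t t_ge0 te.
have [->|tn0] := eqVneq t 0; first by rewrite mulr0 (young0 yF) (young0 yA) mule0.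
have tp : 0 < t by rewrite lt_neqAle eq_sym tn0.
have Vt : V t by apply: eV => //=; rewrite sub0r normrN ger0_norm.
have : (F (l * t)%R / A t <= C%:E)%E by apply: le_trans HC; apply: ereal_sup_ubound; exists t.
have Af : A t \is a fin_num by rewrite ge0_fin_numE ?fA// young_ge0.
have A_pos : 0 < fine (A t) by rewrite fine_gt0// ndA//= fA.
by rewrite -(fineK Af) inver gt_eqF// lee_pdivrMr.
Qed.

(** If [F (k * v) <= A p] the hypothesis near 0 is used at [p]. Otherwise it is used at a point [t]
    of [[p, t1]] with [A t = F (k * v)], and the limsup condition bounds [F (k * v)] by
    [C * A v]. *)
Lemma growth_small k : 0 < k -> exists e C : R, [/\ 0 < e, 0 <= C &
  forall p v, 0 <= p <= t1 -> 0 <= v <= e -> (B (p * E (k * v))%R <= A p + C%:E * A v)%E].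
Proof.
move=> k0; have [e [C [e0 C0 FC]]] := growth_limsup k0.
(* The second bound on [v] gives [C * A v <= A t1], so that the intermediate value is attained no
   later than [t1]. *)
exists (Num.min (e / 2) (t1 / (C + 1))), C; split => //.
  by rewrite lt_min !divr_gt0// ltr_wpDl.
move=> p v /andP[p0 pt1] /andP[v0]; rewrite le_min => /andP[ve vt].
have kv0 : 0 <= k * v by rewrite mulr_ge0// ltW.
have CA0 : (0 <= C%:E * A v)%E by rewrite mule_ge0 ?lee_fin// young_ge0.
have [Fp|pF] := leP (F (k * v)) (A p).
  apply: (@le_trans _ _ (A p)); last by rewrite leeDl.
  apply: le_trans (BF (_ : 0 <= p <= t1)); last by rewrite p0.
  apply: (young_homo yB); rewrite mulr_ge0 ?E0//= ler_wpM2l// Emono//.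
  by apply: le_rc_inverse => //; exact: fA.
have Fv : (F (k * v) <= C%:E * A v)%E by apply: FC => //; lra.
have Avf : A v \is a fin_num by rewrite ge0_fin_numE ?fA// young_ge0.
have Foo : (F (k * v) < +oo)%E by apply: (le_lt_trans Fv); rewrite -(fineK Avf) -EFinM ltry.
have Ff : F (k * v) \is a fin_num by rewrite ge0_fin_numE// young_ge0.
have Ft1 : (F (k * v) <= A t1)%E.
  apply: (le_trans Fv); have At1f : A t1 \is a fin_num by rewrite ge0_fin_numE ?fA ?young_ge0// ltW.
  have vt1 : v <= t1.
    by apply: (le_trans vt); rewrite ler_pdivrMr ?ltr_wpDl// ler_peMr ?(ltW t10)// lerDr.
  have := young_le_scale yA (_ : 0 <= v <= t1) t10; rewrite v0 vt1 => /(_ isT).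
  rewrite -(fineK Avf) -(fineK At1f) -!EFinM !lee_fin => Av.
  have a1 : 0 <= fine (A t1) by rewrite fine_ge0// young_ge0// ltW.
  apply: (le_trans (ler_wpM2l C0 Av)); rewrite mulrA ler_piMl// mulrA ler_pdivrMr// mul1r mulrC.
  have C1 : 0 < C + 1 by rewrite ltr_wpDl.
  by rewrite ler_pdivlMr// in vt; apply: le_trans vt; rewrite ler_wpM2l// lerDl.
have [t /andP[pt tt1] At] := young_ivt yA fA p0 pt1 (y := fine (F (k * v))) ltac:(by rewrite fineK// (ltW pF)).
rewrite fineK// in At.
have t_ge0 := le_trans p0 pt.
apply: (@le_trans _ _ (A t)); last by rewrite At (le_trans Fv)// leeDr// young_ge0.
apply: le_trans (BF (_ : 0 <= t <= t1)); last by rewrite t_ge0.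
apply: (young_homo yB); rewrite mulr_ge0 ?E0//=; apply: ler_pM => //; first exact: E0.
by apply: Emono => //; apply: le_rc_inverse => //; rewrite At.
Qed.

(** When both [p] and [v] are small this is [growth_small]. Otherwise [A v] or [A p] is bounded
    below, and it absorbs the constant [A t] left by [growth_large]. *)
Lemma growth_bounded k M : 0 < k -> 0 <= M -> exists2 D : R, 1 <= D &
  forall p v, 0 <= p -> 0 <= v <= M -> (B (p * E (k * v))%R <= D%:E * (A p + A v))%E.
Proof.
move=> k0 M0; have [e [C [e0 C0 small]]] := growth_small k0.
have [t [tp t0t kM]] : exists t, [/\ 0 < t, t0 <= t & k * M <= H t].
  have [t tp kM] := Hoo (k * M); exists (Num.max t t0); rewrite lt_max tp le_max lexx orbT; split => //.
  by apply: (le_trans kM); apply: Hmono => //; rewrite le_max lexx.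
have fin s : 0 < s -> (A s \is a fin_num) /\ 0 < fine (A s).
  by move=> s0; rewrite ge0_fin_numE ?fA ?young_ge0 ?(ltW s0)// fine_gt0// ndA//= fA// ltW.
have [Atf At0] := fin t tp; have [Aef Ae0] := fin e e0; have [At1f At10] := fin t1 t10.
pose K := fine (A t) / fine (A e) + fine (A t) / fine (A t1) + C + 1.
have q1 : 0 <= fine (A t) / fine (A e) by rewrite divr_ge0// ltW.
have q2 : 0 <= fine (A t) / fine (A t1) by rewrite divr_ge0// ltW.
have K1 : 1 <= K by rewrite /K; lra.
exists K => // p v p0 /andP[v0 vM]; have Ap0 := young_ge0 yA p0; have Av0 := young_ge0 yA v0.
have kv0 : 0 <= k * v by rewrite mulr_ge0// ltW.
have one x : (0 <= x -> x <= K%:E * x)%E by move=> x0; rewrite lee_pemull// lee_fin.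
have coef (c : R) x : 0 <= c -> c <= K -> (0 <= x -> c%:E * x <= K%:E * x)%E.
  by move=> c0 cK x0; rewrite lee_wpmul2r// lee_fin.
rewrite muleDr ?ge0_adde_def ?inE//.
have large : (B (p * E (k * v))%R <= A p + A t)%E.
  by apply: growth_large => //; apply: le_trans kM; rewrite ler_pM2l.
have ratio s r : 0 < s -> s <= r -> (A t <= (fine (A t) / fine (A s))%:E * A r)%E.
  move=> s0 sr; have [Asf As0] := fin s s0.
  apply: (@le_trans _ _ ((fine (A t) / fine (A s))%:E * A s)%E).
    by rewrite -{2}(fineK Asf) -EFinM mulfVK ?gt_eqF// fineK.
  by rewrite lee_wpmul2l ?lee_fin ?divr_ge0 ?(ltW At0) ?(ltW As0)//; apply: (young_homo yA); rewrite sr ltW.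
have [ev|ve] := leP e v.
  apply: (le_trans large); apply: leeD; first exact: one.
  by apply: (le_trans (ratio _ _ e0 ev)); apply: coef => //; rewrite /K; lra.
have [t1p|pt1] := leP t1 p.
  apply: (le_trans large); apply: (@le_trans _ _ (K%:E * A p)%E); last by rewrite leeDl// mule_ge0// lee_fin; lra.
  apply: (@le_trans _ _ (A p + (fine (A t) / fine (A t1))%:E * A p)%E); first by rewrite leeD2l// ratio.
  have -> : (A p + (fine (A t) / fine (A t1))%:E * A p = (1 + fine (A t) / fine (A t1))%:E * A p)%E.
    by rewrite EFinD ge0_muleDl ?lee_fin// mul1e.
  by apply: coef => //; rewrite /K; lra.
apply: (le_trans (small p v _ _)); [by rewrite p0 ltW|by rewrite v0 ltW|].
by apply: leeD; [exact: one|apply: coef => //; rewrite /K; lra].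
Qed.

End growth.

(* The composition with a function [f] such that [|f'| <= w(|.|)] is controlled in [B]
   by the modular [A], up to a remainder whose integral is uniformly small. *)
Definition growth_control {R : realType} (n : nat) (O : set 'rV[R]_n) (A B : R -> \bar R) (w : R -> R) :=
  forall L M : R, 0 < L -> 0 <= M -> exists2 l : R, 0 < l &
  forall Psi : 'rV[R]_n -> \bar R, measurable_fun setT Psi -> (forall x, 0 <= Psi x)%E ->
  (\int[borel_lebesgue n]_(x in O) Psi x <= M%:E)%E ->
  forall e : R, 0 < e -> exists2 D : R, 0 <= D & forall v H,
    (forall i, borel_weak O i v (H i)) ->
    {ae borel_lebesgue n, forall x, O x -> (A (`|v x| / L)%R <= Psi x)%E /\ (A (gradnorm H x / L)%R <= Psi x)%E} ->
    exists r : 'rV[R]_n -> \bar R, [/\ measurable_fun setT r, (forall x, 0 <= r x)%E,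
      (\int[borel_lebesgue n]_(x in O) r x <= e%:E)%E &
      {ae borel_lebesgue n, forall x, O x -> forall p : R, 0 <= p ->
        (B (p * w `|v x| / l)%R <= D%:E * (A (p / L)%R + A (`|v x| / L)%R) + r x)%E}].

(** * Smallness of tails of integrals *)

Section integral_tails.
Context d (T : measurableType d) (R : realType) (mu : {measure set T -> \bar R}).
Variables (O : set T) (f : T -> \bar R).
Hypotheses (mO : measurable O) (mf : measurable_fun setT f) (f0 : forall x, (0 <= f x)%E).

Lemma integral_vanishing_sets (S : nat -> set T) (e : R) : (forall k, measurable (S k)) -> mu.-integrable O f ->
  {ae mu, forall x, O x -> exists N, forall k, (N <= k)%N -> ~ S k x} -> 0 < e ->
  exists k, (\int[mu]_(x in O `&` S k) f x <= e%:E)%E.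
Proof.
move=> mS iF SN e0.
have mfS k : measurable_fun O (f \_ (S k)).
  by apply: measurable_funTS; apply/(measurable_restrictT _ (mS _)); exact: measurable_funTS.
have dct : {ae mu, forall x, O x -> (f \_ (S k)) x @[k --> \oo] --> (cst 0%E : T -> \bar R) x}.
  apply: filterS SN => x SNx Ox; apply/cvge0P => [k|e' e'0]; first by rewrite patchE; case: ifP.
  by have [N HN] := SNx Ox; exists N => k Nk; rewrite patchE memNset ?lee_fin ?ltW//; exact: HN.
have dom : {ae mu, forall x k, O x -> (`|(f \_ (S k)) x| <= f x)%E}.
  by apply: aeW => x k Ox; rewrite patchE; case: ifP => _; rewrite ?gee0_abs ?abse0.
have [_ _] := dominated_convergence mO mfS (measurable_cst _) dct iF dom.
rewrite integral0 => /(iffLR (cvge0P _)) H.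
have [|k kN] := H _ e e0; first by move=> k; apply: integral_ge0 => x _; rewrite patchE; case: ifP.
by exists k; have := kN k (leqnn _); rewrite integral_mkcondr.
Qed.

Lemma integral_small_on_large (e : R) : (\int[mu]_(x in O) f x < +oo)%E -> 0 < e ->
  exists2 M : R, 1 <= M & (\int[mu]_(x in O `&` [set x | M%:E <= f x]) f x <= e%:E)%E.
Proof.
move=> foo e0.
have iF : mu.-integrable O f.
  by apply/integrableP; split; [exact: measurable_funTS|under eq_integral do rewrite gee0_abs//].
pose S (k : nat) := [set x | ((k%:R + 1)%R%:E <= f x)%E].
have mS k : measurable (S k).
  rewrite (_ : S k = f @^-1` `[(k%:R + 1)%:E, +oo[); first by rewrite -[X in measurable X]setTI; apply: mf => //; exact: emeasurable_itv.
  by apply/seteqP; split => x /=; rewrite in_itv/= andbT.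
have [|k Hk] := integral_vanishing_sets mS iF _ e0; last by exists (k%:R + 1); rewrite ?lerDr.
apply: filterS (integrable_ae mO iF) => x fin_ Ox; have fx := fin_ Ox.
exists (Num.bound (fine (f x))) => k Nk; rewrite /S /= -[X in (_ <= X)%E](fineK fx) lee_fin leNgt => /negP; apply.
apply: lt_le_trans (archi_boundP _) _; first by rewrite fine_ge0.
by rewrite (@le_trans _ _ k%:R) ?ler_nat// lerDl.
Qed.

End integral_tails.

(** * Growth control in the two cases *)

Section control.
Context {R : realType} (n : nat).
Hypothesis n1 : (1 < n)%N.
Local Notation mu := (@borel_lebesgue R n).
Variables (O : set 'rV[R]_n) (C : R).
Hypotheses (ext : borel_extension O C) (C0 : 0 < C) (oO : open O).

Let mO : measurable O := open_measurable_rV oO.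
Let i0 : 'I_n := Ordinal (ltnW n1).

Lemma borel_weak_scale c i u (G : 'rV[R]_n -> R) : borel_weak O i u G ->
  borel_weak O i (fun x => c * u x) (fun x => c * G x).
Proof.
move=> uG; have [mu_ mG iu iG _] := uG; split.
- by apply: measurable_funM => //; exact: measurable_cst.
- by apply: measurable_funM => //; exact: measurable_cst.
- move=> K cK KO; rewrite (_ : _ \o _ = (fun x => c%:E * (EFin \o u) x)%E)//.
  by apply: integrableZl; [exact: compact_measurable_rV|exact: iu].
- move=> K cK KO; rewrite (_ : _ \o _ = (fun x => c%:E * (EFin \o G) x)%E)//.
  by apply: integrableZl; [exact: compact_measurable_rV|exact: iG].
- move=> phi tphi; have := chain_rule_bounded oO uG (bounded_measurable_cst c) tphi.
  by under eq_integral do rewrite prim_cst.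
Qed.

(** Boundedness of [v] bounds [w (|v|)] by a constant, which is put into the scale [l]; the
    remainder is 0. *)
Lemma growth_control_bounded (A : R -> \bar R) (w : R -> R) : young A -> nondegenerate_young A ->
  cvg_int_infty (sobolev_integrand n A) -> (forall s, 0 <= s -> 0 <= w s) ->
  (forall s t, 0 <= s -> s <= t -> w s <= w t) -> growth_control O A A w.
Proof.
move=> yA ndA Aoo w0 wmono L M L0 M0.
have [b b0 Hb] := sobolev_bounded n1 ext C0 oO yA ndA Aoo M0.
have Lb0 : 0 <= L * b by rewrite mulr_ge0// ltW.
have wb := w0 _ Lb0; have l0 : 0 < L * (w (L * b) + 1) by rewrite mulr_gt0// ltr_wpDl.
exists (L * (w (L * b) + 1)) => // Psi mPsi Psi0 PsiM e e0; exists 1 => // v H vH HPsi.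
exists (fun=> 0%E); split => //; first by rewrite integral0 lee_fin ltW.
have vH' i := borel_weak_scale L^-1 (vH i).
have Li0 : 0 <= L^-1 by rewrite invr_ge0 ltW.

have mv : measurable_fun setT v by case: (vH i0).
have mH i : measurable_fun setT (H i) by case: (vH i).
have le_ae (f : 'rV[R]_n -> R) : measurable_fun setT f -> (forall x, 0 <= f x) ->
    {ae mu, forall x, O x -> (A (f x) <= Psi x)%E} ->
    (\int[mu]_(x in O) A (f x) <= M%:E)%E.
  move=> mf f0 HA; apply: le_trans PsiM; apply: ae_ge0_le_integral => //.
  - by move=> x _; exact: young_ge0.
  - apply: measurable_funTS; rewrite (_ : (fun x => _) = (fun x => A `|f x|)).
      exact: measurable_young_comp.
    by apply/funext => x; rewrite ger0_norm.
  - exact: measurable_funTS.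
have := Hb _ _ vH' _ _; move/(_ _ _) => Hbd.
have {}Hbd : {ae mu, forall x, O x -> `|L^-1 * v x| <= b}.
  apply: Hbd.
  - apply: le_ae => //.
      by apply: measurableT_comp => //; apply: measurable_funM => //; exact: measurable_cst.
    by apply: filterS HPsi => x Hx Ox; have [h _] := Hx Ox; rewrite normrM (ger0_norm Li0) mulrC.
  - apply: le_ae => //.
    + by apply: measurable_gradnorm => i; apply: measurable_funM => //; exact: measurable_cst.
    + by move=> x; exact: gradnorm_ge0.
    by apply: filterS HPsi => x Hx Ox; have [_ h] := Hx Ox; rewrite gradnorm_scale (ger0_norm Li0) mulrC.
apply: filterS Hbd => x Hx Ox p p0; rewrite mul1e adde0.
apply: (@le_trans _ _ (A (p / L))); last by rewrite leeDl// young_ge0// divr_ge0// ltW.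
have vb : `|v x| <= L * b.
  by have := Hx Ox; rewrite normrM (ger0_norm Li0) mulrC ler_pdivrMr// mulrC.
apply: (young_homo yA); rewrite !mulr_ge0 ?invr_ge0 ?w0 ?(ltW l0)//=.
rewrite invfM mulrA [p * _ / L]mulrAC -[_ * _ / (_ + 1)]mulrA ler_piMr ?divr_ge0 ?(ltW L0)//.
by rewrite ler_pdivrMr ?ltr_wpDl// mul1r; apply: le_trans (wmono _ _ _ vb) _ => //; rewrite lerDl.
Qed.

(** The remainder is the sum of [a j] over the superlevel sets containing the point. Each term is
    paid by the energy of its own layer, and the layers are disjoint. *)
Lemma dyadic_remainder (v : 'rV[R]_n -> R) (Q : 'rV[R]_n -> \bar R) (m : R) (a : nat -> \bar R) :
  measurable_fun setT v -> measurable_fun setT Q -> (forall x, 0 <= Q x)%E -> 0 < m ->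
  (forall j, 0 <= a j)%E ->
  (forall j, a j * mu (O `&` [set x | (m * 2 ^+ j.+1 <= `|v x|)%R]) <=
     \int[mu]_(x in slice O v (m * 2 ^+ j) (m * 2 ^+ j.+1)) Q x)%E ->
  exists r : 'rV[R]_n -> \bar R, [/\ measurable_fun setT r, (forall x, 0 <= r x)%E,
    (\int[mu]_(x in O) r x <= \int[mu]_(x in superlevel O v m) Q x)%E &
    forall x j, O x -> m * 2 ^+ j.+1 <= `|v x| -> (a j <= r x)%E].
Proof.
move=> mv mQ Q0 m0 a0 Ha; pose t j : R := m * 2 ^+ j.
pose S j := O `&` [set x | (t j.+1 <= `|v x|)%R].
have mS j : measurable (S j) by exact: measurable_superlevel_ge.
pose g j (x : 'rV[R]_n) : \bar R := (a j * (\1_(S j) x)%:E)%E.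
have g0 j x : (0 <= g j x)%E by rewrite mule_ge0.
have mg j D : measurable_fun D (g j).
  by apply: measurable_funTS; apply: measurable_funeM; apply/measurable_EFinP; exact: measurable_indic.
exists (fun x => \sum_(j <oo) g j x)%E; split.
- by apply: ge0_emeasurable_sum.
- by move=> x; exact: nneseries_ge0.
- rewrite integral_nneseries//.
  apply: (@le_trans _ _ (\sum_(j <oo) \int[mu]_(x in slice O v (t j) (t j.+1)) Q x)%E).
    apply: lee_nneseries => [j _ _|j _]; first by exact: integral_ge0.
    rewrite /g ge0_integralZl//; last by apply/measurable_EFinP; exact: measurable_indic.
    rewrite integral_indic// setIC (_ : O `&` S j = S j); first exact: Ha.
    by rewrite /S setIA setIid.
  have tS i j : (i < j)%N -> t i.+1 <= t j.
    by move=> ij; rewrite /t ler_pM2l// ler_weXn2l// ler1n.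
  rewrite -ge0_integral_bigcup//.
  + apply: ge0_subset_integral => //.
    * by apply: bigcupT_measurable => j; exact: measurable_slice.
    * exact: measurable_superlevel.
    * exact: measurable_funTS.
    * move=> x [j _ [Ox /= /andP[tv _]]]; split => //=; apply: le_lt_trans tv.
      by rewrite ler_peMr ?(ltW m0)// exprn_ege1// ler1n.
  + by move=> j; exact: measurable_slice.
  + exact: measurable_funTS.
  + apply/trivIsetP => i j _ _ ij; apply/seteqP; split => x // [[_ /= /andP[i1 i2]] [_ /= /andP[j1 j2]]].
    have [ltij|ltji|eij] := ltngtP i j; last by rewrite eij eqxx in ij.
      by have := lt_trans i2 (le_lt_trans (tS _ _ ltij) j1); rewrite ltxx.
    by have := lt_trans j2 (le_lt_trans (tS _ _ ltji) i1); rewrite ltxx.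
- move=> x j Ox tv; have Sx : S j x by split.
  apply: (@le_trans _ _ (g j x)); first by rewrite /g indicE mem_set// mule1.
  by rewrite (@nneseriesD1 _ _ j)// leeDl// nneseries_ge0.
Qed.

(** Up to the level [2 * m] the estimate is [growth_bounded]. Above it, [growth_large] is used with
    threshold [t_ j], and the term [A (t_ j)] that it leaves goes into the remainder. *)
Lemma growth_control_divergent (A B Ah F : R -> \bar R) (E : R -> R) (kappa t0 t1 : R) :
  young A -> nondegenerate_young A -> dvg_int_infty (sobolev_integrand n A) -> H_admissible n A Ah ->
  young B -> young F -> 0 < kappa -> (forall t, 0 <= t -> 0 <= E t) ->
  (forall s t, 0 <= s -> s <= t -> E s <= E t) ->
  (forall t, t0 <= t -> (B (t * E (H_ n Ah t))%R <= A t)%E) -> 0 < t1 ->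
  (forall t, 0 <= t <= t1 -> (B (t * E (fine (rc_inverse F (A t))))%R <= A t)%E) ->
  (forall l, 0 < l -> (limf_esup (fun t : R => F (l * t)%R / A t) (0%R : R)^'+ < +oo)%E) ->
  growth_control O A B (fun s => kappa * E (kappa * s)).
Proof.
move=> yA ndA Aoo adm yB yF k0 E0 Emono BA t10 BF FA L M' L0 _.
have [yAh ndAh Ah0 [c [T [c1 T0 eqv]]]] := admissible_young n1 yA ndA adm.
have fA := dvg_young_finite n1 yA Aoo.
have fAh := admissible_finite n1 yA ndA Aoo adm.
have Ahoo := admissible_dvg n1 yA ndA Aoo adm.
have c0 : 0 < c := lt_le_trans ltr01 c1.
pose H := H_ n Ah.
have H_ge0' t : 0 < t -> 0 <= H t by exact: H_ge0.
have Hmono s t : 0 < s -> s <= t -> H s <= H t by exact: H_homo.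
have Hoo x : exists2 t, 0 < t & x <= H t by exact: H_unbounded.
(* The factor [c] bounds [Ah] at scale [L'] by [A] at scale [L], above the threshold [T]. *)
pose L' := c * L; have L'0 : 0 < L' by exact: mulr_gt0.
pose k' := kappa * L'; have k'0 : 0 < k' by exact: mulr_gt0.
exists k' => // Psi mPsi Psi0 PsiM e e0; have Psioo := le_lt_trans PsiM (ltry M').
pose K0 := 2 ^+ n * C; have K00 : 0 < K0 by rewrite mulr_gt0// exprn_gt0.
pose r0 := K0^-1; have r00 : 0 < r0 by rewrite invr_gt0.
(* Since [H (c * t_ j)] is at most [8 * c * k' * tau j], this value makes the width bound of
   [weak_type_level] at most half of [tau j], the width of the layer. *)
pose m0 := (3 * K0 * (8 * c * k') * 2)^-1.
have m00 : 0 < m0 by rewrite invr_gt0 !mulr_gt0.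
(* The energy above level [m] has to stay within the allowed error [e] and below [m0 ^+ n]. *)
pose d := Num.min e (m0 ^+ n / 2).
have d0 : 0 < d by rewrite lt_min e0 divr_gt0// exprn_gt0.
pose aT := fine (Ah T); have aTE : (aT%:E = Ah T)%E by rewrite fineK// ge0_fin_numE ?fAh ?young_ge0// ltW.
have aT0 : 0 <= aT by rewrite fine_ge0// young_ge0// ltW.
(* The factor [1 + aT] pays for the constant by which [Ah] may exceed [Psi] at small gradients; the
   bound by [r0 ^+ n] is for the absorption in the width estimate. *)
pose d' := Num.min (d / (1 + aT)) (r0 ^+ n).
have aT1 : 0 < 1 + aT by rewrite ltr_pwDl.
have d'0 : 0 < d' by rewrite lt_min divr_gt0//= exprn_gt0.
have [M M1 HM] := integral_small_on_large mO mPsi Psi0 Psioo d'0.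
have [ca [da [ca0 da0 Alin]]] := young_linear yA.
pose ts := Num.max t0 T; have ts0 : 0 < ts by rewrite lt_max T0 orbT.
(* The first term makes [A m] at least [M], so that [Psi] is large where [|v'|] exceeds [m]; the
   second lets [H_between] start from [ts]. *)
pose m := Num.max ((M + da) / ca) (H ts / (4 * k')) + 1.
have Mda : 0 < (M + da) / ca by rewrite divr_gt0// ltr_pwDl// (lt_le_trans ltr01).
have m_pos : 0 < m by rewrite ltr_wpDl// le_max (ltW Mda).
have AmM : (M%:E <= A m)%E.
  have := Alin m (ltW m_pos); rewrite -leeBlDr//; apply: le_trans; rewrite -EFinB lee_fin.
  have : (M + da) / ca <= m by rewrite (@le_trans _ _ (Num.max ((M + da) / ca) (H ts / (4 * k'))))// ?le_max ?lexx// /m lerDl.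
  by rewrite ler_pdivrMr// mulrC; lra.
have Hm : H ts <= 4 * k' * m.
  have : H ts / (4 * k') <= m by rewrite (@le_trans _ _ (Num.max ((M + da) / ca) (H ts / (4 * k'))))// ?le_max ?lexx ?orbT// /m lerDl.
  by rewrite ler_pdivrMr ?mulr_gt0// mulrC.
pose tau j : R := m * 2 ^+ j.
have tau_ge j : m <= tau j by rewrite ler_peMr ?(ltW m_pos)// exprn_ege1// ler1n.
have tau0 j : 0 < tau j by exact: lt_le_trans (tau_ge j).
have tauS j : tau j.+1 = 2 * tau j by rewrite /tau exprS mulrCA.
(* The factor 4 is there because [|v'|] may approach [tau j.+2], which is [4 * tau j], while the
   weak-type estimate controls the superlevel set at [tau j.+1]. *)
have pick j : exists t, ts <= t /\ 4 * k' * tau j <= H t <= 2 * (4 * k' * tau j).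
  have [|t t1' t2'] := @H_between R n n1 Ah yAh ndAh fAh Ah0 ts (4 * k' * tau j) Ahoo ts0.
    by apply: (le_trans Hm); rewrite ler_pM2l// mulr_gt0.
  by exists t.
have [t_ Ht_] := choice pick.
have t_pos j : 0 < t_ j by have [h _] := Ht_ j; exact: lt_le_trans h.
have [D D1 HD] := growth_bounded yA ndA fA yB yF E0 Emono Hmono Hoo BA t10 BF FA k'0 (ltW (tau0 1%N)).
exists D; first by lra.
move=> v G vG HPsi.
pose v' x := L'^-1 * v x; pose G' i x := L'^-1 * G i x.
have v'G' i : borel_weak O i v' (G' i) by exact: borel_weak_scale.
have L'i0 : 0 <= L'^-1 by rewrite invr_ge0 ltW.
have mv' : measurable_fun setT v' by case: (v'G' i0).
have mG' i : measurable_fun setT (G' i) by case: (v'G' i).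
have v'E x : `|v' x| = `|v x| / L' by rewrite normrM ger0_norm// mulrC.
have G'E x : gradnorm G' x = gradnorm G x / L' by rewrite /G' gradnorm_scale ger0_norm// mulrC.
have LL' z : 0 <= z -> z / L' <= z / L.
  by move=> z0; rewrite ler_wpM2l// /L' invfM ler_piMl ?invr_ge0 ?(ltW L0)// invf_le1.
have Av' x : O x -> ((A (`|v x| / L)%R <= Psi x)%E /\ (A (gradnorm G x / L)%R <= Psi x)%E) -> (A `|v' x|%R <= Psi x)%E.
  move=> Ox [h _]; apply: le_trans h; apply: (young_homo yA); rewrite normr_ge0/= v'E; exact: LL'.
pose Q x := Ah (gradnorm G' x).
have mQ : measurable_fun setT Q.
  rewrite (_ : Q = fun x => Ah `|gradnorm G' x|).
    by apply: measurable_young_comp => //; exact: measurable_gradnorm.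
  by apply/funext => x; rewrite ger0_norm// gradnorm_ge0.
have Q0 x : (0 <= Q x)%E by rewrite young_ge0// gradnorm_ge0.
have QPsi x : O x -> ((A (`|v x| / L)%R <= Psi x)%E /\ (A (gradnorm G x / L)%R <= Psi x)%E) ->
    (Q x <= Psi x + aT%:E)%E.
  move=> Ox [_ h]; have [gT|Tg] := leP (gradnorm G' x) T.
    apply: (@le_trans _ _ aT%:E); last by rewrite leeDr.
    by rewrite aTE; apply: (young_homo yAh); rewrite gradnorm_ge0.
  apply: (@le_trans _ _ (Psi x)); last by rewrite leeDl// lee_fin.
  apply: le_trans h; have [_] := eqv _ (ltW Tg); congr (_ <= A _)%E.
  by rewrite G'E /L' invfM mulrCA [c * _]mulrA mulfV ?gt_eqF// mul1r.
pose S := superlevel O v' m; have mS : measurable S by exact: measurable_superlevel.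
have SPsi : (\int[mu]_(x in S) Psi x <= d'%:E)%E.
  apply: le_trans HM; rewrite [leLHS]integral_mkcond [leRHS]integral_mkcond.
  have mP : measurable (O `&` [set x | (M%:E <= Psi x)%E]).
    apply: measurableI => //; rewrite (_ : [set x | _] = Psi @^-1` `[M%:E, +oo[).
      by rewrite -[X in measurable X]setTI; apply: mPsi => //; exact: emeasurable_itv.
    by apply/seteqP; split => x /=; rewrite in_itv/= andbT.
  apply: ae_ge0_le_integral => //.
  - by move=> x _; apply: erestrict_ge0.
  - by apply/(measurable_restrictT _ mS); exact: measurable_funTS.
  - by move=> x _; apply: erestrict_ge0.
  - by apply/(measurable_restrictT _ mP); exact: measurable_funTS.
  apply: filterS HPsi => x Hx _; rewrite !patchE; case: ifPn => [/set_mem[Ox /= mv]|_]; last by case: ifP.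
  rewrite ifT//; apply/mem_set; split => //=; apply: (le_trans AmM).
  by apply: le_trans (Av' x Ox (Hx Ox)); apply: (young_homo yA); rewrite (ltW m_pos) ltW.
have muS : (mu S <= d'%:E)%E.
  have := superlevel_chebyshev oO yA mv' (ltW m_pos) (le_trans ler01 M1) AmM => HS.
  apply: (@le_trans _ _ (M%:E * mu S)%E); first by rewrite lee_pemull// lee_fin.
  apply: (le_trans HS); apply: le_trans SPsi; apply: ae_ge0_le_integral => //.
  - by move=> x _; exact: young_ge0.
  - by apply: measurable_funTS; exact: measurable_young_comp.
  - exact: measurable_funTS.
  by apply: filterS HPsi => x Hx [Ox _]; exact: (Av' x Ox (Hx Ox)).
have IQ : (\int[mu]_(x in S) Q x <= d%:E)%E.
  apply: (@le_trans _ _ (\int[mu]_(x in S) (Psi x + aT%:E))%E).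
    apply: ae_ge0_le_integral => //.
    - exact: measurable_funTS.
    - by move=> x _; rewrite adde_ge0.
    - by apply: emeasurable_funD => //; exact: measurable_funTS.
    by apply: filterS HPsi => x Hx [Ox _]; exact: (QPsi x Ox (Hx Ox)).
  rewrite ge0_integralD//; last exact: measurable_funTS.
  rewrite integral_cst//; apply: (@le_trans _ _ (d'%:E + aT%:E * d'%:E)%E).
    by apply: leeD => //; rewrite lee_wpmul2l.
  rewrite -EFinM -EFinD lee_fin -{1}[d']mul1r -mulrDl mulrC -ler_pdivlMr//.
  by rewrite /d' ge_min lexx.
pose a_ j := A (t_ j).
have [r [mr r_ge0 Ir Hr]] : exists r : 'rV[R]_n -> \bar R, [/\ measurable_fun setT r, (forall x, 0 <= r x)%E,
    (\int[mu]_(x in O) r x <= \int[mu]_(x in superlevel O v' m) Q x)%E &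
    forall x j, O x -> m * 2 ^+ j.+1 <= `|v' x| -> (a_ j <= r x)%E].
  apply: dyadic_remainder => //; first by move=> j; rewrite young_ge0// ltW.
  move=> j; rewrite -/(tau j) -/(tau j.+1).
  have [tst /andP[Ht1 Ht2]] := Ht_ j; have ct0 : 0 < c * t_ j by exact: mulr_gt0.
  have [y [y0 yH Iy]] := H_root n1 yAh ndAh fAh Ah0 ct0.
  have mSl : measurable (slice O v' (tau j) (tau j.+1)) by exact: measurable_slice.
  have Sld : (\int[mu]_(x in slice O v' (tau j) (tau j.+1)) Q x <= d%:E)%E.
    apply: le_trans IQ; apply: ge0_subset_integral => //; first exact: measurable_funTS.
    by move=> x [Ox /= /andP[tx _]]; split => //=; apply: le_lt_trans tx.
  have Slfin : (\int[mu]_(x in slice O v' (tau j) (tau j.+1)) Q x)%E \is a fin_num.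
    by rewrite ge0_fin_numE ?integral_ge0//; apply: le_lt_trans Sld (ltry _).
  pose Fj := fine (\int[mu]_(x in slice O v' (tau j) (tau j.+1)) Q x).
  apply: (@le_trans _ _ (Ah (c * t_ j)%R * mu (O `&` [set x | (tau j.+1 <= `|v' x|)%R]))%E).
    have Tt : T <= t_ j by apply: le_trans tst; rewrite /ts le_max lexx orbT.
    by apply: lee_wpmul2r => //; have [] := eqv _ Tt.
  rewrite -(fineK Slfin).
  apply: (weak_type_level n1 ext C0 oO yAh ndAh v'G' ct0 (fAh _ (ltW ct0)) y0 m00 (tau0 j) _ r00 _ Iy).
  - by rewrite tauS ltr_pMl// ltr1n.
  - by rewrite -/K0 /r0 divff// gt_eqF.
  - apply: (@le_trans _ _ (mu S)); first exact: superlevel_anti.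
    by apply: (le_trans muS); rewrite lee_fin /d' ge_min lexx orbT.
  - by rewrite fineK.
  - apply: (@le_lt_trans _ _ d); first by rewrite -lee_fin fineK.
    rewrite /d gt_min; apply/orP; right; rewrite ltr_pdivrMr// ltr_pMr ?exprn_gt0// ltr1n//.
  - rewrite tauS -/K0 -yH.
    have Hc : H (c * t_ j) <= c * (8 * k' * tau j).
      apply: (le_trans (H_scale n1 yAh ndAh fAh Ah0 c1 (t_pos j))); rewrite ler_pM2l//.
      by have <- : 2 * (4 * k' * tau j) = 8 * k' * tau j by ring.
    have : 3 * K0 * H (c * t_ j) * m0 <= 3 * K0 * (c * (8 * k' * tau j)) * m0.
      by rewrite ler_pM2r// ler_pM2l// mulr_gt0.
    have -> : 3 * K0 * (c * (8 * k' * tau j)) * m0 = tau j / 2.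
      rewrite /m0; field; rewrite ?gt_eqF//.
    move=> h; apply: (le_lt_trans h); have -> : 2 * tau j - tau j = tau j by ring.
    by rewrite ltr_pdivrMr// ltr_pMr// ltr1n.
exists r; split => //; first by apply: (le_trans Ir); apply: (le_trans IQ); rewrite lee_fin /d ge_min lexx.
apply: filterS HPsi => x Hx Ox p p0.
have -> : p * (kappa * E (kappa * `|v x|)) / k' = p / L' * E (k' * `|v' x|).
  have -> : k' * `|v' x| = kappa * `|v x| by rewrite v'E /k' -mulrA [L' * _]mulrC mulfVK ?gt_eqF.
  by rewrite /k'; field; rewrite !gt_eqF.
have p'0 : 0 <= p / L' by rewrite divr_ge0// ltW.
have Ap' : (A (p / L')%R <= A (p / L)%R)%E by apply: (young_homo yA); rewrite p'0 LL'.
have Avx : (A `|v' x|%R <= A (`|v x| / L)%R)%E.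
  by apply: (young_homo yA); rewrite normr_ge0/= v'E LL'.
have ApL : (0 <= A (p / L)%R)%E by rewrite young_ge0// divr_ge0// ltW.
have AvL : (0 <= A (`|v x| / L)%R)%E by rewrite young_ge0// divr_ge0// ltW.
have [vt|tv] := leP `|v' x| (tau 1%N).
  apply: (le_trans (HD _ _ p'0 _)); first by rewrite normr_ge0.
  apply: (@le_trans _ _ (D%:E * (A (p / L)%R + A (`|v x| / L)%R))%E); last by rewrite leeDl.
  by apply: lee_wpmul2l; [rewrite lee_fin (le_trans ler01)|exact: leeD].
(* Index shift by one: the layer below the one containing [|v' x|] pays for the remainder at [x]. *)
have [j /andP[jv vj]] : exists j, tau j.+1 <= `|v' x| < tau j.+2.
  have [k1 Hk1] : exists k, `|v' x| < tau k.
    have := archi_boundP (divr_ge0 (normr_ge0 (v' x)) (ltW m_pos)); set k := Num.bound _ => vk; exists k.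
    rewrite /tau mulrC -ltr_pdivrMr//; apply: (lt_le_trans vk).
    by rewrite -natrX ler_nat ltnW// ltn_expl.
  have [k Hk kmin] := ex_minnP (ex_intro (fun k => `|v' x| < tau k) k1 Hk1).
  case: k => [|[|k]] in Hk kmin *.
  - have : tau 0%N <= tau 1%N by rewrite tauS ler_peMl ?ler1n// ltW.
    by rewrite leNgt (lt_trans tv Hk).
  - by have := lt_trans tv Hk; rewrite ltxx.
  - by exists k; rewrite Hk andbT leNgt; apply/negP => /kmin; rewrite ltnn.
have [tst /andP[Ht1 Ht2]] := Ht_ j.
have large : (B (p / L' * E (k' * `|v' x|))%R <= A (p / L')%R + A (t_ j))%E.
  apply: (growth_large yA yB E0 Emono Hmono BA) => //.
  - by rewrite mulr_ge0// ltW.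
  - by apply: le_trans tst; rewrite /ts le_max lexx.
  - apply: le_trans Ht1; have -> : 4 * k' * tau j = k' * (2 * (2 * tau j)) by ring.
    by rewrite ler_pM2l// -!tauS ltW.
apply: (le_trans large); apply: leeD; last exact: Hr.
apply: (le_trans Ap'); apply: (@le_trans _ _ (A (p / L)%R + A (`|v x| / L)%R)%E); first by rewrite leeDl.
by rewrite lee_pemull ?adde_ge0// lee_fin.
Qed.

End control.

(** * Convergence of compositions *)

(** Dropping the first terms of a summable subsequence brings the sum below 1, a bound known before
    the subsequence is chosen. *)
Lemma summable_subsequence_le1 {R : realType} (a : nat -> \bar R) : (forall k, 0 <= a k)%E ->
  a k @[k --> \oo] --> 0%E ->
  exists2 s : nat -> nat, {homo s : i j / (i < j)%N} & (\sum_(0 <= k <oo) a (s k) <= 1)%E.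
Proof.
move=> a0 acvg; have [s sincr ssum] := summable_subsequence a0 acvg.
have tail := @nneseries_tail_cvg R (fun k => a (s k)) xpredT ssum (fun k _ => a0 _).
have [N HN] := iffLR (cvge0P (fun N => nneseries_ge0 (fun k _ _ => a0 (s k)))) tail 1 ltr01.
exists (fun k => s (k + N)%N); first by move=> i j ij; apply: sincr; rewrite ltn_add2r.
by have := HN N (leqnn N); rewrite (@nneseries_addn R (fun k => a (s k)) N).
Qed.

(** A sequence not tending to 0 has a subsequence bounded away from 0, so one good index in every
    subsequence suffices. *)
Lemma cvge0_subsequence {R : realType} (a : nat -> \bar R) : (forall k, 0 <= a k)%E ->
  (forall e : R, 0 < e -> forall s : nat -> nat, {homo s : i j / (i < j)%N} -> exists j, (a (s j) <= e%:E)%E) ->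
  a k @[k --> \oo] --> 0%E.
Proof.
move=> a0 H; apply/(cvge0P a0) => e e0; apply: contrapT => /forallNP bad.
have next N : exists k, (N <= k)%N /\ (e%:E < a k)%E.
  have /existsNP[k /not_implyP[Nk /negP]] := bad N; rewrite -ltNge => ek; by exists k.
pose nx N := projT1 (cid (next N)).
have nxP N : (N <= nx N)%N /\ (e%:E < a (nx N))%E by exact: (projT2 (cid (next N))).
pose s := fix s j := if j is j'.+1 then nx (s j').+1 else nx 0%N.
have sS j : (s j < s j.+1)%N by have [] := nxP (s j).+1.
have sincr : {homo s : i j / (i < j)%N} by apply: homo_ltn => //; exact: ltn_trans.
have [j] := H e e0 s sincr; rewrite leNgt => /negP; apply.
by case: j => [|j]; [have [] := nxP 0%N|have [] := nxP (s j).+1].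
Qed.

Lemma cvg0_of_le {R : realType} (x : nat -> R) (a : nat -> \bar R) : (forall k, ((`|x k|)%:E <= a k)%E) ->
  a k @[k --> \oo] --> 0%E -> x k @[k --> \oo] --> 0.
Proof.
move=> xa acvg; have a0 k : (0 <= a k)%E by apply: le_trans (xa k); rewrite lee_fin.
apply/cvgrPdist_le => e e0; have [N HN] := iffLR (cvge0P a0) acvg e e0.
exists N => // k /= Nk; rewrite sub0r normrN -lee_fin; exact: le_trans (xa k) (HN k Nk).
Qed.

Lemma normr_Rintegral_le d (T : measurableType d) (R : realType) (mu : {measure set T -> \bar R}) (D : set T)
    (F g : T -> R) (c : R) : measurable D -> mu.-integrable D (EFin \o F) -> measurable_fun D g -> 0 <= c ->
  (forall x, D x -> 0 <= g x) -> (forall x, D x -> `|F x| <= c * g x) ->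
  ((`|\int[mu]_(x in D) F x|)%:E <= c%:E * \int[mu]_(x in D) (g x)%:E)%E.
Proof.
move=> mD iF mg c0 g0 Fg; rewrite EFin_normr_Rintegral//.
have mF : measurable_fun D (EFin \o F) by exact: measurable_int iF.
apply: (le_trans (le_abse_integral mu mD mF)); rewrite -ge0_integralZl//; last exact/measurable_EFinP.
apply: ge0_le_integral => //.
- exact: measurableT_comp.
- by apply: measurable_funeM; exact/measurable_EFinP.
Qed.

Section local_convergence.
Context {R : realType} (n : nat).
Hypothesis n0 : (0 < n)%N.
Local Notation mu := (@borel_lebesgue R n).
Implicit Types (O : set 'rV[R]_n).

(** Indexing by [nat] lets finite unions of boxes exhaust [O] and leave a small tail of the
    majorant. *)
Lemma box_exhaustion O : open O -> exists a b : nat -> 'I_n -> R,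
  (forall p, [set x : 'rV[R]_n | forall i, `[a p i, b p i]%classic (x 0 i)] `<=` O) /\
  (forall x, O x -> exists p, box (a p) (b p) x).
Proof.
move=> oO; pose i0 : 'I_n := Ordinal n0.
pose good (q : 'rV[rat]_n * nat) := ccube (@qcenter R n q) (3 * @qradius R n q) `<=` O.
have H (p : nat) : exists ab : ('I_n -> R) * ('I_n -> R),
    [set x : 'rV[R]_n | forall i, `[ab.1 i, ab.2 i]%classic (x 0 i)] `<=` O /\
    forall q, unpickle p = Some q -> good q ->
      ball (@qcenter R n q) (@qradius R n q) `<=` box ab.1 ab.2.
  have [[q [Eq gq]]|no] := pselect (exists q, unpickle p = Some q /\ good q); last first.
    (* Indices that code no admissible cube get an empty box; emptiness is seen on the coordinate
       [i0]. *)
    exists ((fun=> 1), (fun=> 0)); split=> /=.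
      by move=> x /(_ i0); rewrite /= in_itv/= => /andP[/le_trans h /h]; rewrite ler10.
    by move=> q Eq gq; exfalso; apply: no; exists q.
  have r0 := @qradius_gt0 R n q.
  exists ((fun i => @qcenter R n q 0 i - @qradius R n q), (fun i => @qcenter R n q 0 i + @qradius R n q)); split => /=.
    move=> x Hx; apply: gq => i; have := Hx i; rewrite /= in_itv/= => /andP[h1 h2].
    by rewrite ler_norml; apply/andP; split; lra.
  move=> q'; rewrite Eq => -[<-] _ x /(ball_rV _ _ r0) Hx i; have := Hx i; rewrite ltr_norml => /andP[h1 h2].
  by rewrite /= in_itv/=; apply/andP; split; lra.
pose ab p := projT1 (cid (H p)); have abP p := projT2 (cid (H p)).
exists (fun p => (ab p).1), (fun p => (ab p).2); split; first by move=> p; have [] := abP p.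
move=> x Ox; have [q [qx gq]] := qcube_cover oO Ox; exists (pickle q).
by have [_ Hq] := abP (pickle q); exact: (Hq q (pickleK q) gq).
Qed.

(* Weak continuity of [u |-> theta(u) G]: for test functions it follows from the chain
   rule for the primitive of [theta]; it extends to bounded Borel functions on boxes. *)
Lemma weak_cvg_bounded O i (v : nat -> 'rV[R]_n -> R) (H : nat -> 'rV[R]_n -> R) v0 H0 (theta : R -> R)
    (a b : 'I_n -> R) (psi : 'rV[R]_n -> R) : open O ->
  (forall k, borel_weak O i (v k) (H k)) -> borel_weak O i v0 H0 ->
  (forall K, compact K -> K `<=` O -> (\int[mu]_(x in K) `|(v k x - v0 x)%:E|)%E @[k --> \oo] --> 0%E) ->
  (forall K, compact K -> K `<=` O -> (\int[mu]_(x in K) `|(H k x - H0 x)%:E|)%E @[k --> \oo] --> 0%E) ->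
  bounded_measurable (theta : measurableTypeR R -> R) ->
  [set x : 'rV[R]_n | forall i, `[a i, b i]%classic (x 0 i)] `<=` O -> bounded_measurable psi ->
  \int[mu]_(x in box a b) ((theta (v k x) - theta (v0 x)) * H0 x * psi x) @[k --> \oo] --> 0.
Proof.
move=> oO vH vH0 cv cH btheta abO bpsi.
have [mtheta [M thM]] := btheta.
have M0 : 0 <= M by apply: le_trans (thM 0).
have [mv0 mH0 iv0 iH0 _] := vH0.
have mv k : measurable_fun setT (v k) by case: (vH k).
have mH k : measurable_fun setT (H k) by case: (vH k).
have mth (u : 'rV[R]_n -> R) : measurable_fun setT u -> measurable_fun setT (fun x => theta (u x)).
  by move=> mu_; exact: (measurableT_comp mtheta mu_).
pose z k x := theta (v k x) - theta (v0 x).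
have mz k : measurable_fun setT (z k) by apply: measurable_funB; exact: mth.
have z2 k x : `|z k x| <= 2 * M.
  by apply: le_trans (ler_normB _ _) _; have := thM (v k x); have := thM (v0 x); lra.
pose Q := box a b; have mQ : measurable Q := measurable_box a b.
have cQ : compact [set x : 'rV[R]_n | forall i, `[a i, b i]%classic (x 0 i)].
  by apply: (@rV_compact _ _ (fun j => `[a j, b j]%classic)) => j; exact: segment_compact.
have iHQ : mu.-integrable Q (EFin \o H0).
  apply: integrableS (iH0 _ cQ abO) => //; first exact: compact_measurable_rV.
  by move=> x Qx j; have := Qx j; rewrite /= !in_itv/= => /andP[/ltW -> /ltW ->].
have izH k : mu.-integrable Q (EFin \o (fun x => z k x * H0 x)).
  rewrite (_ : _ \o _ = (fun x => (H0 x * z k x)%:E)); last by apply/funext => x /=; rewrite mulrC.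
  by apply: (integrable_mul_bounded mQ iHQ (measurable_funTS (mz k)) (fun x _ => z2 k x)).
have izHp k p : bounded_measurable p -> mu.-integrable Q (EFin \o (fun x => z k x * H0 x * p x)).
  move=> [mp [N pN]]; exact: (integrable_mul_bounded mQ (izH k) (measurable_funTS mp) (fun x _ => pN x)).
pose P p := \int[mu]_(x in Q) (z k x * H0 x * p x) @[k --> \oo] --> 0.
(* The estimate is uniform in [k]: [z k] is bounded by [2 * M], so replacing [f] by [f_ m] costs at
   most [2 * M] times the integral of [|H0| |f - f_ m|], which does not involve [k]. *)
have Plim (f_ : nat -> 'rV[R]_n -> R) f N : (forall m, measurable_fun setT (f_ m)) ->
    (forall m x, `|f_ m x| <= N) -> (forall x, f_ m x @[m --> \oo] --> f x) -> (forall m, P (f_ m)) -> P f.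
  move=> mf_ f_N cf Pf.
  have bf_ m : bounded_measurable (f_ m) by split => //; exists N.
  have mf : measurable_fun setT f by apply: (measurable_fun_cvg mf_) => x _; exact: cf.
  have fN x : `|f x| <= N by exact: (norm_cvg_le (cf x)).
  have bf : bounded_measurable f by split => //; exists N.
  pose D m := (\int[mu]_(x in Q) (`|H0 x| * `|f x - f_ m x|)%:E)%E.
  have mfd m : measurable_fun setT (fun x => `|f x - f_ m x|).
    by apply: measurableT_comp => //; exact: measurable_funB.
  have D0 m : (0 <= D m)%E by apply: integral_ge0 => x _; rewrite lee_fin mulr_ge0.
  have cD : D m @[m --> \oo] --> 0%E.
    have -> : 0%E = (\int[mu]_(x in Q) (`|H0 x| * (cst 0 x : R))%:E)%E.
      by rewrite integral0_eq// => x _; rewrite mulr0.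
    apply: (@dct_on_support _ _ _ mu Q (fun x => `|H0 x|) (cst 0) (fun m x => `|f x - f_ m x|) (2 * N)) => //.
    - by rewrite (_ : _ \o _ = (abse \o (EFin \o H0)))//; exact: integrable_abse.
    - by move=> m; exact: measurable_funTS.
    - move=> m x _; rewrite normr_id; apply: le_trans (ler_normB _ _) _; have := fN x; have := f_N m x; lra.
    apply: aeW => x _ _; rewrite -(normr0 R); apply: cvg_norm; rewrite -(subrr (f x)).
    by apply: cvgB => //; exact: cvg_cst.
  apply/cvgrPdist_le => e e0; have M20 : 0 < 2 * (2 * M + 1) by lra.
  have [m Dm] := iffLR (cvge0P D0) cD _ (divr_gt0 e0 M20).
  have e20 : 0 < e / 2 by exact: divr_gt0.
  have /cvgrPdist_le/(_ _ e20)[K _ HK] := Pf m; exists K => // k Kk.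
  have {}HK := HK k Kk; rewrite sub0r normrN in HK; rewrite sub0r normrN.
  have -> : \int[mu]_(x in Q) (z k x * H0 x * f x) = \int[mu]_(x in Q) (z k x * H0 x * f_ m x) +
      \int[mu]_(x in Q) (z k x * H0 x * (f x - f_ m x)).
    rewrite -RintegralD//; last 2 first.
    - exact: izHp.
    - apply: izHp; split; first exact: measurable_funB.
      by exists (N + N) => x; apply: le_trans (ler_normB _ _) _; exact: lerD.
    by apply: eq_Rintegral => x _; ring.
  apply: le_trans (ler_normD _ _) _; have -> : e = e / 2 + e / 2 by lra.
  apply: lerD => //; rewrite -lee_fin.
  have ip : mu.-integrable Q (EFin \o (fun x => z k x * H0 x * (f x - f_ m x))).
    apply: izHp; split; first exact: measurable_funB.
    by exists (N + N) => x; apply: le_trans (ler_normB _ _) _; exact: lerD.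
  have M2 : 0 <= 2 * M by rewrite mulr_ge0.
  apply: (le_trans (normr_Rintegral_le (g := fun x => `|H0 x| * `|f x - f_ m x|) (c := 2 * M) mQ ip _ M2 _ _)) => //.
  - by apply: measurable_funTS; apply: measurable_funM => //; exact: measurableT_comp.
  - by move=> x _; rewrite !normrM -[leLHS]mulrA ler_wpM2r// mulr_ge0.
  have := Dm m (leqnn m); rewrite -/(D m) => Dle.
  apply: (@le_trans _ _ ((2 * M)%:E * (e / (2 * (2 * M + 1)))%:E)%E); first by rewrite lee_wpmul2l.
  rewrite -EFinM lee_fin mulrA ler_pdivrMr//.
  by have -> : e / 2 * (2 * (2 * M + 1)) = 2 * M * e + e by [field]; rewrite lerDl ltW.
have Ptest phi : test_function O phi -> (forall x, ~ Q x -> phi x = 0) -> P phi.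
  move=> tphi phiQ.
  have [K [N [[cK KO N0 phi0 phiN] [mphi mdphi]]]] := test_function_facts i tphi.
  have mK := compact_measurable_rV cK.
  (* Difference of the chain rules for [v k] and [v0], arranged so that each term is controlled by
     [v k - v0] or [H k - H0], which tend to 0 in L^1. *)
  pose E k x := (prim theta (v k x) - prim theta (v0 x)) * partial i phi x + theta (v k x) * (H k x - H0 x) * phi x.
  have EE k : \int[mu]_(x in Q) (z k x * H0 x * phi x) = - \int[mu]_x E k x.
    have -> : \int[mu]_(x in Q) (z k x * H0 x * phi x) = \int[mu]_x (z k x * H0 x * phi x).
      rewrite Rintegral_mkcond; apply: eq_Rintegral => x _; rewrite patchE.
      by case: ifPn => // /negP xQ; rewrite phiQ ?mulr0// => Qx; apply: xQ; exact/mem_set.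
    have T12 k' : \int[mu]_x (prim theta (v k' x) * partial i phi x) = - \int[mu]_x (theta (v k' x) * H k' x * phi x).
      by rewrite /Rintegral (chain_rule_bounded oO (vH k') btheta tphi) fineN.
    have T0 : \int[mu]_x (prim theta (v0 x) * partial i phi x) = - \int[mu]_x (theta (v0 x) * H0 x * phi x).
      by rewrite /Rintegral (chain_rule_bounded oO vH0 btheta tphi) fineN.
    have I1 u : measurable_fun setT u -> (forall K, compact K -> K `<=` O -> mu.-integrable K (EFin \o u)) ->
        mu.-integrable setT (EFin \o (fun x => prim theta (u x) * partial i phi x)).
      move=> mu_ iu; apply: (integrable_test (O := O) _ _ cK KO (fun x h => (phi0 x h).2) mdphi (fun x => (phiN x).2)).
        exact: (measurableT_comp (measurable_prim btheta) mu_).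
      move=> L cL LO; have mL := compact_measurable_rV cL.
      apply: (le_integrable mL _ _ (integrableZl mL M (iu L cL LO))).
        by apply/measurable_EFinP; apply: measurable_funTS; exact: (measurableT_comp (measurable_prim btheta) mu_).
      move=> x _ /=; rewrite lee_fin normrM (ger0_norm M0).
      by have := @prim_le _ theta 0 (u x) M btheta (fun x _ => thM x); rewrite prim0 !subr0.
    have I2 u G : measurable_fun setT u -> measurable_fun setT G ->
        (forall K, compact K -> K `<=` O -> mu.-integrable K (EFin \o G)) ->
        mu.-integrable setT (EFin \o (fun x => theta (u x) * G x * phi x)).
      move=> mu_ mG iG; apply: (integrable_test (O := O) _ _ cK KO (fun x h => (phi0 x h).1) mphi (fun x => (phiN x).1)).
        by apply: measurable_funM => //; exact: mth.
      move=> L cL LO; have mL := compact_measurable_rV cL.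
      rewrite (_ : _ \o _ = (fun x => (G x * theta (u x))%:E)); last by apply/funext => x /=; rewrite mulrC.
      exact: (integrable_mul_bounded mL (iG L cL LO) (measurable_funTS (mth _ mu_)) (fun x _ => thM (u x))).
    have [_ _ ivk iHk _] := vH k.
    have J1 := I1 _ (mv k) ivk; have J10 := I1 _ mv0 iv0.
    have J2 := I2 _ _ (mv k) (mH k) iHk; have J20 := I2 _ _ mv0 mH0 iH0; have J3 := I2 _ _ (mv k) mH0 iH0.
    have -> : \int[mu]_x (z k x * H0 x * phi x) =
        \int[mu]_x (theta (v k x) * H0 x * phi x) - \int[mu]_x (theta (v0 x) * H0 x * phi x).
      by rewrite -RintegralB//; apply: eq_Rintegral => x _; rewrite /z; ring.
    have -> : \int[mu]_x E k x =
        (\int[mu]_x (prim theta (v k x) * partial i phi x) - \int[mu]_x (prim theta (v0 x) * partial i phi x)) +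
        (\int[mu]_x (theta (v k x) * H k x * phi x) - \int[mu]_x (theta (v k x) * H0 x * phi x)).
      rewrite -!RintegralB// -RintegralD//.
      - by apply: eq_Rintegral => x _; rewrite /E; ring.
      - exact: (integrableB measurableT J1 J10).
      - exact: (integrableB measurableT J2 J3).
    by rewrite T12 T0; ring.
  rewrite /P; under eq_fun => k do rewrite EE.
  apply: (@cvg0_of_le _ _ (fun k => ((M * N)%:E * (\int[mu]_(x in K) `|(v k x - v0 x)%:E| +
     \int[mu]_(x in K) `|(H k x - H0 x)%:E|))%E)); last first.
    by apply: cvge0Zl; apply: cvge0D; [exact: cv|exact: cH].
  move=> k; rewrite normrN.
  pose g x := \1_K x * (`|v k x - v0 x| + `|H k x - H0 x|).
  have mvd : measurable_fun setT (fun x => `|v k x - v0 x|) by apply: measurableT_comp => //; exact: measurable_funB.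
  have mHd : measurable_fun setT (fun x => `|H k x - H0 x|) by apply: measurableT_comp => //; exact: measurable_funB.
  have mg : measurable_fun setT g by apply: measurable_funM; [exact: measurable_indic|exact: measurable_funD].
  have g0 x : 0 <= g x by rewrite /g mulr_ge0// addr_ge0.
  have mE : measurable_fun setT (E k).
    apply: measurable_funD; apply: measurable_funM => //.
      by apply: measurable_funB; apply: (measurableT_comp (measurable_prim btheta)).
    by apply: measurable_funM; [exact: mth|exact: measurable_funB].
  have Eg x : `|E k x| <= M * N * g x.
    have [Kx|nKx] := pselect (K x); last first.
      by rewrite /E; have [-> ->] := phi0 x nKx; rewrite !mulr0 addr0 normr0 mulr_ge0// mulr_ge0// ltW.
    rewrite /g indicE mem_set// mul1r mulrDr; apply: le_trans (ler_normD _ _) _; rewrite !normrM.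
    have p1 := @prim_le _ theta (v0 x) (v k x) M btheta (fun x _ => thM x).
    have [f1 f2] := phiN x; apply: lerD.
      rewrite [M * N * _]mulrAC; apply: ler_pM => //; rewrite mulr_ge0//.
    by rewrite mulrAC; apply: ler_wpM2r => //; exact: ler_pM.
  have intg : (\int[mu]_x (g x)%:E = \int[mu]_(x in K) `|(v k x - v0 x)%:E| + \int[mu]_(x in K) `|(H k x - H0 x)%:E|)%E.
    rewrite -ge0_integralD//; last 2 first.
    - by apply: measurable_funTS; apply: measurableT_comp => //; apply/measurable_EFinP; exact: measurable_funB.
    - by apply: measurable_funTS; apply: measurableT_comp => //; apply/measurable_EFinP; exact: measurable_funB.
    rewrite [RHS]integral_mkcond; apply: eq_integral => x _; rewrite patchE /g indicE.
    by case: (x \in K); rewrite ?mul1r ?mul0r// !abse_EFin EFinD.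
  have iE : mu.-integrable setT (EFin \o E k).
    have [_ _ ivk iHk _] := vH k.
    apply/integrableP; split; first exact/measurable_EFinP.
    apply: (@le_lt_trans _ _ ((M * N)%:E * \int[mu]_x (g x)%:E)%E).
      rewrite -ge0_integralZl//; last 3 first.
      - exact/measurable_EFinP.
      - by move=> x _; rewrite lee_fin.
      - by rewrite lee_fin mulr_ge0// ltW.
      apply: ge0_le_integral => //.
      - by apply: measurableT_comp => //; exact/measurable_EFinP.
      - by apply: measurable_funeM; exact/measurable_EFinP.
      - by move=> x _; rewrite -EFinM /= lee_fin.
    have fin u u0 : mu.-integrable K (EFin \o u) -> mu.-integrable K (EFin \o u0) ->
        (\int[mu]_(x in K) `|(u x - u0 x)%:E| < +oo)%E.
      by move=> iu iu0; have /integrableP[] := integrableB mK iu iu0.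
    by rewrite intg lte_mul_pinfty ?lee_fin ?mulr_ge0 ?(ltW N0)// lte_add_pinfty//; apply: fin; auto.
  by rewrite -intg; apply: normr_Rintegral_le => //; rewrite mulr_ge0// ltW.
have Pcongr p q : (forall x, Q x -> p x = q x) -> P p -> P q.
  move=> pq; rewrite /P; have -> // : (fun k => \int[mu]_(x in Q) (z k x * H0 x * p x)) =
    (fun k => \int[mu]_(x in Q) (z k x * H0 x * q x)).
  by apply/funext => k; apply: eq_Rintegral => x; rewrite inE => /pq ->.
have PS S : boxes S -> P \1_S.
  (* The box is intersected with [Q], so that plateaus inside it are test functions on [O]. *)
  move=> [[c d] _ <-] /=.
  pose c' j := Num.max (c j) (a j); pose d' j := Num.min (d j) (b j).
  have sub x : (forall j, `[c' j, d' j]%classic (x 0 j)) -> forall j, `[a j, b j]%classic (x 0 j).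
    move=> Hx j; have := Hx j; rewrite /= !in_itv/= /c' /d' ge_max le_min => /andP[/andP[_ ->] /andP[_ ->]]//.
  have : P \1_(box c' d').
    apply: (Plim (fun m => plateaus m c' d') _ 1).
    - by move=> m; exact: plateaus_measurable.
    - by move=> m x; have /andP[h1 h2] := plateaus01 m c' d' x; rewrite ger0_norm.
    - by move=> x; exact: plateaus_cvg.
    - move=> m; apply: Ptest; first by apply: plateaus_test => x Hx; apply: abO; exact: sub.
      move=> x nQ; have [i' Hi] : exists i', ~ `]c' i', d' i'[%classic (x 0 i').
        apply/existsNP => Hx; apply: nQ => j; have := Hx j; rewrite /= !in_itv/= /c' /d' gt_max lt_min.
        by move=> /andP[/andP[_ ->] /andP[_ ->]].
      by rewrite /plateaus /tensor (bigD1 i')//= plateau_out ?mul0r.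
  apply: Pcongr => x Qx.
  rewrite !indicE; congr (_%:R); congr nat_of_bool; apply/idP/idP => /set_mem H1; apply/mem_set => j.
    by have := H1 j; rewrite /= !in_itv/= /c' /d' gt_max lt_min => /andP[/andP[-> _] /andP[-> _]].
  by have := H1 j; have := Qx j; rewrite /= !in_itv/= /c' /d' gt_max lt_min => /andP[-> ->] /andP[-> ->].
suff : P psi by [].
apply: (@monotone_class _ _ _ (@boxes R n) P _ _ _ PS _ Plim psi bpsi).
- exact: measurable_boxes.
- exact: boxes_setI.
- have : P \1_(box a b) by apply: PS; exists (a, b).
  by apply: Pcongr => x Qx; rewrite indicE mem_set.
- move=> c f g bf bg Pf Pg; rewrite /P.
  have -> : (fun k => \int[mu]_(x in Q) (z k x * H0 x * (c * f x + g x))) =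
    (fun k => c * \int[mu]_(x in Q) (z k x * H0 x * f x) + \int[mu]_(x in Q) (z k x * H0 x * g x)).
    apply/funext => k; rewrite -RintegralZl//; last exact: izHp.
    rewrite -RintegralD//; last 2 first.
    - exact: (integrableZl mQ c (izHp k f bf)).
    - exact: izHp.
    by apply: eq_Rintegral => x _; ring.
  rewrite -[X in _ --> X](addr0 0) -{1}(mulr0 c); apply: cvgD => //; exact: cvgMr.
Qed.

End local_convergence.

(** * Pointwise limits of compositions *)

Section composition_limits.
Context {R : realType} (n : nat).
Hypothesis n0 : (0 < n)%N.
Local Notation mu := (@borel_lebesgue R n).
Implicit Types (O : set 'rV[R]_n).

Lemma young_cvg0 (B : R -> \bar R) (x : nat -> R) : young B -> (forall k, 0 <= x k) ->
  x k @[k --> \oo] --> 0 -> B (x k) @[k --> \oo] --> 0%E.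
Proof.
move=> yB x0 cx; have [t [c [t0 c0 Bc]]] := young_small yB.
apply/cvge0P => [k|e e0]; first exact: young_ge0.
pose d := Num.min t (e / (c + 1)); have c1 : 0 < c + 1 by rewrite ltr_wpDl.
have d0 : 0 < d by rewrite lt_min t0 divr_gt0.
have /cvgrPdist_le/(_ _ d0)[N _ HN] := cx; exists N => k Nk.
have := HN k Nk; rewrite sub0r normrN ger0_norm// le_min => /andP[xt xe].
apply: (le_trans (Bc (x k) _)); first by rewrite x0.
by rewrite lee_fin; rewrite ler_pdivlMr// in xe; apply: le_trans xe; rewrite mulrC ler_wpM2l// lerDl.
Qed.

Lemma young_cvg0_inv (A : R -> \bar R) (x : nat -> R) : young A -> nondegenerate_young A -> (forall k, 0 <= x k) ->
  A (x k) @[k --> \oo] --> 0%E -> x k @[k --> \oo] --> 0.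
Proof.
move=> yA ndA x0 cA; apply/cvgrPdist_le => e e0.
have [a [a0 aA]] : exists a : R, 0 < a /\ (a%:E < A e)%E.
  have := ndA e e0; case: (A e) => [r|_|//]; last by exists 1; rewrite ltry.
  by rewrite lte_fin => r0; exists (r / 2); rewrite divr_gt0// lte_fin; split => //; lra.
have [N HN] := iffLR (cvge0P (fun k => young_ge0 yA (x0 k))) cA a a0.
exists N => // k /= Nk; rewrite sub0r normrN ger0_norm// leNgt; apply/negP => ex.
have := le_trans (young_homo yA (_ : 0 <= e <= x k)) (HN k Nk).
by rewrite (ltW e0) (ltW ex) => /(_ isT); rewrite leNgt aA.
Qed.

(** The square equals the difference of the squares minus [2 * theta (v0 x)] times the difference;
    with the sign of [H0] among the bounded factors, both parts are limits given by
    [weak_cvg_bounded]. *)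
Lemma square_cvg_bounded O i (v : nat -> 'rV[R]_n -> R) (H : nat -> 'rV[R]_n -> R) v0 H0 (theta : R -> R)
    (a b : 'I_n -> R) : open O ->
  (forall k, borel_weak O i (v k) (H k)) -> borel_weak O i v0 H0 ->
  (forall K, compact K -> K `<=` O -> (\int[mu]_(x in K) `|(v k x - v0 x)%:E|)%E @[k --> \oo] --> 0%E) ->
  (forall K, compact K -> K `<=` O -> (\int[mu]_(x in K) `|(H k x - H0 x)%:E|)%E @[k --> \oo] --> 0%E) ->
  bounded_measurable (theta : measurableTypeR R -> R) ->
  [set x : 'rV[R]_n | forall i, `[a i, b i]%classic (x 0 i)] `<=` O ->
  (\int[mu]_(x in box a b) ((theta (v k x) - theta (v0 x)) ^+ 2 * `|H0 x|)%:E)%E @[k --> \oo] --> 0%E.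
Proof.
move=> oO vH vH0 cv cH bth abO; have [mth [M thM]] := bth.
have [mv0 mH0 iv0 iH0 _] := vH0.
have mv k : measurable_fun setT (v k) by case: (vH k).
have mthv u : measurable_fun setT u -> measurable_fun setT (fun x : 'rV[R]_n => theta (u x)).
  by move=> mu_; exact: (measurableT_comp mth mu_).
have bth2 : bounded_measurable ((fun s => theta s ^+ 2) : measurableTypeR R -> R).
  split; first exact: measurable_funX.
  by exists (M ^+ 2) => s; rewrite normrX ler_pXn2r ?nnegrE// (le_trans _ (thM s)).
(* The sign of [H0], taken to be 1 on its zero set. *)
pose sg x : R := 2 * \1_[set x | 0 <= H0 x] x - 1.
have msg : measurable_fun setT sg.
  apply: measurable_funB => //; apply: measurable_funM => //; apply: measurable_indic.
  rewrite (_ : [set x | _] = H0 @^-1` `[0, +oo[); first by rewrite -[X in measurable X]setTI; exact: mH0.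
  by apply/seteqP; split => x /=; rewrite in_itv/= andbT.
have sgE x : H0 x * sg x = `|H0 x|.
  rewrite /sg indicE; have [h|h] := leP 0 (H0 x).
    by rewrite mem_set// ger0_norm// mulr1; ring.
  by rewrite memNset/= ?ltr0_norm// ?mulr0 ?sub0r ?mulrN1//; apply/negP; rewrite -ltNge.
have sg1 x : `|sg x| <= 1.
  by rewrite /sg indicE; case: (_ \in _); rewrite ?mulr1 ?mulr0 ?sub0r ?normrN ?normr1//; rewrite ger0_norm; lra.
have b1 : bounded_measurable sg by split => //; exists 1.
have b2 : bounded_measurable (fun x => theta (v0 x) * sg x).
  split; first by apply: measurable_funM => //; exact: mthv.
  by exists (M * 1) => x; rewrite normrM ler_pM.
have c1 := weak_cvg_bounded oO vH vH0 cv cH bth2 abO b1.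
have c2 := weak_cvg_bounded oO vH vH0 cv cH bth abO b2.
pose Q := box a b; have mQ : measurable Q := measurable_box a b.
have iHQ : mu.-integrable Q (EFin \o H0).
  have cQ : compact [set x : 'rV[R]_n | forall i, `[a i, b i]%classic (x 0 i)].
    by apply: (@rV_compact _ _ (fun j => `[a j, b j]%classic)) => j; exact: segment_compact.
  apply: integrableS (iH0 _ cQ abO) => //; first exact: compact_measurable_rV.
  by move=> x Qx j; have := Qx j; rewrite /= !in_itv/= => /andP[/ltW -> /ltW ->].
have ib (p : 'rV[R]_n -> R) : bounded_measurable p -> mu.-integrable Q (fun x => (H0 x * p x)%:E).
  by move=> [mp [N pN]]; exact: (integrable_mul_bounded mQ iHQ (measurable_funTS mp) (fun x _ => pN x)).
have bM (p q : 'rV[R]_n -> R) : bounded_measurable p -> bounded_measurable q -> bounded_measurable (fun x => p x * q x).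
  move=> [mp [N pN]] [mq [N' qN]]; split; first exact: measurable_funM.
  by exists (N * N') => x; rewrite normrM ler_pM.
have bB (p q : 'rV[R]_n -> R) : bounded_measurable p -> bounded_measurable q -> bounded_measurable (fun x => p x - q x).
  move=> [mp [N pN]] [mq [N' qN]]; split; first exact: measurable_funB.
  by exists (N + N') => x; apply: le_trans (ler_normB _ _) _; exact: lerD.
have bthv (t : R -> R) u : bounded_measurable (t : measurableTypeR R -> R) -> measurable_fun setT u ->
    bounded_measurable (fun x : 'rV[R]_n => t (u x)).
  by move=> [mt [N tN]] mu_; split; [exact: (measurableT_comp mt mu_)|exists N => x].
have E k : (\int[mu]_(x in Q) ((theta (v k x) - theta (v0 x)) ^+ 2 * `|H0 x|)%:E =
   (\int[mu]_(x in Q) ((theta (v k x) ^+ 2 - theta (v0 x) ^+ 2) * H0 x * sg x) -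
    2 * \int[mu]_(x in Q) ((theta (v k x) - theta (v0 x)) * H0 x * (theta (v0 x) * sg x)))%:E)%E.
  have J1 : mu.-integrable Q (EFin \o (fun x => (theta (v k x) ^+ 2 - theta (v0 x) ^+ 2) * H0 x * sg x)).
    rewrite (_ : _ \o _ = (fun x => (H0 x * ((theta (v k x) ^+ 2 - theta (v0 x) ^+ 2) * sg x))%:E)).
      by apply: ib; apply: bM => //; apply: bB; apply: (bthv (fun s => theta s ^+ 2)).
    by apply/funext => x /=; congr EFin; ring.
  have J2 : mu.-integrable Q (EFin \o (fun x => (theta (v k x) - theta (v0 x)) * H0 x * (theta (v0 x) * sg x))).
    rewrite (_ : _ \o _ = (fun x => (H0 x * ((theta (v k x) - theta (v0 x)) * (theta (v0 x) * sg x)))%:E)).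
      by apply: ib; apply: bM => //; apply: bB; apply: bthv.
    by apply/funext => x /=; congr EFin; ring.
  rewrite -RintegralZl// -RintegralB//; last exact: (integrableZl mQ 2 J2).
  rewrite /Rintegral fineK.
    apply: eq_integral => x _; congr EFin; rewrite -sgE; ring.
  by apply: integrable_fin_num => //; exact: (integrableB mQ J1 (integrableZl mQ 2 J2)).
under eq_fun => k do rewrite E.
rewrite -[0%E]/((0:R)%:E); apply: cvg_EFin; first exact: nearW.
have -> : 0 = 0 - 2 * 0 :> R by ring.
by apply: cvgB => //; exact: cvgMr.
Qed.

(** The map [y / (1 + |y|)] has the continuous inverse [z / (1 - |z|)] on []-1, 1[]; it reduces an
    unbounded [h] to a bounded one. *)
Lemma cvg_bounded_transform (h : R -> R) (s : nat -> R) (s0 : R) :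
  h (s k) / (1 + `|h (s k)|) @[k --> \oo] --> h s0 / (1 + `|h s0|) -> h (s k) @[k --> \oo] --> h s0.
Proof.
have pos (y : R) : 0 < 1 + `|y| by rewrite ltr_pwDl.
have E (y : R) : y = (y / (1 + `|y|)) / (1 - `|y / (1 + `|y|)|).
  rewrite normrM normfV (ger0_norm (ltW (pos y))).
  have -> : 1 - `|y| / (1 + `|y|) = (1 + `|y|)^-1 by field; rewrite gt_eqF.
  by rewrite invrK mulfVK// gt_eqF.
move=> c; rewrite [X in _ --> X]E; under eq_fun => k do rewrite [h (s k)]E.
apply: cvgM => //; apply: cvgV; last by apply: cvgB; [exact: cvg_cst|exact: cvg_norm].
rewrite normrM normfV (ger0_norm (ltW (pos _))).
have -> : 1 - `|h s0| / (1 + `|h s0|) = (1 + `|h s0|)^-1 by field; rewrite gt_eqF.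
by rewrite invr_eq0 gt_eqF.
Qed.

Lemma cvg_square0 (x : nat -> R) (y c : R) : 0 < c ->
  ((x k - y) ^+ 2 * c)%:E @[k --> \oo] --> 0%E -> x k @[k --> \oo] --> y.
Proof.
move=> c0 cx; apply/cvgrPdist_le => e e0.
have p0 k : (0 <= ((x k - y) ^+ 2 * c)%:E)%E by rewrite lee_fin mulr_ge0 ?sqr_ge0// ltW.
have [N HN] := iffLR (cvge0P p0) cx (e ^+ 2 * c) (mulr_gt0 (exprn_gt0 2 e0) c0).
exists N => // k /= Nk; have := HN k Nk; rewrite lee_fin ler_pM2r//.
by rewrite distrC -[(_ - _) ^+ 2]real_normK ?num_real// ler_pXn2r ?nnegrE// ltW.
Qed.

(** Over finitely many boxes the integrals of the squares add up to one sequence tending to 0, so a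
    single subsequence serves all of them; the points outside these boxes are left to the tail of
    the majorant. *)
Lemma cvg_composition_subsequence O (a b : nat -> 'I_n -> R) (N : nat) (h : R -> R)
    (v : nat -> 'rV[R]_n -> R) (H : nat -> 'I_n -> 'rV[R]_n -> R) v0 H0 : open O ->
  (forall p, [set x : 'rV[R]_n | forall i, `[a p i, b p i]%classic (x 0 i)] `<=` O) ->
  (forall k i, borel_weak O i (v k) (H k i)) -> (forall i, borel_weak O i v0 (H0 i)) ->
  (forall K, compact K -> K `<=` O -> (\int[mu]_(x in K) `|(v k x - v0 x)%:E|)%E @[k --> \oo] --> 0%E) ->
  (forall i K, compact K -> K `<=` O -> (\int[mu]_(x in K) `|(H k i x - H0 i x)%:E|)%E @[k --> \oo] --> 0%E) ->
  measurable_fun [set: measurableTypeR R] h ->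
  exists2 s : nat -> nat, {homo s : j k / (j < k)%N} &
    {ae mu, forall x, (exists2 p, (p < N)%N & box (a p) (b p) x) -> forall i, H0 i x != 0 ->
      h (v (s k) x) @[k --> \oo] --> h (v0 x)}.
Proof.
move=> oO abO vH vH0 cv cH mh.
pose i0 : 'I_n := Ordinal n0.
pose theta (s : R) := h s / (1 + `|h s|).
have pos (y : R) : 0 < 1 + `|y| by rewrite ltr_pwDl.
have mth : measurable_fun [set: measurableTypeR R] theta.
  apply: measurable_funM => //; apply: (measurableT_comp (@measurable_invr R)).
  by apply: measurable_funD => //; exact: measurableT_comp.
have bth : bounded_measurable (theta : measurableTypeR R -> R).
  split => //; exists 1 => s; rewrite /theta normrM normfV (ger0_norm (ltW (pos _))).
  by rewrite ler_pdivrMr// mul1r lerDr.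
pose F i k x := (((theta (v k x) - theta (v0 x)) ^+ 2 * `|H0 i x|)%:E : \bar R).
have mv k : measurable_fun setT (v k) by case: (vH k i0).
have mv0 : measurable_fun setT v0 by case: (vH0 i0).
have mH0 i : measurable_fun setT (H0 i) by case: (vH0 i).
have mF i k : measurable_fun setT (F i k).
  apply/measurable_EFinP; apply: measurable_funM; last exact: measurableT_comp.
  by apply: measurable_funX; apply: measurable_funB; [exact: (measurableT_comp mth (mv k))|exact: (measurableT_comp mth mv0)].
have F0 i k x : (0 <= F i k x)%E by rewrite lee_fin mulr_ge0// sqr_ge0.
pose I p i k := (\int[mu]_(x in box (a p) (b p)) F i k x)%E.
have I0 p i k : (0 <= I p i k)%E by apply: integral_ge0 => x _; exact: F0.
have cI p i : I p i k @[k --> \oo] --> 0%E.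
  by apply: (square_cvg_bounded oO (fun k => vH k i) (vH0 i) cv (cH i) bth (abO p)).
pose S k := (\sum_(p < N) \sum_(i < n) I p i k)%E.
have cS : S k @[k --> \oo] --> 0%E.
  have sum0 (m : nat) (G : 'I_m -> nat -> \bar R) : (forall i k, (0 <= G i k)%E) -> (forall i, G i k @[k --> \oo] --> 0%E) ->
      (\sum_(i < m) G i k)%E @[k --> \oo] --> 0%E.
    elim: m G => [|m ih] G G0 cG; first by under eq_fun do rewrite big_ord0; exact: cvg_cst.
    by under eq_fun do rewrite big_ord_recl; apply: cvge0D => //; apply: ih.
  apply: (sum0 N (fun p k => \sum_(i < n) I p i k)%E) => [p k|p]; first exact: sume_ge0.
  by apply: (sum0 n (fun i k => I p i k)).
have S0 k : (0 <= S k)%E by apply: sume_ge0 => p _; exact: sume_ge0.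
have [s sincr ssum] := summable_subsequence S0 cS.
exists s => //.
have each (q : 'I_N * 'I_n) : {ae mu, forall x, box (a q.1) (b q.1) x -> F q.2 (s k) x @[k --> \oo] --> 0%E}.
  have mQ := measurable_box (a q.1) (b q.1).
  have [] := @ae_cvg0_of_summable _ _ R mu (box (a q.1) (b q.1)) (fun k => F q.2 (s k)) mQ => //.
    by move=> k; apply: measurable_funTS; exact: mF.
  apply: le_lt_trans ssum; apply: lee_nneseries => [k _ _|k _]; first exact: I0.
  rewrite /S (bigD1 q.1)//= (bigD1 q.2)//= -addeA leeDl// adde_ge0//; first exact: sume_ge0.
  by apply: sume_ge0 => p _; exact: sume_ge0.
have := @ae_forall_countable _ _ _ mu ('I_N * 'I_n)%type _ each.
apply: filterS => x Hx [p pN Qx] i Hi; have := Hx (Ordinal pN, i) Qx; rewrite /F /= => cF.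
apply: cvg_bounded_transform; apply: (cvg_square0 _ cF).
by rewrite normr_gt0.
Qed.

Lemma integrable_dominated_cvg0 O (A : R -> \bar R) (L : R) (Psi : 'rV[R]_n -> \bar R) (z : nat -> 'rV[R]_n -> R) K :
  open O -> young A -> 0 < L -> mu.-integrable O Psi -> (forall k, measurable_fun setT (z k)) ->
  {ae mu, forall x, O x -> z k x @[k --> \oo] --> 0} ->
  {ae mu, forall x, O x -> forall k, (A (`|z k x| / L)%R <= Psi x)%E} ->
  compact K -> K `<=` O -> (\int[mu]_(x in K) `|(z k x)%:E|)%E @[k --> \oo] --> 0%E.
Proof.
move=> oO yA L0 iPsi mz cz dom cK KO; have mK := compact_measurable_rV cK.
have [c [d [c0 d0 Alin]]] := young_linear yA.
have iPK : mu.-integrable K Psi by apply: integrableS KO iPsi => //; exact: open_measurable_rV.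
have iC := integrable_cst_compact d cK.
pose g x := ((L / c)%:E * (Psi x + d%:E))%E.
have ig : mu.-integrable K g by apply: integrableZl => //; exact: integrableD.
have mzK k : measurable_fun K (fun x => `|(z k x)%:E|%E).
  by apply: measurable_funTS; apply: measurableT_comp => //; exact/measurable_EFinP.
have dct : {ae mu, forall x, K x -> `|(z k x)%:E|%E @[k --> \oo] --> (cst 0%E : 'rV[R]_n -> \bar R) x}.
  apply: filterS cz => x Hx Kx; have := Hx (KO x Kx) => cx; apply/cvge0P => // e e0.
  have /cvgrPdist_le/(_ _ e0)[N _ HN] := cx; exists N => k Nk.
  by have := HN k Nk; rewrite sub0r normrN abse_EFin lee_fin.
have dom' : {ae mu, forall x k, K x -> (`| `|(z k x)%:E| | <= g x)%E}.
  apply: filterS dom => x Hx k Kx; rewrite abse_id abse_EFin /g.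
  rewrite -lee_pdivrMl ?divr_gt0// -EFinM.
  have zL : 0 <= `|z k x| / L by rewrite divr_ge0// ltW.
  have -> : (L / c)^-1 * `|z k x| = c * (`|z k x| / L) by rewrite invf_div mulrAC mulrA.
  by apply: (le_trans (Alin _ zL)); rewrite leeD2r// Hx//; exact: KO.
have [_ _] := dominated_convergence mK mzK (measurable_cst _) dct ig dom'.
by rewrite integral0.
Qed.

Lemma integral_small_off_boxes O (a b : nat -> 'I_n -> R) (Psi : 'rV[R]_n -> \bar R) (e : R) : open O ->
  (forall x, O x -> exists p, box (a p) (b p) x) -> measurable_fun setT Psi -> (forall x, 0 <= Psi x)%E ->
  mu.-integrable O Psi -> 0 < e ->
  exists N, (\int[mu]_(x in O `&` [set x | ~ exists2 p, (p < N)%N & box (a p) (b p) x]) Psi x <= e%:E)%E.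
Proof.
move=> oO cov mPsi Psi0 iPsi e0; have mO := open_measurable_rV oO.
pose S N := [set x | ~ exists2 p, (p < N)%N & box (a p) (b p) x].
have mS N : measurable (S N).
  rewrite (_ : S N = ~` (\bigcup_(p in `I_N) box (a p) (b p))).
    by apply: measurableC; apply: bigcup_measurable => p _; exact: measurable_box.
  by apply/seteqP; split => x /= H [p pN px]; apply: H; exists p.
have [|N HN] := integral_vanishing_sets mO mPsi Psi0 mS iPsi _ e0; last by exists N.
apply: aeW => x Ox; have [p px] := cov x Ox; exists p.+1 => k pk /=; apply.
by exists p.
Qed.

End composition_limits.

(** Because of [r j] the functions [b j] come without a common integrable majorant. Dominated
    convergence is applied to the minimum of [b j] and [D Psi] on [S]; the excess is at most [r j],
    and off [S] the majorant itself has small integral. *)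
Lemma ex_integral_le d (T : measurableType d) (R : realType) (mu : {measure set T -> \bar R}) (O S : set T)
    (b r : nat -> T -> \bar R) (Psi : T -> \bar R) (D e1 e2 e3 : R) : measurable O -> measurable S ->
  (forall j, measurable_fun setT (b j)) -> (forall j x, 0 <= b j x)%E ->
  (forall j, measurable_fun setT (r j)) -> (forall j x, 0 <= r j x)%E -> (forall j, \int[mu]_(x in O) r j x <= e1%:E)%E ->
  measurable_fun setT Psi -> (forall x, 0 <= Psi x)%E -> mu.-integrable O Psi -> 0 <= D -> 0 < e3 ->
  (\int[mu]_(x in O `&` ~` S) Psi x <= e2%:E)%E ->
  (forall j, {ae mu, forall x, O x -> (b j x <= D%:E * Psi x + r j x)%E}) ->
  {ae mu, forall x, O x -> S x -> b j x @[j --> \oo] --> 0%E} ->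
  exists j, (\int[mu]_(x in O) b j x <= (e1 + D * e2 + e3)%:E)%E.
Proof.
move=> mO mS mb b0 mr r0 re mPsi Psi0 iPsi D0 e30 offS bP cb.
pose c j := (fun x => mine (b j x) (D%:E * Psi x)%E) \_ S.
have mDP : measurable_fun setT (fun x => D%:E * Psi x)%E by exact: measurable_funeM.
have DP0 x : (0 <= D%:E * Psi x)%E by rewrite mule_ge0.
have mc j : measurable_fun O (c j).
  apply: measurable_funTS; apply/(measurable_restrictT _ mS); apply: measurable_funTS.
  exact: measurable_mine.
have c0 j x : (0 <= c j x)%E by rewrite /c patchE; case: ifP => // _; rewrite le_min b0 DP0.
have cc : {ae mu, forall x, O x -> c j x @[j --> \oo] --> (cst 0%E : T -> \bar R) x}.
  apply: filterS cb => x Hx Ox; apply/cvge0P => // e e0.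
  case: (pselect (S x)) => Sx; last by exists 0%N => j _; rewrite /c patchE memNset// lee_fin ltW.
  have [N HN] := iffLR (cvge0P (b0 ^~ x)) (Hx Ox Sx) e e0.
  by exists N => j Nj; rewrite /c patchE mem_set// ge_min HN.
have iDP : mu.-integrable O (fun x => D%:E * Psi x)%E by exact: integrableZl.
have dom : {ae mu, forall x j, O x -> (`|c j x| <= D%:E * Psi x)%E}.
  apply: aeW => x j Ox; rewrite gee0_abs// /c patchE; case: ifP => // _.
  by rewrite ge_min lexx orbT.
have [_ _] := dominated_convergence mO mc (measurable_cst _) cc iDP dom.
rewrite integral0 => /(iffLR (cvge0P _)) H.
have [|j Hj] := H _ e3 e30; first by move=> k; apply: integral_ge0 => x _; exact: c0.
have {}Hj := Hj j (leqnn _); exists j.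
have mSc : measurable (~` S) by exact: measurableC.
pose off := (fun x => D%:E * Psi x)%E \_ (~` S).
have moff : measurable_fun O off.
  by apply: measurable_funTS; apply/(measurable_restrictT _ mSc); exact: measurable_funTS.
have off0 x : (0 <= off x)%E by rewrite /off patchE; case: ifP.
have mrO : measurable_fun O (r j) by exact: measurable_funTS.
apply: (@le_trans _ _ (\int[mu]_(x in O) (r j x + off x + c j x))%E).
  apply: ae_ge0_le_integral => //.
  - exact: measurable_funTS.
  - by move=> x _; rewrite !adde_ge0.
  - by apply: emeasurable_funD => //; apply: emeasurable_funD.
  apply: filterS (bP j) => x Hx Ox; have {Hx}bx := Hx Ox.
  rewrite /off /c !patchE in_setC; case: (x \in S) => /=; last by rewrite adde0 addeC.
  rewrite adde0 minEle; case: ifP => _; first by rewrite leeDr.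
  by rewrite addeC.
rewrite ge0_integralD//; last 2 first.
- by move=> x _; rewrite adde_ge0.
- exact: emeasurable_funD.
rewrite ge0_integralD// EFinD; apply: leeD => //; rewrite EFinD; apply: leeD => //.
rewrite /off -integral_mkcondr ge0_integralZl//; last 2 first.
- exact: measurableI.
- exact: measurable_funTS.
by rewrite EFinM lee_wpmul2l.
Qed.

Lemma cvg_increasing (T : topologicalType) (u : nat -> T) (l : T) (s : nat -> nat) : {homo s : i j / (i < j)%N} ->
  u k @[k --> \oo] --> l -> u (s k) @[k --> \oo] --> l.
Proof.
move=> sincr; have sk k : (k <= s k)%N by elim: k => // k ih; exact: leq_ltn_trans ih (sincr _ _ (ltnSn k)).
move=> cu; apply: (cvg_comp s u _ cu) => P [N _ NP]; exists N => // k /= Nk.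
by apply: NP; exact: leq_trans Nk (sk k).
Qed.

(** The factor 4 collects the 2 of the convexity midpoint and the 2 of crude triangle inequalities
    such as [gradnormD_le]. *)
Lemma young_quarter (R : realType) (C : R -> \bar R) (p q s K : R) : young C -> 0 < K -> 0 <= p -> 0 <= q -> 0 <= s ->
  s <= 2 * (p + q) -> (C (s / (4 * K))%R <= C (p / K)%R + C (q / K)%R)%E.
Proof.
move=> yC K0 p0 q0 s0 spq; apply: (young_mid yC); rewrite ?divr_ge0 ?mulr_ge0 ?(ltW K0)//.
rewrite invfM mulrA ler_pdivlMr ?ltr0n// -mulrDl mulrAC ler_pM2r ?invr_gt0//; lra.
Qed.

Section gradient_norm.
Context {R : realType} (n : nat).
Implicit Types (G H : 'I_n -> 'rV[R]_n -> R).

Lemma gradnormD_le G H x : gradnorm (fun i x => G i x + H i x) x <= 2 * (gradnorm G x + gradnorm H x).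
Proof.
have g0 := gradnorm_ge0 G x; have h0 := gradnorm_ge0 H x.
rewrite -[leRHS]ger0_norm ?mulr_ge0 ?addr_ge0// -sqrtr_sqr [leLHS]gradnormE ler_wsqrtr//.
have sq G' : gradnorm G' x ^+ 2 = \sum_i G' i x ^+ 2.
  by rewrite gradnormE sqr_sqrtr// sumr_ge0// => i _; exact: sqr_ge0.
apply: (@le_trans _ _ (2 * (gradnorm G x ^+ 2 + gradnorm H x ^+ 2))).
  rewrite !sq -big_split/= mulr_sumr; apply: ler_sum => i _; have := sqr_ge0 (G i x - H i x); nra.
nra.
Qed.

Lemma gradnormB_le G H x : gradnorm (fun i x => G i x - H i x) x <= 2 * (gradnorm G x + gradnorm H x).
Proof.
have := @gradnormD_le G (fun i x => -1 * H i x) x.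
by rewrite gradnorm_scale normrN normr1 mul1r; apply: le_trans; rewrite !gradnormE; under eq_bigr do rewrite -mulN1r.
Qed.

Lemma gradnorm_cvg0 (G : nat -> 'I_n -> 'rV[R]_n -> R) x : (forall i, G k i x @[k --> \oo] --> 0) ->
  gradnorm (G k) x @[k --> \oo] --> 0.
Proof.
move=> cG; apply: (@squeeze_cvgr _ _ _ _ (fun=> 0) (fun k => \sum_i `|G k i x|)).
- by apply: nearW => k; rewrite gradnorm_ge0 gradnorm_le.
- exact: cvg_cst.
have c0 i : `|G k i x| @[k --> \oo] --> (0 : R) by rewrite -(normr0 R); exact: cvg_norm.
elim: (index_enum 'I_n) => [|i s ih]; first by under eq_fun do rewrite big_nil; exact: cvg_cst.
rewrite (_ : (fun k => _) = (fun k => `|G k i x| + \sum_(j <- s) `|G k j x|)); last by apply/funext => k; rewrite big_cons.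
have := cvgD (c0 i) ih; rewrite addr0; exact.
Qed.

End gradient_norm.

(** * Composition on Borel representatives *)

Section composition.
Context {R : realType} (n : nat).
Hypothesis n0 : (0 < n)%N.
Local Notation mu := (@borel_lebesgue R n).
Variables (O : set 'rV[R]_n) (A B : R -> \bar R) (f h w : R -> R).
Hypotheses (oO : open O) (yA : young A) (ndA : nondegenerate_young A) (yB : young B).
Hypotheses (cf : continuous f) (fhw : local_primitive f h w) (mw : measurable_fun [set: R] w).
Hypothesis gc : growth_control O A B w.

Let mO : measurable O := open_measurable_rV oO.
Let i0 : 'I_n := Ordinal n0.

Lemma local_primitive_ge0 (s : R) : 0 <= w `|s|.
Proof. by have [_ hw _ _] := fhw; exact: le_trans (hw s). Qed.

Lemma measurable_young_div (C : R -> \bar R) (v : 'rV[R]_n -> R) (l : R) : young C -> 0 < l -> measurable_fun setT v ->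
  measurable_fun setT (fun x => C (`|v x| / l)%R).
Proof.
move=> yC l0 mv; rewrite (_ : (fun x => _) = fun x => C `|v x / l|); last first.
  by apply/funext => x; rewrite normrM normfV (gtr0_norm l0).
by apply: measurable_young_comp => //; apply: measurable_funM => //; exact: measurable_cst.
Qed.

Lemma measurable_young_gradnorm (C : R -> \bar R) (H : 'I_n -> 'rV[R]_n -> R) (l : R) : young C -> 0 < l ->
  (forall i, measurable_fun setT (H i)) -> measurable_fun setT (fun x => C (gradnorm H x / l)%R).
Proof.
move=> yC l0 mH; have := measurable_young_div yC l0 (measurable_gradnorm mH).
by under eq_fun do rewrite (ger0_norm (gradnorm_ge0 _ _)).
Qed.

Lemma composition_bound v (H : 'I_n -> 'rV[R]_n -> R) (Psi r : 'rV[R]_n -> \bar R) (L l D : R) :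
  0 < l -> 0 <= D ->
  {ae mu, forall x, O x -> (A (`|v x| / L)%R <= Psi x)%E /\ (A (gradnorm H x / L)%R <= Psi x)%E} ->
  {ae mu, forall x, O x -> forall p : R, 0 <= p ->
        (B (p * w `|v x| / l)%R <= D%:E * (A (p / L)%R + A (`|v x| / L)%R) + r x)%E} ->
  {ae mu, forall x, O x ->
    [/\ (B (`|v x| * w `|v x| / l)%R <= (2 * D)%:E * Psi x + r x)%E,
        (B (gradnorm H x * w `|v x| / l)%R <= (2 * D)%:E * Psi x + r x)%E,
        (B (`|f (v x)| / l)%R <= (2 * D)%:E * Psi x + r x)%E &
        (B (gradnorm (fun i y => (h (v y) * H i y)%R) x / l)%R <= (2 * D)%:E * Psi x + r x)%E]}.
Proof.
move=> l0 D0 dom gr; have [_ hw _ _] := fhw.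
apply: filterS2 dom gr => x Hx Gx Ox; have [Av Ag] := Hx Ox; have {Gx}G := Gx Ox.
have bound p : 0 <= p -> (A (p / L)%R <= Psi x)%E -> (B (p * w `|v x| / l)%R <= (2 * D)%:E * Psi x + r x)%E.
  move=> p0 Ap; apply: (le_trans (G p p0)); rewrite leeD2r// (mulrC 2) EFinM -muleA lee_wpmul2l//.
  have -> : (2%:E * Psi x = Psi x + Psi x)%E.
    by rewrite -mule2n mule_natl.
  exact: leeD.
have b1 := bound _ (normr_ge0 (v x)) Av; have b2 := bound _ (gradnorm_ge0 H x) Ag; split => //.
  apply: le_trans b1; apply: (young_homo yB); rewrite divr_ge0 ?(ltW l0)//=.
  by rewrite ler_pM2r ?invr_gt0//; exact: local_primitive_le fhw.
apply: le_trans b2; apply: (young_homo yB); rewrite divr_ge0 ?gradnorm_ge0 ?(ltW l0)//=.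
rewrite ler_pM2r ?invr_gt0//.
have -> : gradnorm (fun i y => h (v y) * H i y) x = `|h (v x)| * gradnorm H x.
  by rewrite -gradnorm_scale !gradnormE.
by rewrite mulrC ler_wpM2l ?gradnorm_ge0.
Qed.

Lemma integrable_of_young (z : 'rV[R]_n -> R) (g : 'rV[R]_n -> \bar R) (l : R) K : 0 < l -> measurable_fun setT z ->
  mu.-integrable O g -> {ae mu, forall x, O x -> (B (`|z x| / l)%R <= g x)%E} ->
  compact K -> K `<=` O -> mu.-integrable K (EFin \o z).
Proof.
move=> l0 mz ig dom cK KO; have mK := compact_measurable_rV cK.
have [c [d [c0 d0 Blin]]] := young_linear yB.
have igK : mu.-integrable K g by apply: integrableS KO ig.
have iC := integrable_cst_compact d cK.
have iG : mu.-integrable K (fun x => ((l / c)%:E * (g x + d%:E))%E).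
  by apply: integrableZl => //; exact: integrableD.
have mzK : measurable_fun K (EFin \o z) by apply: measurable_funTS; exact/measurable_EFinP.
have G0 : {ae mu, forall x, K x -> (`|(EFin \o z) x| <= (l / c)%:E * (g x + d%:E))%E}.
  apply: filterS dom => x Hx Kx; rewrite abse_EFin -lee_pdivrMl ?divr_gt0// -EFinM.
  have zl : 0 <= `|z x| / l by rewrite divr_ge0// ltW.
  have -> : (l / c)^-1 * `|z x| = c * (`|z x| / l) by rewrite invf_div mulrAC mulrA.
  by apply: (le_trans (Blin _ zl)); rewrite leeD2r// Hx//; exact: KO.
apply/integrableP; split => //.
have /integrableP[mG Goo] := iG.
apply: le_lt_trans Goo; apply: ae_ge0_le_integral => //.
- exact: measurableT_comp.
- exact: measurableT_comp.
by apply: filterS G0 => x Hx Kx; apply: le_trans (Hx Kx) (lee_abs _).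
Qed.

Lemma composition_weak v (H : 'I_n -> 'rV[R]_n -> R) (g : 'rV[R]_n -> \bar R) (l : R) i : 0 < l ->
  (forall i, borel_weak O i v (H i)) -> mu.-integrable O g ->
  {ae mu, forall x, O x -> [/\ (B (`|v x| * w `|v x| / l)%R <= g x)%E,
        (B (gradnorm H x * w `|v x| / l)%R <= g x)%E,
        (B (`|f (v x)| / l)%R <= g x)%E &
        (B (gradnorm (fun i y => (h (v y) * H i y)%R) x / l)%R <= g x)%E]} ->
  borel_weak O i (f \o v) (fun x => h (v x) * H i x).
Proof.
move=> l0 vH ig dom; have [mv mH _ _ _] := vH i; have [mh hw _ _] := fhw.
apply: (chain_rule_local oO (vH i) fhw mw) => K cK KO.
  apply: (integrable_of_young l0 _ ig _ cK KO).
    apply: measurable_funM; first exact: measurableT_comp.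
    by apply: (measurableT_comp mw); exact: measurableT_comp.
  apply: filterS dom => x Hx Ox; have [H1 _ _ _] := Hx Ox.
  by rewrite ger0_norm// mulr_ge0// local_primitive_ge0.
apply: (integrable_of_young l0 _ ig _ cK KO).
  by apply: measurable_funM => //; exact: (measurableT_comp mh mv).
apply: filterS dom => x Hx Ox; have [_ _ _ H4] := Hx Ox; apply: le_trans H4.
apply: (young_homo yB); rewrite divr_ge0 ?(ltW l0)//= ler_pM2r ?invr_gt0//.
exact: (le_gradnorm (fun i y => h (v y) * H i y)).
Qed.

(** Where the limit gradient vanishes the convergence of [h (s k)] is unknown, but these values are
    eventually bounded by [w (|s0| + 1)], which is enough. *)
Lemma product_cvg (s t : nat -> R) (s0 t0 : R) : s k @[k --> \oo] --> s0 -> t k @[k --> \oo] --> t0 ->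
  (t0 != 0 -> h (s k) @[k --> \oo] --> h s0) -> h (s k) * t k - h s0 * t0 @[k --> \oo] --> 0.
Proof.
move=> cs ct ch; have [_ hw wmon _] := fhw.
have [t00|/ch {}ch] := eqVneq t0 0; last first.
  by rewrite -(subrr (h s0 * t0)); apply: cvgB; [exact: cvgM|exact: cvg_cst].
rewrite t00 mulr0; under eq_fun do rewrite subr0.
have near1 : \forall k \near \oo, `|s k| <= `|s0| + 1.
  have /cvgrPdist_le/(_ 1 ltr01) := cs; apply: filterS => k sk.
  by rewrite -lerBlDl; apply: le_trans sk; rewrite distrC; exact: lerB_dist.
apply/norm_cvg0P; apply: (@squeeze_cvgr _ _ _ _ (fun=> 0) (fun k => w (`|s0| + 1) * `|t k|)).
- apply: filterS near1 => k sk; rewrite normr_ge0/= normrM ler_wpM2r//.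
  by apply: le_trans (hw _) _; exact: wmon.
- exact: cvg_cst.
rewrite -(mulr0 (w (`|s0| + 1))); apply: cvgMr; rewrite -(normr0 R) -t00; exact: cvg_norm.
Qed.

(** Growth control with the sum of the two modulars as majorant and a remainder of integral at most
    1. *)
Lemma composition_orlicz v (H : 'I_n -> 'rV[R]_n -> R) (L : R) : 0 < L ->
  (forall i, borel_weak O i v (H i)) ->
  (\int[mu]_(x in O) A (`|v x| / L)%R < +oo)%E -> (\int[mu]_(x in O) A (gradnorm H x / L)%R < +oo)%E ->
  (forall i, borel_weak O i (f \o v) (fun x => h (v x) * H i x)) /\
  exists2 l, 0 < l & (\int[mu]_(x in O) B (`|f (v x)| / l)%R < +oo)%E /\
    (\int[mu]_(x in O) B (gradnorm (fun i y => (h (v y) * H i y)%R) x / l)%R < +oo)%E.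
Proof.
move=> L0 vH vL gL; have mv : measurable_fun setT v by case: (vH i0).
have mH i : measurable_fun setT (H i) by case: (vH i).
have mh : measurable_fun [set: measurableTypeR R] h by case: fhw.
have mf : measurable_fun setT f := measurable_local_primitive fhw.
pose Psi x := (A (`|v x| / L)%R + A (gradnorm H x / L)%R)%E.
have Av0 x : (0 <= A (`|v x| / L)%R)%E by rewrite young_ge0// divr_ge0// ltW.
have Ag0 x : (0 <= A (gradnorm H x / L)%R)%E by rewrite young_ge0// divr_ge0 ?gradnorm_ge0// ltW.
have mAv := measurable_young_div yA L0 mv; have mAg := measurable_young_gradnorm yA L0 mH.
have mPsi : measurable_fun setT Psi by exact: emeasurable_funD.
have Psi0 x : (0 <= Psi x)%E by exact: adde_ge0.
have PsiE : (\int[mu]_(x in O) Psi x = \int[mu]_(x in O) A (`|v x| / L)%R + \int[mu]_(x in O) A (gradnorm H x / L)%R)%E.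
  by rewrite ge0_integralD//; exact: measurable_funTS.
have Poo : (\int[mu]_(x in O) Psi x < +oo)%E by rewrite PsiE lte_add_pinfty.
have I0 : (0 <= \int[mu]_(x in O) Psi x)%E by apply: integral_ge0.
have iPsi : mu.-integrable O Psi.
  by apply/integrableP; split; [exact: measurable_funTS|under eq_integral do rewrite gee0_abs//].
pose M := fine (\int[mu]_(x in O) Psi x)%E.
have PM : (\int[mu]_(x in O) Psi x <= M%:E)%E by rewrite fineK// ge0_fin_numE.
have [l l0 Hl] := gc L0 (fine_ge0 I0).
have [D D0 HD] := Hl Psi mPsi Psi0 PM 1 ltr01.
have dom : {ae mu, forall x, O x -> (A (`|v x| / L)%R <= Psi x)%E /\ (A (gradnorm H x / L)%R <= Psi x)%E}.
  by apply: aeW => x _; rewrite /Psi leeDl// leeDr.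
have [r [mr r0 r1 gr]] := HD v H vH dom.
have bnd := composition_bound l0 D0 dom gr.
have ir : mu.-integrable O r.
  apply/integrableP; split; [exact: measurable_funTS|under eq_integral do rewrite gee0_abs//].
  by rewrite (le_lt_trans r1)// ltry.
have ig : mu.-integrable O (fun x => (2 * D)%:E * Psi x + r x)%E.
  by apply: integrableD => //; exact: integrableZl.
have g0 x : (0 <= (2 * D)%:E * Psi x + r x)%E by rewrite adde_ge0// mule_ge0// lee_fin mulr_ge0.
have goo : (\int[mu]_(x in O) ((2 * D)%:E * Psi x + r x) < +oo)%E.
  by have /integrableP[_] := ig; under eq_integral do rewrite gee0_abs//.
split; first by move=> i; apply: (composition_weak i l0 vH ig bnd).
have mhv : measurable_fun setT (h \o v) by exact: (measurableT_comp mh mv).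
exists l => //; split; apply: le_lt_trans goo; apply: ae_ge0_le_integral => //.
- by move=> x _; rewrite young_ge0// divr_ge0// ltW.
- apply: measurable_funTS; apply: (measurable_young_div yB l0); exact: measurableT_comp.
- exact: measurable_int ig.
- by apply: filterS bnd => x Hx Ox; have [] := Hx Ox.
- by move=> x _; rewrite young_ge0// divr_ge0 ?gradnorm_ge0// ltW.
- apply: measurable_funTS; apply: (measurable_young_gradnorm yB l0) => i; exact: measurable_funM.
- exact: measurable_int ig.
- by apply: filterS bnd => x Hx Ox; have [] := Hx Ox.
Qed.

Lemma composition_cvg (v : nat -> 'rV[R]_n -> R) (H : nat -> 'I_n -> 'rV[R]_n -> R) v0 H0 (L : R) : 0 < L ->
  (forall k i, borel_weak O i (v k) (H k i)) -> (forall i, borel_weak O i v0 (H0 i)) ->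
  (\int[mu]_(x in O) A (`|v0 x| / L)%R < +oo)%E -> (\int[mu]_(x in O) A (gradnorm H0 x / L)%R < +oo)%E ->
  (\int[mu]_(x in O) A (`|v k x - v0 x| / L)%R)%E @[k --> \oo] --> 0%E ->
  (\int[mu]_(x in O) A (gradnorm (fun i y => (H k i y - H0 i y)%R) x / L)%R)%E @[k --> \oo] --> 0%E ->
  exists2 l, 0 < l &
    (\int[mu]_(x in O) B (`|f (v k x) - f (v0 x)| / l)%R)%E @[k --> \oo] --> 0%E /\
    (\int[mu]_(x in O) B (gradnorm (fun i y => (h (v k y) * H k i y - h (v0 y) * H0 i y)%R) x / l)%R)%E @[k --> \oo] --> 0%E.
Proof.
move=> L0 vH vH0 v0L g0L cv cH.
have mv k : measurable_fun setT (v k) by case: (vH k i0).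
have mH k i : measurable_fun setT (H k i) by case: (vH k i).
have mv0 : measurable_fun setT v0 by case: (vH0 i0).
have mH0 i : measurable_fun setT (H0 i) by case: (vH0 i).
have mh : measurable_fun [set: measurableTypeR R] h by case: fhw.
have mf : measurable_fun setT f := measurable_local_primitive fhw.
have L4 : 0 < 4 * L by rewrite mulr_gt0.
have divL0 (s : R) : 0 <= s -> (0 <= A (s / L)%R)%E by move=> s0; rewrite young_ge0// divr_ge0// ltW.
pose psi k x := (A (`|v k x - v0 x| / L)%R + A (gradnorm (fun i y => (H k i y - H0 i y)%R) x / L)%R)%E.
have mdv k : measurable_fun setT (fun x => v k x - v0 x) by exact: measurable_funB.
have mdH k i : measurable_fun setT (fun x => H k i x - H0 i x) by exact: measurable_funB.
have mpsi k : measurable_fun setT (psi k).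
  apply: emeasurable_funD; first exact: (measurable_young_div yA L0 (mdv k)).
  exact: (measurable_young_gradnorm yA L0 (mdH k)).
have psi0 k x : (0 <= psi k x)%E by apply: adde_ge0; apply: divL0 => //; exact: gradnorm_ge0.
have psiE k : (\int[mu]_(x in O) psi k x = \int[mu]_(x in O) A (`|v k x - v0 x| / L)%R +
    \int[mu]_(x in O) A (gradnorm (fun i y => (H k i y - H0 i y)%R) x / L)%R)%E.
  rewrite ge0_integralD//.
  - by move=> x _; exact: divL0.
  - by apply: measurable_funTS; exact: (measurable_young_div yA L0 (mdv k)).
  - by move=> x _; apply: divL0; exact: gradnorm_ge0.
  - by apply: measurable_funTS; exact: (measurable_young_gradnorm yA L0 (mdH k)).
have cpsi : (\int[mu]_(x in O) psi k x)%E @[k --> \oo] --> 0%E.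
  by under eq_fun do rewrite psiE; rewrite -(adde0 0%E); apply: cvgeD.
pose Q x := (A (`|v0 x| / L)%R + A (gradnorm H0 x / L)%R)%E.
have mAv0 := measurable_young_div yA L0 mv0; have mAg0 := measurable_young_gradnorm yA L0 mH0.
have mQ : measurable_fun setT Q by exact: emeasurable_funD.
have Q0 x : (0 <= Q x)%E by apply: adde_ge0; apply: divL0 => //; exact: gradnorm_ge0.
have Qoo : (\int[mu]_(x in O) Q x < +oo)%E.
  rewrite ge0_integralD//; first exact: lte_add_pinfty.
  - by move=> x _; exact: divL0.
  - exact: measurable_funTS.
  - by move=> x _; apply: divL0; exact: gradnorm_ge0.
  - exact: measurable_funTS.
have IQ0 : (0 <= \int[mu]_(x in O) Q x)%E by exact: integral_ge0.
(* The summand 1 bounds the series of modulars along any subsequence extracted later, so that the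
   scale [l] can be fixed now. *)
pose M := fine (\int[mu]_(x in O) Q x)%E + 1.
have M0 : 0 <= M by rewrite addr_ge0 ?fine_ge0.
have [l l0 Hl] := gc L4 M0.
have l4 : 0 < 4 * l by rewrite mulr_gt0.
pose b k x := (B (`|f (v k x) - f (v0 x)| / (4 * l))%R +
   B (gradnorm (fun i y => (h (v k y) * H k i y - h (v0 y) * H0 i y)%R) x / (4 * l))%R)%E.
have divl0 (s : R) : 0 <= s -> (0 <= B (s / (4 * l))%R)%E by move=> s0; rewrite young_ge0// divr_ge0// ltW.
have mb1 k : measurable_fun setT (fun x => B (`|f (v k x) - f (v0 x)| / (4 * l))%R).
  by apply: (measurable_young_div yB l4); apply: measurable_funB; [exact: (measurableT_comp mf (mv k))|exact: (measurableT_comp mf mv0)].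
have mb2 k : measurable_fun setT (fun x => B (gradnorm (fun i y => (h (v k y) * H k i y - h (v0 y) * H0 i y)%R) x / (4 * l))%R).
  apply: (measurable_young_gradnorm yB l4) => i; apply: measurable_funB; apply: measurable_funM => //.
    exact: (measurableT_comp mh (mv k)).
  exact: (measurableT_comp mh mv0).
have mb k : measurable_fun setT (b k) by exact: emeasurable_funD.
have b0 k x : (0 <= b k x)%E by apply: adde_ge0; apply: divl0 => //; exact: gradnorm_ge0.
have cb : (\int[mu]_(x in O) b k x)%E @[k --> \oo] --> 0%E; last first.
  exists (4 * l) => //; split; apply: squeeze_cvge cb; try exact: cvg_cst; apply: nearW => k; apply/andP; split.
  - by apply: integral_ge0 => x _; exact: divl0.
  - apply: ge0_le_integral => //; try by (apply: measurable_funTS).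
    + by move=> x _; exact: divl0.
    + by move=> x _; rewrite leeDl//; apply: divl0; exact: gradnorm_ge0.
  - by apply: integral_ge0 => x _; apply: divl0; exact: gradnorm_ge0.
  - apply: ge0_le_integral => //; try by (apply: measurable_funTS).
    + by move=> x _; apply: divl0; exact: gradnorm_ge0.
    + by move=> x _; rewrite leeDr//; exact: divl0.
apply: cvge0_subsequence => [k|e e0 s0 s0incr]; first exact: integral_ge0.
have I0psi k : (0 <= \int[mu]_(x in O) psi k x)%E by exact: integral_ge0.
have cs0 := cvg_increasing s0incr cpsi.
have [s1 s1incr sum1] := summable_subsequence_le1 (fun k => I0psi (s0 k)) cs0.
pose t k := s0 (s1 k).
(* Sum of the modulars along the subsequence: with [Q] added it dominates, at scale [4 * L], every
   member and the limit, gradients included. *)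
pose Sg x := (\sum_(0 <= k <oo) psi (t k) x)%E.
have mSg : measurable_fun setT Sg by apply: (ge0_emeasurable_sum (P := xpredT)) => // k x _ _; exact: psi0.
have Sg0 x : (0 <= Sg x)%E by apply: nneseries_ge0 => k _ _; exact: psi0.
have ISg : (\int[mu]_(x in O) Sg x <= 1)%E.
  by rewrite integral_nneseries// => k; exact: measurable_funTS.
have psiSg j x : (psi (t j) x <= Sg x)%E.
  have le1 : (psi (t j) x <= \sum_(0 <= k < j.+1) psi (t k) x)%E.
    by rewrite big_nat_recr//= leeDr// sume_ge0.
  by apply: (le_trans le1); apply: nneseries_lim_ge => k _ _; exact: psi0.
pose Psi x := (Q x + Sg x)%E.
have mPsi : measurable_fun setT Psi by exact: emeasurable_funD.
have Psi0 x : (0 <= Psi x)%E by exact: adde_ge0.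
have PM : (\int[mu]_(x in O) Psi x <= M%:E)%E.
  rewrite ge0_integralD//; last 2 first.
  - exact: measurable_funTS.
  - exact: measurable_funTS.
  by rewrite EFinD fineK ?ge0_fin_numE//; apply: leeD.
have iPsi : mu.-integrable O Psi.
  apply/integrableP; split; [exact: measurable_funTS|under eq_integral do rewrite gee0_abs//].
  by rewrite (le_lt_trans PM)// ltry.
(* The target [e] is spent as [e / 2] on the two remainders, each of integral [e / 8] and counted
   twice, and as [e / 4] each on the region off the boxes and on dominated convergence. *)
have e8 : 0 < e / 8 by rewrite divr_gt0.
have [D D0 HD] := Hl Psi mPsi Psi0 PM (e / 8) e8.
have div4 (s : R) : 0 <= s -> s / (4 * L) <= s / L.
  by move=> s0'; rewrite ler_wpM2l// lef_pV2 ?posrE// ler_peMl ?(ltW L0)// ler1n.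
have QPsi x : (Q x <= Psi x)%E by rewrite /Psi leeDl.
have dom0 : {ae mu, forall x, O x -> (A (`|v0 x| / (4 * L))%R <= Psi x)%E /\ (A (gradnorm H0 x / (4 * L))%R <= Psi x)%E}.
  apply: aeW => x _; split; apply: le_trans (QPsi x).
    apply: (@le_trans _ _ (A (`|v0 x| / L)%R)); last by rewrite leeDl//; apply: divL0; exact: gradnorm_ge0.
    by apply: (young_homo yA); rewrite divr_ge0 ?(ltW L4)//= div4.
  apply: (@le_trans _ _ (A (gradnorm H0 x / L)%R)); last by rewrite leeDr//; exact: divL0.
  by apply: (young_homo yA); rewrite divr_ge0 ?gradnorm_ge0 ?(ltW L4)//= div4// gradnorm_ge0.

have domj j : {ae mu, forall x, O x -> (A (`|v (t j) x| / (4 * L))%R <= Psi x)%E /\ (A (gradnorm (H (t j)) x / (4 * L))%R <= Psi x)%E}.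
  apply: aeW => x _; have ps : (psi (t j) x + Q x <= Psi x)%E by rewrite addeC /Psi leeD2l.
  split; apply: le_trans ps.
    apply: (le_trans (@young_quarter _ A `|v (t j) x - v0 x| `|v0 x| _ L yA L0 _ _ _ _)) => //.
      have := ler_normD (v (t j) x - v0 x) (v0 x); rewrite subrK => le1.
      by apply: (le_trans le1); rewrite mulrDl mul1r lerDl addr_ge0.
    by apply: leeD; rewrite leeDl//; apply: divL0; exact: gradnorm_ge0.
  apply: (le_trans (@young_quarter _ A (gradnorm (fun i y => H (t j) i y - H0 i y) x) (gradnorm H0 x) _ L yA L0 _ _ _ _)) => //; try exact: gradnorm_ge0.
    apply: le_trans (gradnormD_le (fun i y => H (t j) i y - H0 i y) H0 x).
    by rewrite !gradnormE; under [X in _ <= Num.sqrt X]eq_bigr do rewrite subrK.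
  by apply: leeD; rewrite leeDr//; exact: divL0.
have [r0 [mr0 r00 r0e gr0]] := HD v0 H0 vH0 dom0.
have /choice[r rP] : forall j, exists r : 'rV[R]_n -> \bar R, [/\ measurable_fun setT r, (forall x, 0 <= r x)%E,
      (\int[mu]_(x in O) r x <= (e / 8)%:E)%E &
      {ae mu, forall x, O x -> forall p : R, 0 <= p ->
        (B (p * w `|v (t j) x| / l)%R <= D%:E * (A (p / (4 * L))%R + A (`|v (t j) x| / (4 * L))%R) + r x)%E}].
  by move=> j; exact: (HD (v (t j)) (H (t j)) (vH (t j)) (domj j)).
have bnd0 := composition_bound l0 D0 dom0 gr0.
have bnd j : {ae mu, forall x, O x -> (b (t j) x <= (8 * D)%:E * Psi x + (2%:E * r j x + 2%:E * r0 x))%E}.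
  have [_ _ _ grj] := rP j; have := composition_bound l0 D0 (domj j) grj.
  apply: filterS2 bnd0 => x Hx0 Hx Ox; have [_ _ F0 G0] := Hx0 Ox; have [_ _ F1 G1] := Hx Ox.
  have lB := @young_quarter _ B `|f (v (t j) x)| `|f (v0 x)| `|f (v (t j) x) - f (v0 x)| l yB l0 (normr_ge0 _) (normr_ge0 _) (normr_ge0 _).
  have nB : `|f (v (t j) x) - f (v0 x)| <= 2 * (`|f (v (t j) x)| + `|f (v0 x)|).
    by apply: (le_trans (ler_normB _ _)); rewrite mulrDl mul1r lerDl addr_ge0.
  have lG := @young_quarter _ B _ _ _ l yB l0 (gradnorm_ge0 (fun i y => h (v (t j) y) * H (t j) i y) x) (gradnorm_ge0 (fun i y => h (v0 y) * H0 i y) x)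
     (gradnorm_ge0 _ _) (gradnormB_le _ _ _).
  apply: (le_trans (leeD (le_trans (lB nB) (leeD F1 F0)) (le_trans lG (leeD G1 G0)))).
  have rj0 : (0 <= r j x)%E by have [_ ->] := rP j.
  have E8 : ((8 * D)%:E * Psi x = (2 * D)%:E * Psi x + (2 * D)%:E * Psi x + ((2 * D)%:E * Psi x + (2 * D)%:E * Psi x))%E.
    have D2 : (0 <= (2 * D)%:E)%E by rewrite lee_fin mulr_ge0.
    rewrite -!ge0_muleDl ?adde_ge0// -!EFinD; congr (_%:E * _)%E; ring.
  have E2 (y : \bar R) : (2%:E * y = y + y)%E by rewrite -mule2n mule_natl.
  have AC (X y z : \bar R) : (X + y + (X + z) + (X + y + (X + z)) = X + X + (X + X) + (y + y + (z + z)))%E.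
    by rewrite (addeACA X y) (addeACA (X + X)%E) (addeACA y z).
  by rewrite E8 !E2 AC.
have cPsi : {ae mu, forall x, O x -> psi (t j) x @[j --> \oo] --> 0%E}.
  have [] := @ae_cvg0_of_summable _ _ R mu O (fun k => psi (t k)) mO => //.
    by move=> k; exact: measurable_funTS.
  by apply: le_lt_trans sum1 _; rewrite ltry.
have caev : {ae mu, forall x, O x -> v (t j) x - v0 x @[j --> \oo] --> 0}.
  apply: filterS cPsi => x Hx Ox.
  have : A (`|v (t j) x - v0 x| / L)%R @[j --> \oo] --> 0%E.
    apply: squeeze_cvge (Hx Ox); last exact: cvg_cst.
    by apply: nearW => j; rewrite divL0//= leeDl//; apply: divL0; exact: gradnorm_ge0.
  move=> /(young_cvg0_inv yA ndA (fun j => divr_ge0 (normr_ge0 _) (ltW L0))) c1.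
  apply/norm_cvg0P; rewrite -(mul0r L).
  by under eq_fun do rewrite -[`|_|](divfK (lt0r_neq0 L0)); exact: cvgMl.
have caeH i : {ae mu, forall x, O x -> H (t j) i x - H0 i x @[j --> \oo] --> 0}.
  apply: filterS cPsi => x Hx Ox.
  have : A (gradnorm (fun i y => (H (t j) i y - H0 i y)%R) x / L)%R @[j --> \oo] --> 0%E.
    apply: squeeze_cvge (Hx Ox); last exact: cvg_cst.
    by apply: nearW => j; rewrite divL0 ?gradnorm_ge0//= leeDr//; exact: divL0.
  move=> /(young_cvg0_inv yA ndA (fun j => divr_ge0 (gradnorm_ge0 _ _) (ltW L0))) c1.
  have c2 : gradnorm (fun i y => (H (t j) i y - H0 i y)%R) x @[j --> \oo] --> 0.
    rewrite -(mul0r L); under eq_fun do rewrite -[gradnorm _ _](divfK (lt0r_neq0 L0)); exact: cvgMl.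
  apply/norm_cvg0P; apply: squeeze_cvgr c2; last exact: cvg_cst.
  by apply: nearW => j; rewrite normr_ge0/=; exact: (le_gradnorm (fun i y => H (t j) i y - H0 i y)).
have psiPsi j x : (psi (t j) x <= Psi x)%E by apply: (le_trans (psiSg j x)); rewrite /Psi leeDr.
have L1v K : compact K -> K `<=` O -> (\int[mu]_(x in K) `|(v (t k) x - v0 x)%:E|)%E @[k --> \oo] --> 0%E.
  apply: (integrable_dominated_cvg0 oO yA L0 iPsi (fun k => mdv (t k)) caev).
  apply: aeW => x Ox k; apply: le_trans (psiPsi k x); rewrite leeDl//; apply: divL0; exact: gradnorm_ge0.
have L1H i K : compact K -> K `<=` O -> (\int[mu]_(x in K) `|(H (t k) i x - H0 i x)%:E|)%E @[k --> \oo] --> 0%E.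
  apply: (integrable_dominated_cvg0 oO yA L0 iPsi (fun k => mdH (t k) i) (caeH i)).
  apply: aeW => x Ox k; apply: le_trans (psiPsi k x); apply: (@le_trans _ _ (A (gradnorm (fun i y => (H (t k) i y - H0 i y)%R) x / L)%R)).
    apply: (young_homo yA); rewrite divr_ge0 ?(ltW L0)//= ler_pM2r ?invr_gt0//.
    exact: (le_gradnorm (fun i y => H (t k) i y - H0 i y)).
  by rewrite leeDr//; exact: divL0.
have [ba [bb [boxO cov]]] := box_exhaustion n0 oO.
have e2 : 0 < e / (4 * (8 * D + 1)) by rewrite divr_gt0// mulr_gt0// ltr_wpDl// mulr_ge0.
have [N HN] := integral_small_off_boxes oO cov mPsi Psi0 iPsi e2.
have [s2 s2incr cs2] := cvg_composition_subsequence n0 N oO boxO (fun k => vH (t k)) vH0 L1v L1H mh.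
pose S := [set x : 'rV[R]_n | exists2 p, (p < N)%N & box (ba p) (bb p) x].
have mS : measurable S.
  rewrite (_ : S = \bigcup_(p in `I_N) box (ba p) (bb p)); last by apply/seteqP; split => x /= [p pN px]; exists p.
  by apply: bigcup_measurable => p _; exact: measurable_box.
have mR j : measurable_fun setT (fun x => (2%:E * r j x + 2%:E * r0 x)%E).
  by have [mr _ _ _] := rP j; apply: emeasurable_funD; exact: measurable_funeM.
have R0 j x : (0 <= 2%:E * r j x + 2%:E * r0 x)%E by have [_ rj0 _ _] := rP j; rewrite adde_ge0// mule_ge0.
have Re j : (\int[mu]_(x in O) (2%:E * r j x + 2%:E * r0 x) <= (e / 2)%:E)%E.
  have [mr rj0 rje _] := rP j; rewrite ge0_integralD//; last 4 first.
  - by move=> x _; rewrite mule_ge0.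
  - by apply: measurable_funTS; exact: measurable_funeM.
  - by move=> x _; rewrite mule_ge0.
  - by apply: measurable_funTS; exact: measurable_funeM.
  rewrite !ge0_integralZl//; try exact: measurable_funTS.
  apply: (le_trans (leeD (lee_wpmul2l (_ : (0 <= 2%:E)%E) rje) (lee_wpmul2l (_ : (0 <= 2%:E)%E) r0e))) => //.
  rewrite -!EFinM -EFinD lee_fin le_eqVlt; apply/orP; left; apply/eqP; by field.
have cb0 : {ae mu, forall x, O x -> S x -> b (t (s2 j)) x @[j --> \oo] --> 0%E}.
  have caeHall := @ae_forall_countable _ _ _ mu 'I_n (fun i x => O x -> H (t j) i x - H0 i x @[j --> \oo] --> 0) caeH.
  apply: filterS3 caev caeHall cs2 => x cvx cHx cx Ox Sx.
  have cv' : v (t (s2 j)) x @[j --> \oo] --> v0 x.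
    by apply/subr_cvg0; exact: (cvg_increasing s2incr (cvx Ox)).
  have cH' i : H (t (s2 j)) i x @[j --> \oo] --> H0 i x.
    by apply/subr_cvg0; exact: (cvg_increasing s2incr (cHx i Ox)).
  rewrite -(adde0 0%E); apply: cvgeD => //.
    apply: (young_cvg0 yB) => [j|]; first by rewrite divr_ge0// ltW.
    rewrite -(mul0r (4 * l)^-1); apply: cvgMl; apply/norm_cvg0P; apply/subr_cvg0.
    by apply: continuous_cvg => //; exact: cf.
  apply: (young_cvg0 yB) => [j|]; first by rewrite divr_ge0 ?gradnorm_ge0// ltW.
  rewrite -(mul0r (4 * l)^-1); apply: cvgMl; apply: gradnorm_cvg0 => i.
  exact: (product_cvg cv' (cH' i) (fun Hi => cx Sx i Hi)).
have D8 : 0 <= 8 * D by rewrite mulr_ge0.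
have e4 : 0 < e / 4 by rewrite divr_gt0.
have [j Hj] := ex_integral_le mO mS (fun j => mb (t (s2 j))) (fun j => b0 (t (s2 j))) (fun j => mR (s2 j))
  (fun j => R0 (s2 j)) (fun j => Re (s2 j)) mPsi Psi0 iPsi D8 e4 HN (fun j => bnd (s2 j)) cb0.
exists (s1 (s2 j)); apply: (le_trans Hj); rewrite lee_fin.
have D81 : 0 < 8 * D + 1 by rewrite ltr_wpDl.
have -> : 8 * D * (e / (4 * (8 * D + 1))) = e / 4 * (8 * D / (8 * D + 1)) by field; rewrite gt_eqF.
rewrite -addrA -lerBrDl (_ : e - e / 2 = e / 4 + e / 4); last by field.
by rewrite lerD2r ler_piMr ?(ltW e4)// ler_pdivrMr// mul1r lerDl.
Qed.

End composition.

(** * Orlicz-Sobolev spaces *)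

Section transfer.
Context {R : realType} (n : nat).
Hypothesis n0 : (0 < n)%N.
Local Notation mu := (@borel_lebesgue R n).
Local Notation lmu := (lebesgueN R n).
Variables (O : set 'rV[R]_n).
Hypotheses (oO : open O).

Let mO : measurable O := open_measurable_rV oO.
Let i0 : 'I_n := Ordinal n0.

Lemma lebesgue_measurableB (u v : 'rV[R]_n -> R) : lebesgue_measurable O u -> lebesgue_measurable O v ->
  lebesgue_measurable O (fun x => u x - v x).
Proof. by move=> mu_ mv; exact: (measurable_funB mu_ mv). Qed.

Lemma integral_young_transfer (C : R -> \bar R) (u v : 'rV[R]_n -> R) (l : R) : young C -> 0 < l ->
  lebesgue_measurable O u -> measurable_fun setT v -> {ae mu, forall x, O x -> u x = v x} ->
  (\int[lmu]_(x in O) C (`|u x| / l)%R = \int[mu]_(x in O) C (`|v x| / l)%R)%E.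
Proof.
move=> yC l0 mu_ mv uv.
have mp : measurable_fun (O : set (lebesgueT R n)) (fun x : lebesgueT R n => C (`|u x| / l)%R).
  rewrite (_ : (fun x => _) = fun x : lebesgueT R n => C `|u x / l|).
    apply: (measurableT_comp (measurable_young yC)); apply: measurable_funM => //; exact: measurable_cst.
  by apply/funext => x; rewrite normrM normfV (gtr0_norm l0).
have pq : {ae mu, forall x, O x -> C (`|u x| / l)%R = C (`|v x| / l)%R}.
  by apply: filterS uv => x H Ox; rewrite H.
exact: (integral_ae_lebesgueN mO (fun x Ox => Ox) mp (measurable_young_div yC l0 mv) pq).
Qed.

Lemma integral_young_transfer_vec (C : R -> \bar R) (G : 'rV[R]_n -> 'rV[R]_n) (H : 'I_n -> 'rV[R]_n -> R) (l : R) :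
  young C -> 0 < l -> (forall i, lebesgue_measurable O (fun x => G x 0 i)) -> (forall i, measurable_fun setT (H i)) ->
  {ae mu, forall x, O x -> forall i, G x 0 i = H i x} ->
  (\int[lmu]_(x in O) C (euclid_norm (G x) / l)%R = \int[mu]_(x in O) C (gradnorm H x / l)%R)%E.
Proof.
move=> yC l0 mG mH GH.
have mg : lebesgue_measurable O (fun x => euclid_norm (G x)).
  apply: (measurableT_comp (continuous_measurable_fun (@sqrt_continuous R))).
  by apply: measurable_sum => i; apply: measurable_funX; exact: mG.
have := integral_young_transfer yC l0 mg (measurable_gradnorm mH) (euclid_norm_ae GH).
under eq_integral do rewrite ger0_norm ?sqrtr_ge0//.
by under [X in _ = X -> _]eq_integral do rewrite ger0_norm ?gradnorm_ge0//.
Qed.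

Lemma orlicz_scale_le (C : R -> \bar R) (v : 'rV[R]_n -> R) (l L : R) : young C -> 0 < l -> l <= L -> measurable_fun setT v ->
  (\int[mu]_(x in O) C (`|v x| / L)%R <= \int[mu]_(x in O) C (`|v x| / l)%R)%E.
Proof.
move=> yC l0 lL mv; have L0 := lt_le_trans l0 lL.
apply: ge0_le_integral => //.
- by move=> x _; rewrite young_ge0// divr_ge0// ltW.
- by apply: measurable_funTS; exact: measurable_young_div.
- by apply: measurable_funTS; exact: measurable_young_div.
by move=> x _; apply: (young_homo yC); rewrite divr_ge0 ?(ltW L0)//= ler_wpM2l// lef_pV2.
Qed.

Lemma orlicz_scale_le_vec (C : R -> \bar R) (H : 'I_n -> 'rV[R]_n -> R) (l L : R) : young C -> 0 < l -> l <= L ->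
  (forall i, measurable_fun setT (H i)) ->
  (\int[mu]_(x in O) C (gradnorm H x / L)%R <= \int[mu]_(x in O) C (gradnorm H x / l)%R)%E.
Proof.
move=> yC l0 lL mH; have := orlicz_scale_le yC l0 lL (measurable_gradnorm mH).
under eq_integral do rewrite ger0_norm ?gradnorm_ge0//.
by under [X in (_ <= X)%E -> _]eq_integral do rewrite ger0_norm ?gradnorm_ge0//.
Qed.

Lemma orlicz_sobolev_borel (C : R -> \bar R) u : young C -> orlicz_sobolev C O u ->
  exists v (H : 'I_n -> 'rV[R]_n -> R), [/\ forall i, borel_weak O i v (H i),
    {ae mu, forall x, O x -> u x = v x}, {ae mu, forall x, O x -> forall i, weak_gradient O u x 0 i = H i x} &
    exists2 l : R, 0 < l & (\int[mu]_(x in O) C (`|v x| / l)%R < +oo)%E /\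
      (\int[mu]_(x in O) C (gradnorm H x / l)%R < +oo)%E].
Proof.
move=> yC [wu [mu_ [l1 l10 u1]] [mG [l2 l20 G2]]].
have [v [H [vH uvH]]] := weak_gradient_borel oO (weak_gradientP wu).
have mv : measurable_fun setT v by case: (vH i0).
have mH i : measurable_fun setT (H i) by case: (vH i).
have uv : {ae mu, forall x, O x -> u x = v x} by apply: filterS uvH => x Hx Ox; have [] := Hx Ox.
have GH : {ae mu, forall x, O x -> forall i, weak_gradient O u x 0 i = H i x}.
  by apply: filterS uvH => x Hx Ox; have [] := Hx Ox.
exists v, H; split => //; exists (Num.max l1 l2); first by rewrite lt_max l10.
split.
  apply: (le_lt_trans (orlicz_scale_le yC l10 _ mv)); first by rewrite le_max lexx.
  by rewrite -(integral_young_transfer yC l10 mu_ mv uv).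
apply: (le_lt_trans (orlicz_scale_le_vec yC l20 _ mH)); first by rewrite le_max lexx orbT.
by rewrite -(integral_young_transfer_vec yC l20 mG mH GH).
Qed.

Lemma borel_orlicz_sobolev (C : R -> \bar R) u v (H : 'I_n -> 'rV[R]_n -> R) (l : R) : young C -> 0 < l ->
  lebesgue_measurable O u -> {ae mu, forall x, O x -> u x = v x} -> (forall i, borel_weak O i v (H i)) ->
  (\int[mu]_(x in O) C (`|v x| / l)%R < +oo)%E -> (\int[mu]_(x in O) C (gradnorm H x / l)%R < +oo)%E ->
  orlicz_sobolev C O u /\ {ae mu, forall x, O x -> forall i, weak_gradient O u x 0 i = H i x}.
Proof.
move=> yC l0 mu_ uv vH vl Hl; have [mv _ iv _ _] := vH i0.
have mH i : measurable_fun setT (H i) by case: (vH i).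
have wd : weakly_differentiable O u by exists (fun x => \row_i H i x); exact: (borel_weak_gradient oO mu_ uv mv vH iv).
have wG := weak_gradientP wd; have GH := weak_gradient_unique oO wG vH mv uv.
have mG i : lebesgue_measurable O (fun x => weak_gradient O u x 0 i) by have [_ /(_ i)[]] := wG.
split => //; split => //.
- by split => //; exists l => //; rewrite (integral_young_transfer yC l0 mu_ mv uv).
- by split => //; exists l => //; rewrite (integral_young_transfer_vec yC l0 mG mH GH).
Qed.

Variables (A B : R -> \bar R) (f h w : R -> R).
Hypotheses (yA : young A) (ndA : nondegenerate_young A) (yB : young B).
Hypotheses (cf : continuous f) (fhw : local_primitive f h w) (mw : measurable_fun [set: R] w).
Hypothesis gc : growth_control O A B w.

Lemma superposition_sobolev u v (H : 'I_n -> 'rV[R]_n -> R) (l : R) : 0 < l -> orlicz_sobolev A O u ->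
  {ae mu, forall x, O x -> u x = v x} -> (forall i, borel_weak O i v (H i)) ->
  (\int[mu]_(x in O) A (`|v x| / l)%R < +oo)%E -> (\int[mu]_(x in O) A (gradnorm H x / l)%R < +oo)%E ->
  orlicz_sobolev B O (superposition f u) /\
  {ae mu, forall x, O x -> forall i, weak_gradient O (superposition f u) x 0 i = h (v x) * H i x}.
Proof.
move=> l0 [_ [mu_ _] _] uv vH vl Hl.
have [wk [l' l'0 [fl gl]]] := composition_orlicz n0 oO yA yB fhw mw gc l0 vH vl Hl.
apply: (@borel_orlicz_sobolev B _ (f \o v) (fun i x => h (v x) * H i x) l') => //.
- exact: (measurableT_comp (measurable_local_primitive fhw) mu_).
- by apply: filterS uv => x Hx Ox; rewrite /superposition /= Hx.
Qed.

Lemma superposition_maps : maps_orlicz_sobolev A B O (superposition f).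
Proof.
move=> u Au; have [v [H [vH uv _ [l l0 [vl Hl]]]]] := orlicz_sobolev_borel yA Au.
by have [] := superposition_sobolev l0 Au uv vH vl Hl.
Qed.

Lemma superposition_continuous : modular_continuous A B O (superposition f).
Proof.
move=> u_ u Au_ Au [[l1 l10 cu] [l2 l20 cG]].
have [v0 [H0 [vH0 uv0 GH0 [l0' l00 [v0l H0l]]]]] := orlicz_sobolev_borel yA Au.
have ex k := orlicz_sobolev_borel yA (Au_ k).
have [v vP] := choice ex; have [H HP] := choice vP.
have mv k : measurable_fun setT (v k) by have [/(_ i0)[]] := HP k.
have mH k i : measurable_fun setT (H k i) by have [/(_ i)[]] := HP k.
have mv0 : measurable_fun setT v0 by case: (vH0 i0).
have mH0 i : measurable_fun setT (H0 i) by case: (vH0 i).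
have mu0 : lebesgue_measurable O u by have [_ []] := Au.
have muk k : lebesgue_measurable O (u_ k) by have [_ []] := Au_ k.
have mG i : lebesgue_measurable O (fun x => weak_gradient O u x 0 i) by have [_ _ []] := Au.
have mGk k i : lebesgue_measurable O (fun x => weak_gradient O (u_ k) x 0 i) by have [_ _ []] := Au_ k.
(* One scale for the limit function and for both convergences; modulars decrease when the scale
   grows. *)
pose L := Num.max l0' (Num.max l1 l2).
have l0L : l0' <= L by rewrite le_max lexx.
have l1L : l1 <= L by rewrite !le_max lexx orbT.
have l2L : l2 <= L by rewrite !le_max lexx !orbT.
have L0 : 0 < L := lt_le_trans l00 l0L.
have E1 (C : R -> \bar R) l (U : nat -> 'rV[R]_n -> R) U0 V V0 k : young C -> 0 < l -> lebesgue_measurable O (U k) -> lebesgue_measurable O U0 ->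
    measurable_fun setT V -> measurable_fun setT V0 -> {ae mu, forall x, O x -> U k x = V x} -> {ae mu, forall x, O x -> U0 x = V0 x} ->
    (\int[lmu]_(x in O) C (`|U k x - U0 x| / l)%R = \int[mu]_(x in O) C (`|V x - V0 x| / l)%R)%E.
  move=> yC l0 mU mU0 mV mV0 UV UV0.
  apply: (@integral_young_transfer C (fun x => U k x - U0 x) (fun x => V x - V0 x)) => //.
  - exact: lebesgue_measurableB.
  - exact: measurable_funB.
  - by apply: filterS2 UV UV0 => x p q Ox; rewrite p// q.
have E2 (C : R -> \bar R) l (U U0 : 'rV[R]_n -> 'rV[R]_n) V V0 : young C -> 0 < l ->
    (forall i, lebesgue_measurable O (fun x => U x 0 i)) -> (forall i, lebesgue_measurable O (fun x => U0 x 0 i)) ->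
    (forall i, measurable_fun setT (V i)) -> (forall i, measurable_fun setT (V0 i)) ->
    {ae mu, forall x, O x -> forall i, U x 0 i = V i x} -> {ae mu, forall x, O x -> forall i, U0 x 0 i = V0 i x} ->
    (\int[lmu]_(x in O) C (euclid_norm (U x - U0 x) / l)%R = \int[mu]_(x in O) C (gradnorm (fun i y => (V i y - V0 i y)%R) x / l)%R)%E.
  move=> yC l0 mU mU0 mV mV0 UV UV0.
  apply: (@integral_young_transfer_vec C (fun x => U x - U0 x) (fun i y => V i y - V0 i y)) => //.
  - move=> i; rewrite (_ : (fun x => (U x - U0 x) 0 i) = (fun x => U x 0 i - U0 x 0 i)).
      exact: (lebesgue_measurableB (mU i) (mU0 i)).
    by apply/funext => x; rewrite !mxE.
  - by move=> i; exact: measurable_funB.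
  - by apply: filterS2 UV UV0 => x p q Ox i; rewrite !mxE p// q.
have vH k i : borel_weak O i (v k) (H k i) by have [] := HP k.
have uv k : {ae mu, forall x, O x -> u_ k x = v k x} by have [] := HP k.
have GH k : {ae mu, forall x, O x -> forall i, weak_gradient O (u_ k) x 0 i = H k i x} by have [] := HP k.
have v0L : (\int[mu]_(x in O) A (`|v0 x| / L)%R < +oo)%E by exact: le_lt_trans (orlicz_scale_le yA l00 l0L mv0) v0l.
have H0L : (\int[mu]_(x in O) A (gradnorm H0 x / L)%R < +oo)%E by exact: le_lt_trans (orlicz_scale_le_vec yA l00 l0L mH0) H0l.
have cv : (\int[mu]_(x in O) A (`|v k x - v0 x| / L)%R)%E @[k --> \oo] --> 0%E.
  apply: squeeze_cvge cu; last exact: cvg_cst.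
  apply: nearW => k; rewrite integral_ge0/=; last by move=> x _; rewrite young_ge0// divr_ge0// ltW.
  rewrite (E1 A l1 u_ u (v k) v0)//; apply: (orlicz_scale_le yA l10 l1L); exact: measurable_funB.
have cH : (\int[mu]_(x in O) A (gradnorm (fun i y => (H k i y - H0 i y)%R) x / L)%R)%E @[k --> \oo] --> 0%E.
  apply: squeeze_cvge cG; last exact: cvg_cst.
  apply: nearW => k; rewrite integral_ge0/=; last by move=> x _; rewrite young_ge0// divr_ge0 ?gradnorm_ge0// ltW.
  have mHk i : measurable_fun setT (fun y => H k i y - H0 i y) by exact: (measurable_funB (mH k i) (mH0 i)).
  apply: le_trans (orlicz_scale_le_vec yA l20 l2L mHk) _.
  by rewrite (E2 A l2 _ _ (H k) H0 yA l20 (mGk k) mG (mH k) mH0 (GH k) GH0).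
have [l l0 [c1 c2]] := composition_cvg n0 oO yA ndA yB cf fhw gc L0 vH vH0 v0L H0L cv cH.
have mf := measurable_local_primitive fhw; have mh : measurable_fun [set: measurableTypeR R] h by case: fhw.
have out k : orlicz_sobolev B O (superposition f (u_ k)) /\
    {ae mu, forall x, O x -> forall i, weak_gradient O (superposition f (u_ k)) x 0 i = h (v k x) * H k i x}.
  have [_ _ _ [lk lk0 [vlk Hlk]]] := HP k.
  exact: (superposition_sobolev lk0 (Au_ k) (uv k) (vH k) vlk Hlk).
have [out0 gout0] := superposition_sobolev l00 Au uv0 vH0 v0l H0l.
split; exists l => //.
  apply: cvg_trans c1; apply: near_eq_cvg; apply: nearW => k; apply/esym.
  apply: (E1 B l (fun k => superposition f (u_ k)) (superposition f u) (f \o v k) (f \o v0)) => //.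
  - exact: (measurableT_comp mf (muk k)).
  - exact: (measurableT_comp mf mu0).
  - exact: (measurableT_comp mf (mv k)).
  - exact: (measurableT_comp mf mv0).
  - by apply: filterS (uv k) => x Hx Ox; rewrite /superposition /= Hx.
  - by apply: filterS uv0 => x Hx Ox; rewrite /superposition /= Hx.
apply: cvg_trans c2; apply: near_eq_cvg; apply: nearW => k; apply/esym.
have [[_ _ [mGo _]] gout] := out k; have [_ _ [mGo0 _]] := out0.
have mhk i : measurable_fun setT (fun y => h (v k y) * H k i y).
  exact: (measurable_funM (measurableT_comp mh (mv k)) (mH k i)).
have mh0 i : measurable_fun setT (fun y => h (v0 y) * H0 i y).
  exact: (measurable_funM (measurableT_comp mh mv0) (mH0 i)).
exact: (E2 B l _ _ _ _ yB l0 mGo mGo0 mhk mh0 gout gout0).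
Qed.

End transfer.

(** * A monotone bound for the derivative of f *)

Section locally_lipschitz.
Context {R : realType}.
Variable f : R -> R.
Hypothesis lipf : [locally [lipschitz f x | x in [set: R]]].

Lemma locally_lipschitz_continuous : continuous f.
Proof.
move=> x; have [L L0 fL] := locally_lipschitz_itv (`|x| + 1) lipf.
apply/cvgrPdist_le => e e0; near=> y.
have xy1 : `|x - y| <= 1 by near: y; apply: cvgr_dist_le.
have xye : `|x - y| <= e / L by near: y; apply: cvgr_dist_le => //; exact: divr_gt0.
apply: (le_trans (fL x y _ _)); first by rewrite lerDl.
  by rewrite -lerBlDl; apply: le_trans xy1; rewrite distrC; exact: lerB_dist.
by rewrite mulrC -ler_pdivlMr.
Unshelve. all: by end_near. Qed.

Lemma derive1_le m L t : (forall x y, `|x| <= m -> `|y| <= m -> `|f x - f y| <= L * `|x - y|) ->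
  `|t| < m -> derivable f t 1 -> `|derive1 f t| <= L.
Proof.
move=> fL tm df.
have d : s^-1 *: (f (s *: 1 + t) - f t) @[s --> (0:R)^'] --> derive1 f t.
  by rewrite derive1E; exact: df.
have c : `|s^-1 *: (f (s *: 1 + t) - f t)| @[s --> (0:R)^'] --> `|derive1 f t| by exact: cvg_norm.
rewrite -(cvg_lim _ c)//; apply: limr_le; first exact: cvgP c.
have m0 : 0 < m - `|t| by rewrite subr_gt0.
near=> s; have s0 : s != 0 by near: s; exact: nbhs_dnbhs_neq.
have sm : `|s| <= m - `|t|.
  near: s; apply: nbhs_dnbhs; apply: filterS (nbhsx_ballx (0 : R) _ m0) => s.
  by rewrite /ball/= sub0r normrN => /ltW.
rewrite /GRing.scale/= mulr1 normrM normfV ler_pdivrMl ?normr_gt0// mulrC.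
have := fL (s + t) t _ (ltW tm); rewrite addrK; apply.
by apply: (le_trans (ler_normD _ _)); rewrite -lerBrDr.
Unshelve. all: by end_near. Qed.

(** Case (i) comes without a growth function, so one is built from the Lipschitz constants on
    [[-k, k]]. *)
Lemma locally_lipschitz_slope : exists w : R -> R, [/\ measurable_fun [set: R] w, forall s, 0 <= s -> 0 <= w s,
  forall s t, 0 <= s -> s <= t -> w s <= w t & forall t, derivable f t 1 -> `|derive1 f t| <= w `|t|].
Proof.
have /choice[L LP] : forall k : nat, exists L, 0 <= L /\ forall x y : R, `|x| <= k%:R -> `|y| <= k%:R -> `|f x - f y| <= L * `|x - y|.
  by move=> k; have [L /ltW L0 fL] := locally_lipschitz_itv k%:R lipf; exists L.
have L0 k : 0 <= L k by have [] := LP k.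
(* Summing the constants makes [w] monotone. The last index is [(Num.truncn s).+1], which exceeds
   [s], so the constant of an interval containing [s] in its interior is included. *)
pose w (s : R) := \sum_(k < (Num.truncn s).+2) L k.
have wmon : nondecreasing_fun w.
  move=> s t st; rewrite /w -!(big_mkord xpredT L).
  have ts : ((Num.truncn s).+2 <= (Num.truncn t).+2)%N by rewrite !ltnS le_truncn.
  by rewrite (big_cat_nat (leq0n _) ts)//= lerDl sumr_ge0.
exists w; split => //.
- exact: nondecreasing_measurable.
- by move=> s _; exact: sumr_ge0.
- by move=> s t _; exact: wmon.
move=> t df; have tk : `|t| < (Num.truncn `|t|).+1%:R by exact: truncnS_gt.
apply: (le_trans (derive1_le (LP _).2 tk df)).
by rewrite /w big_ord_recr/= lerDr sumr_ge0.
Qed.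

End locally_lipschitz.

Theorem theorem3p7 (R : realType) (n : nat) (Omega : set 'rV[R]_n)
    (A B : R -> \bar R) (f : R -> R) :
  (2 <= n)%N ->
  extension_domain Omega ->
  young A -> nondegenerate_young A ->
  young B ->
  [locally [lipschitz f x | x in [set: R]]] -> f 0 = 0 ->
  (cvg_int_infty (sobolev_integrand n A) ->
   maps_orlicz_sobolev A A Omega (superposition f) /\
   modular_continuous A A Omega (superposition f))
  /\
  (dvg_int_infty (sobolev_integrand n A) ->
   forall (kappa : R) (E : R -> R) (Ah : R -> \bar R),
     0 < kappa ->
     (forall t : R, 0 <= t -> 0 <= E t) ->
     {in `[0, +oo[ &, {homo E : s t / s <= t}} ->
     {within `[0, +oo[, continuous E} ->
     (exists2 t : R, 0 <= t & E t != 0) ->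
     {ae lebesgue_measure, forall t : R,
        `|derive1 f t| <= kappa * E (kappa * `|t|)} ->
     H_admissible n A Ah ->
     (exists2 t0 : R, 0 <= t0 &
        forall t : R, t0 <= t -> (B (t * E (H_ n Ah t))%R <= A t)%E) ->
     (exists (t1 : R) (F : R -> \bar R),
        [/\ 0 < t1, young F,
            forall t : R, 0 <= t <= t1 ->
              (B (t * E (fine (rc_inverse F (A t))))%R <= A t)%E &
            forall l : R, 0 < l ->
              (limf_esup (fun t : R => F (l * t)%R / A t) (0%R : R)^'+ < +oo)%E]) ->
     maps_orlicz_sobolev A B Omega (superposition f) /\
     modular_continuous A B Omega (superposition f)).
Proof.
move=> n1 extO yA ndA yB lipf f0; have n0 : (0 < n)%N by exact: ltnW.
have oO : open Omega by case: extO.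
have [C C0 ext] := extension_domain_borel n0 extO.
have cf := locally_lipschitz_continuous lipf.
split=> [cvgA|dvgA kappa E Ah k0 E0 Emon _ _ fE adm [t0 _ BA] [t1 [F [t10 yF BF FA]]]].
  have [w [mw w0 wmon fw]] := locally_lipschitz_slope lipf.
  have fw' : {ae lebesgue_measure, forall t : R, derivable f t 1 -> `|derive1 f t| <= w `|t|} by exact: aeW.
  have [h fhw] := locally_lipschitz_primitive lipf f0 mw w0 wmon fw'.
  have gc := growth_control_bounded n1 ext C0 oO yA ndA cvgA w0 wmon.
  split; first exact: (superposition_maps n0 oO yA yA fhw mw gc).
  exact: (superposition_continuous n0 oO yA ndA yA cf fhw mw gc).
(* [E] is only constrained on nonnegative arguments. *)
pose E' s := E (Num.max 0 s).
have E'E s : 0 <= s -> E' s = E s by move=> s0; rewrite /E' max_r.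
have E'mon : nondecreasing_fun E'.
  have max0 (s : R) : Num.max 0 s \in `[0, +oo[ by rewrite in_itv/= andbT le_max lexx.
  by move=> s t st; apply: (Emon _ _ (max0 s) (max0 t)); rewrite ge_max !le_max lexx st orbT.
have E'0 t : 0 <= E' t by apply: E0; rewrite le_max lexx.
pose w s := kappa * E' (kappa * s).
have wmon : nondecreasing_fun w.
  by move=> s t st; rewrite /w ler_pM2l//; apply: E'mon; rewrite ler_pM2l.
have mw : measurable_fun [set: R] w by exact: nondecreasing_measurable.
have fw : {ae lebesgue_measure, forall t : R, derivable f t 1 -> `|derive1 f t| <= w `|t|}.
  by apply: filterS fE => t + _; rewrite /w E'E// mulr_ge0// ltW.
have w0 s : 0 <= s -> 0 <= w s by rewrite /w mulr_ge0// ltW.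
have [h fhw] := locally_lipschitz_primitive lipf f0 mw w0 (fun s t _ => @wmon s t) fw.
have BA' t : Num.max 0 t0 <= t -> (B (t * E' (H_ n Ah t))%R <= A t)%E.
  by rewrite ge_max => /andP[_ tt]; rewrite E'E ?BA// /H_ fine_ge0// poweR_ge0.
have BF' t : 0 <= t <= t1 -> (B (t * E' (fine (rc_inverse F (A t))))%R <= A t)%E.
  move=> tt; rewrite E'E ?BF// fine_ge0//; apply: le_ereal_inf_tmp => _ [s [s0 _] <-].
  by rewrite lee_fin.
have gc : growth_control Omega A B w.
  exact: (growth_control_divergent n1 ext C0 oO yA ndA dvgA adm yB yF k0 (fun t _ => E'0 t)
     (fun s t _ => @E'mon s t) BA' t10 BF' FA).
split; first exact: (superposition_maps n0 oO yA yB fhw mw gc).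
exact: (superposition_continuous n0 oO yA ndA yB cf fhw mw gc).
Qed.
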